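(* Let $\Omega\subset\mathbb{R}^n$ be a bounded domain and let $\sigma\colon\Omega\to[0,\infty]$ be a measurable function. Write $D_0=\sigma^{-1}(\{0\})$ and $D_\infty=\sigma^{-1}(\{\infty\})$ and suppose the following: (1) the sets $D_0$ and $D_\infty$ are open; (2) the sets $\overline{D_0}$, $\overline{D_\infty}$ and $\partial\Omega$ are (pairwise) disjoint; (3) $\sigma$ is essentially bounded from below and above by positive constants in $\Omega\setminus(D_0\cup D_\infty)$; (4) the set $D_0$ has Lipschitz boundary. Fix $p\in(1,\infty)$. Then, given any $f\in W^{1,p}(\Omega)$, there is a minimizer $u\in f+W^{1,p}_0(\Omega)$ of the energy $$E(v)=\int_\Omega\sigma|\nabla v|^p\,dx$$ over $f+W^{1,p}_0(\Omega)$. The minimal energy is finite, and the minimizer is unique up to functions that have zero gradient outside $D_0$ and zero Dirichlet boundary values on $\partial\Omega$. The minimizer satisfies, in the weak sense, $\operatorname{div}(\sigma|\nabla u|^{p-2}\nabla u)=0$ in $\Omega\setminus(\overline{D_0}\cup\overline{D_\infty})$ and $\nabla u=0$ in $D_\infty$.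
   Context: The dimension satisfies $n\ge 2$. Functions are real-valued. $W^{1,p}_0(\Omega)$ is the closure of $C_c^\infty(\Omega)$ in $W^{1,p}(\Omega)$; ''zero Dirichlet boundary values'' means belonging to $W^{1,p}_0(\Omega)$. In the energy, the convention $\infty\cdot 0=0$ is used, so that $E(v)=\infty$ unless $\nabla v=0$ almost everywhere in $D_\infty$. The equation $\operatorname{div}(\sigma|\nabla u|^{p-2}\nabla u)=0$ holds weakly in an open set $U$ if $\int_U\sigma|\nabla u|^{p-2}\nabla u\cdot\nabla\varphi\,dx=0$ for all $\varphi\in C_c^\infty(U)$. *)

(* Defs.v *)
From HB Require Import structures.
From mathcomp Require Import all_boot all_order all_algebra.
From mathcomp Require Import all_classical all_reals all_analysis.
From mathcomp Require Import measurable_realfun.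

Set Implicit Arguments.
Unset Strict Implicit.
Unset Printing Implicit Defensive.

Import Order.TTheory GRing.Theory Num.Theory.
Import numFieldNormedType.Exports.

Local Open Scope classical_set_scope.
Local Open Scope ring_scope.

(* MathComp-Analysis only provides the one-dimensional Lebesgue measure.  The
   n-dimensional one is built on 'rV[R]_n as follows: take the n-fold product
   of the one-dimensional measure, on the product sigma-algebra of n.-tuple R;
   read the associated outer measure through the identification of row vectors
   with tuples; restrict it to its Caratheodory sigma-algebra.  Thus
   "measurable" for a subset of 'rV[R]_n means Lebesgue measurable. *)
Section lebesgue_tuple.
Context {R : realType}.
Local Open Scope ereal_scope.
Local Notation R' := (measurableTypeR R).

Definition tcons n (xt : R' * n.-tuple R') : n.+1.-tuple R' :=
  [tuple of xt.1 :: xt.2].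

Lemma measurable_tcons n : measurable_fun [set: _] (@tcons n).
Proof. exact: measurable_cons. Qed.

Definition tuncons n (t : n.+1.-tuple R') : R' * n.-tuple R' :=
  (tnth t ord0, [tuple of behead t]).

Lemma measurable_tuncons n : measurable_fun [set: _] (@tuncons n).
Proof.
apply/measurable_fun_pairP; split.
  exact: measurable_tnth.
exact: measurable_behead.
Qed.

Lemma tconsK n : cancel (@tcons n) (@tuncons n).
Proof. by move=> [x t]; congr pair; exact/val_inj. Qed.

Lemma tunconsK n : cancel (@tuncons n) (@tcons n).
Proof. by move=> t; rewrite [RHS]tuple_eta. Qed.

Section succ.
Context (n : nat) (m : {sigma_finite_measure set (n.-tuple R') -> \bar R}).

Definition lebesgue_succ : set (n.+1.-tuple R') -> \bar R :=
  pushforward (@lebesgue_measure R \x m) (@tcons n).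

Let succ0 : lebesgue_succ set0 = 0.
Proof. by rewrite /lebesgue_succ /pushforward preimage_set0 measure0. Qed.

Let succ_ge0 A : 0 <= lebesgue_succ A.
Proof. exact: (measure_ge0 (@lebesgue_measure R \x m)). Qed.

Let succ_sigma_additive : semi_sigma_additive lebesgue_succ.
Proof.
pose pm : {measure set _ -> \bar R} := (@lebesgue_measure R \x m).
exact: (@measure_semi_sigma_additive _ _ _
  (measure_function_pushforward__canonical__measure_function_Measure
    pm (@measurable_tcons n))).
Qed.

HB.instance Definition _ := isMeasure.Build _ _ _ lebesgue_succ
  succ0 succ_ge0 succ_sigma_additive.

Let succ_sigma_finite : sigma_finite setT lebesgue_succ.
Proof.
have [[F TF Foo]] := lebesgue_integral_fubini.measure_function_Measure_isSigmaFinite__to__measure_function_isSigmaFinite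
  (@lebesgue_measure R) m.
exists (fun k => @tuncons n @^-1` F k).
  by rewrite -preimage_bigcup -TF preimage_setT.
move=> k; split.
  by rewrite -[X in measurable X]setTI; apply: measurable_tuncons => //;
    have [] := Foo k.
rewrite /lebesgue_succ /pushforward -comp_preimage.
have -> : @tuncons n \o @tcons n = id by apply/funext => x; exact: tconsK.
by have [] := Foo k.
Qed.

HB.instance Definition _ := @Measure_isSigmaFinite.Build _ _ _ lebesgue_succ
  succ_sigma_finite.

End succ.

Fixpoint lebesgue_tuple n : {sigma_finite_measure set (n.-tuple R') -> \bar R} :=
  match n with
  | 0 => dirac [tuple]
  | n'.+1 => lebesgue_succ (lebesgue_tuple n')
  end.

End lebesgue_tuple.

Section lebesgue_rV.
Context {R : realType} {n : nat}.
Local Open Scope ereal_scope.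

Definition rV_of_tuple (t : n.-tuple (measurableTypeR R)) : 'rV[R]_n :=
  \row_i tnth t i.

Definition lebesgue_rV (A : set 'rV[R]_n) : \bar R :=
  (lebesgue_tuple n)^*%mu (rV_of_tuple @^-1` A).

Let lebesgue_rV0 : lebesgue_rV set0 = 0.
Proof. by rewrite /lebesgue_rV preimage_set0 outer_measure0. Qed.

Let lebesgue_rV_ge0 A : 0 <= lebesgue_rV A.
Proof. exact: outer_measure_ge0. Qed.

Let le_lebesgue_rV : {homo lebesgue_rV : A B / A `<=` B >-> A <= B}.
Proof. by move=> A B AB; apply: le_outer_measure => t; exact: AB. Qed.

Let lebesgue_rV_sigma_subadditive : sigma_subadditive lebesgue_rV.
Proof.
move=> F; rewrite /lebesgue_rV preimage_bigcup.
exact: outer_measure_sigma_subadditive.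
Qed.

HB.instance Definition _ := isOuterMeasure.Build R 'rV[R]_n lebesgue_rV
  lebesgue_rV0 lebesgue_rV_ge0 le_lebesgue_rV lebesgue_rV_sigma_subadditive.

End lebesgue_rV.

HB.instance Definition _ (R : realType) (n : nat) :=
  @isMeasurable.Build (caratheodory_display (@lebesgue_rV R n)) 'rV[R]_n
    (@lebesgue_rV R n).-caratheodory
    (caratheodory_measurable_set0 (@lebesgue_rV R n))
    (@caratheodory_measurable_setC _ _ (@lebesgue_rV R n))
    (@caratheodory_measurable_bigcup _ _ (@lebesgue_rV R n)).

Section lebesgue_rV_measure.
Context {R : realType} {n : nat}.

Let lebesgue_rV_sigma_additive :
  semi_sigma_additive (@lebesgue_rV R n : set 'rV[R]_n -> \bar R).
Proof.
exact: (@caratheodory_measure_sigma_additive R 'rV[R]_n (@lebesgue_rV R n)).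
Qed.

HB.instance Definition _ := @isMeasure.Build _ 'rV[R]_n R (@lebesgue_rV R n)
  (outer_measure0 _) (outer_measure_ge0 _) lebesgue_rV_sigma_additive.

End lebesgue_rV_measure.

Section euclidean.
Context {R : realType} {n : nat}.
Implicit Types (v w : 'rV[R]_n).

Definition dotv v w : R := \sum_i v 0 i * w 0 i.

(* The library norm `|v| on 'rV[R]_n is the sup norm. *)
Definition enorm v : R := Num.sqrt (dotv v v).

End euclidean.

Section sobolev.
Context {R : realType} {n : nat}.
Local Notation E := 'rV[R]_n.
Local Notation mu := (@lebesgue_rV R n).
Implicit Types (U D : set E) (u f phi : E -> R) (p : R).

Definition partial (i : 'I_n) f : E -> R := 'D_(delta_mx 0 i) f.

Definition grad f (x : E) : E := \row_i partial i f x.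

Definition smooth f := forall s : seq 'I_n, let g := foldr partial f s in
  continuous g /\ forall i x, derivable g x (delta_mx 0 i).

Definition supp f : set E := closure [set x | f x != 0].

Definition Cc_smooth U : set (E -> R) :=
  [set phi | [/\ smooth phi, compact (supp phi) & supp phi `<=` U]].

(* Functions on an open set U are represented by total functions on R^n whose
   values outside U are irrelevant. *)

Definition loc_integrable U u := measurable_fun U u /\
  forall K, compact K -> K `<=` U -> mu.-integrable K (EFin \o u).

Definition is_weak_grad U u (G : E -> E) := [/\ loc_integrable U u,
  (forall i, loc_integrable U (fun x => G x 0 i)) &
  forall phi, Cc_smooth U phi -> forall i,
    (\int[mu]_(x in U) (u x * partial i phi x) =
     - \int[mu]_(x in U) (G x 0 i * phi x))%R].

(* The weak gradient of u in U, if it exists; it is unique up to null sets. *)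
Definition wgrad U u : E -> E := xget (fun=> 0) [set G | is_weak_grad U u G].

Definition Lp U p u := u \_ U \in Lfun mu p%:E.

Definition W1p U p : set (E -> R) :=
  [set u | [/\ Lp U p u, exists G, is_weak_grad U u G &
               forall i, Lp U p (fun x => wgrad U u x 0 i)]].

Definition W1p_norm U p u : \bar R :=
  ('N[mu]_(p%:E) [EFin \o (u \_ U)] +
   'N[mu]_(p%:E) [EFin \o ((enorm \o wgrad U u) \_ U)])%E.

Definition W1p0 U p : set (E -> R) :=
  [set u | W1p U p u /\ forall e : R, 0 < e ->
    exists2 phi, Cc_smooth U phi & (W1p_norm U p (u \- phi)%R < e%:E)%E].

Definition W1p_affine U p f : set (E -> R) := [set v | W1p0 U p (v \- f)].

Definition boundary D : set E := closure D `\` interior D.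

(* Near each boundary point, D is the strict epigraph of a Lipschitz function:
   nu is the direction of the last axis of a rotated coordinate system and
   x - (x . nu) nu stands for the other n - 1 coordinates of x, so that only
   the values of g on the hyperplane orthogonal to nu matter. *)
Definition Lipschitz_boundary D := forall x0, boundary D x0 ->
  exists (nu : E) (g : E -> R) (L : R),
    [/\ enorm nu = 1,
        (forall y z, `|g y - g z| <= L * enorm (y - z)) &
        \forall x \near x0, D x <-> g (x - dotv x nu *: nu) < dotv x nu].

Definition domain U := [/\ U !=set0, open U & connected U].

End sobolev.

Section energy.
Context {R : realType} {n : nat}.
Local Notation E := 'rV[R]_n.
Local Notation mu := (@lebesgue_rV R n).
Implicit Types (U Omega : set E) (sigma : E -> \bar R) (p : R) (u v f : E -> R).

Definition D_zero Omega sigma : set E := Omega `&` sigma @^-1` [set 0%E].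

Definition D_infty Omega sigma : set E := Omega `&` sigma @^-1` [set +oo%E].

(* In \bar R, +oo * 0 = 0. *)
Definition energy Omega sigma p v : \bar R :=
  (\int[mu]_(x in Omega) (sigma x * (enorm (wgrad Omega v x) `^ p)%:E))%E.

Definition is_minimizer Omega sigma p f u := W1p_affine Omega p f u /\
  forall v, W1p_affine Omega p f v ->
    (energy Omega sigma p u <= energy Omega sigma p v)%E.

(* div (sigma |G|^(p-2) G) = 0 weakly in U.  The factor |G|^(p-2) G vanishes
   where G does, also for p < 2. The extended integral is not 0 when both the
   positive and the negative part of the integrand have infinite integral. *)
Definition weak_div_eq0 U sigma p (G : E -> E) :=
  forall phi, Cc_smooth U phi ->
    (\int[mu]_(x in U)
      (sigma x * (enorm (G x) `^ (p - 2) * dotv (G x) (grad phi x))%:E) = 0)%E.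

End energy.

(* Main.v *)
Require Import Defs.
From HB Require Import structures.
From mathcomp Require Import all_boot all_order all_algebra.
From mathcomp Require Import all_classical all_reals all_analysis.
From mathcomp Require Import measurable_realfun.
From mathcomp Require Import ring lra.

(* With s = sigma^(1/p) outside D_infty, the finite energies are the p-th powers of
   ||s (grad f + G)||_p, where G runs over the gradients of functions of
   W_0^{1,p}(Omega) with grad f + G = 0 on D_infty; -f multiplied by a cutoff that
   is 1 near D_infty shows that such G exist.  By uniform convexity of the L^p norm,
   s G_k is Cauchy along a minimizing sequence, so the G_k are Cauchy off D_0;
   uniqueness off D_0 has the same reason, and the equation is the vanishing first
   variation.

   Nothing is known about G_k inside D_0.  There one uses that every phi in
   C_c^oo(Omega) can be changed inside D_0 so that its gradient becomes bounded by
   C ||grad phi||_{L^p(Omega \ D_0)}.  Otherwise there are phi_k with bounded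
   gradients, with gradients tending to 0 off D_0, and whose gradients cannot be
   made small by changes inside D_0.  By Rellich's theorem a subsequence is Cauchy in
   L^p, with small consecutive differences.  Extending the differences from the
   outside of D_0 (locally, by reflection in the Lipschitz graph) gives small
   W_0^{1,p} functions, whose sum has, off D_0, the gradient
   lim grad phi_k - grad phi_0 = - grad phi_0: it provides a small change of phi_0,
   a contradiction. *)

Set Implicit Arguments.
Unset Strict Implicit.
Unset Printing Implicit Defensive.

Import Order.TTheory GRing.Theory Num.Theory.
Import numFieldNormedType.Exports.

Local Open Scope classical_set_scope.
Local Open Scope ring_scope.

(** * Invariance of Lebesgue measure *)

(** The obstacle is that the gradient off D_0 does not control the function there: a part of Omega
    enclosed by D_0 may carry any constant at no cost. The extension estimate therefore also needs
    the L^p norm of the function, and compactness has to supply it. For the same reason a corrected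
    function is only asked to have the same gradient off D_0, not the same values.

    Folding along a Lipschitz graph destroys smoothness, so an extended function is known only
    through bounds on its difference quotients. Mollification turns these into gradient bounds for
    smooth functions, and uniform convexity, applied to averages of the mollified functions, turns a
    bounded and weakly convergent sequence into a strongly convergent one. This puts the extension
    back into W_0^{1,p}. The fold itself is treated as a change of variables without a Jacobian:
    continuous functions are averaged over small balls, and only the measure of preimages of balls
    enters.

    Membership in W_0^{1,p} is handled throughout as a property of pairs (u, G) on the whole space,
    so that outside values and null sets cause no trouble. *)

Section lebesgue_measure_1d.
Context {R : realType}.
Local Notation R' := (measurableTypeR R).
Local Notation leb := (@lebesgue_measure R).

(** The image measure under the translation agrees with Lebesgue measure on the intervals []a, b]],
    and these determine it. *)
Lemma lebesgue_measure_shift (c : R) (A : set R') : measurable A ->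
  leb ((fun x => x + c) @^-1` A) = leb A.
Proof.
move=> mA.
have mf : measurable_fun [set: R'] (fun x : R' => (x + c : R')).
  exact: measurable_funD.
apply/esym.
have := @lebesgue_measure_unique R (measure_function_pushforward__canonical__measure_function_Measure leb mf).
apply => // X.
case=> -[a b] _ <- /=.
have H : (fun x => x + c) @^-1` `]a, b] = `]a - c, b - c]%classic.
  by apply/seteqP; split => x /=; rewrite !in_itv/= ltrBlDr lerBrDr.
by rewrite /pushforward H !lebesgue_measure_itv/= !lte_fin ltrD2r -!EFinB opprB addrA subrK.
Qed.

Lemma lebesgue_measure_opp (A : set R') : measurable A ->
  leb (-%R @^-1` A) = leb A.
Proof.
move=> mA.
have mf : measurable_fun [set: R'] (fun x : R' => (- x : R')).
  exact: measurable_funN.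
apply/esym.
have := @lebesgue_measure_unique R (measure_function_pushforward__canonical__measure_function_Measure leb mf).
apply => // X.
case=> -[a b] _ <- /=.
have H : (fun x => - x) @^-1` `]a, b] = `[- b, - a[%classic.
  apply/seteqP; split => x /=; rewrite !in_itv/= => /andP[? ?]; apply/andP; split; lra.
by rewrite /pushforward H !lebesgue_measure_itv/= !lte_fin ltrN2 -!EFinB opprK addrC.
Qed.
End lebesgue_measure_1d.

(** * Coordinatewise maps and boxes under the product measure *)

Section lebesgue_tuple_invariance.
Context {R : realType}.
Local Notation R' := (measurableTypeR R).
Local Notation leb := (@lebesgue_measure R).

Definition tuple_app n (phi : 'I_n -> R' -> R') (t : n.-tuple R') : n.-tuple R' :=
  [tuple phi i (tnth t i) | i < n].

Lemma measurable_tuple_app n (phi : 'I_n -> R' -> R') :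
  (forall i, measurable_fun setT (phi i)) -> measurable_fun setT (tuple_app phi).
Proof.
move=> mphi; apply/measurable_fun_tnthP => i.
rewrite (_ : _ \o _ = fun t => phi i (tnth t i)); last first.
  by apply/funext => t; rewrite /= tnth_mktuple.
by apply: (measurableT_comp (mphi i)); exact: measurable_tnth.
Qed.

(** Induction on [n] through uniqueness of the product measure: the image under the map acting on
    head and tail has the right value on rectangles, the tail being the induction hypothesis. *)
Lemma lebesgue_tuple_app n (phi : 'I_n -> R' -> R') :
  (forall i, measurable_fun setT (phi i)) ->
  (forall i A, measurable A -> leb (phi i @^-1` A) = leb A) ->
  forall B, measurable B -> lebesgue_tuple n (tuple_app phi @^-1` B) = lebesgue_tuple n B.
Proof.
elim: n phi => [|n IH] phi mphi phiE B mB.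
  rewrite (_ : tuple_app phi = id)//; apply/funext => t.
  by apply: eq_from_tnth => -[].
rewrite /= /lebesgue_succ /pushforward.
pose phi' i := phi (lift ord0 i).
pose Psi (z : R' * n.-tuple R') := (phi ord0 z.1, tuple_app phi' z.2).
have mPsi : measurable_fun setT Psi.
  apply/measurable_fun_pairP; split.
    exact: (measurableT_comp (mphi ord0)).
  exact: (measurableT_comp (measurable_tuple_app (fun i => mphi (lift ord0 i)))).
have -> : @tcons R n @^-1` (tuple_app phi @^-1` B) = Psi @^-1` (@tcons R n @^-1` B).
  have -> : @tcons R n @^-1` (tuple_app phi @^-1` B) = (tuple_app phi \o @tcons R n) @^-1` B by [].
  have -> : Psi @^-1` (@tcons R n @^-1` B) = (@tcons R n \o Psi) @^-1` B by [].
  congr (_ @^-1` B); apply/funext => -[x t].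
  apply: eq_from_tnth => i; rewrite /= tnth_mktuple /=.
  by case: (unliftP ord0 i) => [j ->|->]; rewrite ?tnthS ?tnth0 //= tnth_mktuple.
pose m' := measure_function_pushforward__canonical__measure_function_Measure
  (leb \x lebesgue_tuple n)%E mPsi.
apply/esym.
have := @product_measure_unique _ _ _ _ _ leb (lebesgue_tuple n) m'.
apply => [A C mA mC|]; last first.
  by rewrite -[X in measurable X]setTI; exact: measurable_tcons.
have mA' : measurable (phi ord0 @^-1` A).
  by rewrite -[X in measurable X]setTI; exact: mphi.
have mC' : measurable (tuple_app phi' @^-1` C).
  rewrite -[X in measurable X]setTI.
  exact: (measurable_tuple_app (fun i => mphi (lift ord0 i))).
rewrite /m' /= /pushforward.
have -> : Psi @^-1` (A `*` C) = (phi ord0 @^-1` A) `*` (tuple_app phi' @^-1` C) by [].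
rewrite product_measure1E//; congr (_ * _)%E; first exact: phiE.
by apply: IH => // i; [exact: mphi|exact: phiE].
Qed.

Lemma lebesgue_tuple_box n (A : 'I_n -> set R') : (forall i, measurable (A i)) ->
  lebesgue_tuple n [set t | forall i, A i (tnth t i)] = (\prod_i leb (A i))%E.
Proof.
elim: n A => [|n IH] A mA.
  rewrite /= big_ord0 diracE /= mem_set//=; by case.
rewrite /= /lebesgue_succ /pushforward big_ord_recl -IH//.
rewrite -product_measure1E//; last first.
  have -> : [set t : n.-tuple R' | forall i, A (lift ord0 i) (tnth t i)] =
    \bigcap_(i in [set: 'I_n]) ((fun t => tnth t i) @^-1` A (lift ord0 i)).
    by apply/seteqP; split => t /= h i; [move=> _|]; apply: h.
  apply: fin_bigcap_measurable => // i _.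
  by rewrite -[X in measurable X]setTI; exact: measurable_tnth.
congr (_ _); apply/seteqP; split => -[x t] /= h.
  by split => [|i]; [have := h ord0; rewrite tnth0|have := h (lift ord0 i); rewrite tnthS].
by move=> i; case: (unliftP ord0 i) => [j ->|->]; rewrite ?tnthS ?tnth0; apply h.
Qed.
End lebesgue_tuple_invariance.

Lemma exists_invn_lt (R : realType) (e : R) : 0 < e -> exists k : nat, k.+1%:R^-1 < e.
Proof.
move=> e0; have [N _ H] := near_infty_natSinv_lt (PosNum e0).
by exists N; exact: (H N (leqnn N)).
Qed.

Section rV_norm.
Context {R : realType} {n : nat}.
Implicit Types x : 'rV[R]_n.

Lemma coord_norm_le x i : `|x 0 i| <= `|x|.
Proof. by rewrite [leRHS]/Num.norm /= mx_normrE; apply/bigmax_geP; right => /=; exists (0, i). Qed.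

Lemma rV_norm_le x r : 0 <= r -> (forall i, `|x 0 i| <= r) -> `|x| <= r.
Proof.
move=> r0 h; rewrite /Num.norm /= mx_normrE; apply/bigmax_leP; split => // -[i j] _ /=.
by rewrite (ord1 i).
Qed.

Lemma rV_norm_lt x r : 0 < r -> (forall i, `|x 0 i| < r) -> `|x| < r.
Proof.
move=> r0 h; rewrite /Num.norm /= mx_normrE; apply/bigmax_ltP; split => // -[i j] _ /=.
by rewrite (ord1 i).
Qed.
End rV_norm.

(** * Lebesgue measure on row vectors: open sets, invariant maps, boxes *)

Section rV_measure.
Context {R : realType} {n : nat}.
Local Notation E := 'rV[R]_n.
Local Notation mu := (@lebesgue_rV R n).
Local Notation R' := (measurableTypeR R).

Definition tuple_of_rV (x : E) : n.-tuple R' := [tuple x 0 i | i < n].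

Lemma rV_of_tupleK : cancel (@rV_of_tuple R n) tuple_of_rV.
Proof. by move=> t; apply: eq_from_tnth => i; rewrite tnth_mktuple mxE. Qed.

Lemma tuple_of_rVK : cancel tuple_of_rV (@rV_of_tuple R n).
Proof. by move=> x; apply/rowP => i; rewrite mxE tnth_mktuple. Qed.

(** A set of the product sigma-algebra satisfies the Caratheodory condition for the induced outer
    measure, and [lebesgue_rV] is that outer measure read on row vectors. *)
Lemma measurable_rV (A : set E) : measurable (@rV_of_tuple R n @^-1` A) -> measurable A.
Proof.
move=> mA; suff : caratheodory_measurable mu A by [].
move=> X.
by have := caratheodory_measurable_mu_ext (lebesgue_tuple n) mA (@rV_of_tuple R n @^-1` X).
Qed.

Lemma lebesgue_rVE (A : set E) : measurable (@rV_of_tuple R n @^-1` A) ->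
  mu A = lebesgue_tuple n (@rV_of_tuple R n @^-1` A).
Proof. by move=> mA; rewrite /lebesgue_rV measurable_mu_extE. Qed.

Lemma measurable_coord i : measurable_fun setT (fun x : E => x 0 i : R').
Proof.
move=> _ Y mY; rewrite setTI; apply: measurable_rV.
rewrite (_ : _ @^-1` _ = (fun t : n.-tuple R' => tnth t i) @^-1` Y).
  by rewrite -[X in measurable X]setTI; exact: measurable_tnth.
by apply/seteqP; split => t /=; rewrite mxE.
Qed.

(** A countable base: sup-norm balls with rational centre and radius [1/(k+1)]. Such balls are
    boxes, so measurability of open sets reduces to that of the coordinates. *)
Definition rat_center (z : 'rV[rat]_n * nat) : E := \row_i ratr (z.1 0 i).
Definition rat_ball (z : 'rV[rat]_n * nat) : set E := [set x | `|x - rat_center z| < z.2.+1%:R^-1].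

Lemma rat_ballE z : rat_ball z =
  \bigcap_(i in [set: 'I_n]) [set x : E | `|x 0 i - rat_center z 0 i| < z.2.+1%:R^-1].
Proof.
apply/seteqP; split => x /= h.
  by move=> i _; have := coord_norm_le (x - rat_center z) i; rewrite !mxE => /le_lt_trans; apply.
by apply: rV_norm_lt => // i; have := h i I; rewrite !mxE.
Qed.

Lemma open_rat_ball (O : set E) x : open O -> O x ->
  exists z, rat_ball z x /\ [set y : E | `|y - rat_center z| <= z.2.+1%:R^-1] `<=` O.
Proof.
move=> oO Ox.
have /nbhs_normP[e /= e0 eO] := oO x Ox.
have [k] := exists_invn_lt (divr_gt0 e0 (ltr0n R 2)).
have : 0 < k.+1%:R^-1 :> R by [].
rewrite /rat_ball /rat_center; move Ek : (k.+1%:R^-1) => d d0 kE.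
have /choice[r rE] : forall i : 'I_n, exists r : rat, `|x 0 i - ratr r| < d.
  move=> i; have [|r] := @rat_in_itvoo R (x 0 i - d) (x 0 i + d); first by lra.
  by rewrite in_itv/= => /andP[? ?]; exists r; rewrite ltr_norml; apply/andP; split; lra.
exists (\row_i r i, k) => /=; rewrite Ek; split.
  by apply: rV_norm_lt => // i; rewrite !mxE.
move=> y /= By; apply: eO; apply: rV_norm_lt => // j.
have := le_trans (coord_norm_le _ j) By; have := rE j; rewrite !mxE => h1 h2.
rewrite (_ : x 0 j - y 0 j = (x 0 j - ratr (r j)) - (y 0 j - ratr (r j))); last by ring.
by rewrite (le_lt_trans (ler_normB _ _))//; lra.
Qed.

Lemma open_rV_bigcup (O : set E) : open O -> O = \bigcup_(z in [set z | rat_ball z `<=` O]) rat_ball z.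
Proof.
move=> oO; apply/seteqP; split => [x Ox|x [z /= BO Bx]]; last exact: BO.
have [z [zx zO]] := open_rat_ball oO Ox; exists z => //= y yz.
by apply: zO; exact: ltW.
Qed.

(** Stated for maps from any measurable space because it is also applied on [E * E] with its product
    sigma-algebra, to kernels such as [rho (x - y)]. *)
Lemma mfun_open_preimage d (T : measurableType d) (F : T -> E) (O : set E) :
  (forall i, measurable_fun setT (fun t => F t 0 i)) -> open O -> measurable (F @^-1` O).
Proof.
move=> mF /open_rV_bigcup ->; rewrite preimage_bigcup.
rewrite bigcup_mkcond; apply: countable_bigcupT_measurable => [|z]; first exact: countableP.
case: ifP => // _; rewrite rat_ballE preimage_bigcap.
apply: fin_bigcap_measurable; first exact: finite_finset.
move=> i _.
have -> : F @^-1` [set x : E | `|x 0 i - rat_center z 0 i| < z.2.+1%:R^-1] =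
   setT `&` (fun t => F t 0 i) @^-1` (ball (rat_center z 0 i) z.2.+1%:R^-1).
  by rewrite setTI; apply/seteqP; split => x /=; rewrite /ball /= distrC.
by apply: mF => //; apply: measurable_ball.
Qed.

Lemma open_rV_measurable (O : set E) : open O -> measurable O.
Proof. by move=> oO; exact: (@mfun_open_preimage _ E id O measurable_coord oO). Qed.

Lemma mfun_continuous_comp d (T : measurableType d) (F : T -> E) (f : E -> R) :
  (forall i, measurable_fun setT (fun t => F t 0 i)) -> continuous f ->
  measurable_fun setT (fun t => f (F t)).
Proof.
move=> mF cf; apply: (measurability _ (RGenOInfty.measurableE R)) => // _ [_ [a ->] <-].
rewrite setTI; apply: (@mfun_open_preimage _ _ F (f @^-1` `]a, +oo[)) => //.
by apply: open_comp => // x _; exact: cf.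
Qed.

Lemma continuous_rV_measurable (f : E -> R) : continuous f -> measurable_fun setT (f : E -> R').
Proof.
move=> cf; apply: (measurability _ (RGenOInfty.measurableE R)) => // _ [_ [a ->] <-].
rewrite setTI; apply: open_rV_measurable; apply: open_comp => // x _; exact: cf.
Qed.

Lemma closed_rV_measurable (O : set E) : closed O -> measurable O.
Proof. by move=> cO; rewrite -(setCK O); apply: measurableC; apply: open_rV_measurable; rewrite openC. Qed.

Lemma compact_rV_measurable (O : set E) : compact O -> measurable O.
Proof. by move=> cO; apply: closed_rV_measurable; apply: compact_closed => //; exact: norm_hausdorff. Qed.

Definition rV_app (phi : 'I_n -> R -> R) (x : E) : E := \row_i phi i (x 0 i).

(** A countable cover of [A] pulls back to a cover of the preimage with the same total measure;
    hence no measurability of [A] is involved. *)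
Lemma le_lebesgue_rV_app (phi : 'I_n -> R' -> R') A :
  (forall i, measurable_fun setT (phi i)) ->
  (forall i B, measurable B -> @lebesgue_measure R (phi i @^-1` B) = lebesgue_measure B) ->
  (mu (rV_app phi @^-1` A) <= mu A)%E.
Proof.
move=> mphi phiE; rewrite /lebesgue_rV.
have -> : @rV_of_tuple R n @^-1` (rV_app phi @^-1` A) =
   tuple_app phi @^-1` (@rV_of_tuple R n @^-1` A).
  apply/seteqP; split => t /=; congr A; apply/rowP => i; rewrite !mxE tnth_mktuple//.
move: (_ @^-1` A) => X.
apply/le_ereal_inf_tmp => x [B [mB XB] <-].
apply: ereal_inf_lbound; exists (fun k => tuple_app phi @^-1` B k).
  split => [k|t Xt]; last exact: (XB (tuple_app phi t)).
  rewrite -[X in measurable X]setTI; exact: (measurable_tuple_app mphi).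
by apply: eq_eseriesr => k _; rewrite lebesgue_tuple_app.
Qed.

Definition mu_invariant (Phi : E -> E) := measurable_fun setT Phi /\
  forall A, mu (Phi @^-1` A) = mu A.

(** The two inequalities give equality of outer measures on all sets, and the Caratheodory condition
    for a preimage is then the one for the original set, tested on transported sets. This is how
    [Phi] becomes measurable for Lebesgue sets; continuity would only yield Borel sets. *)
Lemma mu_invariant_bij (Phi Psi : E -> E) : cancel Phi Psi -> cancel Psi Phi ->
  (forall A, mu (Phi @^-1` A) <= mu A)%E -> (forall A, mu (Psi @^-1` A) <= mu A)%E ->
  mu_invariant Phi.
Proof.
move=> PhiK PsiK h1 h2.
have PP A : Psi @^-1` (Phi @^-1` A) = A by apply/seteqP; split=> x /=; rewrite PsiK.
have PP' A : Phi @^-1` (Psi @^-1` A) = A by apply/seteqP; split=> x /=; rewrite PhiK.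
have eqm A : mu (Phi @^-1` A) = mu A.
  by apply/eqP; rewrite eq_le h1/= -{1}(PP A) h2.
split => // _ A mA; rewrite setTI.
suff : caratheodory_measurable mu (Phi @^-1` A) by [].
move=> X; rewrite -[X in mu X]PP' eqm.
have -> := (mA : caratheodory_measurable mu A) (Psi @^-1` X).
by rewrite -eqm -[in X in (_ + X)%E]eqm !preimage_setI PP' preimage_setC.
Qed.

Lemma mu_invariant_app (phi psi : 'I_n -> R' -> R') :
  (forall i, cancel (phi i) (psi i)) -> (forall i, cancel (psi i) (phi i)) ->
  (forall i, measurable_fun setT (phi i)) -> (forall i, measurable_fun setT (psi i)) ->
  (forall i B, measurable B -> @lebesgue_measure R (phi i @^-1` B) = lebesgue_measure B) ->
  (forall i B, measurable B -> @lebesgue_measure R (psi i @^-1` B) = lebesgue_measure B) ->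
  mu_invariant (rV_app phi).
Proof.
move=> k1 k2 m1 m2 h1 h2; apply: (@mu_invariant_bij _ (rV_app psi)).
- by move=> x; apply/rowP => i; rewrite !mxE k1.
- by move=> x; apply/rowP => i; rewrite !mxE k2.
- by move=> A; exact: le_lebesgue_rV_app.
- by move=> A; exact: le_lebesgue_rV_app.
Qed.

Lemma mu_invariant_shift (y : E) : mu_invariant (fun x => x + y).
Proof.
have -> : (fun x : E => x + y) = rV_app (fun i t => t + y 0 i).
  by apply/funext => x; apply/rowP => i; rewrite !mxE.
apply: (@mu_invariant_app _ (fun i t => t - y 0 i)).
- by move=> i t; rewrite addrK.
- by move=> i t; rewrite subrK.
- by move=> i; exact: measurable_funD.
- by move=> i; exact: measurable_funB.
- by move=> i B mB; exact: lebesgue_measure_shift.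
- by move=> i B mB; exact: lebesgue_measure_shift.
Qed.

Lemma mu_invariant_opp : mu_invariant (fun x => - x).
Proof.
have -> : (fun x : E => - x) = rV_app (fun i t => - t).
  by apply/funext => x; apply/rowP => i; rewrite !mxE.
apply: (@mu_invariant_app _ (fun i t => - t)).
- by move=> i t; rewrite opprK.
- by move=> i t; rewrite opprK.
- by move=> i; exact: measurable_funN.
- by move=> i; exact: measurable_funN.
- by move=> i B mB; exact: lebesgue_measure_opp.
- by move=> i B mB; exact: lebesgue_measure_opp.
Qed.

Lemma ge0_integral_invariant (Phi : E -> E) (f : E -> \bar R) : mu_invariant Phi ->
  measurable_fun setT f -> (forall x, 0 <= f x)%E ->
  (\int[mu]_x f (Phi x) = \int[mu]_x f x)%E.
Proof.
move=> [mPhi PhiE] mf f0.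
rewrite -[LHS](ge0_integral_pushforward mPhi mu measurableT mf)//.
by apply: eq_measure_integral => A mA _; exact: PhiE.
Qed.

Lemma lebesgue_rV_box (A : 'I_n -> set R') : (forall i, measurable (A i)) ->
  mu [set x : E | forall i, A i (x 0 i)] = (\prod_i lebesgue_measure (A i))%E.
Proof.
move=> mA.
have H : @rV_of_tuple R n @^-1` [set x : E | forall i, A i (x 0 i)] =
         [set t : n.-tuple R' | forall i, A i (tnth t i)].
  by apply/seteqP; split => t /= h i; have := h i; rewrite mxE.
rewrite lebesgue_rVE H ?lebesgue_tuple_box//.
have -> : [set t : n.-tuple R' | forall i, A i (tnth t i)] =
    \bigcap_(i in [set: 'I_n]) ((fun t => tnth t i) @^-1` A i).
  by apply/seteqP; split => t /= h i; [move=> _|]; apply: h.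
apply: fin_bigcap_measurable => // i _.
by rewrite -[X in measurable X]setTI; exact: measurable_tnth.
Qed.

Definition cube (r : R) : set E := [set x : E | forall i, `[- r, r]%classic (x 0 i)].

Lemma measurable_cube r : measurable (cube r).
Proof.
have -> : cube r = \bigcap_(i in [set: 'I_n]) (setT `&` (fun x : E => x 0 i : R') @^-1` `[- r, r]%classic).
  apply/seteqP; split => x /= h i; [move=> _; rewrite setTI|]; first exact: h.
  by have := h i I; rewrite setTI.
by apply: fin_bigcap_measurable => // i _; apply: measurable_coord.
Qed.

Lemma lebesgue_cube_lty r : (mu (cube r) < +oo)%E.
Proof.
rewrite /cube (@lebesgue_rV_box (fun=> `[- r, r]%classic)) => [|i]; last exact: measurable_itv.
under eq_bigr => i _ do rewrite lebesgue_measure_itv/=.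
by rewrite ltey_eq prode_fin_num// => i _; case: ifP.
Qed.

Lemma bounded_cube (A : set E) : bounded_set A -> exists r, A `<=` cube r.
Proof.
move=> [M [_ HM]]; exists (M + 1) => x Ax i /=.
have /= := HM (M + 1) (ltr_pwDr ltr01 (lexx M)) x Ax.
move=> h; rewrite in_itv/= -ler_norml; apply: le_trans h.
exact: coord_norm_le.
Qed.

End rV_measure.

(** * Measures with a density, Borel hulls, functions with vanishing integrals *)

Section density_measure.
Local Open Scope ereal_scope.
Context d (T : measurableType d) (R : realType) (m : {measure set T -> \bar R}).
Variables (f : T -> \bar R) (mf : measurable_fun setT f) (f0 : forall x, 0 <= f x).

(** The proofs are arguments of the term so that its measure structure can be inferred from it. *)
Definition density (_ : measurable_fun setT f) (_ : forall x, 0 <= f x) (A : set T) := \int[m]_(x in A) f x.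

Local Notation df := (density mf f0).

Let density0 : df set0 = 0.
Proof. exact: integral_set0. Qed.

Let density_ge0 A : 0 <= df A.
Proof. exact: integral_ge0. Qed.

Let density_sigma_additive : semi_sigma_additive df.
Proof.
move=> F mF tF mUF; rewrite /density ge0_integral_bigcup//.
  apply: is_cvg_nneseries => k _ _; exact: integral_ge0.
exact: measurable_funS mf.
Qed.

HB.instance Definition _ := isMeasure.Build _ _ _ df
  density0 density_ge0 density_sigma_additive.
End density_measure.

Section rV_borel.
Context {R : realType} {n : nat}.
Local Notation E := 'rV[R]_n.
Local Notation mu := (@lebesgue_rV R n).
Local Notation R' := (measurableTypeR R).

Lemma lebesgue_rV_sigma_finite : sigma_finite [set: E] mu.
Proof.
exists (fun k => cube k%:R); last by move=> k; split; [exact: measurable_cube|exact: lebesgue_cube_lty].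
apply/seteqP; split => // x _.
exists (Num.truncn `|x|).+1 => // i /=; rewrite in_itv/= -ler_norml.
apply: (le_trans (coord_norm_le _ _)); apply: ltW.
by have := truncnS_gt `|x|.
Qed.

HB.instance Definition _ := @Measure_isSigmaFinite.Build _ E R mu lebesgue_rV_sigma_finite.

Lemma compact_bounded_cube (K : set E) : compact K -> exists r, K `<=` cube r.
Proof. by move=> /compact_bounded; exact: bounded_cube. Qed.

Lemma compact_lebesgue_lty (K : set E) : compact K -> (mu K < +oo)%E.
Proof.
move=> cK; have [r Kr] := compact_bounded_cube cK.
apply: le_lt_trans (lebesgue_cube_lty r); apply: le_measure => //; rewrite inE.
  exact: compact_rV_measurable.
exact: measurable_cube.
Qed.

Lemma lebesgue_ball_gt0 (x : E) r : 0 < r -> (0 < mu [set y : E | (`|y - x| < r)%R])%E.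
Proof.
move=> r0.
have -> : [set y : E | `|y - x| < r] = [set y | forall i, `]x 0 i - r, x 0 i + r[%classic (y 0 i)].
  apply/seteqP; split => y /= h.
    move=> i; rewrite in_itv/= -ltr_distl; have := coord_norm_le (y - x) i.
    by rewrite !mxE => h'; apply: le_lt_trans h.
  by apply: rV_norm_lt => // i; have := h i; rewrite !mxE in_itv/= -ltr_distl.
rewrite (@lebesgue_rV_box _ _ (fun i => `]x 0 i - r, x 0 i + r[%classic)); last by move=> i; exact: measurable_itv.
under eq_bigr => i _ do rewrite lebesgue_measure_itv/= lte_fin ltrD2l gtrN// -EFinB.
elim/big_ind : _ => // [a b|i _]; first exact: mule_gt0.
by rewrite lte_fin; lra.
Qed.

(** The Borel structure on [E], kept apart from the Lebesgue one that [E] carries by default. *)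
Let Bo := g_sigma_algebraType (@open E).

Lemma borel_measurable (A : set E) : <<s open >> A -> measurable A.
Proof.
apply: smallest_sub; first exact: sigma_algebra_measurable.
by move=> O; exact: open_rV_measurable.
Qed.

Lemma measurable_tuple_of_rV : measurable_fun setT (tuple_of_rV : Bo -> n.-tuple R').
Proof.
apply/measurable_fun_tnthP => i.
rewrite (_ : _ \o _ = fun x : E => x 0 i); last first.
  by apply/funext => x; rewrite /= tnth_mktuple.
apply: (measurability _ (RGenOInfty.measurableE R)) => // _ [_ [a ->] <-].
rewrite setTI; apply: sub_sigma_algebra => /=; apply: open_comp => // x _.
exact: coord_continuous.
Qed.

(** The covers in the definition of the outer measure consist of product-measurable sets, which are
    Borel; intersect covers with excess [1/(k+1)]. *)
Lemma borel_hull (A : set E) : measurable A -> (mu A < +oo)%E ->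
  exists B, [/\ <<s open >> B, A `<=` B & mu B = mu A].
Proof.
move=> mA Aoo.
have Afin : mu A \is a fin_num by rewrite ge0_fin_numE.
have H k : exists B, [/\ <<s open >> B, A `<=` B & (mu B <= mu A + k.+1%:R^-1%:E)%E].
  have k0 : 0 < k.+1%:R^-1 :> R by [].
  have [_ [F [mF AF] <-] Fle] := lb_ereal_inf_adherent k0 Afin.
  have mG j : <<s open >> (tuple_of_rV @^-1` F j).
    have := @measurable_tuple_of_rV measurableT (F j) (mF j).
    by rewrite setTI.
  exists (\bigcup_j (tuple_of_rV @^-1` F j)); split.
  - exact: (@bigcupT_measurable _ Bo).
  - move=> x Ax; have [|j _ Fj] := AF (tuple_of_rV x); first by rewrite /= tuple_of_rVK.
    by exists j.
  - apply: le_trans (ltW Fle).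
    apply: le_trans; first by apply: (@outer_measure_sigma_subadditive R E mu).
    rewrite le_eqVlt; apply/orP; left; apply/eqP; apply: eq_eseriesr => j _.
    have TT : @rV_of_tuple R n @^-1` (tuple_of_rV @^-1` F j) = F j.
      by apply/seteqP; split => t /=; rewrite rV_of_tupleK.
    by have := @lebesgue_rVE R n (tuple_of_rV @^-1` F j); rewrite TT; apply.
have /choice[B HB] := H.
exists (\bigcap_k B k); split.
- by apply: (@bigcap_measurableType _ Bo) => k _; case: (HB k).
- by move=> x Ax k _; case: (HB k) => _ + _; exact.
- apply/eqP; rewrite eq_le; apply/andP; split.
    apply/lee_addgt0Pr => e /exists_invn_lt[k ke].
    have [_ _ h] := HB k.
    apply: (@le_trans _ _ (mu (B k))).
      by apply: le_outer_measure; exact: bigcap_inf.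
    by apply: (le_trans h); rewrite leeD2l// lee_fin ltW.
  apply: le_outer_measure => x Ax k _; case: (HB k) => _ + _; exact.
Qed.

(** The positive and negative parts of [g] are densities of two finite measures that agree on open
    sets, a class stable under intersection, hence on Borel sets. Borel hulls carry the equality
    over to Lebesgue sets of finite measure, and cubes exhaust the space. *)
Lemma measurable_open_integral0_ae (g : E -> \bar R) :
  mu.-integrable setT g ->
  (forall O, open O -> (\int[mu]_(x in O) g x = 0)%E) ->
  ae_eq mu setT g (cst 0%E).
Proof.
move=> ig g0.
have mg := measurable_int _ ig.
have mp := measurable_funepos mg.
have mn := measurable_funeneg mg.
pose m1 := density mu mp (@funepos_ge0 _ _ g) : {measure set E -> \bar R}.
pose m2 := density mu mn (@funeneg_ge0 _ _ g) : {measure set E -> \bar R}.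
have ip := integrable_funepos measurableT ig.
have inn := integrable_funeneg measurableT ig.
have fin1 A : measurable A -> m1 A \is a fin_num.
  move=> mA; apply: integrable_fin_num => //; exact: integrableS ip.
have fin2 A : measurable A -> m2 A \is a fin_num.
  move=> mA; apply: integrable_fin_num => //; exact: integrableS inn.
have m12 : forall A, <<s open >> A -> m1 A = m2 A.
  have H0 : @open E `<=` measurable by move=> O; exact: open_rV_measurable.
  have := @g_sigma_algebra_measure_unique _ _ _ (@open E) H0 (fun=> setT) _ _ m1 m2.
  apply.
  - by move=> _; exact: openT.
  - by rewrite bigcup_const//; exists 0%N.
  - by move=> *; exact: openI.
  - move=> O oO; have mO := open_rV_measurable oO.
    have := g0 _ oO; rewrite integralE -/(density mu mp (@funepos_ge0 _ _ g) O) -/(density mu mn (@funeneg_ge0 _ _ g) O).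
    by move/eqP; rewrite sube_eq ?add0e ?(fin1 _ mO, fin2 _ mO) ?fin_num_adde_defl ?(fin1 _ mO, fin2 _ mO) // => /eqP.
  - by move=> _; rewrite ltey_eq (fin1 _ measurableT).
have fA A : measurable A -> (mu A < +oo)%E -> (\int[mu]_(x in A) g x = 0)%E.
  move=> mA Aoo; have [B [bB AB muB]] := borel_hull mA Aoo.
  have mB := borel_measurable bB.
  have N0 : mu (B `\` A) = 0%E.
    rewrite measureD//=; last by rewrite muB.
    by rewrite setIidr// muB subee// ge0_fin_numE.
  have gB : (\int[mu]_(x in B) g x = 0)%E.
    by rewrite integralE -/(density mu mp (@funepos_ge0 _ _ g) B) -/(density mu mn (@funeneg_ge0 _ _ g) B) (m12 _ bB) subee// fin2.
  rewrite -gB (@negligible_integral _ _ _ mu B (B `\` A))//.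
  - by rewrite setDD setIidr.
  - exact: measurableD.
  - exact: integrableS ig.
have ck k : ae_eq mu (cube k%:R) g (cst 0%E).
  apply: integral_ae_eq => //.
  - exact: measurable_cube.
  - by apply: integrableS ig => //; exact: measurable_cube.
  - move=> A Ak mA; rewrite integral0 fA//.
    apply: le_lt_trans (lebesgue_cube_lty k%:R); apply: le_measure => //; rewrite inE//.
    exact: measurable_cube.
have /= := ae_foralln ck.
apply: filterS => x h _; apply: (h (Num.truncn `|x|).+1) => i /=; rewrite in_itv/= -ler_norml.
apply: (le_trans (coord_norm_le _ _)); apply: ltW.
by have := truncnS_gt `|x|.
Qed.

End rV_borel.

(** * L^p norms and uniform convexity *)

Section powR_facts.
Context {R : realType}.
Implicit Types (p x y : R).

Lemma le_powR2 p x y : 0 <= p -> 0 <= x -> x <= y -> x `^ p <= y `^ p.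
Proof. by move=> p0 x0 xy; apply: ge0_ler_powR => //; rewrite nnegrE// (le_trans x0). Qed.

Lemma lt_powR2 p x y : 0 < p -> 0 <= x -> x < y -> x `^ p < y `^ p.
Proof. by move=> p0 x0 xy; apply: gt0_ltr_powR => //; rewrite nnegrE// (le_trans x0)// ltW. Qed.

Lemma powR_le_cancel p x y : 0 < p -> 0 <= y -> x `^ p <= y `^ p -> x <= y.
Proof. by move=> p0 y0; apply: contraTT; rewrite -!ltNge => yx; apply: lt_powR2. Qed.

Lemma powRVK p x : 0 < p -> 0 <= x -> (x `^ p^-1) `^ p = x.
Proof. by move=> p0 x0; rewrite -powRrM mulVf ?gt_eqF// powRr1. Qed.

Lemma powRKV p x : 0 < p -> 0 <= x -> (x `^ p) `^ p^-1 = x.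
Proof. by move=> p0 x0; rewrite -powRrM mulfV ?gt_eqF// powRr1. Qed.

Lemma powR_continuous_normr p : 0 < p -> continuous (fun t : R => `|t| `^ p).
Proof.
move=> p0 t; have [->|t0] := eqVneq t 0.
  rewrite /continuous_at normr0 powR0 ?gt_eqF//.
  apply/cvgrPdist_lt => e e0.
  have e1 : 0 < e `^ p^-1 by rewrite powR_gt0.
  have H : \forall x \near (0 : R), `|x| < e `^ p^-1 by exact: nbhs0_lt.
  apply: filterS H => x xe; rewrite sub0r normrN ger0_norm ?powR_ge0//.
  by rewrite -[ltRHS](@powRVK p) ?(ltW e0)//; apply: lt_powR2.
apply: (@continuous_comp _ _ _ (fun t : R => `|t|) (fun x => x `^ p)).
  exact: norm_continuous.
apply: differentiable_continuous; apply/derivable1_diffP.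
by apply: derivable_powR; rewrite in_itv/= normr_gt0 t0.
Qed.

(** Mean value theorem on each half of the interval: the derivative [p t^(p-1)] is strictly larger
    on the right half. The function is written with [|t|] because the power jumps to the left of
    [0], which would spoil continuity at an endpoint. *)
Lemma powR_half_strict p x y : 1 < p -> 0 <= x -> 0 <= y -> x != y ->
  ((x + y) / 2) `^ p < (x `^ p + y `^ p) / 2.
Proof.
move=> p1; wlog xy : x y / x < y.
  move=> H x0 y0 /[dup] xy; rewrite neq_lt => /orP[?|?]; first exact: H.
  by rewrite addrC [ltRHS](_ : _ = (y `^ p + x `^ p) / 2); [apply: H => //; rewrite eq_sym|rewrite [X in X / _]addrC].
move=> x0 y0 _.
have p0 : 0 < p by rewrite (lt_trans _ p1).
set z := (x + y) / 2.
have xz : x < z by rewrite /z; lra.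
have zy : z < y by rewrite /z; lra.
have cf a b : {within `[a, b], continuous (fun t : R => `|t| `^ p)}.
  by apply: continuous_subspaceT; exact: powR_continuous_normr.
have df (a b : R) : 0 <= a -> forall t : R, t \in `]a, b[ ->
    is_derive t 1 (fun t : R => `|t| `^ p) (p * t `^ (p - 1)).
  move=> a0 t; rewrite in_itv/= => /andP[at_ tb].
  have t0 : 0 < t by apply: le_lt_trans at_.
  have H : \forall s \near t, s `^ p = `|s| `^ p.
    by apply: filterS (lt_nbhsr t0) => s s0; rewrite gtr0_norm.
  apply: (near_eq_is_derive H).
  apply: DeriveDef; first by apply: derivable_powR; rewrite in_itv/= t0.
  by rewrite -derive1E powR_derive1// in_itv/= t0.
have [u + Hu] := MVT xz (df x z x0) (cf x z).
have [v + Hv] := MVT zy (df z y (le_trans x0 (ltW xz))) (cf z y).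
rewrite !in_itv/= => /andP[zv vy] /andP[xu uz].
have uv : u `^ (p - 1) < v `^ (p - 1).
  apply: lt_powR2; first by rewrite subr_gt0.
    exact: (le_trans x0 (ltW xu)).
  exact: lt_trans zv.
move: Hu Hv; rewrite !ger0_norm ?(le_trans x0)//; try exact: ltW.
have -> : z - x = (y - x) / 2 by rewrite /z; field.
have -> : y - z = (y - x) / 2 by rewrite /z; field.
move: uv; move: (u `^ _) (v `^ _) (x `^ _) (y `^ _) (z `^ _) => A B X Y Z uv HX HY.
have h : p * A * ((y - x) / 2) < p * B * ((y - x) / 2).
  by rewrite ltr_pM2r ?divr_gt0 ?subr_gt0// ltr_pM2l.
lra.
Qed.

Lemma powR_half p x y : 1 < p -> 0 <= x -> 0 <= y ->
  ((x + y) / 2) `^ p <= (x `^ p + y `^ p) / 2.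
Proof.
move=> p1 x0 y0; have [->|xy] := eqVneq x y; last exact/ltW/powR_half_strict.
by rewrite (_ : (y + y) / 2 = y); [lra|field].
Qed.

Lemma powRD_le p x y : 1 < p -> 0 <= x -> 0 <= y ->
  (x + y) `^ p <= 2 `^ p * (x `^ p + y `^ p).
Proof.
move=> p1 x0 y0; have p0 : 0 <= p by lra.
wlog xy : x y x0 y0 / x <= y.
  by move=> H; have [?|/ltW ?] := leP x y; [exact: H|rewrite addrC [in leRHS]addrC; exact: H].
apply: (@le_trans _ _ ((2 * y) `^ p)); first by apply: le_powR2 => //; lra.
by rewrite powRM// ler_pM2l ?powR_gt0// lerDr powR_ge0.
Qed.

End powR_facts.

(** * The L^p norm of functions, Fatou and completeness *)

Section Lp_norm.
Context d (T : measurableType d) (R : realType) (m : {measure set T -> \bar R}).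
Variable p : R.
Implicit Types (f g : T -> R) (c : R).
Local Open Scope ereal_scope.

Definition lpn f : \bar R := 'N[m]_(p%:E)[EFin \o f].

Hypothesis p1 : (1 < p)%R.
Let p0 : (0 < p)%R. Proof. exact: lt_trans p1. Qed.

Lemma lpn_ge0 f : 0 <= lpn f.
Proof. exact: Lnorm_ge0. Qed.

Lemma measurable_normpow f : measurable_fun setT f ->
  measurable_fun setT (fun x => (`|f x| `^ p)%:E).
Proof.
move=> mf; apply/measurable_EFinP.
by apply: (measurableT_comp (measurable_powR p)); exact: measurableT_comp.
Qed.

Lemma lpnE f : lpn f = (\int[m]_x (`|f x| `^ p)%:E) `^ p^-1.
Proof. by rewrite /lpn unlock /Lnorm. Qed.

Lemma eq_lpn_int f g : \int[m]_x (`|f x| `^ p)%:E = \int[m]_x (`|g x| `^ p)%:E -> lpn f = lpn g.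
Proof. by move=> h; rewrite lpnE h -lpnE. Qed.

Lemma lpn_pow f : (lpn f) `^ p = \int[m]_x (`|f x| `^ p)%:E.
Proof. by rewrite /lpn poweR_Lnorm ?gt_eqF. Qed.

Lemma int_normpow_ge0 f : 0 <= \int[m]_x (`|f x| `^ p)%:E.
Proof. by apply: integral_ge0 => x _; rewrite lee_fin powR_ge0. Qed.

Lemma lpn_leP f c : (0 <= c)%R ->
  (lpn f <= c%:E) = (\int[m]_x (`|f x| `^ p)%:E <= (c `^ p)%:E).
Proof.
move=> c0; apply/idP/idP => h.
  rewrite -lpn_pow -poweR_EFin; apply: gt0_ler_poweR; rewrite ?(ltW p0)//.
    by rewrite in_itv/= lpn_ge0 leey.
  by rewrite in_itv/= lee_fin c0 leey.
rewrite lpnE -[leRHS](_ : (c `^ p)%:E `^ p^-1 = c%:E); last first.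
  by rewrite poweR_EFin powRKV.
apply: gt0_ler_poweR; rewrite ?invr_ge0 ?(ltW p0)//.
  by rewrite in_itv/= int_normpow_ge0 leey.
by rewrite in_itv/= lee_fin powR_ge0 leey.
Qed.

Lemma lpn_lty f : (lpn f < +oo) = (\int[m]_x (`|f x| `^ p)%:E < +oo).
Proof.
apply/idP/idP => h; last by rewrite lpnE poweR_lty.
by rewrite -lpn_pow poweR_lty.
Qed.

Lemma le_lpn f g : measurable_fun setT f -> measurable_fun setT g ->
  (forall x, (`|f x| <= `|g x|)%R) -> lpn f <= lpn g.
Proof.
move=> mf mg fg; rewrite lpnE lpnE; apply: gt0_ler_poweR.
- by rewrite invr_ge0 ltW.
- by rewrite in_itv/= int_normpow_ge0 leey.
- by rewrite in_itv/= int_normpow_ge0 leey.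
apply: ge0_le_integral => //.
- exact: measurable_normpow.
- exact: measurable_normpow.
- by move=> x _; rewrite lee_fin; apply: le_powR2 => //; exact: ltW.
Qed.

Lemma eq_lpn f g : f =1 g -> lpn f = lpn g.
Proof. by move=> /funext ->. Qed.

Lemma lpn_norm f : lpn (fun x => `|f x|%R) = lpn f.
Proof. apply: eq_lpn_int; apply: eq_integral => x _; by rewrite normr_id. Qed.

Lemma ae_eq_lpn f g : measurable_fun setT f -> measurable_fun setT g ->
  {ae m, forall x, f x = g x} -> lpn f = lpn g.
Proof.
move=> mf mg fg; apply: eq_lpn_int; apply: ge0_ae_eq_integral => //.
- exact: measurable_normpow.
- exact: measurable_normpow.
- by apply: filterS fg => x -> _.
Qed.

Lemma lpnD f g : measurable_fun setT f -> measurable_fun setT g ->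
  lpn (fun x => f x + g x)%R <= lpn f + lpn g.
Proof. by move=> mf mg; apply: minkowski_EFin => //; exact: ltW. Qed.

Lemma lpn0 : lpn (fun=> 0%R) = 0.
Proof. by rewrite /lpn; have := @Lnorm0 _ T R m p%:E; apply; rewrite eqe gt_eqF. Qed.

Lemma lpnN f : lpn (fun x => - f x)%R = lpn f.
Proof. apply: eq_lpn_int; apply: eq_integral => x _; by rewrite normrN. Qed.

Lemma lpnB f g : measurable_fun setT f -> measurable_fun setT g ->
  lpn (fun x => f x - g x)%R <= lpn f + lpn g.
Proof.
move=> mf mg; rewrite -(lpnN g); apply: lpnD => //.
exact: measurable_funN.
Qed.

Lemma lpnC f g : lpn (fun x => f x - g x)%R = lpn (fun x => g x - f x)%R.
Proof. by rewrite -lpnN; apply: eq_lpn => x; rewrite opprB. Qed.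

Lemma lpnZ f c : measurable_fun setT f -> lpn (fun x => c * f x)%R = `|c|%:E * lpn f.
Proof.
move=> mf; rewrite 2!lpnE.
under eq_integral do rewrite normrM powRM// EFinM.
rewrite ge0_integralZl//; [|exact: measurable_normpow].
rewrite poweRM ?int_normpow_ge0 ?lee_fin ?powR_ge0//.
by rewrite poweR_EFin powRKV.
Qed.

Lemma lpn_sum (I : Type) (r : seq I) (P : pred I) (f : I -> T -> R) :
  (forall i, measurable_fun setT (f i)) ->
  lpn (fun x => \sum_(i <- r | P i) f i x)%R <= \sum_(i <- r | P i) lpn (f i).
Proof.
move=> mf.
have mS (s : seq I) : measurable_fun setT (fun x => \sum_(i <- s | P i) f i x)%R.
  elim: s => [|i s IH].
    by rewrite (_ : (fun x => _) = fun=> 0%R)//; apply/funext => x; rewrite big_nil.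
  case Pi : (P i).
    rewrite (_ : (fun x => _) = fun x => f i x + \sum_(j <- s | P j) f j x)%R; first exact: measurable_funD.
    by apply/funext => x; rewrite big_cons Pi.
  rewrite (_ : (fun x => _) = fun x => \sum_(j <- s | P j) f j x)%R//.
  by apply/funext => x; rewrite big_cons Pi.
elim: r => [|i r IH].
  rewrite big_nil (@eq_lpn _ (fun=> 0%R)) ?lpn0//.
  by move=> x; rewrite big_nil.
rewrite big_cons; case Pi : (P i).
  rewrite (@eq_lpn _ (fun x => f i x + \sum_(j <- r | P j) f j x)%R).
    by apply: le_trans (leeD2l _ IH); apply: lpnD.
  by move=> x; rewrite big_cons Pi.
rewrite (@eq_lpn _ (fun x => \sum_(j <- r | P j) f j x)%R)//.
by move=> x; rewrite big_cons Pi.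
Qed.

Lemma lpn_eq0 f : measurable_fun setT f -> lpn f = 0 -> {ae m, forall x, f x = 0%R}.
Proof.
move=> mf /Lnorm_eq0_eq0 H.
have : ae_eq m setT (EFin \o f) (cst 0) by apply: H => //; exact/measurable_EFinP.
by apply: filterS => x /(_ I) /= [].
Qed.

Lemma lpn_fatou (f : (T -> R)^nat) g c : (0 <= c)%R ->
  (forall k, measurable_fun setT (f k)) ->
  (forall x, f ^~ x @ \oo --> g x) ->
  (\forall k \near \oo, lpn (f k) <= c%:E) -> lpn g <= c%:E.
Proof.
move=> c0 mf fg fle; rewrite lpn_leP//.
have H := fatou m measurableT (fun k => measurable_normpow (mf k))
  (fun k x _ => (powR_ge0 `|f k x| p : 0 <= (`|f k x| `^ p)%:E)).
have E x : limn_einf (fun k => (`|f k x| `^ p)%:E) = (`|g x| `^ p)%:E.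
  apply: (cvg_limn_einf_sup _).1.
  apply: cvg_EFin; first exact: nearW.
  apply: (@cvg_comp _ _ _ (f^~ x) (fun t => `|t| `^ p)%R _ _ _ (fg x)).
  exact: powR_continuous_normr.
under eq_integral do rewrite -E.
apply: (le_trans H); rewrite limn_einf_lim.
apply: lime_le; first exact: is_cvg_einfs.
case: fle => N _ fle; exists N => // k /= Nk.
apply: (@le_trans _ _ (\int[m]_x (`|f k x| `^ p)%:E)).
  by apply: ereal_inf_lbound; exists k => /=.
by rewrite -lpn_leP//; apply: fle.
Qed.

(** The bound is the exact geometric sum of [2^-j] for [k <= j < l], the form in which the induction
    on [l] closes. *)
Lemma lpn_cauchy_tail (f : (T -> R)^nat) : (forall k, measurable_fun setT (f k)) ->
  (forall k, lpn (fun x => f k.+1 x - f k x)%R <= (2^-1 ^+ k)%:E) ->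
  forall k l, (k <= l)%N -> lpn (fun x => f l x - f k x)%R <= (2 * 2^-1 ^+ k - 2 * 2^-1 ^+ l)%:E.
Proof.
move=> mf fle k l; elim: l => [|l IH]; first by rewrite leqn0 => /eqP ->; rewrite (@eq_lpn _ (fun=> 0%R)) ?lpn0 ?subrr// => x; rewrite subrr.
rewrite leq_eqVlt => /predU1P[->|kl].
  by rewrite (@eq_lpn _ (fun=> 0%R)) ?lpn0 ?subrr// => x; rewrite subrr.
rewrite (@eq_lpn _ (fun x => (f l.+1 x - f l x) + (f l x - f k x))%R); last by move=> x; rewrite addrA subrK.
apply: le_trans; first by apply: lpnD; apply: measurable_funB.
apply: le_trans; first exact: leeD (fle l) (IH kl).
rewrite -EFinD lee_fin exprS.
by move: (2^-1 ^+ l)%R (2^-1 ^+ k)%R => a b; lra.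
Qed.

(** Riesz-Fischer: the sums [S k] of absolute increments have norm at most 2, so by monotone
    convergence their limit is finite almost everywhere and the sequence converges there. The tail
    bound passes to the limit by Fatou. *)
Lemma lpn_complete (f : (T -> R)^nat) : (forall k, measurable_fun setT (f k)) ->
  (forall k, lpn (fun x => f k.+1 x - f k x)%R <= (2^-1 ^+ k)%:E) ->
  exists g, measurable_fun setT g /\
    forall k, lpn (fun x => g x - f k x)%R <= (2 * 2^-1 ^+ k)%:E.
Proof.
move=> mf fle.
pose S k x := (\sum_(0 <= j < k) `|f j.+1 x - f j x|)%R.
have mS k : measurable_fun setT (S k).
  apply: measurable_sum => j; apply: measurableT_comp => //; exact: measurable_funB.
have S0 k x : (0 <= S k x)%R by apply: sumr_ge0.
have ndS x : nondecreasing_seq (S ^~ x).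
  by apply/nondecreasing_seqP => k; rewrite /S big_nat_recr//= lerDl.
have Sle k : lpn (S k) <= 2%:E.
  apply: le_trans; first by apply: lpn_sum => j; apply: measurableT_comp => //; exact: measurable_funB.
  have H j : lpn (fun x => `|f j.+1 x - f j x|)%R <= (2^-1 ^+ j)%:E by rewrite lpn_norm.
  apply: (@le_trans _ _ (\sum_(0 <= j < k) (2^-1 ^+ j)%:E)); first exact: lee_sum.
  rewrite sumEFin lee_fin.
  suff -> : (\sum_(0 <= j < k) 2^-1 ^+ j = 2 - 2 * 2^-1 ^+ k :> R)%R.
    by rewrite gerBl mulr_ge0// exprn_ge0.
  elim: k => [|k IH]; first by rewrite big_nil expr0; lra.
  by rewrite big_nat_recr//= IH exprS; move: (2^-1 ^+ k)%R => a; lra.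
pose P k x := (`|S k x| `^ p)%:E.
have mP k : measurable_fun setT (P k) by exact: measurable_normpow.
have P0 k x : 0 <= P k x by rewrite lee_fin powR_ge0.
have ndP x : {homo P ^~ x : i j / (i <= j)%N >-> i <= j}.
  move=> i j ij; rewrite lee_fin; apply: le_powR2 => //; first exact: ltW.
  by rewrite !ger0_norm//; apply: ndS.
pose G x := limn (P ^~ x).
have cP x : cvgn (P ^~ x) by apply: ereal_nondecreasing_is_cvgn; exact: ndP.
have mG : measurable_fun setT G.
  apply: (emeasurable_fun_cvg P) => // x _; exact: cP.
have G0 x : 0 <= G x by apply: lime_ge; [exact: cP|exact: nearW].
have iG : \int[m]_x G x <= (2 `^ p)%:E.
  rewrite (monotone_convergence m measurableT mP (fun k x _ => P0 k x) (fun x _ => ndP x)).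
  apply: lime_le.
    apply: ereal_nondecreasing_is_cvgn => i j ij; apply: ge0_le_integral => //.
    by move=> x _; apply: ndP.
  by apply: nearW => k; rewrite /P -lpn_leP.
(* Off this set the sequence is replaced by [0], which makes the pointwise limit exist everywhere
   and hence measurable. *)
pose D := [set x | G x < +oo].
have mD : measurable D.
  have -> : D = setT `&` G @^-1` (~` [set +oo]).
    by rewrite setTI; apply/seteqP; split => x /=; rewrite /D /= ltey => /eqP.
  by apply: mG => //; apply: measurableC; exact: emeasurable_set1.
have aeD : {ae m, forall x, D x}.
  have iG' : m.-integrable setT G.
    apply/integrableP; split => //; under eq_integral do rewrite gee0_abs//.
    exact: le_lt_trans iG (ltry _).
  by have := integrable_ae measurableT iG'; apply: filterS => x /(_ I); rewrite /D /= => /fin_numPlt/andP[].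
have cf x : D x -> cvgn (f ^~ x).
  move=> Dx.
  have [B HB] : exists B, forall k, (S k x <= B)%R.
    have Gf : G x \is a fin_num by rewrite ge0_fin_numE.
    exists (fine (G x) `^ p^-1)%R => k.
    apply: (@powR_le_cancel _ p); rewrite ?powR_ge0// powRVK ?fine_ge0//.
    rewrite -lee_fin fineK//.
    apply: (@le_trans _ _ (P k x)); first by rewrite /P lee_fin ger0_norm.
    apply: lime_ge; first exact: cP.
    by exists k => // j /= kj; apply: ndP.
  have cS : cvgn (S ^~ x).
    by apply: nondecreasing_is_cvgn => //; exists B => _ [k _ <-].
  have cs : cvgn (@series R (fun j => f j.+1 x - f j x)%R).
    by apply: normed_cvg; exact: cS.
  have -> : f ^~ x = (fun k => f 0%N x + @series R (fun j => f j.+1 x - f j x) k)%R.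
    apply/funext => k; rewrite /series/= telescope_sumr//; lra.
  by apply: is_cvgD => //; exact: is_cvg_cst.
pose h k x := (f k x * \1_D x)%R.
pose g x := limn (h ^~ x).
have ch x : h ^~ x @ \oo --> g x.
  suff : cvgn (h ^~ x) by [].
  rewrite /h; have [Dx|nDx] := pselect (D x).
    by apply: is_cvgM; [exact: cf|exact: is_cvg_cst].
  rewrite indicE memNset//; under eq_fun do rewrite mulr0; exact: is_cvg_cst.
have mh k : measurable_fun setT (h k).
  by apply: measurable_funM => //; exact: measurable_indic.
have mg : measurable_fun setT g by apply: (measurable_fun_cvg mh) => x _; exact: ch.
exists g; split => // k.
have -> : lpn (fun x => g x - f k x)%R = lpn (fun x => g x - h k x)%R.
  apply: ae_eq_lpn; [exact: measurable_funB|exact: measurable_funB|].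
  by apply: filterS aeD => x Dx; rewrite /h indicE mem_set// mulr1.
apply: (@lpn_fatou (fun l x => h l x - h k x)%R).
- by rewrite mulr_ge0// exprn_ge0.
- by move=> l; exact: measurable_funB.
- by move=> x; apply: cvgB; [exact: ch|exact: cvg_cst].
exists k => // l /= kl.
apply: (@le_trans _ _ (lpn (fun x => f l x - f k x)%R)).
  apply: le_lpn; [exact: measurable_funB|exact: measurable_funB|move=> x].
  rewrite /h -mulrBl normrM ler_piMr// indicE; case: (x \in D) => /=; rewrite ?normr1 ?normr0//.
apply: le_trans; first exact: lpn_cauchy_tail.
by rewrite lee_fin gerBl mulr_ge0// exprn_ge0.
Qed.

End Lp_norm.

(** * The Euclidean norm and its comparison with the sup norm *)

Section euclidean_norm.
Context {R : realType} {n : nat}.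
Local Notation E := 'rV[R]_n.
Implicit Types (a b c : E) (k : R).

Lemma dotvC a b : dotv a b = dotv b a.
Proof. by apply: eq_bigr => i _; rewrite mulrC. Qed.

Lemma dotvDl a b c : dotv (a + b) c = dotv a c + dotv b c.
Proof. by rewrite -big_split/=; apply: eq_bigr => i _; rewrite mxE mulrDl. Qed.

Lemma dotvZl k a b : dotv (k *: a) b = k * dotv a b.
Proof. by rewrite mulr_sumr; apply: eq_bigr => i _; rewrite mxE mulrA. Qed.

Lemma dotvDr a b c : dotv c (a + b) = dotv c a + dotv c b.
Proof. by rewrite !(dotvC c) dotvDl. Qed.

Lemma dotvZr k a b : dotv b (k *: a) = k * dotv b a.
Proof. by rewrite !(dotvC b) dotvZl. Qed.

Lemma dotvNl a b : dotv (- a) b = - dotv a b.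
Proof. by rewrite -scaleN1r dotvZl mulN1r. Qed.

Lemma dotvNr a b : dotv b (- a) = - dotv b a.
Proof. by rewrite !(dotvC b) dotvNl. Qed.

Lemma dotvBl a b c : dotv (a - b) c = dotv a c - dotv b c.
Proof. by rewrite dotvDl dotvNl. Qed.

Lemma dotvBr a b c : dotv c (a - b) = dotv c a - dotv c b.
Proof. by rewrite dotvDr dotvNr. Qed.

Lemma dotv0l a : dotv 0 a = 0.
Proof. by rewrite -(scale0r 0) dotvZl mul0r. Qed.

Lemma dotvv_ge0 a : 0 <= dotv a a.
Proof. by apply: sumr_ge0 => i _; rewrite -expr2 sqr_ge0. Qed.

Lemma enorm_ge0 a : 0 <= enorm a.
Proof. exact: sqrtr_ge0. Qed.

Lemma enorm_sqr a : enorm a ^+ 2 = dotv a a.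
Proof. by rewrite sqr_sqrtr ?dotvv_ge0. Qed.

Lemma coord_enorm a i : `|a 0 i| <= enorm a.
Proof.
rewrite -sqrtr_sqr ler_wsqrtr// /dotv (bigD1 i)//=.
by rewrite -expr2 lerDl sumr_ge0// => j _; rewrite -expr2 sqr_ge0.
Qed.

Lemma enorm_eq0 a : enorm a = 0 -> a = 0.
Proof.
move=> a0; apply/rowP => i; rewrite mxE; apply/eqP; rewrite -normr_le0 -a0.
exact: coord_enorm.
Qed.

Lemma enorm0 : enorm (0 : E) = 0.
Proof. by rewrite /enorm dotv0l sqrtr0. Qed.

Lemma enormZ k a : enorm (k *: a) = `|k| * enorm a.
Proof. by rewrite /enorm dotvZl dotvZr mulrA -expr2 sqrtrM ?sqr_ge0// sqrtr_sqr. Qed.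

Lemma enormN a : enorm (- a) = enorm a.
Proof. by rewrite -scaleN1r enormZ normrN normr1 mul1r. Qed.

(** Expand the square of [enorm b *: a - enorm a *: b], which is nonnegative. *)
Lemma dotv_enorm a b : dotv a b <= enorm a * enorm b.
Proof.
have [/enorm_eq0 ->|a0] := eqVneq (enorm a) 0.
  by rewrite dotv0l enorm0 mul0r.
have [/enorm_eq0 ->|b0] := eqVneq (enorm b) 0.
  by rewrite dotvC dotv0l enorm0 mulr0.
have := dotvv_ge0 (enorm b *: a - enorm a *: b).
rewrite !(dotvBl, dotvBr, dotvZl, dotvZr) (dotvC b a) -!enorm_sqr.
have : 0 < enorm a by rewrite lt_neqAle eq_sym a0 enorm_ge0.
have : 0 < enorm b by rewrite lt_neqAle eq_sym b0 enorm_ge0.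
move: (enorm a) (enorm b) (dotv a b) => x y z y0 x0 h.
have : 0 <= (2 * x * y) * (x * y - z) by lra.
by rewrite pmulr_rge0 ?subr_ge0// !mulr_gt0.
Qed.

Lemma norm_dotv a b : `|dotv a b| <= enorm a * enorm b.
Proof.
rewrite ler_norml dotv_enorm andbT lerNl -dotvNl.
by rewrite -(enormN a) dotv_enorm.
Qed.

Lemma enormD a b : enorm (a + b) <= enorm a + enorm b.
Proof.
rewrite -ler_sqr ?nnegrE ?addr_ge0 ?enorm_ge0// enorm_sqr sqrrD !enorm_sqr dotvDl !dotvDr.
by rewrite (dotvC b a); have := dotv_enorm a b; lra.
Qed.

Lemma enormB a b : enorm (a - b) <= enorm a + enorm b.
Proof. by rewrite -(enormN b) enormD. Qed.

Lemma enorm_distC a b : enorm (a - b) = enorm (b - a).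
Proof. by rewrite -enormN opprB. Qed.

Lemma ler_dist_enorm a b : `|enorm a - enorm b| <= enorm (a - b).
Proof.
rewrite ler_distl; apply/andP; split.
  by rewrite lerBlDr addrC -{1}(subrK a b) enorm_distC enormD.
by rewrite addrC -{1}(subrK b a) enormD.
Qed.

Lemma enorm_parallelogram a b :
  enorm (a + b) ^+ 2 + enorm (a - b) ^+ 2 = 2 * (enorm a ^+ 2 + enorm b ^+ 2).
Proof. by rewrite !enorm_sqr !(dotvDl, dotvDr, dotvNl, dotvNr); ring. Qed.

Lemma enorm_le_sum a : enorm a <= \sum_i `|a 0 i|.
Proof.
have s0 : 0 <= \sum_i `|a 0 i| by apply: sumr_ge0.
rewrite -ler_sqr ?nnegrE ?enorm_ge0// enorm_sqr expr2 /dotv mulr_sumr.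
apply: ler_sum => i _; rewrite mulrC.
apply: (le_trans (ler_norm _)); rewrite normrM mulrC.
rewrite ler_wpM2r//= (bigD1 i)//= lerDl sumr_ge0//.
Qed.

Lemma enorm_le_norm a : enorm a <= n%:R * `|a|.
Proof.
apply: (le_trans (enorm_le_sum a)).
rewrite -[n in n%:R]card_ord -sum1_card natr_sum mulr_suml; apply: ler_sum => i _.
by rewrite mul1r coord_norm_le.
Qed.

Lemma norm_le_enorm a : `|a| <= enorm a.
Proof. by apply: rV_norm_le; [exact: enorm_ge0|exact: coord_enorm]. Qed.

Lemma lipschitz_rV_continuous (V : normedModType R) (f : E -> V) (L : R) :
  (forall x y, `|f x - f y| <= L * `|x - y|) -> continuous f.
Proof.
move=> H x; apply/(@cvgrPdist_lt _ V _ _ (nbhs_filter x)) => e e0.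
have L0 : 0 < `|L| + 1 by rewrite ltr_wpDl.
have H1 : \forall y \near x, `|x - y| < e / (`|L| + 1).
  by apply/nbhs_normP; exists (e / (`|L| + 1)); rewrite /= ?divr_gt0.
apply: filterS H1 => y xy.
apply: (le_lt_trans (H x y)).
have -> : e = e / (`|L| + 1) * (`|L| + 1) by rewrite divfK ?gt_eqF.
have := ler_norm L; have := normr_ge0 (x - y).
move: xy; move: (`|x - y|) (e / _) => u v uv u0 Ll.
apply: (@le_lt_trans _ _ (u * (`|L| + 1))); last by rewrite ltr_pM2r.
by rewrite mulrC ler_wpM2l//; lra.
Qed.

Lemma enorm_continuous : continuous (@enorm R n).
Proof.
apply: (@lipschitz_rV_continuous R^o _ n%:R) => x y.
exact: (le_trans (ler_dist_enorm _ _) (enorm_le_norm _)).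
Qed.

End euclidean_norm.

(** * Uniform convexity of the p-th power of the Euclidean norm *)

Section uniform_convexity.
Context {R : realType} {n : nat}.
Local Notation E := 'rV[R]_n.
Variables (p : R) (p1 : 1 < p).
Implicit Types (a b : E).

Local Notation N a := (enorm a `^ p).

Let p0 : 0 < p. Proof. exact: lt_trans p1. Qed.

Lemma enorm_half a b : enorm (2^-1 *: (a + b)) <= (enorm a + enorm b) / 2.
Proof.
rewrite enormZ ger0_norm// mulrC.
by rewrite ler_pM2r// enormD.
Qed.

Lemma enorm_pow_half a b : N (2^-1 *: (a + b)) <= (N a + N b) / 2.
Proof.
apply: le_trans (powR_half p1 (enorm_ge0 a) (enorm_ge0 b)).
by apply: le_powR2; [exact: ltW|exact: enorm_ge0|exact: enorm_half].
Qed.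

(** Strict convexity of the real power forces equal norms; then the parallelogram law leaves nothing
    for [a - b]. *)
Lemma enorm_pow_half_strict a b : (N a + N b) / 2 <= N (2^-1 *: (a + b)) -> a = b.
Proof.
move=> h.
have ab : enorm a = enorm b.
  apply/eqP; apply: contraT => ab.
  have := powR_half_strict p1 (enorm_ge0 a) (enorm_ge0 b) ab.
  have := @le_powR2 R p _ _ (ltW p0) (enorm_ge0 _) (enorm_half a b).
  move: h; move: (N a) (N b) (N _) (_ `^ p) => x y z w; lra.
have : enorm a <= enorm (2^-1 *: (a + b)).
  apply: (@powR_le_cancel _ p); rewrite ?enorm_ge0//.
  by move: h; rewrite -ab; move: (N a) (N _) => x y; lra.
rewrite enormZ ger0_norm// => h2.
have h3 : (2 * enorm a) ^+ 2 <= enorm (a + b) ^+ 2.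
  by rewrite ler_sqr ?nnegrE ?mulr_ge0 ?enorm_ge0//; move: (enorm a) (enorm _) h2 => x y; lra.
have := enorm_parallelogram a b; rewrite -ab => h4.
have h5 : enorm (a - b) ^+ 2 <= 0.
  by move: h3 h4; move: (enorm (a - b)) (enorm (a + b)) (enorm a) => x y z; lra.
apply/eqP; rewrite -subr_eq0; apply/eqP; apply: enorm_eq0; apply/eqP.
by rewrite -sqrf_eq0 eq_le h5 sqr_ge0.
Qed.

Lemma enorm_pow_continuous : continuous (fun a => N a).
Proof.
move=> a; have -> : (fun a => N a) = (fun t => `|t| `^ p) \o @enorm R n.
  by apply/funext => x /=; rewrite ger0_norm ?enorm_ge0.
by apply: continuous_comp; [exact: enorm_continuous|exact: powR_continuous_normr].
Qed.

Lemma enorm_powZ k a : N (k *: a) = `|k| `^ p * N a.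
Proof. by rewrite enormZ powRM ?enorm_ge0. Qed.

Lemma enorm_powB_le a b : N (a - b) <= 2 `^ p * (N a + N b).
Proof.
apply: le_trans (powRD_le p1 (enorm_ge0 a) (enorm_ge0 b)).
by apply: le_powR2; [exact: ltW|exact: enorm_ge0|exact: enormB].
Qed.

(** On the compact set where [N a + N b = 1] and [N (a - b) >= e], the convexity gap at the midpoint
    has a positive minimum [m], and homogeneity spreads this to all pairs with [N (a - b)] large.
    For these, [C = 2^p / m] times the gap dominates [N (a - b)]; for the others the term with [e]
    does. *)
Lemma uniform_convexity (e : R) : 0 < e -> exists2 C, 0 <= C & forall a b,
  N (a - b) + C * N (2^-1 *: (a + b)) <= (e + C / 2) * (N a + N b).
Proof.
move=> e0.
(* A pair of vectors is encoded as one row of length [n + n], so that compactness and the extreme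
   value theorem for rows apply. *)
pose l := @lsubmx R 1 n n; pose r := @rsubmx R 1 n n.
have cl : continuous l.
  apply: (@lipschitz_rV_continuous R _ _ _ 1) => x y; rewrite mul1r.
  by apply: rV_norm_le => // i; rewrite !mxE; have := coord_norm_le (x - y) (lshift n i); rewrite !mxE.
have cr : continuous r.
  apply: (@lipschitz_rV_continuous R _ _ _ 1) => x y; rewrite mul1r.
  by apply: rV_norm_le => // i; rewrite !mxE; have := coord_norm_le (x - y) (rshift n i); rewrite !mxE.
pose s (x : 'rV[R]_(n + n)) := N (l x) + N (r x).
pose dlt (x : 'rV[R]_(n + n)) := N (l x - r x).
pose F (x : 'rV[R]_(n + n)) := - N (2^-1 *: (l x + r x)).
have comp (g : 'rV[R]_(n + n) -> E) : continuous g -> continuous (fun x => N (g x)).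
  by move=> cg x; apply: (@continuous_comp _ _ _ g (fun a => N a)); [exact: cg|exact: enorm_pow_continuous].
have cs : continuous s by move=> x; exact: (cvgD (comp _ cl x) (comp _ cr x)).
have cd : continuous dlt.
  by apply: comp => x; exact: (cvgB (cl x) (cr x)).
have cF : continuous F.
  have H : continuous (fun x => N (2^-1 *: (l x + r x))).
    apply: comp; apply: (@lipschitz_rV_continuous R _ _ _ 1) => x y; rewrite mul1r.
    apply: rV_norm_le => // i; rewrite !mxE.
    have := coord_norm_le (x - y) (rshift n i).
    have := coord_norm_le (x - y) (lshift n i).
    rewrite !mxE -mulrBr normrM ger0_norm// opprD addrACA => h1 h2.
    rewrite mulrC ler_pdivrMr// (le_trans (ler_normD _ _))// mulr_natr mulr2n.
    exact: lerD.
  by move=> x; exact: (cvgN (H x)).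
pose K := (s @^-1` [set 1]) `&` (dlt @^-1` [set y | e <= y]).
have cK : compact K.
  apply: bounded_closed_compact.
    exists 1; split => // M M1 x [sx _]; apply: le_trans (ltW M1).
    have h1 : enorm (l x) <= 1.
      apply: (@powR_le_cancel _ p) => //; rewrite powR1 -sx lerDl powR_ge0//.
    have h2 : enorm (r x) <= 1.
      apply: (@powR_le_cancel _ p) => //; rewrite powR1 -sx lerDr powR_ge0//.
    apply: rV_norm_le => // i; case: (splitP i) => j ij.
      have -> : i = lshift n j by apply/val_inj.
      by apply: le_trans h1; have := coord_enorm (l x) j; rewrite mxE.
    have -> : i = rshift n j by apply/val_inj.
    by apply: le_trans h2; have := coord_enorm (r x) j; rewrite mxE.
  apply: closedI.
    by apply: (preimage_closed (fun x _ => cs x)); exact: closed_eq.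
  by apply: (preimage_closed (fun x _ => cd x)); exact: closed_ge.
have [m m0 Hm] : exists2 m, 0 < m & forall x, K x -> m <= 1 / 2 + F x.
  have [K0|/set0P K0] := eqVneq K set0.
    by exists 1 => // x; rewrite K0.
  have [c Kc Hc] := @EVT_min_rV R _ F K K0 cK (continuous_subspaceT cF).
  exists (1 / 2 + F c); last by move=> x Kx; have := Hc x (mem_set Kx); rewrite lerD2l.
  rewrite ltNge; apply/negP => h.
  have [sc dc] : K c by rewrite -inE.
  have /enorm_pow_half_strict lr : (N (l c) + N (r c)) / 2 <= N (2^-1 *: (l c + r c)).
    move: h sc; rewrite /F /s /=; move: (N (l c)) (N (r c)) (N _) => x y z; lra.
  by move: dc; rewrite /dlt /= lr subrr enorm0 powR0 ?gt_eqF// leNgt e0.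
pose C := 2 `^ p / m.
have C0 : 0 <= C by rewrite divr_ge0 ?powR_ge0// ltW.
exists C; first exact: C0.
move=> a b.
have [S0|S0] := eqVneq (N a + N b) 0.
  have Na : N a = 0.
    apply: le_anti; rewrite powR_ge0 andbT -S0 lerDl; exact: powR_ge0.
  have Nb : N b = 0 by move: S0; rewrite Na add0r.
  have := enorm_powB_le a b; have := enorm_pow_half a b.
  rewrite Na Nb addr0 mul0r !mulr0 => h1 h2.
  apply: (le_trans (lerD h2 (mulr_ge0_le0 C0 h1))); rewrite addr0; exact: lexx.
have Spos : 0 < N a + N b by rewrite lt_neqAle eq_sym S0 addr_ge0 ?powR_ge0.
have half := enorm_pow_half a b.
have big := enorm_powB_le a b.
have H0 : e * (N a + N b) < N (a - b) -> m * (N a + N b) <= (N a + N b) / 2 - N (2^-1 *: (a + b)).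
  move=> bg.
  pose k := ((N a + N b)^-1) `^ p^-1.
  have kp : `|k| `^ p = (N a + N b)^-1.
    by rewrite ger0_norm ?powR_ge0// powRVK// invr_ge0 ltW.
  have Kk : K (row_mx (k *: a) (k *: b)).
    split; rewrite /s /dlt /= /l /r row_mxKl row_mxKr.
      by rewrite !enorm_powZ kp -mulrDr mulVf.
    by rewrite -scalerBr enorm_powZ kp mulrC ler_pdivlMr// ltW.
  have := Hm _ Kk; rewrite /F /l /r row_mxKl row_mxKr.
  have -> : 2^-1 *: (k *: a + k *: b) = k *: (2^-1 *: (a + b)) by rewrite -scalerDr !scalerA mulrC.
  rewrite enorm_powZ kp.
  move=> /(ler_wpM2r (ltW Spos)).
  move: (N (_ *: _)) (N a + N b) S0 => H S S0.
  have -> : (1 / 2 - S^-1 * H) * S = S / 2 - H by field.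
  exact.
have C2 : C * m = 2 `^ p by rewrite /C divfK// gt_eqF.
move: (N a + N b) Spos half big H0 => S Spos half big H0.
move: (N (_ *: _)) (N (a - b)) (2 `^ p) half big H0 C2 => H D q half big H0 C2.
have CH := ler_wpM2l C0 half.
have [small|/H0 h] := leP D (e * S).
  by move: CH small; lra.
have := ler_wpM2l C0 h; rewrite mulrA C2.
have : 0 <= e * S by rewrite mulr_ge0 ?ltW.
by move: big; lra.
Qed.

End uniform_convexity.

Lemma ereal_eqW (R : realType) (x y : \bar R) : x = y -> (x <= y)%E.
Proof. by move=> ->. Qed.

(** * Vector fields in L^p *)

Section Lp_fields.
Context d (T : measurableType d) (R : realType) (m : {measure set T -> \bar R}) (n : nat).
Local Notation E := 'rV[R]_n.
Variables (p : R) (p1 : 1 < p).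
Implicit Types (a b : T -> E).

Let p0 : 0 < p. Proof. exact: lt_trans p1. Qed.

Definition mfield (a : T -> E) := forall i, measurable_fun setT (fun x => a x 0 i).

Definition vlpn a : \bar R := lpn m p (fun x => enorm (a x)).

Lemma mfieldD a b : mfield a -> mfield b -> mfield (fun x => a x + b x).
Proof.
move=> ma mb i; rewrite (_ : (fun x => _) = (fun x => a x 0 i + b x 0 i)).
  exact: measurable_funD.
by apply/funext => x; rewrite mxE.
Qed.

Lemma mfieldB a b : mfield a -> mfield b -> mfield (fun x => a x - b x).
Proof.
move=> ma mb i; rewrite (_ : (fun x => _) = (fun x => a x 0 i - b x 0 i)).
  exact: measurable_funB.
by apply/funext => x; rewrite !mxE.
Qed.

Lemma mfieldZ (k : T -> R) a : measurable_fun setT k -> mfield a -> mfield (fun x => k x *: a x).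
Proof.
move=> mk ma i; rewrite (_ : (fun x => _) = (fun x => k x * a x 0 i)).
  exact: measurable_funM.
by apply/funext => x; rewrite !mxE.
Qed.

Lemma mfieldcZ (k : R) a : mfield a -> mfield (fun x => k *: a x).
Proof. exact: mfieldZ. Qed.

Lemma measurable_dotv a b : mfield a -> mfield b -> measurable_fun setT (fun x => dotv (a x) (b x)).
Proof. by move=> ma mb; apply: measurable_sum => i; exact: measurable_funM. Qed.

Lemma mfield_enorm a : mfield a -> measurable_fun setT (fun x => enorm (a x)).
Proof.
move=> ma; apply: (measurableT_comp (f := @Num.sqrt R)).
  exact: continuous_measurable_fun (@sqrt_continuous R).
exact: measurable_dotv.
Qed.

Lemma vlpn_ge0 a : (0 <= vlpn a)%E.
Proof. exact: lpn_ge0. Qed.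

Lemma vlpnD a b : mfield a -> mfield b -> (vlpn (fun x => a x + b x)%R <= vlpn a + vlpn b)%E.
Proof.
move=> ma mb; apply: le_trans; last by apply: (lpnD _ p1); exact: mfield_enorm.
apply: le_lpn => //.
- by apply: mfield_enorm; exact: mfieldD.
- by apply: measurable_funD; exact: mfield_enorm.
- by move=> x; rewrite !ger0_norm ?addr_ge0 ?enorm_ge0// enormD.
Qed.

Lemma vlpnN a : vlpn (fun x => - a x) = vlpn a.
Proof. by apply: eq_lpn => x; rewrite enormN. Qed.

Lemma vlpnB a b : mfield a -> mfield b -> (vlpn (fun x => a x - b x)%R <= vlpn a + vlpn b)%E.
Proof.
move=> ma mb; rewrite -(vlpnN b); apply: vlpnD => //.
move=> i; rewrite (_ : (fun x => _) = (fun x => - b x 0 i)); first exact: measurable_funN.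
by apply/funext => x; rewrite mxE.
Qed.

Lemma vlpn_distC a b : vlpn (fun x => a x - b x) = vlpn (fun x => b x - a x).
Proof. by apply: eq_lpn => x; rewrite enorm_distC. Qed.

Lemma vlpn0 : vlpn (fun=> 0) = 0%E.
Proof. by rewrite -(lpn0 m p1); apply: eq_lpn => x; rewrite enorm0. Qed.

Lemma vlpnZ k a : mfield a -> vlpn (fun x => k *: a x) = (`|k|%:E * vlpn a)%E.
Proof.
move=> ma; have := lpnZ m p1 `|k| (mfield_enorm ma); rewrite normr_id => <-.
by apply: eq_lpn => x; rewrite enormZ.
Qed.

Lemma lpn_coord_le a i : mfield a -> (lpn m p (fun x => (a x 0 i)%R) <= vlpn a)%E.
Proof.
move=> ma; apply: le_lpn => //; first exact: mfield_enorm.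
by move=> x; rewrite (ger0_norm (enorm_ge0 _)) coord_enorm.
Qed.

Lemma vlpn_le_sum a : mfield a -> (vlpn a <= \sum_(i < n) lpn m p (fun x => (a x 0 i)%R))%E.
Proof.
move=> ma; apply: (@le_trans _ _ (lpn m p (fun x => \sum_(i < n) `|a x 0 i|))).
  apply: le_lpn => //; first exact: mfield_enorm.
    by apply: measurable_sum => i; exact: measurableT_comp.
  move=> x; rewrite !ger0_norm ?enorm_ge0 ?sumr_ge0// enorm_le_sum//.
apply: le_trans; first by apply: lpn_sum => // i; exact: measurableT_comp.
by apply: lee_sum => i _; rewrite lpn_norm.
Qed.

Lemma ae_eq_vlpn a b : mfield a -> mfield b -> {ae m, forall x, a x = b x} -> vlpn a = vlpn b.
Proof.
move=> ma mb ab; apply: ae_eq_lpn => //; try exact: mfield_enorm.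
by apply: filterS ab => x ->.
Qed.

Lemma le_vlpn a b : mfield a -> mfield b -> (forall x, enorm (a x) <= enorm (b x)) ->
  (vlpn a <= vlpn b)%E.
Proof.
move=> ma mb ab; apply: le_lpn => //; try exact: mfield_enorm.
by move=> x; rewrite !ger0_norm ?enorm_ge0.
Qed.

Lemma vlpn_eq0 a : mfield a -> vlpn a = 0%E -> {ae m, forall x, a x = 0}.
Proof.
move=> ma /(lpn_eq0 p1 (mfield_enorm ma)); apply: filterS => x; exact: enorm_eq0.
Qed.

Lemma vlpn_complete (f : nat -> T -> E) : (forall k, mfield (f k)) ->
  (forall k, vlpn (fun x => f k.+1 x - f k x)%R <= (2^-1 ^+ k)%:E)%E ->
  exists g, mfield g /\
    forall k, (vlpn (fun x => g x - f k x)%R <= (n%:R * (2 * 2^-1 ^+ k))%:E)%E.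
Proof.
move=> mf fle.
have /choice[g gE] : forall i : 'I_n, exists g : T -> R, measurable_fun setT g /\
    forall k, (lpn m p (fun x => g x - f k x 0 i)%R <= (2 * 2^-1 ^+ k)%:E)%E.
  move=> i; apply: (lpn_complete p1 (f := fun k x => f k x 0 i)) => [k|k]; first exact: mf.
  apply: le_trans (fle k).
  have := @lpn_coord_le (fun x => f k.+1 x - f k x) i (mfieldB (mf _) (mf _)).
  by rewrite (@eq_lpn _ _ _ _ _ _ (fun x => f k.+1 x 0 i - f k x 0 i))// => x; rewrite !mxE.
exists (fun x => \row_i g i x).
have mg : mfield (fun x => \row_i g i x).
  by move=> i; rewrite (_ : (fun x => _) = g i); [case: (gE i)|apply/funext => x; rewrite mxE].
split=> // k.
apply: le_trans; first by apply: vlpn_le_sum; exact: mfieldB.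
rewrite -[X in X%:R]card_ord mulr_natl -sumr_const -sumEFin.
apply: lee_sum => i _; apply: le_trans ((gE i).2 k).
by rewrite (@eq_lpn _ _ _ _ _ _ (fun x => g i x - f k x 0 i))// => x; rewrite !mxE.
Qed.

(** The p-th power of [vlpn]: energies and the convexity inequality are integrals of powers, while
    completeness and the triangle inequality speak of norms. *)
Definition plpn a : \bar R := (\int[m]_x (enorm (a x) `^ p)%:E)%E.

Lemma plpnE a : plpn a = (\int[m]_x (`|enorm (a x)| `^ p)%:E)%E.
Proof. by apply: eq_integral => x _; rewrite ger0_norm ?enorm_ge0. Qed.

Lemma plpn_ge0 a : (0 <= plpn a)%E.
Proof. by apply: integral_ge0 => x _; rewrite lee_fin powR_ge0. Qed.

Lemma measurable_enorm_pow a : mfield a -> measurable_fun setT (fun x => (enorm (a x) `^ p)%:E).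
Proof.
move=> ma; have := measurable_normpow p (mfield_enorm ma).
by apply: eq_measurable_fun => x _; rewrite ger0_norm ?enorm_ge0.
Qed.

Lemma vlpn_leP a (c : R) : 0 <= c -> (vlpn a <= c%:E)%E = (plpn a <= (c `^ p)%:E)%E.
Proof. by move=> c0; rewrite plpnE -lpn_leP. Qed.

Lemma plpn_uc (e : R) : 0 < e -> exists2 C, 0 <= C & forall a b, mfield a -> mfield b ->
  (plpn (fun x => a x - b x)%R + C%:E * plpn (fun x => 2^-1 *: (a x + b x))%R <=
  (e + C / 2)%:E * (plpn a + plpn b))%E.
Proof.
move=> e0; have [C C0 HC] := uniform_convexity (n := n) p1 e0.
exists C => // a b ma mb.
have mB := measurable_enorm_pow (mfieldB ma mb).
have mD := measurable_enorm_pow (mfieldcZ 2^-1 (mfieldD ma mb)).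
have ma' := measurable_enorm_pow ma.
have mb' := measurable_enorm_pow mb.
have pos (f : T -> E) x : setT x -> (0 <= (enorm (f x) `^ p)%:E)%E.
  by move=> _; rewrite lee_fin powR_ge0.
have eC : (0 <= (e + C / 2)%:E)%E by rewrite lee_fin addr_ge0 ?divr_ge0// ltW.
have pos2 x : setT x -> (0 <= (enorm (a x) `^ p)%:E + (enorm (b x) `^ p)%:E)%E.
  by move=> _; rewrite -EFinD lee_fin addr_ge0 ?powR_ge0.
have mab := emeasurable_funD ma' mb'.
have pos3 x : setT x -> (0 <= C%:E * (enorm (2^-1 *: (a x + b x)) `^ p)%:E)%E.
  by move=> _; rewrite -EFinM lee_fin; apply: mulr_ge0 => //; exact: powR_ge0.
have mCD := measurable_funeM C%:E mD.
have mCab := measurable_funeM (e + C / 2)%:E mab.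
have eC0 : (0 <= C%:E)%E by rewrite lee_fin.
have L : (\int[m]_x ((enorm (a x - b x) `^ p)%:E + C%:E * (enorm (2^-1 *: (a x + b x)) `^ p)%:E) =
    plpn (fun x => a x - b x)%R + C%:E * plpn (fun x => 2^-1 *: (a x + b x))%R)%E.
  rewrite (ge0_integralD m measurableT (pos _) mB pos3 mCD); congr (_ + _)%E.
  exact: (ge0_integralZl m measurableT mD (pos _) eC0).
have Rr : (\int[m]_x ((e + C / 2)%:E * ((enorm (a x) `^ p)%:E + (enorm (b x) `^ p)%:E)) =
    (e + C / 2)%:E * (plpn a + plpn b))%E.
  rewrite (ge0_integralZl m measurableT mab pos2 eC); congr (_ * _)%E.
  exact: (ge0_integralD m measurableT (pos a) ma' (pos b) mb').
apply: (le_trans (ereal_eqW (esym L))); apply: (le_trans _ (ereal_eqW Rr)).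
apply: ge0_le_integral; first exact: measurableT.
- by move=> x _; rewrite -EFinM -EFinD lee_fin; apply: addr_ge0; [exact: powR_ge0|apply: mulr_ge0 => //; exact: powR_ge0].
- exact: (emeasurable_funD mB mCD).
- exact: mCab.
- move=> x _; have := HC (a x) (b x).
  by rewrite -lee_fin !EFinD !EFinM EFinD.
Qed.

(** Integrated uniform convexity: almost minimal fields whose midpoints cannot fall much below the
    minimum are close to each other. Only midpoints enter, so the lemma serves minimizing sequences,
    the averages of a weakly convergent sequence, and uniqueness. *)
Lemma minimizing_cauchy (a : nat -> T -> E) (M : R) (dl : nat -> R) :
  (forall k, mfield (a k)) -> 0 <= M -> dl @ \oo --> 0 ->
  (forall k, plpn (a k) <= (M + dl k)%:E)%E ->
  (forall k l, (k <= l)%N -> (M - dl k)%:E <= plpn (fun x => 2^-1 *: (a k x + a l x))%R)%E ->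
  forall eta : R, 0 < eta -> exists N, forall k l, (N <= k)%N -> (N <= l)%N ->
    (plpn (fun x => a k x - a l x)%R <= eta%:E)%E.
Proof.
move=> ma M0 dl0 h1 h2 eta eta0.
have e0 : 0 < eta / (4 * (M + 1)) by rewrite divr_gt0// mulr_gt0//; lra.
have [C C0 HC] := plpn_uc e0.
(* [q <= 1] keeps the term with the small factor below [eta / 2]; the terms with [C] add up to at
   most [2 * C * q <= eta / 4]. *)
pose q := Num.min 1 (eta / (8 * (C + 1))).
have q0 : 0 < q by rewrite lt_min ltr01 divr_gt0// mulr_gt0//; lra.
have [N _ HN] : \forall k \near \oo, `|dl k| < q.
  by have /cvgrPdist_lt /(_ _ q0) := dl0; apply: filterS => k; rewrite sub0r normrN.
exists N.
suff H k l : (N <= k)%N -> (N <= l)%N -> (k <= l)%N ->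
    (plpn (fun x => a k x - a l x)%R <= eta%:E)%E.
  move=> k l Nk Nl; have [kl|/ltnW kl] := leqP k l; first exact: H.
  have -> : plpn (fun x => a k x - a l x) = plpn (fun x => a l x - a k x).
    by apply: eq_integral => x _; rewrite enorm_distC.
  exact: H.
move=> Nk Nl kl.
have dk := HN k Nk; have d_l := HN l Nl; rewrite /= in dk d_l.
have HH := HC _ _ (ma k) (ma l).
have H3 : ((eta / (4 * (M + 1)) + C / 2)%:E * (plpn (a k) + plpn (a l)) <=
          ((eta / (4 * (M + 1)) + C / 2) * (M + dl k + (M + dl l)))%:E)%E.
  rewrite EFinM; apply: lee_wpmul2l; first by rewrite lee_fin; apply: addr_ge0; [exact: ltW|exact: divr_ge0].
  by rewrite EFinD; apply: leeD.
have H4 : ((C * (M - dl k))%:E <= C%:E * plpn (fun x => 2^-1 *: (a k x + a l x))%R)%E.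
  by rewrite EFinM; apply: lee_wpmul2l; [rewrite lee_fin|exact: h2].
have := le_trans (leeD2l _ H4) (le_trans HH H3).
rewrite -leeBrDr// => /le_trans; apply; rewrite -EFinB lee_fin.
move: dk d_l; rewrite !ltr_norml => /andP[_ dk] /andP[_ d_l].
have q1 : q <= 1 by rewrite ge_min lexx.
have q2 : (C + 1) * q <= eta / 8.
  apply: (@le_trans _ _ ((C + 1) * (eta / (8 * (C + 1))))).
    by rewrite ler_wpM2l ?ge_min ?lexx ?orbT//; lra.
  have -> : (C + 1) * (eta / (8 * (C + 1))) = eta / 8 by field; lra.
  exact: lexx.
have E1 : eta / (4 * (M + 1)) * (M + dl k + (M + dl l)) <= eta / 2.
  apply: (@le_trans _ _ (eta / (4 * (M + 1)) * (2 * (M + 1)))).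
    by rewrite ler_pM2l//; lra.
  have -> : eta / (4 * (M + 1)) * (2 * (M + 1)) = eta / 2 by field; lra.
  exact: lexx.
have E2 : C * dl k <= C * q by rewrite ler_wpM2l// ltW.
have E3 : C * dl l <= C * q by rewrite ler_wpM2l// ltW.
lra.
Qed.

End Lp_fields.

(** * Smooth compactly supported functions *)

Section flat_functions.
Context {R : realType}.
Implicit Types (q : {poly R}) (t y : R).

(* The family is closed under differentiation and its members are flat at 0. *)
Definition flat q t : R := if 0 < t then q.[t^-1] * expR (- t^-1) else 0.

(** The derivative of [q(1/t) exp(-1/t)] is [t^-2 (q - q')(1/t) exp(-1/t)]. *)
Definition dflat q : {poly R} := 'X^2 * (q - q^`()).

(** From [exp(y/m) >= 1 + y/m >= y/m], raised to the power [m]. *)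
Lemma expR_ge_pow (m : nat) y : 0 <= y -> y ^+ m * expR (- y) <= m%:R ^+ m.
Proof.
move=> y0; case: m => [|m].
  by rewrite !expr0 mul1r -expR0 ler_expR oppr_le0.
have m0 : 0 < m.+1%:R :> R by [].
rewrite expRN ler_pdivrMr ?expR_gt0//.
have -> : expR y = expR (y / m.+1%:R) ^+ m.+1.
  by rewrite -expRM_natl mulrCA mulfV ?mulr1// gt_eqF.
rewrite -exprMn; apply: lerXn2r; rewrite ?nnegrE ?mulr_ge0 ?expR_ge0//.
apply: (@le_trans _ _ (m.+1%:R * (1 + y / m.+1%:R))).
  by rewrite mulrDr mulr1 mulrCA mulfV ?gt_eqF// mulr1 lerDr ltW.
by rewrite ler_pM2l// expR_ge1Dx.
Qed.

(** The factor [y ^+ 2], with [y = 1/h], is what gives [flat q h = O(h^2)] and hence the derivative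
    [0] at the origin. *)
Lemma poly_exp_bound q : exists2 C, 0 <= C & forall y, 0 <= y ->
  `|q.[y]| * y ^+ 2 * expR (- y) <= C.
Proof.
elim/poly_ind: q => [|q c [C C0 HC]].
  by exists 0 => // y y0; rewrite horner0 normr0 !mul0r.
pose B := \sum_(i < size q) `|q`_i| * (i + 3)%N%:R ^+ (i + 3).
have B0 : 0 <= B by apply: sumr_ge0 => i _; rewrite mulr_ge0// exprn_ge0.
exists (B + `|c| * 2%:R ^+ 2) => [|y y0]; first by rewrite addr_ge0// mulr_ge0.
have h1 : `|q.[y]| * y ^+ 3 * expR (- y) <= B.
  rewrite horner_coef.
  apply: (@le_trans _ _ ((\sum_(i < size q) `|q`_i| * y ^+ i) * y ^+ 3 * expR (- y))).
    rewrite !ler_wpM2r ?expR_ge0 ?exprn_ge0//.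
    apply: (le_trans (ler_norm_sum _ _ _)); apply: ler_sum => i _.
    by rewrite normrM (ger0_norm (exprn_ge0 _ _)).
  rewrite !mulr_suml; apply: ler_sum => i _.
  rewrite -mulrA -mulrA ler_wpM2l//.
  by have := expR_ge_pow (i + 3) y0; rewrite [y ^+ _]exprD -mulrA.
have h2 := expR_ge_pow 2 y0.
rewrite hornerD hornerMX hornerC.
apply: (@le_trans _ _ ((`|q.[y]| * y + `|c|) * y ^+ 2 * expR (- y))).
  rewrite !ler_wpM2r ?expR_ge0 ?exprn_ge0//.
  by apply: (le_trans (ler_normD _ _)); rewrite normrM (ger0_norm y0).
rewrite !mulrDl; apply: lerD; first by rewrite -(mulrA `|q.[y]|) -exprS.
by rewrite -mulrA ler_wpM2l.
Qed.

Lemma is_derive_flat q t : is_derive t (1 : R) (flat q) (flat (dflat q) t).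
Proof.
have [t0|t0|->] := ltrgt0P t.
- have H : \forall s \near t, (fun s => q.[s^-1] * expR (- s^-1)) s = flat q s.
    by apply: filterS (lt_nbhsr t0) => s s0; rewrite /flat s0.
  apply: (near_eq_is_derive H).
  have tn : t != 0 by rewrite gt_eqF.
  have iv : is_derive t (1 : R) (@GRing.inv R) (- t ^- 2).
    apply: (is_derive_eq (@is_deriveV R id t 1 1 tn (is_derive_id _ _))).
    by rewrite [_ *: _]mulr1.
  have iN : is_derive t (1 : R) (fun s : R => - s^-1) (t ^- 2).
    by apply: (is_derive_eq (is_deriveN iv)); rewrite opprK.
  have ie := @is_derive1_comp R expR (fun s => - s^-1) t _ _ (is_derive_expR (- t^-1)) iN.
  have iq := @is_derive1_comp R (horner q) (@GRing.inv R) t _ _ (is_derive_poly q t^-1) iv.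
  apply: (is_derive_eq (is_deriveM iq ie)).
  rewrite /flat t0 /dflat hornerM hornerXn hornerD hornerN /= /GRing.scale /=.
  move: (expR _) => z; field; exact: tn.
- have H : \forall s \near t, cst 0 s = flat q s.
    by apply: filterS (lt_nbhsl t0) => s s0; rewrite /flat ltNge (ltW s0).
  apply: (near_eq_is_derive H).
  by rewrite /flat ltNge (ltW t0); exact: is_derive_cst.
- have [C C0 HC] := poly_exp_bound q.
  have flat0 q' : flat q' 0 = 0 by rewrite /flat ltxx.
  have fle h : `|flat q h| <= C * `|h| ^+ 2.
    rewrite /flat; case: ifPn => h0; last by rewrite normr0 mulr_ge0.
    have := HC h^-1; rewrite invr_ge0 (ltW h0) => /(_ isT).
    rewrite normrM (ger0_norm (expR_ge0 _)) (gtr0_norm h0) exprVn mulrAC.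
    by rewrite ler_pdivrMr ?exprn_gt0.
  have D : (fun h => h^-1 *: ((flat q \o shift 0) (h *: 1) - flat q 0)) @ 0^' --> (0 : R).
    apply/cvgrPdist_lt => e e0.
    have C1 : 0 < C + 1 by lra.
    have H : \forall h \near (0 : R)^', `|h| < e / (C + 1).
      by apply: dnbhs0_lt; rewrite divr_gt0.
    have H0 : \forall h \near (0 : R)^', h != 0 by exact: nbhs_dnbhs_neq.
    apply: filterS2 H H0 => h he h0.
    rewrite sub0r normrN flat0 subr0 /= addr0 [_ *: 1]mulr1 /GRing.scale /= normrM normfV.
    rewrite mulrC ltr_pdivrMr ?normr_gt0//.
    apply: (le_lt_trans (fle h)); rewrite expr2 mulrA ltr_pM2r ?normr_gt0//.
    move: he; rewrite ltr_pdivlMr// => he.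
    apply: le_lt_trans he; rewrite mulrC ler_wpM2l//; lra.
  apply: DeriveDef; first by apply/cvg_ex; exists 0.
  by rewrite flat0; apply: cvg_lim => //.
Qed.

Lemma flat_ge0 t : 0 <= flat 1 t.
Proof. by rewrite /flat; case: ifP => // _; rewrite hornerC mul1r expR_ge0. Qed.

Lemma flat_gt0 t : 0 < t -> 0 < flat 1 t.
Proof. by rewrite /flat => ->; rewrite hornerC mul1r expR_gt0. Qed.

Lemma flat_eq0 q t : t <= 0 -> flat q t = 0.
Proof. by rewrite /flat leNgt => /negbTE ->. Qed.

End flat_functions.

(** * Stability of smooth functions; bump functions *)

Section smooth_calculus.
Context {R : realType} {n : nat}.
Local Notation E := 'rV[R]_n.
Implicit Types (f g phi : E -> R) (i : 'I_n).
Local Notation e_ i := (delta_mx 0 i : E).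

(** Coinduction: smoothness is membership in some class of continuous, partially differentiable
    functions that is stable under partial derivatives. Smoothness proofs then amount to naming the
    class. *)
Lemma smooth_coind (P : set (E -> R)) :
  (forall f, P f -> [/\ continuous f, forall i x, derivable f x (e_ i) & forall i, P (partial i f)]) ->
  P `<=` smooth.
Proof.
move=> HP f Pf s /=.
have : P (foldr partial f s).
  by elim: s => //= i s IH; have [_ _] := HP _ IH; exact.
by move=> /HP[].
Qed.

Lemma smooth_partial i f : smooth f -> smooth (partial i f).
Proof. by move=> sf s; have := sf (rcons s i); rewrite foldr_rcons. Qed.

Lemma smooth_continuous f : smooth f -> continuous f.
Proof. by move=> /(_ [::])[]. Qed.

Lemma smooth_derivable f i x : smooth f -> derivable f x (e_ i).
Proof. by move=> /(_ [::])[]. Qed.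

(** A derivative of a product is a sum of products, so products alone are not stable under
    differentiation; the algebra generated by smooth functions is. *)
Inductive smooth_alg : (E -> R) -> Prop :=
| smooth_alg_base f : smooth f -> smooth_alg f
| smooth_alg_add f g : smooth_alg f -> smooth_alg g -> smooth_alg (f + g)
| smooth_alg_mul f g : smooth_alg f -> smooth_alg g -> smooth_alg (f * g).

Lemma partialD i f g x : derivable f x (e_ i) -> derivable g x (e_ i) ->
  partial i (f + g) x = partial i f x + partial i g x.
Proof. exact: deriveD. Qed.

Lemma partialM i f g x : derivable f x (e_ i) -> derivable g x (e_ i) ->
  partial i (f * g) x = f x * partial i g x + g x * partial i f x.
Proof. exact: deriveM. Qed.

Lemma smooth_algP f : smooth_alg f -> smooth f.
Proof.
move: f; apply: smooth_coind => f; elim=> {f}[f sf|f g sf [cf df pf] sg [cg dg pg]|f g sf [cf df pf] sg [cg dg pg]].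
- split; [exact: smooth_continuous|by move=> *; exact: smooth_derivable|].
  by move=> i; apply: smooth_alg_base; exact: smooth_partial.
- split; [by move=> x; exact: (cvgD (cf x) (cg x))|by move=> i x; exact: (derivableD (df i x) (dg i x))|move=> i].
  rewrite (_ : partial i (f + g) = partial i f + partial i g); first exact: smooth_alg_add.
  by apply/funext => x; rewrite partialD.
- split; [by move=> x; exact: (cvgM (cf x) (cg x))|by move=> i x; exact: (derivableM (df i x) (dg i x))|move=> i].
  rewrite (_ : partial i (f * g) = f * partial i g + g * partial i f).
    by apply: smooth_alg_add; apply: smooth_alg_mul.
  by apply/funext => x; rewrite partialM.
Qed.

Lemma smoothD f g : smooth f -> smooth g -> smooth (f + g).
Proof. by move=> sf sg; apply: smooth_algP; apply: smooth_alg_add; apply: smooth_alg_base. Qed.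

Lemma smoothM f g : smooth f -> smooth g -> smooth (f * g).
Proof. by move=> sf sg; apply: smooth_algP; apply: smooth_alg_mul; apply: smooth_alg_base. Qed.

Lemma partial_cst i (c : R) : partial i (cst c) = cst 0.
Proof. by apply/funext => x; exact: derive_cst. Qed.

Lemma smooth_cst (c : R) : smooth (cst c : E -> R).
Proof.
suff : [set f : E -> R | exists c, f = cst c] `<=` smooth by apply; exists c.
apply: smooth_coind => f [k ->]; split; [exact: cst_continuous|by move=> *; exact: derivable_cst|].
by move=> i; exists 0; exact: partial_cst.
Qed.

Lemma smooth_prod (I : Type) (r : seq I) (F : I -> E -> R) :
  (forall k : I, smooth (F k)) -> smooth (\prod_(k <- r) F k).
Proof.
move=> sF; elim: r => [|i r IH]; first by rewrite big_nil; exact: smooth_cst.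
rewrite big_cons; exact: (smoothM (sF _) IH).
Qed.

Lemma derive_coord_comp (h dh : R -> R) (c b : R) j i (x : E) :
  is_derive (c * x 0 j + b) (1 : R) h (dh (c * x 0 j + b)) ->
  is_derive x (e_ i) (fun x : E => h (c * x 0 j + b)) ((j == i)%:R * c * dh (c * x 0 j + b)).
Proof.
move=> dhx.
have H : is_derive (0 : R) (1 : R) (fun t : R => h ((j == i)%:R * c * t + (c * x 0 j + b)))
    ((j == i)%:R * c * dh (c * x 0 j + b)).
  have L : is_derive (0 : R) (1 : R) (fun t : R => (j == i)%:R * c * t + (c * x 0 j + b)) ((j == i)%:R * c).
    have -> : (fun t : R => (j == i)%:R * c * t + (c * x 0 j + b)) =
       ((j == i)%:R * c) \*: id + cst (c * x 0 j + b) by apply/funext => t.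
    by apply: is_derive_eq; rewrite addr0 /GRing.scale /= mulr1.
  have dhx0 : is_derive ((j == i)%:R * c * 0 + (c * x 0 j + b)) (1 : R) h (dh (c * x 0 j + b)).
    by rewrite mulr0 add0r.
  apply: (is_derive_eq (@is_derive1_comp R h (fun t : R => (j == i)%:R * c * t + (c * x 0 j + b)) 0 _ _ dhx0 L)).
  exact: mulrC.
have E1 : (fun t : R => h ((j == i)%:R * c * t + (c * x 0 j + b))) =
   (fun t : R => (fun x : E => h (c * x 0 j + b)) (t *: e_ i + x)).
  apply/funext => t; congr h; rewrite !mxE eqxx /=; case: (j == i) => /=; ring.
split.
  by apply/derivable1P; rewrite -E1; case: H.
case: H => dH <-; rewrite E1.
rewrite /derive; congr (lim (_ @ 0^')).
apply/funext => t /=.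
by rewrite !scale0r !add0r addr0 [t%:A]mulr1.
Qed.

(** The stable class lets both the polynomial and a real factor vary; each derivative replaces [q]
    by [dflat q] and multiplies the factor by [c] or [0]. *)
Lemma smooth_flat_coord q (c b : R) j : smooth (fun x : E => flat q (c * x 0 j + b)).
Proof.
suff : [set f : E -> R | exists q (k : R), f = fun x => k * flat q (c * x 0 j + b)] `<=` smooth.
  by apply; exists q, 1; apply/funext => x; rewrite mul1r.
apply: smooth_coind => _ [q' [k ->]].
have D i x := @derive_coord_comp (flat q') (flat (dflat q')) c b j i x (is_derive_flat _ _).
have D' i x : is_derive x (e_ i) (fun x : E => k * flat q' (c * x 0 j + b))
    (k * ((j == i)%:R * c * flat (dflat q') (c * x 0 j + b))).
  have -> : (fun x : E => k * flat q' (c * x 0 j + b)) =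
      k \*: (fun x : E => flat q' (c * x 0 j + b)) by apply/funext.
  by apply: is_derive_eq.
split.
- move=> x; apply: (@continuous_comp _ _ _ (fun x : E => c * x 0 j + b) (fun t => k * flat q' t)).
    apply: (@lipschitz_rV_continuous _ _ R^o _ `|c|) => y z.
    rewrite opprD addrACA subrr addr0 -mulrBr normrM ler_wpM2l//.
    by have := coord_norm_le (y - z) j; rewrite !mxE.
  have Dt t := is_deriveZ k (is_derive_flat q' t).
  apply: differentiable_continuous; apply/derivable1_diffP.
  by case: (Dt (c * x 0 j + b)).
- by move=> i x; case: (D' i x).
- move=> i; exists (dflat q'), (k * ((j == i)%:R * c)); apply/funext => x.
  by rewrite /partial; case: (D' i x) => _ ->; rewrite -!mulrA.
Qed.

(** The two factors of coordinate [i] vanish to the left of [c_i - r] and to the right of [c_i + r],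
    so the product is positive exactly in the sup-norm ball. The factors [1] and [-1] fit the affine
    form of [smooth_flat_coord]. *)
Definition bumpf (c : E) (r : R) (x : E) : R :=
  \prod_i (flat 1 (1 * x 0 i + (r - c 0 i)) * flat 1 (-1 * x 0 i + (r + c 0 i))).

Lemma smooth_bump c r : smooth (bumpf c r).
Proof.
have -> : bumpf c r = \prod_i ((fun x : E => flat 1 (1 * x 0 i + (r - c 0 i))) *
                              (fun x : E => flat 1 (-1 * x 0 i + (r + c 0 i)))).
  by apply/funext => x; rewrite /bumpf fct_prodE.
by apply: smooth_prod => i; apply: smoothM; exact: smooth_flat_coord.
Qed.

Lemma bump_ge0 c r x : 0 <= bumpf c r x.
Proof. by apply: prodr_ge0 => i _; rewrite mulr_ge0// flat_ge0. Qed.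

Lemma bump_gt0 c r x : `|x - c| < r -> 0 < bumpf c r x.
Proof.
move=> xr; apply: prodr_gt0 => i _.
have := coord_norm_le (x - c) i; rewrite !mxE ler_norml => /andP[h1 h2].
by rewrite mulr_gt0// flat_gt0//; lra.
Qed.

Lemma bump_eq0 c r x : 0 < r -> r <= `|x - c| -> bumpf c r x = 0.
Proof.
move=> r0 rx; apply/eqP; apply: contraLR rx => /prodf_neq0 H.
rewrite -ltNge; apply: rV_norm_lt => // i; have := H i isT.
rewrite mulf_eq0 negb_or => /andP[h1 h2].
have k1 : 0 < 1 * x 0 i + (r - c 0 i) by rewrite ltNge; apply: contra h1 => /flat_eq0 ->.
have k2 : 0 < -1 * x 0 i + (r + c 0 i) by rewrite ltNge; apply: contra h2 => /flat_eq0 ->.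
by rewrite !mxE ltr_norml; apply/andP; split; lra.
Qed.

End smooth_calculus.

(** * Mean value and Taylor estimates; the space of test functions *)

Section smooth_estimates.
Context {R : realType} {n : nat}.
Local Notation E := 'rV[R]_n.
Local Notation mu := (@lebesgue_rV R n).
Implicit Types (f g phi : E -> R) (i : 'I_n).
Local Notation e_ i := (delta_mx 0 i : E).

Lemma is_derive_line f i (a : E) (t : R) : derivable f (a + t *: e_ i) (e_ i) ->
  is_derive t (1 : R) (fun s : R => f (a + s *: e_ i)) (partial i f (a + t *: e_ i)).
Proof.
have E1 : (fun h : R => (fun s : R => f (a + s *: e_ i)) (h *: (1 : R) + t)) =
          (fun h : R => f (h *: e_ i + (a + t *: e_ i))).
  apply/funext => h; congr f.
  by rewrite [h *: (1 : R)]mulr1 scalerDl addrCA.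
move=> df; split.
  apply/derivable1P; rewrite E1; exact: ((derivable1P f _ _).1 df).
rewrite /partial /derive; congr (lim (_ @ 0^')).
apply/funext => h /=; congr (_ *: (f _ - _)).
by rewrite [h *: (1 : R)]mulr1 scalerDl addrCA.
Qed.

Lemma coordinate_mvt f i (a : E) (s : R) : (forall x, derivable f x (e_ i)) ->
  exists2 t, `|t| <= `|s| & f (a + s *: e_ i) - f a = s * partial i f (a + t *: e_ i).
Proof.
move=> df.
pose g (t : R) := f (a + t *: e_ i).
have dg (t : R) : is_derive t (1 : R) g (partial i f (a + t *: e_ i)) by apply: is_derive_line.
have cg u v : {within `[u, v], continuous g}.
  apply: continuous_subspaceT => t; apply: differentiable_continuous.
  by apply/derivable1_diffP; case: (dg t).
have g0 : f a = g 0 by rewrite /g scale0r addr0.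
have [->|] := eqVneq s 0.
  by exists 0 => //; rewrite scale0r addr0 subrr mul0r.
rewrite neq_lt => /orP[s0|s0]; last first.
- have [t + H] := MVT s0 (fun t _ => dg t) (cg 0 s).
  rewrite in_itv/= => /andP[t0 ts]; exists t; first by rewrite !gtr0_norm// ltW.
  by rewrite g0 -/(g s) H subr0 mulrC.
- have [t + H] := MVT s0 (fun t _ => dg t) (cg s 0).
  rewrite in_itv/= => /andP[t0 ts]; exists t; first by rewrite !ltr0_norm// lerN2 ltW.
  by rewrite g0 -/(g s) -opprB H sub0r mulrN opprK mulrC.
Qed.

(** Go from [a] to [a + v] changing one coordinate at a time, with the mean value theorem on each
    segment. Only partial derivatives are used, at the price of one intermediate point per
    coordinate. *)
Lemma path_mvt f (a v : E) : (forall i x, derivable f x (e_ i)) ->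
  exists xi : 'I_n -> E, (forall i, `|xi i - a| <= `|v|) /\
    f (a + v) - f a = \sum_i v 0 i * partial i f (xi i).
Proof.
move=> df.
pose q (j : nat) : E := a + \row_i (if (i < j)%N then v 0 i else 0).
have qS (j : 'I_n) : q j.+1 = q j + v 0 j *: e_ j.
  apply/rowP => i; rewrite !mxE -addrA; congr (_ + _).
  have [->|ij] := eqVneq i j; first by rewrite ltnn ltnSn eqxx mulr1 add0r.
  have -> : (i < j.+1)%N = (i < j)%N by rewrite ltnS leq_eqVlt (inj_eq val_inj) (negbTE ij).
  by rewrite andbF mulr0 addr0.
have /choice[t Ht] : forall j : 'I_n, exists t, `|t| <= `|v 0 j| /\
    f (q j.+1) - f (q j) = v 0 j * partial j f (q j + t *: e_ j).
  by move=> j; have [t h1 h2] := @coordinate_mvt f j (q j) (v 0 j) (df j); exists t; rewrite qS.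
exists (fun j : 'I_n => q j + t j *: e_ j); split => [j|].
  apply: rV_norm_le => // i; rewrite !mxE addrAC [a 0 i + _]addrC addrK.
  have [->|ij] := eqVneq i j.
    by rewrite ltnn add0r eqxx mulr1; apply: le_trans (coord_norm_le v j); case: (Ht j).
  rewrite andbF mulr0 addr0; case: ifP => _; last by rewrite normr0.
  exact: coord_norm_le.
have -> : a + v = q n.
  by apply/rowP => i; rewrite !mxE ltn_ord.
have -> : f a = f (q 0%N).
  by congr f; apply/rowP => i; rewrite !mxE ltn0 addr0.
rewrite -(telescope_sumr (fun j => f (q j)))// big_mkord.
by apply: eq_bigr => j _; case: (Ht j).
Qed.

(* Values are controlled on the whole space by vanishing outside a ball. *)
Definition vanish_out (r : R) f := forall x, r < `|x| -> f x = 0.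

Lemma csupp_vanish phi : compact (supp phi) -> exists2 r, 0 < r & vanish_out r phi.
Proof.
move=> /compact_bounded [M [_ HM]]; exists (`|M| + 1); first by rewrite ltr_wpDl.
move=> x xM; apply/eqP; apply: contraTT xM => phix; rewrite -leNgt.
apply: HM; first by rewrite (le_lt_trans (ler_norm M))// ltrDl.
exact: subset_closure.
Qed.

Lemma ball_closed_compact (r : R) : compact [set x : E | `|x| <= r].
Proof.
apply: bounded_closed_compact.
  exists r; split; first exact: num_real.
  by move=> M rM x /= xr; rewrite (le_trans xr)// ltW.
have c : continuous (fun x : E => `|x|) by exact: norm_continuous.
have -> : [set x : E | `|x| <= r] = (fun x : E => `|x|) @^-1` [set y | y <= r] by [].
by apply: (preimage_closed (fun x _ => c x)); exact: closed_le.
Qed.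

Lemma vanish_bounded r f : continuous f -> vanish_out r f ->
  exists2 M, 0 <= M & forall x, `|f x| <= M.
Proof.
move=> cf vf.
have cK := @ball_closed_compact r.
have cnf : continuous (fun x => `|f x|).
  by move=> x; apply: (@continuous_comp _ _ _ f (fun t : R => `|t|)); [exact: cf|exact: norm_continuous].
have [K0|/set0P K0] := eqVneq [set x : E | `|x| <= r] set0.
  exists 0 => // x; rewrite vf ?normr0//; rewrite ltNge; apply/negP => xr.
  by have : set0 x by rewrite -K0.
have [c Kc Hc] := @EVT_max_rV R n (fun x => `|f x|) _ K0 cK (continuous_subspaceT cnf).
exists `|f c| => // x; have [xr|xr] := leP `|x| r.
  by apply: Hc; rewrite inE.
by rewrite vf// normr0.
Qed.

Lemma partial_vanish r i f : vanish_out r f -> vanish_out r (partial i f).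
Proof.
move=> vf x rx.
have H : \forall y \near x, cst 0 y = f y.
  have : \forall y \near x, r < `|y|.
    have : \forall y \near x, `|x - y| < `|x| - r.
      by apply/nbhs_normP; exists (`|x| - r) => //=; rewrite subr_gt0.
    apply: filterS => y; have := ler_normD (x - y) y; rewrite subrK; lra.
  by apply: filterS => y ry; rewrite /cst vf.
rewrite /partial -(near_eq_derive _ H); exact: derive_cst.
Qed.

Definition smooth_cs r f := smooth f /\ vanish_out r f.

Lemma smooth_cs_partial r i f : smooth_cs r f -> smooth_cs r (partial i f).
Proof. by move=> [sf vf]; split; [exact: smooth_partial|exact: partial_vanish]. Qed.

Lemma smooth_cs_bounded r f : smooth_cs r f -> exists2 M, 0 <= M & forall x, `|f x| <= M.
Proof. by move=> [sf vf]; apply: (vanish_bounded _ vf); exact: smooth_continuous. Qed.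

Lemma smooth_cs_lipschitz r f : smooth_cs r f ->
  exists2 L, 0 <= L & forall x v, `|f (x + v) - f x| <= L * `|v|.
Proof.
move=> sf.
have /choice[M HM] : forall i : 'I_n, exists M, 0 <= M /\ forall x, `|partial i f x| <= M.
  by move=> i; have [M ? ?] := smooth_cs_bounded (smooth_cs_partial i sf); exists M.
exists (\sum_i M i); first by apply: sumr_ge0 => i _; case: (HM i).
move=> x v; have [xi [_ ->]] := @path_mvt f x v (fun i x => smooth_derivable sf.1).
rewrite (le_trans (ler_norm_sum _ _ _))// mulr_suml; apply: ler_sum => i _.
by rewrite normrM mulrC ler_pM//; [case: (HM i)|exact: coord_norm_le].
Qed.

(** The partial derivatives are Lipschitz, and the intermediate points of [path_mvt] lie within
    [|v|] of [x]. *)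
Lemma smooth_cs_taylor r f : smooth_cs r f ->
  exists2 C, 0 <= C & forall x v, `|f (x + v) - f x - \sum_i v 0 i * partial i f x| <= C * `|v| ^+ 2.
Proof.
move=> sf.
have /choice[L HL] : forall i : 'I_n, exists L, 0 <= L /\ forall x v, `|partial i f (x + v) - partial i f x| <= L * `|v|.
  by move=> i; have [M ? ?] := smooth_cs_lipschitz (smooth_cs_partial i sf); exists M.
exists (\sum_i L i); first by apply: sumr_ge0 => i _; case: (HL i).
move=> x v; have [xi [Hxi ->]] := @path_mvt f x v (fun i x => smooth_derivable sf.1).
rewrite -sumrB (le_trans (ler_norm_sum _ _ _))// mulr_suml; apply: ler_sum => i _.
rewrite -mulrBr normrM expr2 mulrA mulrC; apply: ler_pM => //; last exact: coord_norm_le.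
have [L0 HLi] := HL i.
have := HLi x (xi i - x); rewrite (_ : x + (xi i - x) = xi i); last by rewrite addrC subrK.
move=> /le_trans; apply.
by rewrite ler_wpM2l.
Qed.

Lemma smooth_cs_partial_taylor r f i : smooth_cs r f ->
  exists2 C, 0 <= C & forall x (h : R), `|f (x + h *: e_ i) - f x - h * partial i f x| <= C * `|h| ^+ 2.
Proof.
move=> /smooth_cs_taylor[C C0 HC]; exists C => // x h.
have := HC x (h *: e_ i).
rewrite (bigD1 i)//= big1 ?addr0 => [|j ji]; last by rewrite !mxE (negbTE ji) andbF mulr0 mul0r.
rewrite !mxE !eqxx mulr1 => /le_trans; apply; rewrite ler_wpM2l//.
rewrite lerXn2r ?nnegrE//; apply: rV_norm_le => // j; rewrite !mxE.
by rewrite normrM; case: (_ && _) => /=; rewrite ?normr1 ?mulr1// normr0 mulr0.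
Qed.

Lemma Cc_smoothP (U : set E) phi : Cc_smooth U phi -> exists2 r, 0 < r & smooth_cs r phi.
Proof. by move=> [sp cp _]; have [r r0 vr] := csupp_vanish cp; exists r. Qed.

Lemma supp_notin phi x : ~ supp phi x -> \forall y \near x, cst 0 y = phi y.
Proof.
move=> nx; have oC : open (~` supp phi) by rewrite openC; exact: closed_closure.
have := open_nbhs_nbhs (conj oC nx); apply: filterS => y /= ny.
apply: contrapT => h; apply: ny; apply: subset_closure => /=; apply/eqP => h0.
by apply: h; rewrite h0.
Qed.

Lemma supp_partial i phi : supp (partial i phi) `<=` supp phi.
Proof.
have -> : supp phi = closure (supp phi) by apply/closure_id; exact: closed_closure.
apply: closureS => x /= px; apply: contrapT => nx; move: px.
by rewrite /partial -(near_eq_derive _ (supp_notin nx)) derive_cst eqxx.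
Qed.

Lemma Cc_smooth_partial (U : set E) i phi : Cc_smooth U phi -> Cc_smooth U (partial i phi).
Proof.
move=> [sp cp sU]; split; first exact: smooth_partial.
  by apply: subclosed_compact cp _; [exact: closed_closure|exact: supp_partial].
exact: subset_trans (@supp_partial i phi) sU.
Qed.

Lemma Cc_smooth_sub (U V : set E) phi : U `<=` V -> Cc_smooth U phi -> Cc_smooth V phi.
Proof. by move=> UV [? ? sU]; split => //; exact: subset_trans UV. Qed.

Lemma supp_eq0 (U : set E) phi x : supp phi `<=` U -> ~ U x -> phi x = 0.
Proof. by move=> sU nU; apply/eqP; apply: contra_notT nU => h; apply: sU; exact: subset_closure. Qed.

Lemma supp_sub (A : set E) phi : closed A -> (forall x, ~ A x -> phi x = 0) -> supp phi `<=` A.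
Proof.
move=> cA h; rewrite [A in _ `<=` A](closure_id _).1//; apply: closureS => x /= px.
by apply: contrapT => /h /eqP; apply/negP.
Qed.

Lemma Cc_smoothD (U : set E) f g : Cc_smooth U f -> Cc_smooth U g -> Cc_smooth U (f + g).
Proof.
move=> [sf cf fU] [sg cg gU].
have S : supp (f + g) `<=` supp f `|` supp g.
  apply: supp_sub => [|x]; first by apply: closedU; exact: closed_closure.
  move=> /not_orP[nf ng]; rewrite /GRing.add /=.
  by rewrite (supp_eq0 (@subset_refl _ _) nf) (supp_eq0 (@subset_refl _ _) ng) addr0.
split; first exact: smoothD.
  apply: (subclosed_compact _ (compactU cf cg)) => //; exact: closed_closure.
by apply: (subset_trans S) => x [/fU|/gU].
Qed.

Lemma Cc_smoothMr (U : set E) f g : smooth g -> Cc_smooth U f -> Cc_smooth U (g * f).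
Proof.
move=> sg [sf cf fU].
have S : supp (g * f) `<=` supp f.
  apply: supp_sub => [|x nf]; first exact: closed_closure.
  by rewrite /GRing.mul /= (supp_eq0 (@subset_refl _ _) nf) mulr0.
split; first exact: smoothM.
  by apply: (subclosed_compact _ cf S); exact: closed_closure.
exact: subset_trans fU.
Qed.

Lemma Cc_smoothZ (U : set E) (c : R) f : Cc_smooth U f -> Cc_smooth U (cst c * f).
Proof. by apply: Cc_smoothMr; exact: smooth_cst. Qed.

Lemma Cc_smooth0 (U : set E) : Cc_smooth U (cst 0).
Proof.
have S : supp (cst 0 : E -> R) `<=` set0 by apply: supp_sub => //; exact: closed0.
split; first exact: smooth_cst.
  by apply: (subclosed_compact _ (@compact0 _) S); exact: closed_closure.
by apply: subset_trans S _.
Qed.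

Lemma grad_coord f x i : grad f x 0 i = partial i f x.
Proof. by rewrite mxE. Qed.

Lemma gradD f g x : smooth f -> smooth g -> grad (f + g) x = grad f x + grad g x.
Proof.
move=> sf sg; apply/rowP => i; rewrite !mxE; apply: deriveD; exact: smooth_derivable.
Qed.

Lemma gradZ (c : R) f x : smooth f -> grad (cst c * f) x = c *: grad f x.
Proof.
move=> sf; apply/rowP => i; rewrite !mxE /partial deriveM.
- by rewrite derive_cst scaler0 addr0.
- exact: derivable_cst.
- exact: smooth_derivable.
Qed.

End smooth_estimates.

(** * Mollification *)

Section integrable_functions.
Context {R : realType} {n : nat}.
Local Notation E := 'rV[R]_n.
Local Notation mu := (@lebesgue_rV R n).
Implicit Types (f g u h : E -> R).

Definition intg f := mu.-integrable [set: E] (EFin \o f).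

Lemma Rint_ext f g : (forall x, f x = g x) -> \int[mu]_x f x = \int[mu]_x g x.
Proof. by move=> fg; apply: eq_Rintegral => x _; exact: fg. Qed.

Lemma measurable_normf f : measurable_fun setT f -> measurable_fun setT (fun x => `|f x|).
Proof. by move=> mf; exact: measurableT_comp. Qed.

Lemma intg_measurable f : intg f -> measurable_fun setT f.
Proof. by move=> /measurable_int /measurable_EFinP. Qed.

Lemma intg_le f g : measurable_fun setT f -> (forall x, `|f x| <= `|g x|) -> intg g -> intg f.
Proof.
move=> mf fg gi; apply: (le_integrable measurableT _ _ gi); first exact/measurable_EFinP.
by move=> x _; rewrite lee_fin; exact: fg.
Qed.

Lemma intgD f g : intg f -> intg g -> intg (fun x => f x + g x).
Proof. by move=> fi gi; exact: (integrableD measurableT fi gi). Qed.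

Lemma intgB f g : intg f -> intg g -> intg (fun x => f x - g x).
Proof. by move=> fi gi; exact: (integrableB measurableT fi gi). Qed.

Lemma intgZ (c : R) f : intg f -> intg (fun x => c * f x).
Proof. by move=> fi; exact: (integrableZl measurableT c fi). Qed.

Lemma intg_norm f : intg f -> intg (fun x => `|f x|).
Proof. by move=> fi; exact: (integrable_norm fi). Qed.

Lemma intg_mulb u h M : intg u -> measurable_fun setT h -> (forall x, `|h x| <= M) ->
  intg (fun x => u x * h x).
Proof.
move=> ui mh hM; apply: (@intg_le _ (fun x => `|M| * u x)); last exact: intgZ.
  by apply: measurable_funM => //; exact: intg_measurable.
move=> x; rewrite !normrM normr_id mulrC ler_wpM2r//.
by rewrite (le_trans (hM x))// ler_norm.
Qed.

Lemma intg_vanish r M f : measurable_fun setT f -> (forall x, `|f x| <= M) -> vanish_out r f -> intg f.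
Proof.
move=> mf fM vf.
have mB : measurable [set x : E | `|x| <= r] by apply: compact_rV_measurable; exact: ball_closed_compact.
have H : intg (fun x => \1_[set x : E | `|x| <= r] x).
  apply/integrableP; split; first by apply/measurable_EFinP; exact: measurable_indic.
  under eq_integral do rewrite /= ger0_norm//.
  by rewrite integral_indic// setIT; apply: compact_lebesgue_lty; exact: ball_closed_compact.
apply: (@intg_le _ (fun x => M * \1_[set x : E | `|x| <= r] x)) => //; last exact: intgZ.
move=> x; rewrite indicE; have [xr|xr] := leP `|x| r.
  by rewrite mem_set//= mulr1 (le_trans (fM x))// ler_norm.
by rewrite vf// normr0.
Qed.

Lemma smooth_cs_intg r f : smooth_cs r f -> intg f.
Proof.
move=> sf; have [M M0 HM] := smooth_cs_bounded sf.
apply: (intg_vanish _ HM sf.2); apply: continuous_rV_measurable.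
exact: smooth_continuous sf.1.
Qed.

Lemma smooth_measurable f : smooth f -> measurable_fun setT f.
Proof. by move=> sf; apply: continuous_rV_measurable; exact: smooth_continuous. Qed.

Lemma integral_invariant (Phi : E -> E) f : mu_invariant Phi -> intg f ->
  intg (fun x => f (Phi x)) /\ \int[mu]_x f (Phi x) = \int[mu]_x f x.
Proof.
move=> iPhi fi; have [mPhi PhiE] := iPhi.
have mf := intg_measurable fi.
have mfP : measurable_fun setT (fun x => f (Phi x)) by exact: measurableT_comp mf mPhi.
have i2 : intg (fun x => f (Phi x)).
  apply/integrableP; split; first exact/measurable_EFinP.
  have -> : (\int[mu]_x `|(f (Phi x))%:E| = \int[mu]_x `|(f x)%:E|)%E.
    apply: (ge0_integral_invariant (f := fun x => `|(f x)%:E|%E) iPhi).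
      exact: (measurableT_comp (@abse_measurable R setT) (measurable_int _ fi)).
    by move=> x; exact: abse_ge0.
  by case/integrableP : fi.
split => //; rewrite /Rintegral; congr fine.
have -> : (\int[mu]_x (f x)%:E = \int[pushforward mu Phi]_x (f x)%:E)%E.
  by apply: eq_measure_integral => A mA _; exact/esym/PhiE.
have mfe : measurable_fun setT (EFin \o f) by exact/measurable_EFinP.
by rewrite (integral_pushforward mPhi mfe i2 measurableT).
Qed.

Lemma intg_shift f y : intg f -> intg (fun x => f (x + y)).
Proof. by move=> fi; case: (integral_invariant (mu_invariant_shift y) fi). Qed.

Lemma Rintegral_shift f y : intg f -> \int[mu]_x f (x + y) = \int[mu]_x f x.
Proof. by move=> fi; case: (integral_invariant (mu_invariant_shift y) fi). Qed.

Lemma intg_reflect f x : intg f -> intg (fun y => f (x - y)).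
Proof.
move=> /(intg_shift x) /(integral_invariant mu_invariant_opp)[+ _].
by under [X in intg X -> _]funext do rewrite addrC.
Qed.

Lemma Rintegral_reflect f x : intg f -> \int[mu]_y f (x - y) = \int[mu]_y f y.
Proof.
move=> fi; rewrite -(Rintegral_shift x fi).
have := (integral_invariant mu_invariant_opp (intg_shift x fi)).2 => <-.
by apply: eq_Rintegral => y _; rewrite addrC.
Qed.

Lemma Rintegral_norm_le u h M : intg u -> measurable_fun setT h -> (forall x, `|h x| <= M) ->
  `|\int[mu]_x (u x * h x)| <= M * \int[mu]_x `|u x|.
Proof.
move=> ui mh hM; have uh := intg_mulb ui mh hM.
apply: (le_trans (le_normr_Rintegral measurableT uh)).
rewrite -RintegralZl//; last exact: intg_norm.
apply: le_Rintegral => //; [exact: intg_norm uh|exact: (intgZ M (intg_norm ui))|].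
by move=> x _; rewrite normrM mulrC ler_wpM2r.
Qed.

(* Translation invariance kills the integral of the difference quotients. *)
Lemma Rintegral_partial0 r i f : smooth_cs r f -> \int[mu]_x partial i f x = 0.
Proof.
move=> sf; have [C C0 HC] := smooth_cs_partial_taylor i sf.
have fi := smooth_cs_intg sf.
have pi := smooth_cs_intg (smooth_cs_partial i sf).
(* For steps [h <= 1] the function, its translate and its derivative all vanish outside this ball,
   so the Taylor remainder is integrated over a set of finite measure. *)
pose B := [set x : E | `|x| <= r + 1].
have mB : measurable B by apply: compact_rV_measurable; exact: ball_closed_compact.
have Boo : (mu B < +oo)%E by apply: compact_lebesgue_lty; exact: ball_closed_compact.
have bi : intg (fun x => \1_B x).
  apply/integrableP; split; first by apply/measurable_EFinP; exact: measurable_indic.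
  under eq_integral do rewrite /= ger0_norm//.
  by rewrite integral_indic// setIT.
pose K := C * \int[mu]_x \1_B x.
have K0 : 0 <= K by rewrite mulr_ge0// Rintegral_ge0.
have H (h : R) : 0 < h -> h <= 1 -> `|\int[mu]_x partial i f x| <= K * h.
  move=> h0 h1.
  have di : intg (fun x => f (x + h *: delta_mx 0 i) - f x) by apply: intgB => //; exact: intg_shift.
  have E0 : \int[mu]_x (f (x + h *: delta_mx 0 i) - f x) = 0.
    by rewrite RintegralB ?Rintegral_shift ?subrr//; exact: intg_shift.
  have : `|h * \int[mu]_x partial i f x| <= C * h ^+ 2 * \int[mu]_x \1_B x.
    rewrite -RintegralZl// -normrN -[X in `|X|]add0r -E0 -RintegralB//; last exact: intgZ.
    have qi : intg (fun x => f (x + h *: delta_mx 0 i) - f x - h * partial i f x).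
      by apply: intgB => //; exact: intgZ.
    apply: (le_trans (le_normr_Rintegral measurableT qi)).
    rewrite -RintegralZl//; apply: le_Rintegral => //; [exact: intg_norm qi|exact: (intgZ _ bi)|].
    move=> x _; rewrite indicE; have [xB|xB] := leP `|x| (r + 1).
      by rewrite mem_set// mulr1 (le_trans (HC x h))// gtr0_norm.
    have e1 : f (x + h *: delta_mx 0 i) = 0.
      apply: sf.2.
      have := ler_normD (x + h *: delta_mx 0 i) (- (h *: delta_mx 0 i)); rewrite addrK normrN.
      have : `|h *: (delta_mx 0 i : E)| <= 1.
        have h2 : `|delta_mx 0 i : E| <= 1.
          by apply: rV_norm_le => // j; rewrite mxE; case: (_ && _); rewrite ?normr1 ?normr0.
        by rewrite normrZ gtr0_norm// -[leRHS]mulr1; apply: ler_pM => //; exact: ltW.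
      move: xB; lra.
    have e2 : f x = 0 by apply: sf.2; move: xB; lra.
    have e3 : partial i f x = 0 by apply: (smooth_cs_partial i sf).2; move: xB; lra.
    rewrite e1 e2 e3 mulr0 !subrr normr0; apply: mulr_ge0 => //.
    by apply: mulr_ge0 => //; exact: sqr_ge0.
  rewrite normrM gtr0_norm// expr2 -mulrA mulrCA [C * _]mulrC -!mulrA ler_pM2l//.
  move: (\int[mu]_x \1_B x) => J.
  by have -> : h * (J * C) = C * (J * h) by ring.
apply/eqP; rewrite -normr_le0; apply/ler_addgt0Pr => e e0; rewrite add0r.
pose h := Num.min 1 (e / (K + 1)).
have K1 : 0 < K + 1 by lra.
have h0 : 0 < h by rewrite lt_min ltr01 divr_gt0.
apply: (le_trans (H h h0 _)); first by rewrite ge_min lexx.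
apply: (@le_trans _ _ (K * (e / (K + 1)))); first by rewrite ler_wpM2l// ge_min lexx orbT.
by rewrite mulrA ler_pdivrMr// [K * e]mulrC ler_pM2l// lerDl.
Qed.

Lemma integration_by_parts_smooth r i f g : smooth f -> smooth_cs r g ->
  \int[mu]_x (f x * partial i g x) = - \int[mu]_x (partial i f x * g x).
Proof.
move=> sf sg.
have sfg : smooth_cs r (f * g).
  by split; [exact: smoothM sg.1|move=> x rx; rewrite /GRing.mul /= sg.2// mulr0].
have s1 : smooth_cs r (f * partial i g).
  split; first exact: (smoothM sf (smooth_partial i sg.1)).
  by move=> x rx; rewrite /GRing.mul /= (smooth_cs_partial i sg).2// mulr0.
have s2 : smooth_cs r (partial i f * g).
  split; first exact: (smoothM (smooth_partial i sf) sg.1).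
  by move=> x rx; rewrite /GRing.mul /= sg.2// mulr0.
apply/eqP; rewrite -addr_eq0 -RintegralD//; [|exact: (smooth_cs_intg s1)|exact: (smooth_cs_intg s2)].
apply/eqP; rewrite -(Rintegral_partial0 i sfg); apply: eq_Rintegral => x _.
rewrite partialM; [|exact: smooth_derivable|exact: (smooth_derivable sg.1)].
by rewrite [g x * _]mulrC.
Qed.

End integrable_functions.

(** * Convolution with a mollifier and Young's inequality *)

Section convolution.
Context {R : realType} {n : nat}.
Local Notation E := 'rV[R]_n.
Local Notation mu := (@lebesgue_rV R n).
Implicit Types (f g u h rho : E -> R).

Definition convol u rho (x : E) : R := \int[mu]_y (u y * rho (x - y)).

Lemma kernel_intg r rho x : smooth_cs r rho -> intg (fun y => rho (x - y)).
Proof. by move=> sr; apply: intg_reflect; exact: smooth_cs_intg sr. Qed.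

Lemma kernel_measurable r rho x : smooth_cs r rho -> measurable_fun setT (fun y : E => rho (x - y)).
Proof. by move=> sr; apply: intg_measurable; exact: kernel_intg sr. Qed.

Lemma conv_intg r rho u x : intg u -> smooth_cs r rho -> intg (fun y => u y * rho (x - y)).
Proof.
move=> ui sr; have [M M0 HM] := smooth_cs_bounded sr.
apply: (intg_mulb ui (kernel_measurable x sr) (M := M)) => y; exact: HM.
Qed.

(** The constant depends on [u] only through its L^1 norm, which makes mollified bounded families
    equicontinuous. *)
Lemma conv_lipschitz r rho : smooth_cs r rho -> exists2 L, 0 <= L & forall u, intg u ->
  forall x x', `|convol u rho x - convol u rho x'| <= L * (\int[mu]_y `|u y|) * `|x - x'|.
Proof.
move=> sr; have [L L0 HL] := smooth_cs_lipschitz sr.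
exists L => // u ui x x'; rewrite /convol -RintegralB//; try exact: (conv_intg _ ui sr).
rewrite (Rint_ext (g := fun y => u y * (rho (x - y) - rho (x' - y)))); last first.
  by move=> y; rewrite mulrBr.
rewrite mulrAC; apply: (Rintegral_norm_le ui).
  exact: (measurable_funB (kernel_measurable x sr) (kernel_measurable x' sr)).
move=> y; rewrite (_ : x - y = (x' - y) + (x - x')) ?HL//.
by rewrite [RHS]addrC addrA subrK.
Qed.

Lemma conv_continuous r rho u : intg u -> smooth_cs r rho -> continuous (convol u rho).
Proof.
move=> ui sr; have [L _ HL] := conv_lipschitz sr.
exact: (@lipschitz_rV_continuous _ _ R^o _ _ (HL u ui)).
Qed.

Lemma is_derive_quadratic f i x (d C : R) :
  (forall t : R, `|f (x + t *: delta_mx 0 i) - f x - t * d| <= C * `|t| ^+ 2) ->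
  is_derive x (delta_mx 0 i : E) f d.
Proof.
move=> key; pose e : E := delta_mx 0 i.
have D : (fun t => t^-1 *: ((f \o shift x) (t *: e) - f x)) @ 0^' --> d.
  apply/cvgrPdist_lt => eps eps0.
  have CI : 0 < `|C| + 1 by rewrite ltr_wpDl.
  have H : \forall t \near (0 : R)^', `|t| < eps / (`|C| + 1).
    by apply: dnbhs0_lt; rewrite divr_gt0.
  have H0 : \forall t \near (0 : R)^', t != 0 by exact: nbhs_dnbhs_neq.
  apply: filterS2 H H0 => t td t0.
  have -> : d - t^-1 *: ((f \o shift x) (t *: e) - f x) = - (t^-1 * (f (x + t *: e) - f x - t * d)).
    by rewrite mulrBr mulKf// opprB /= [x + _]addrC.
  rewrite normrN normrM normfV mulrC ltr_pdivrMr ?normr_gt0//.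
  apply: (le_lt_trans (key t)).
  rewrite expr2 mulrA ltr_pM2r ?normr_gt0//.
  move: td; rewrite ltr_pdivlMr//; apply: le_lt_trans.
  by rewrite mulrC; apply: ler_wpM2l => //; have := ler_norm C; lra.
apply: DeriveDef; first by apply/cvg_ex; exists d.
exact: cvg_lim.
Qed.

(** The Taylor remainder of [rho] is uniform in its base point, so it integrates against [|u|] to a
    remainder of second order. *)
Lemma conv_is_derive r rho u i x : intg u -> smooth_cs r rho ->
  is_derive x (delta_mx 0 i : E) (convol u rho) (convol u (partial i rho) x).
Proof.
move=> ui sr; have [C C0 HC] := smooth_cs_partial_taylor i sr.
have spr := smooth_cs_partial i sr.
apply: (@is_derive_quadratic _ _ _ _ (C * \int[mu]_y `|u y|)) => t.
rewrite /convol -RintegralZl//; last exact: (conv_intg _ ui spr).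
rewrite -RintegralB//; try exact: (conv_intg _ ui sr).
rewrite -RintegralB//; first last.
- exact: (intgZ t (conv_intg x ui spr)).
- exact: (intgB (conv_intg _ ui sr) (conv_intg _ ui sr)).
rewrite (Rint_ext (g := fun y => u y * (rho (x + t *: delta_mx 0 i - y) - rho (x - y) - t * partial i rho (x - y)))); last first.
  by move=> y; rewrite !mulrBr mulrCA.
rewrite mulrAC; apply: (Rintegral_norm_le ui).
  exact: (measurable_funB (measurable_funB (kernel_measurable _ sr) (kernel_measurable _ sr))
    (measurable_funM (measurable_cst t) (kernel_measurable _ spr))).
move=> y; have -> : x + t *: delta_mx 0 i - y = (x - y) + t *: delta_mx 0 i by rewrite addrAC.
exact: HC.
Qed.

Lemma smooth_conv r rho u : intg u -> smooth_cs r rho -> smooth (convol u rho).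
Proof.
move=> ui sr.
suff : [set f : E -> R | exists2 rho, smooth_cs r rho & f = convol u rho] `<=` smooth.
  by apply; exists rho.
apply: smooth_coind => _ [k sk ->]; split.
- exact: conv_continuous ui sk.
- by move=> i x; case: (conv_is_derive i x ui sk).
- move=> i; exists (partial i k); first exact: smooth_cs_partial.
  by apply/funext => x; rewrite /partial; case: (conv_is_derive i x ui sk).
Qed.

Lemma partial_conv r rho u i x : intg u -> smooth_cs r rho ->
  partial i (convol u rho) x = convol u (partial i rho) x.
Proof. by move=> ui sr; case: (conv_is_derive i x ui sr). Qed.

Lemma conv_support r rho u x : vanish_out r rho -> convol u rho x != 0 ->
  exists2 y, u y != 0 & `|x - y| <= r.
Proof.
move=> vr; apply: contraPP => H.
rewrite /convol (Rint_ext (g := fun=> 0)) ?Rintegral_cst ?mul0r ?eqxx// => y.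
have [->|uy] := eqVneq (u y) 0; first by rewrite mul0r.
rewrite vr ?mulr0// ltNge; apply/negP => h; apply: H; exists y => //.
Qed.

Lemma measurable_kernel2 rho : continuous rho ->
  measurable_fun [set: E * E] (fun z => rho (z.1 - z.2)).
Proof.
move=> cr; apply: (@mfun_continuous_comp _ _ _ _ (fun z : E * E => z.1 - z.2)) => // i.
rewrite (_ : (fun z => _) = (fun z : E * E => z.1 0 i - z.2 0 i)).
  apply: measurable_funB.
    exact: (measurableT_comp (measurable_coord i) measurable_fst).
  exact: (measurableT_comp (measurable_coord i) measurable_snd).
by apply/funext => z; rewrite !mxE.
Qed.

Definition mollifier (r : R) rho := [/\ 0 < r, smooth_cs r rho, forall x, 0 <= rho x & \int[mu]_x rho x = 1].

(** A normalized bump. Its integral is not zero: otherwise the bump would vanish almost everywhere,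
    whereas it is positive on a ball of positive measure. *)
Lemma mollifier_exists (r : R) : 0 < r -> exists rho, mollifier r rho.
Proof.
move=> r0; pose b := bumpf (0 : E) r.
have sb : smooth_cs r b.
  by split; [exact: smooth_bump|move=> x rx; apply: bump_eq0 => //; rewrite subr0 ltW].
have bi := smooth_cs_intg sb.
have I0 : 0 < \int[mu]_x b x.
  rewrite lt_neqAle Rintegral_ge0 ?andbT; last by move=> x _; exact: bump_ge0.
  apply/eqP => /esym I0.
  have Ie : (\int[mu]_x `|(b x)%:E| = 0)%E.
    under eq_integral do rewrite gee0_abs ?lee_fin ?bump_ge0//.
    have := integrable_fin_num measurableT bi.
    by move: I0; rewrite /Rintegral /=; case: (\int[mu]_x _)%E => //= z ->.
  have := (ae_eq_integral_abs mu measurableT (measurable_int _ bi)).1 Ie.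
  move=> [N [mN N0 NS]].
  have := lebesgue_ball_gt0 (0 : E) r0.
  rewrite ltNge => /negP; apply; rewrite -N0; apply: le_outer_measure => x /= xr.
  apply: NS => /= /(_ I) [] h.
  by have := bump_gt0 xr; rewrite -/b h ltxx.
exists (fun x => (\int[mu]_x b x)^-1 * b x); split => //.
- split; first exact: (smoothM (smooth_cst (\int[mu]_x b x)^-1) sb.1).
  by move=> x rx; rewrite sb.2// mulr0.
- by move=> x; rewrite mulr_ge0 ?bump_ge0// invr_ge0 ltW.
- by rewrite RintegralZl// mulVf// gt_eqF.
Qed.

Section young.
Variables (p : R) (p1 : 1 < p).
Let p0 : 0 < p. Proof. exact: lt_trans p1. Qed.

(** Jensen's inequality through Hölder: write [g w] as [(g w^(1/p)) w^(1/q)], whose second factor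
    has L^q norm 1. *)
Lemma jensen_weight w g : intg w -> (forall y, 0 <= w y) -> \int[mu]_y w y = 1 ->
  measurable_fun setT g -> intg (fun y => g y * w y) ->
  ((`|\int[mu]_y (g y * w y)| `^ p)%:E <= \int[mu]_y (`|g y| `^ p * w y)%:E)%E.
Proof.
move=> wi w0 w1 mg gwi.
have mw := intg_measurable wi.
pose q := p / (p - 1).
have q0 : 0 < q by rewrite divr_gt0// subr_gt0.
have pq : p^-1 + q^-1 = 1 by rewrite /q; field; rewrite ?subr_eq0 ?gt_eqF.
pose f y := `|g y| * w y `^ p^-1.
pose k y := w y `^ q^-1.
have mwp s : measurable_fun setT (fun y => w y `^ s).
  exact: (measurableT_comp (measurable_powR s) mw).
have mf : measurable_fun setT f.
  exact: (measurable_funM (measurable_normf mg) (mwp _)).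
have H := hoelder mu mf (mwp q^-1) p0 q0 pq.
have fp y : `|f y| `^ p = `|g y| `^ p * w y.
  by rewrite ger0_norm ?mulr_ge0 ?powR_ge0// powRM ?powR_ge0// powRVK.
have kq y : `|k y| `^ q = w y.
  by rewrite ger0_norm ?powR_ge0// powRVK.
have Nk : ('N[mu]_(q%:E)[EFin \o k] = 1)%E.
  have -> : 'N[mu]_(q%:E)[EFin \o k]%E = lpn mu q k by [].
  rewrite lpnE; under eq_integral do rewrite kq.
  have : (\int[mu]_y (w y)%:E \is a fin_num)%E by exact: (integrable_fin_num measurableT wi).
  move: w1; rewrite /Rintegral; case: (\int[mu]_y (w y)%:E)%E => //= z -> _.
  by rewrite /= powR1.
rewrite Nk mule1 in H.
have fk y : f y * k y = `|g y * w y|.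
  by rewrite normrM (ger0_norm (w0 y)) -mulrA -powRD ?pq ?powRr1// oner_eq0.
have Hc : (`|\int[mu]_y (g y * w y)|%:E <= lpn mu p f)%E.
  apply: le_trans H; rewrite Lnorm1 EFin_normr_Rintegral//.
  have := le_abse_integral mu measurableT (measurable_int _ gwi) => /le_trans; apply.
  apply: ereal_eqW; apply: eq_integral => y _ /=.
  by rewrite fk normr_id.
have E1 : (\int[mu]_y (`|g y| `^ p * w y)%:E = \int[mu]_y (`|f y| `^ p)%:E)%E.
  by apply: eq_integral => y _; rewrite fp.
rewrite E1 -(lpn_pow mu p1 f) -poweR_EFin; apply: gt0_ler_poweR => //; first exact: ltW.
  by rewrite in_itv/= lee_fin normr_ge0 leey.
by rewrite in_itv/= lpn_ge0 leey.
Qed.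

(** Jensen with weight [rho (x - y)] in [y], then Tonelli: each [y] is counted with total weight
    1. *)
Lemma conv_lpn_le r rho u : mollifier r rho -> intg u -> (lpn mu p (convol u rho) <= lpn mu p u)%E.
Proof.
move=> [r0 sr rho0 rho1] ui.
have mu_ := intg_measurable ui.
have mup : measurable_fun setT (fun y => `|u y| `^ p) by apply/measurable_EFinP; exact: measurable_normpow.
pose F (z : E * E) : \bar R := (`|u z.2| `^ p * rho (z.1 - z.2))%:E.
have mF : measurable_fun setT F.
  apply/measurable_EFinP; apply: measurable_funM.
    exact: (measurableT_comp mup measurable_snd).
  exact: measurable_kernel2 (smooth_continuous sr.1).
have F0 z : (0 <= F z)%E by rewrite lee_fin mulr_ge0// powR_ge0.
rewrite 2!lpnE; apply: gt0_ler_poweR.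
- by rewrite invr_ge0 ltW.
- by rewrite in_itv/= int_normpow_ge0 leey.
- by rewrite in_itv/= int_normpow_ge0 leey.
apply: (@le_trans _ _ (\int[mu]_x \int[mu]_y F (x, y))%E).
  apply: ge0_le_integral; first exact: measurableT.
  - by move=> x _; rewrite lee_fin powR_ge0.
  - apply: measurable_normpow; apply: continuous_rV_measurable; exact: conv_continuous ui sr.
  - exact: (measurable_fun_fubini_tonelli_F F mF F0).
  move=> x _; apply: jensen_weight => //.
  - exact: kernel_intg sr.
  - by rewrite Rintegral_reflect//; exact: smooth_cs_intg sr.
  - exact: conv_intg sr.
rewrite (fubini_tonelli F mF F0); apply: ereal_eqW; apply: eq_integral => y _.
rewrite /F /=; under eq_integral do rewrite EFinM.
have mk : measurable_fun setT (fun x : E => (rho (x - y))%:E).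
  by apply/measurable_EFinP; apply: intg_measurable; apply: (intg_shift (- y)); exact: smooth_cs_intg sr.
rewrite ge0_integralZl//; try by [move=> x _; rewrite lee_fin|rewrite lee_fin powR_ge0].
have ii : intg (fun x => rho (x - y)) by apply: (intg_shift (- y)); exact: smooth_cs_intg sr.
have := Rintegral_shift (- y) (smooth_cs_intg sr); rewrite rho1.
have := integrable_fin_num measurableT ii.
by rewrite /Rintegral/=; case: (\int[mu]_x _)%E => //= z _ ->; rewrite mule1.
Qed.

End young.
End convolution.

(** * Cutoff functions and the fundamental lemma *)

Section testing.
Context {R : realType} {n : nat}.
Local Notation E := 'rV[R]_n.
Local Notation mu := (@lebesgue_rV R n).
Implicit Types (f g u h rho : E -> R).

Lemma open_norm (O : set E) x : open O -> O x -> exists2 e : R, 0 < e & forall z, `|z - x| < e -> O z.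
Proof.
move=> oO Ox; have /nbhs_normP[e /= e0 He] := open_nbhs_nbhs (conj oO Ox).
by exists e => // z zx; apply: He; rewrite /= distrC.
Qed.

Lemma closed_norm_ge (a : E) (t : R) : closed [set x : E | t <= `|a - x|].
Proof.
have c : continuous (fun x : E => `|a - x|).
  apply: (@lipschitz_rV_continuous _ _ R^o _ 1) => x y; rewrite mul1r.
  apply: le_trans (ler_dist_dist _ _) _.
  have -> : a - x - (a - y) = - (x - y) by rewrite !opprB addrC addrA subrK.
  by rewrite normrN.
have -> : [set x : E | t <= `|a - x|] = (fun x : E => `|a - x|) @^-1` [set y | t <= y] by [].
by apply: (preimage_closed (fun x _ => c x)); exact: closed_ge.
Qed.

(** The points at sup-norm distance at least [t] from the complement of [O], a closed set even when
    [O] is open. *)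
Definition core (O : set E) (t : R) : set E := [set x | forall z, `|z - x| < t -> O z].

Lemma closed_core O t : closed (core O t).
Proof.
have -> : core O t = \bigcap_(z in ~` O) [set x : E | t <= `|z - x|].
  apply/seteqP; split => x /= H z.
    by move=> nO; rewrite /= leNgt; apply/negP => /H.
  by apply: contraPP => nO zx; have := H z nO; rewrite /= leNgt zx.
by apply: closed_bigI => z _; exact: closed_norm_ge.
Qed.

(** The sets of points with margin larger than [1/(i+1)] are open, grow with [i] and cover [O];
    finitely many cover [K], so the largest index does. *)
Lemma compact_core (K O : set E) : compact K -> open O -> K `<=` O ->
  exists2 t : R, 0 < t & K `<=` core O t.
Proof.
move=> cK oO KO.
pose f (i : nat) := [set x : E | exists2 s : R, i.+1%:R^-1 < s & core O s x].
have of_ i : open (f i).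
  rewrite openE => x [s si Hx]; have : \forall y \near (x : E), f i y; last by [].
  apply/nbhs_normP.
  have [e e0 es] : exists2 e, 0 < e & i.+1%:R^-1 < s - e.
    by move: (i.+1%:R^-1) si => w si; exists ((s - w) / 2); lra.
  exists e => // y /= xy; exists (s - e) => //.
  move=> z zy; apply: Hx; rewrite (_ : z - x = (z - y) + (y - x)); last by rewrite addrA subrK.
  by apply: le_lt_trans (ler_normD _ _) _; rewrite (distrC y); lra.
have [D _ HD] : finite_subset_cover [set: nat] f K.
  move: cK; rewrite compact_cover; apply; first by move=> i _; exact: of_.
  move=> x /KO Ox; have [e e0 He] := open_norm oO Ox.
  by have [k ke] := exists_invn_lt e0; exists k => //; exists e.
pose N := (\max_(i <- finmap.enum_fset D) i)%N.
exists N.+1%:R^-1 => // x /HD [i /= iD [s si Hx]] z zx; apply: Hx.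
apply: lt_trans si; apply: lt_le_trans zx _; rewrite lef_pV2 ?posrE// ler_nat ltnS.
exact: (@leq_bigmax_seq _ _ _ id).
Qed.

Lemma intg_indic (A : set E) r : measurable A -> (forall x, A x -> `|x| <= r) -> intg (\1_A : E -> R).
Proof.
move=> mA Ar; apply: (@intg_vanish _ _ r 1).
- exact: measurable_indic.
- by move=> x; rewrite indicE; case: (x \in A); rewrite ?normr1 ?normr0.
- move=> x rx; rewrite indicE memNset// => /Ar; rewrite leNgt rx; exact.
Qed.

Lemma conv_indic_in r rho (A : set E) x : mollifier r rho -> (forall y, `|y - x| <= r -> A y) ->
  convol (\1_A) rho x = 1.
Proof.
move=> [r0 sr _ <-] HA; rewrite -(Rintegral_reflect x (smooth_cs_intg sr)); apply: Rint_ext => y.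
have [xy|xy] := leP `|x - y| r; last by rewrite sr.2// mulr0.
by rewrite indicE mem_set ?mul1r//; apply: HA; rewrite distrC.
Qed.

Lemma conv_indic_bounds r rho (A : set E) r' x : mollifier r rho -> measurable A ->
  (forall x, A x -> `|x| <= r') -> 0 <= convol (\1_A) rho x <= 1.
Proof.
move=> [r0 sr rho0 rho1] mA Ar; have Ai := intg_indic mA Ar.
apply/andP; split.
  by apply: Rintegral_ge0 => y _; rewrite mulr_ge0// indicE ler0n.
rewrite -rho1 -(Rintegral_reflect x (smooth_cs_intg sr)); apply: le_Rintegral => //.
- exact: conv_intg Ai sr.
- exact: kernel_intg sr.
- by move=> y _; rewrite indicE; case: (y \in A); rewrite ?mul1r ?mul0r.
Qed.

Lemma Cc_smooth_compact (U K : set E) phi : smooth phi -> compact K -> closed K -> K `<=` U ->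
  (forall x, phi x != 0 -> K x) -> Cc_smooth U phi.
Proof.
move=> sp cK clK KU H.
have S : supp phi `<=` K.
  by apply: supp_sub => // x nK; apply/eqP; apply: contra_notT nK => /H.
split => //; last exact: subset_trans KU.
by apply: subclosed_compact cK _; first exact: closed_closure.
Qed.

(** Mollify the indicator of the points of margin [t / 2] in the ball of radius [M + 1]. A mollifier
    of radius at most [min(1, t / 4)] leaves the value 1 at margin [t] in the ball [M], and support
    at margin [t / 4] in the ball [M + 2]. The balls are there because [O] may be unbounded. *)
Lemma cutoff_core (O : set E) (t M : R) : 0 < t ->
  exists eta, [/\ Cc_smooth O eta, (forall x, 0 <= eta x <= 1) &
    forall x, `|x| <= M -> core O t x -> eta x = 1].
Proof.
move=> t0; pose r := Num.min 1 (t / 4).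
have r0 : 0 < r by rewrite lt_min ltr01 divr_gt0.
have [r1 rt] : r <= 1 /\ r <= t / 4 by rewrite /r ge_min lexx ge_min lexx orbT.
have [rho mr] := mollifier_exists (n := n) r0.
pose A : set E := core O (t / 2) `&` [set x | `|x| <= M + 1].
have cb c : closed [set x : E | `|x| <= c] by apply: compact_closed; [exact: norm_hausdorff|exact: ball_closed_compact].
have mA : measurable A.
  by apply: closed_rV_measurable; apply: closedI => //; exact: closed_core.
have AM x : A x -> `|x| <= M + 1 by case.
have [_ sr _ _] := mr.
exists (convol (\1_A) rho); split; last 1 first.
- move=> x xM xt; apply: (conv_indic_in mr) => y yx; split.
    move=> z zy; apply: xt; rewrite (_ : z - x = (z - y) + (y - x)); last by rewrite addrA subrK.
    by apply: le_lt_trans (ler_normD _ _) _; lra.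
  rewrite /= (_ : y = (y - x) + x); last by rewrite subrK.
  by apply: le_trans (ler_normD _ _) _; lra.
- apply: (@Cc_smooth_compact _ (core O (t / 4) `&` [set x | `|x| <= M + 2])).
  + by apply: smooth_conv sr; exact: intg_indic mA AM.
  + apply: subclosed_compact (@ball_closed_compact R n (M + 2)) _; last by move=> x [].
    by apply: closedI => //; exact: closed_core.
  + by apply: closedI => //; exact: closed_core.
  + by move=> x [h _]; apply: h; rewrite subrr normr0 divr_gt0.
  + move=> x /(conv_support sr.2)[y]; rewrite indicE pnatr_eq0 eqb0 negbK => /set_mem [yt yM] xy; split.
      move=> z zx; apply: yt; rewrite (_ : z - y = (z - x) + (x - y)); last by rewrite addrA subrK.
      by apply: le_lt_trans (ler_normD _ _) _; lra.
    rewrite /= (_ : x = (x - y) + y); last by rewrite subrK.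
    by apply: le_trans (ler_normD _ _) _; rewrite /= in yM; lra.
- by move=> x; apply: conv_indic_bounds mr mA AM.
Qed.

Lemma cutoff (K O : set E) : compact K -> open O -> K `<=` O ->
  exists eta, [/\ Cc_smooth O eta, (forall x, 0 <= eta x <= 1) &
    exists2 t : R, 0 < t & forall x y, K x -> `|y - x| < t -> eta y = 1].
Proof.
move=> cK oO KO; have [t t0 Ht] := compact_core cK oO KO.
have [M HM] := compact_bounded_cube cK.
have t2 : 0 < t / 2 by lra.
have [eta [e1 e2 e3]] := cutoff_core O (`|M| + t) t2.
exists eta; split => //; exists (t / 2) => // x y Kx yx; apply: e3.
  rewrite (_ : y = (y - x) + x); last by rewrite subrK.
  apply: le_trans (ler_normD _ _) _.
  have : `|x| <= `|M|.
    apply: rV_norm_le => // i; have := HM x Kx i; rewrite /= in_itv /= -ler_norml => /le_trans; apply.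
    exact: ler_norm.
  by lra.
move=> z zy; apply: (Ht x Kx); rewrite (_ : z - x = (z - y) + (y - x)); last by rewrite addrA subrK.
by apply: le_lt_trans (ler_normD _ _) _; lra.
Qed.

Lemma exhaust (O : set E) : open O -> exists eta : nat -> E -> R,
  [/\ forall k, Cc_smooth O (eta k), (forall k x, 0 <= eta k x <= 1) &
    forall x, O x -> \forall k \near \oo, eta k x = 1].
Proof.
move=> oO.
have H k : exists eta, [/\ Cc_smooth O eta, (forall x, 0 <= eta x <= 1) &
    forall x, `|x| <= k%:R -> core O k.+1%:R^-1 x -> eta x = 1].
  by apply: cutoff_core.
have [eta He] := choice H.
exists eta; split; [by move=> k; case: (He k)|by move=> k; case: (He k)|].
move=> x Ox; have [e e0 Hx] := open_norm oO Ox.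
have [N Ne] := exists_invn_lt e0.
exists (maxn N (Num.truncn `|x|).+1) => // k /= kN; have [_ _ ->//] := He k.
  rewrite ltW// (lt_le_trans (truncnS_gt _))// ler_nat.
  by apply: leq_trans kN; exact: leq_maxr.
move=> z zx; apply: Hx; apply: lt_trans Ne; apply: lt_le_trans zx _.
rewrite lef_pV2 ?posrE// ler_nat ltnS; apply: leq_trans kN; exact: leq_maxl.
Qed.

Lemma Rint_dct (f_ : nat -> E -> R) f g : (forall k, measurable_fun setT (f_ k)) ->
  measurable_fun setT f -> (forall x, f_ ^~ x @ \oo --> f x) ->
  intg g -> (forall k x, `|f_ k x| <= g x) ->
  intg f /\ (fun k => \int[mu]_x f_ k x) @ \oo --> \int[mu]_x f x.
Proof.
move=> mf_ mf cf gi fg.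
have [|||||fi _ H] := @dominated_convergence _ _ _ mu setT measurableT (fun k => EFin \o f_ k) (EFin \o f) (EFin \o g).
- by move=> k; exact/measurable_EFinP.
- exact/measurable_EFinP.
- by apply: aeW => x _; apply: cvg_EFin; [exact: nearW|exact: cf].
- exact: gi.
- by apply: aeW => x k _; rewrite /= lee_fin; exact: fg.
split => //.
have fin : (\int[mu]_x (f x)%:E)%E \is a fin_num by exact: integrable_fin_num.
move: H; rewrite -(fineK fin) => /fine_cvgP[_]; exact.
Qed.

(** Test with the cutoffs exhausting an open set: by dominated convergence the integral of [g] over
    every open set vanishes. *)
Lemma fundamental_intg g : intg g ->
  (forall phi, smooth phi -> (exists M, forall x, `|phi x| <= M) -> \int[mu]_x (g x * phi x) = 0) ->
  {ae mu, forall x, g x = 0}.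
Proof.
move=> gi H.
have : ae_eq mu setT (EFin \o g) (cst 0%E).
  apply: measurable_open_integral0_ae => // O oO.
  have [eta [e1 e2 e3]] := exhaust oO.
  have mO := open_rV_measurable oO.
  have giO : intg (fun x => g x * \1_O x).
    have mi : measurable_fun setT (\1_O : E -> R) by exact: measurable_indic.
    apply: (intg_mulb gi mi (M := 1)).
    by move=> x; rewrite indicE; case: (x \in O); rewrite ?normr1 ?normr0.
  have [_ C] : intg (fun x => g x * \1_O x) /\
      (fun k => \int[mu]_x (g x * eta k x)) @ \oo --> \int[mu]_x (g x * \1_O x).
    apply: (@Rint_dct _ _ (fun x => `|g x|)).
    - move=> k; apply: measurable_funM; first exact: intg_measurable.
      by apply: smooth_measurable; case: (e1 k).
    - exact: intg_measurable.
    - move=> x; apply: cvgM; first exact: cvg_cst.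
      rewrite indicE; case: (boolP (x \in O)) => [/set_mem|/negP nO].
        by move=> /e3 h; apply: cvg_near_cst; apply: filterS h => k ->.
      apply: cvg_near_cst; apply: nearW => k; case: (e1 k) => _ _ sO.
      by apply: (supp_eq0 sO) => /mem_set.
    - exact: intg_norm.
    - move=> k x; rewrite normrM ler_piMr//.
      by have /andP[a b] := e2 k x; rewrite ger0_norm.
  have Z : (fun k => \int[mu]_x (g x * eta k x)) = cst 0.
    apply/funext => k; apply: H; first by case: (e1 k).
    by exists 1 => x; have /andP[a b] := e2 k x; rewrite ger0_norm.
  have : \int[mu]_x (g x * \1_O x) = 0.
    by rewrite Z in C; apply: (cvg_unique _ C); [exact: Rhausdorff|exact: cvg_cst].
  rewrite /Rintegral => h0.
  have fin : (\int[mu]_x (g x * \1_O x)%:E)%E \is a fin_num by exact: integrable_fin_num giO.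
  have -> : (\int[mu]_(x in O) (EFin \o g) x = \int[mu]_x (g x * \1_O x)%:E)%E.
    rewrite integral_mkcond; apply: eq_integral => x _; rewrite patchE indicE.
    by case: (x \in O); rewrite /= ?mulr1 ?mulr0.
  by rewrite -(fineK fin) h0.
by apply: filterS => x /(_ I) [].
Qed.

Lemma Lp_mul_Cc (O : set E) g eta : open O -> loc_integrable O g -> Cc_smooth O eta ->
  intg (fun x => g x * eta x).
Proof.
move=> oO [mg Hg] Ce; have [se ce sO] := Ce.
have clS : closed (supp eta) by exact: closed_closure.
have mS := closed_rV_measurable clS.
have [r _ sr] := Cc_smoothP Ce; have [M M0 HM] := smooth_cs_bounded sr.
have giS : intg (g \_ (supp eta)).
  rewrite /intg -restrict_EFin; apply/(integrable_mkcond _ mS); exact: Hg.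
have -> : (fun x => g x * eta x) = (fun x => (g \_ (supp eta)) x * eta x).
  apply/funext => x; rewrite patchE; case: ifPn => // /negP nS.
  rewrite mul0r; apply/eqP; rewrite mulf_eq0; apply/orP; right; apply/eqP.
  by apply: (supp_eq0 (U := supp eta)) => // /mem_set.
exact: (intg_mulb giS (smooth_measurable se) HM).
Qed.

(** Localization: [g * eta k] is integrable on the whole space, [phi * eta k] is a test function in
    [O], and at each point of [O] some [eta k] equals 1. *)
Lemma fundamental_lemma (O : set E) g : open O -> loc_integrable O g ->
  (forall phi, Cc_smooth O phi -> \int[mu]_(x in O) (g x * phi x) = 0) ->
  {ae mu, forall x, O x -> g x = 0}.
Proof.
move=> oO lg H; have [eta [e1 e2 e3]] := exhaust oO.
have Hk k : {ae mu, forall x, g x * eta k x = 0}.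
  apply: fundamental_intg; first exact: Lp_mul_Cc (e1 k).
  move=> phi sphi _.
  rewrite -[RHS](H (phi * eta k)); last exact: Cc_smoothMr.
  rewrite [RHS]Rintegral_mkcond; apply: Rint_ext => x; rewrite patchE.
  case: ifPn => [_|/negP nO]; first by rewrite -mulrA [eta k x * _]mulrC.
  have [_ _ sO] := e1 k.
  by rewrite (supp_eq0 sO) ?mulr0 ?mul0r// => /mem_set.
have : {ae mu, forall x, forall k, g x * eta k x = 0}.
  by apply/ae_foralln => k; exact: Hk.
apply: filterS => x hx /e3 [N _ HN].
by have := hx N; rewrite HN ?mulr1//=.
Qed.

End testing.

(** * Convergence of mollifications; pairing of L^p functions with test functions *)

Section mollified.
Context {R : realType} {n : nat}.
Local Notation E := 'rV[R]_n.
Local Notation mu := (@lebesgue_rV R n).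
Implicit Types (f g u h rho theta : E -> R).

Lemma EFin_Rint f : intg f -> (\int[mu]_x (f x)%:E)%E = (\int[mu]_x f x)%:E.
Proof. by move=> fi; rewrite fineK//; exact: (integrable_fin_num measurableT fi). Qed.

Lemma Rint_eqE f (c : R) : (\int[mu]_x (f x)%:E)%E = c%:E -> \int[mu]_x f x = c.
Proof. by rewrite /Rintegral => ->. Qed.

Lemma mollify_close r rho theta (L : R) y : mollifier r rho -> measurable_fun setT theta ->
  0 <= L -> (exists M, forall x, `|theta x| <= M) ->
  (forall x v, `|theta (x + v) - theta x| <= L * `|v|) ->
  intg (fun x => rho (x - y) * theta x) /\
  `|\int[mu]_x (rho (x - y) * theta x) - theta y| <= L * r.
Proof.
move=> [r0 sr rho0 rho1] mth L0 [M HM] HL.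
have ri : intg (fun x => rho (x - y)) by apply: (intg_shift (- y)); exact: smooth_cs_intg sr.
have r1 : \int[mu]_x rho (x - y) = 1 by rewrite -rho1; exact: Rintegral_shift (- y) (smooth_cs_intg sr).
have rti := intg_mulb ri mth HM.
split => //.
have -> : theta y = \int[mu]_x (theta y * rho (x - y)) by rewrite RintegralZl// r1 mulr1.
rewrite -RintegralB//; last exact: intgZ.
have di := intgB rti (intgZ (theta y) ri).
apply: le_trans (le_normr_Rintegral measurableT di) _.
have -> : L * r = \int[mu]_x (L * r * rho (x - y)) by rewrite RintegralZl// r1 mulr1.
apply: le_Rintegral => //; [exact: intg_norm|exact: (intgZ (L * r) ri)|].
move=> x _.
rewrite (_ : _ - _ = (theta x - theta y) * rho (x - y)); last by rewrite mulrBl mulrC.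
rewrite normrM (ger0_norm (rho0 _)).
have [xy|xy] := leP `|x - y| r; last by rewrite sr.2// !mulr0.
apply: ler_wpM2r => //; apply: (@le_trans _ _ (L * `|x - y|)); last exact: ler_wpM2l.
by have := HL y (x - y); rewrite [y + _]addrC subrK.
Qed.

(** Fubini moves the mollification from [u], which is merely integrable, to the Lipschitz function
    [theta], where it changes values by at most [L * r]. *)
Lemma conv_test r rho u theta (L : R) : mollifier r rho -> intg u -> measurable_fun setT theta ->
  0 <= L -> (exists M, forall x, `|theta x| <= M) ->
  (forall x v, `|theta (x + v) - theta x| <= L * `|v|) ->
  `|\int[mu]_x (convol u rho x * theta x) - \int[mu]_x (u x * theta x)| <= L * r * \int[mu]_x `|u x|.
Proof.
move=> mr ui mth L0 [M HM] HL; have [r0 sr rho0 rho1] := mr.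
have mc y := mollify_close y mr mth L0 (ex_intro _ M HM) HL.
pose F (z : E * E) : \bar R := (u z.2 * (rho (z.1 - z.2) * theta z.1))%:E.
have mF : measurable_fun setT F.
  apply/measurable_EFinP; apply: measurable_funM.
    exact: (measurableT_comp (intg_measurable ui) measurable_snd).
  apply: measurable_funM; first exact: measurable_kernel2 (smooth_continuous sr.1).
  exact: (measurableT_comp mth measurable_fst).
have ri y : intg (fun x => rho (x - y)) by apply: (intg_shift (- y)); exact: smooth_cs_intg sr.
have rE (c : R) (y : E) : \int[mu]_x (c * rho (x - y)) = c.
  have r1 : \int[mu]_x rho (x - y) = 1 by rewrite -rho1; exact: Rintegral_shift (- y) (smooth_cs_intg sr).
  by have riy := ri y; rewrite RintegralZl// r1 mulr1.
have iF : ((mu \x mu)%E).-integrable setT F.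
  apply/(integrable21ltyP _ _ mF).
  apply: (@le_lt_trans _ _ (\int[mu]_y (`|M| * `|u y|)%:E)%E); last first.
    rewrite EFin_Rint ?ltry//; apply: intgZ; exact: intg_norm.
  apply: ge0_le_integral; first exact: measurableT.
  - by move=> y _; apply: integral_ge0 => x _; exact: abse_ge0.
  - apply: (measurable_fun_fubini_tonelli_G (fun z => `|F z|)%E) => //; first exact: measurableT_comp.
    exact/measurable_EFinP/(measurable_funM (measurable_cst _) (measurable_normf (intg_measurable ui))).
  move=> y _; apply: (@le_trans _ _ (\int[mu]_x ((`|u y| * `|M|) * rho (x - y))%:E)%E).
    apply: ge0_le_integral; first exact: measurableT.
    - by move=> x _; exact: abse_ge0.
    - have mFy : measurable_fun setT (fun x : E => F (x, y)).
        exact/measurable_EFinP/(measurable_funM (measurable_cst (u y)) (measurable_funM (intg_measurable (ri y)) mth)).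
      by apply: (measurableT_comp _ mFy).
    - exact/measurable_EFinP/(measurable_funM (measurable_cst _) (intg_measurable (ri y))).
    - move=> x _; rewrite /F /= lee_fin normrM -mulrA ler_wpM2l// normrM mulrC (ger0_norm (rho0 _)).
      by apply: ler_wpM2r => //; apply: le_trans (HM _) (ler_norm _).
  rewrite EFin_Rint; last exact: intgZ.
  by rewrite lee_fin mulrC le_eqVlt; apply/orP; left; apply/eqP; exact: rE.
have E1 x : (\int[mu]_y F (x, y) = (convol u rho x * theta x)%:E)%E.
  rewrite /F /= (_ : (fun y => _) = (fun y => (theta x * (u y * rho (x - y)))%:E)); last first.
    by apply/funext => y; rewrite mulrA mulrC.
  have ci := conv_intg x ui sr.
  rewrite EFin_Rint; last exact: intgZ.
  by rewrite RintegralZl// mulrC.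
have E2 y : (\int[mu]_x F (x, y) = (u y * \int[mu]_x (rho (x - y) * theta x))%:E)%E.
  rewrite /F /= EFin_Rint; last by apply: intgZ; case: (mc y).
  by rewrite RintegralZl//; case: (mc y).
(* The mollified [theta]. It inherits the Lipschitz constant of [theta], which gives its
   measurability. *)
pose k y := \int[mu]_x (rho (x - y) * theta x).
have kE y : k y = \int[mu]_x (rho x * theta (x + y)) /\ intg (fun x => rho x * theta (x + y)).
  have [h1 h2] := integral_invariant (mu_invariant_shift y) (mc y).1.
  split; last by move: h1; under eq_fun do rewrite addrK.
  by rewrite /k -h2; apply: Rint_ext => x; rewrite addrK.
have kL y y' : `|k y - k y'| <= L * `|y - y'|.
  have [-> iy] := kE y; have [-> iy'] := kE y'.
  rewrite -RintegralB//; apply: le_trans (le_normr_Rintegral measurableT (intgB iy iy')) _.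
  have si := smooth_cs_intg sr.
  have -> : L * `|y - y'| = \int[mu]_x (L * `|y - y'| * rho x) by rewrite RintegralZl// rho1 mulr1.
  apply: le_Rintegral => //; [exact: intg_norm (intgB iy iy')|exact: intgZ|].
  move=> x _; rewrite -mulrBr normrM (ger0_norm (rho0 _)) mulrC; apply: ler_wpM2r => //.
  by have -> : x + y = (x + y') + (y - y') by rewrite -addrA [y' + _]addrC subrK.
have mk : measurable_fun setT k.
  by apply: continuous_rV_measurable; exact: (@lipschitz_rV_continuous _ _ R^o _ _ kL).
have kM y : `|k y| <= `|M|.
  have := le_normr_Rintegral measurableT (mc y).1; move/le_trans; apply.
  rewrite -[leRHS](rE _ y).
  apply: le_Rintegral => //; [exact: intg_norm (mc y).1|exact: (intgZ `|M| (ri y))|].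
  move=> x _; rewrite normrM mulrC (ger0_norm (rho0 _)); apply: ler_wpM2r => //.
  by apply: le_trans (HM _) (ler_norm _).
have uk := intg_mulb ui mk kM.
have uth := intg_mulb ui mth HM.
have -> : \int[mu]_x (convol u rho x * theta x) = \int[mu]_y (u y * k y).
  apply: Rint_eqE; rewrite -(EFin_Rint uk).
  have := Fubini iF; under eq_integral do rewrite E1; move=> ->.
  by apply: eq_integral => y _; rewrite E2.
rewrite -RintegralB//.
have -> : \int[mu]_x (u x * k x - u x * theta x) = \int[mu]_x (u x * (k x - theta x)).
  by apply: Rint_ext => x; rewrite mulrBr.
apply: (Rintegral_norm_le ui); first exact: measurable_funB.
by move=> y; case: (mc y).
Qed.

Section lp.
Variables (p : R) (p1 : 1 < p).
Let p0 : 0 < p. Proof. exact: lt_trans p1. Qed.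

(** The difference [phi - phi * rho] is the [rho]-average of [phi x - phi (x - z)] over [z]; use
    Jensen, then Tonelli, and each [z] with [|z| <= r] contributes at most [c^p]. *)
Lemma conv_close r r' rho phi (c : R) : mollifier r rho -> smooth_cs r' phi -> 0 <= c ->
  (forall z, `|z| <= r -> (lpn mu p (fun x => phi x - phi (x - z)%R)%R <= c%:E)%E) ->
  (lpn mu p (fun x => phi x - convol phi rho x)%R <= c%:E)%E.
Proof.
move=> [r0 sr rho0 rho1] sp c0 H.
have pi := smooth_cs_intg sp; have ri := smooth_cs_intg sr.
have [M M0 HM] := smooth_cs_bounded sp.
have cp := smooth_continuous sp.1.
have mphi := smooth_measurable sp.1.
have mk : measurable_fun setT (fun z : E * E => phi z.1 - phi (z.1 - z.2)).
  exact: (measurable_funB (measurableT_comp mphi measurable_fst) (measurable_kernel2 cp)).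
pose F (z : E * E) : \bar R := (`|phi z.1 - phi (z.1 - z.2)| `^ p * rho z.2)%:E.
have mF : measurable_fun setT F.
  apply/measurable_EFinP; apply: measurable_funM.
    by apply/measurable_EFinP; exact: measurable_normpow.
  exact: (measurableT_comp (intg_measurable ri) measurable_snd).
have F0 z : (0 <= F z)%E by rewrite lee_fin mulr_ge0// powR_ge0.
have md (x : E) : measurable_fun setT (fun z : E => phi x - phi (x - z)).
  exact: (measurable_funB (measurable_cst _) (kernel_measurable x sp)).
have di x : intg (fun z => (phi x - phi (x - z)) * rho z).
  rewrite (_ : (fun z => _) = (fun z => rho z * (phi x - phi (x - z)))); last by apply/funext => z; rewrite mulrC.
  apply: (intg_mulb ri (md x) (M := M + M)) => z.
  by apply: le_trans (ler_normB _ _) _; apply: lerD.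
rewrite lpn_leP//; apply: (@le_trans _ _ (\int[mu]_x \int[mu]_z F (x, z))%E).
  apply: ge0_le_integral; first exact: measurableT.
  - by move=> x _; rewrite lee_fin powR_ge0.
  - apply: measurable_normpow; apply: (measurable_funB mphi).
    by apply: continuous_rV_measurable; exact: conv_continuous pi sr.
  - exact: (measurable_fun_fubini_tonelli_F F mF F0).
  move=> x _.
  have -> : phi x - convol phi rho x = \int[mu]_z ((phi x - phi (x - z)) * rho z).
    have i1 := intgZ (phi x) ri.
    have i2 : intg (fun z => phi (x - z) * rho z).
      rewrite (_ : (fun z => _) = (fun z => rho z * phi (x - z))); last by apply/funext => z; rewrite mulrC.
      exact: (intg_mulb ri (kernel_measurable x sp) (M := M)).
    rewrite (Rint_ext (g := fun z => phi x * rho z - phi (x - z) * rho z)); last by move=> z; rewrite mulrBl.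
    rewrite RintegralB// RintegralZl// rho1 mulr1; congr (_ - _).
    rewrite -(Rintegral_reflect x i2); apply: Rint_ext => z.
    by rewrite subKr.
  exact: jensen_weight.
rewrite (fubini_tonelli F mF F0).
apply: (@le_trans _ _ (\int[mu]_z ((c `^ p) * rho z)%:E)%E); last first.
  by rewrite EFin_Rint ?RintegralZl ?rho1 ?mulr1//; exact: intgZ.
apply: ge0_le_integral; first exact: measurableT.
- by move=> z _; exact: integral_ge0.
- exact: (measurable_fun_fubini_tonelli_G F mF F0).
- apply/measurable_EFinP; apply: measurable_funM => //; exact: intg_measurable ri.
move=> z _; have [zr|zr] := leP `|z| r; last first.
  rewrite /F /= (sr.2 _ zr); under eq_integral do rewrite mulr0.
  by rewrite integral0 mulr0.
rewrite /F /=; under eq_integral do rewrite mulrC EFinM.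
have mz : measurable_fun setT (fun x => phi x - phi (x - z)).
  by apply: (measurable_funB mphi); exact: intg_measurable (intg_shift (- z) pi).
rewrite ge0_integralZl; [|exact: measurableT|exact: measurable_normpow| |by rewrite lee_fin]; last first.
  by move=> x _; rewrite lee_fin powR_ge0.
rewrite muleC EFinM; apply: lee_wpmul2r; first by rewrite lee_fin.
by have := H z zr; rewrite lpn_leP.
Qed.

Lemma normr_le_powR (t : R) : `|t| <= 1 + `|t| `^ p.
Proof.
have [h|h] := leP `|t| 1; first by rewrite ler_wpDr// powR_ge0.
rewrite -[leLHS](powRr1 (normr_ge0 t)) ler_wpDl// ler_powR//; exact: ltW.
Qed.

Lemma lpn_fin f : (lpn mu p f < +oo)%E -> exists2 c, 0 <= c & (lpn mu p f = c%:E)%E.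
Proof.
move=> h; exists (fine (lpn mu p f)); first by rewrite fine_ge0// lpn_ge0.
by rewrite fineK// ge0_fin_numE// lpn_ge0.
Qed.

Lemma lpn_intg_pow f : measurable_fun setT f -> (lpn mu p f < +oo)%E -> intg (fun x => `|f x| `^ p).
Proof.
move=> mf h; apply/integrableP; split; first exact: measurable_normpow.
move: h; rewrite (lpn_lty _ p1); under [X in _ -> (X < _)%E]eq_integral do rewrite /= ger0_norm ?powR_ge0//.
exact.
Qed.

Lemma lpn_integrable_on (A : set E) f : measurable A -> (mu A < +oo)%E ->
  measurable_fun setT f -> (lpn mu p f < +oo)%E -> mu.-integrable A (EFin \o f).
Proof.
move=> mA Aoo mf lf.
have i1 : mu.-integrable A (EFin \o cst (1 : R)).
  apply/integrableP; split; first exact/measurable_EFinP/measurable_cst.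
  by rewrite (eq_integral (cst 1%E)) => [|x _ /=]; rewrite ?integral_cst ?mul1e ?normr1.
have i2 : mu.-integrable A (EFin \o (fun x => `|f x| `^ p)).
  by apply: (integrableS measurableT) => //; exact: lpn_intg_pow.
apply: (le_integrable mA _ _ (integrableD mA i1 i2)).
  by apply/measurable_EFinP; exact: measurable_funTS.
move=> x _ /=; rewrite lee_fin; apply: le_trans (normr_le_powR _) _.
exact: ler_norm.
Qed.

Lemma lpn_mul_smooth r f g : smooth_cs r g -> measurable_fun setT f -> (lpn mu p f < +oo)%E ->
  intg (fun x => f x * g x).
Proof.
move=> sg mf lf; have [M M0 HM] := smooth_cs_bounded sg.
have cK := @ball_closed_compact R n r.
have mK := compact_rV_measurable cK.
have fi : intg (f \_ [set x : E | `|x| <= r]).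
  rewrite /intg -restrict_EFin; apply/(integrable_mkcond _ mK).
  by apply: lpn_integrable_on => //; exact: compact_lebesgue_lty.
have -> : (fun x => f x * g x) = (fun x => (f \_ [set x : E | `|x| <= r]) x * g x).
  apply/funext => x; rewrite patchE; case: ifPn => // /negP h.
  rewrite sg.2 ?mulr0 // ltNge; apply/negP => h'; apply: h; exact/mem_set.
exact: (intg_mulb fi (smooth_measurable sg.1) HM).
Qed.

(** Hölder, with [C] the norm of [g] for the conjugate exponent: pairing with a fixed test function
    is continuous in L^p. *)
Lemma lpn_test_small r g : smooth_cs r g -> exists2 C, 0 <= C & forall f (c : R),
  measurable_fun setT f -> 0 <= c -> (lpn mu p f <= c%:E)%E ->
  `|\int[mu]_x (f x * g x)| <= C * c.
Proof.
move=> sg; pose q := p / (p - 1).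
have q0 : 0 < q by rewrite divr_gt0// subr_gt0.
have pq : p^-1 + q^-1 = 1 by rewrite /q; field; rewrite ?subr_eq0 ?gt_eqF.
have q1 : 1 < q by rewrite /q ltr_pdivlMr ?subr_gt0// mul1r ltrBlDr ltrDl.
have mg := smooth_measurable sg.1.
have [M M0 HM] := smooth_cs_bounded sg.
have gq : (lpn mu q g < +oo)%E.
  rewrite (lpn_lty _ q1).
  have : intg (fun x => `|g x| `^ q).
    apply: (@intg_vanish _ _ r (M `^ q)).
    - by apply/measurable_EFinP; exact: measurable_normpow.
    - by move=> x; rewrite ger0_norm ?powR_ge0// le_powR2// ltW.
    - by move=> x rx; rewrite sg.2// normr0 powR0// gt_eqF.
  move=> /integrableP[_]; apply: le_lt_trans; apply: ereal_eqW; apply: eq_integral => x _ /=.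
  by rewrite (ger0_norm (powR_ge0 _ _)).
exists (fine (lpn mu q g)); first by rewrite fine_ge0// lpn_ge0.
move=> f c mf c0 fc.
have fg := lpn_mul_smooth sg mf (le_lt_trans fc (ltry _)).
have Hc : (`|\int[mu]_x (f x * g x)|%:E <= lpn mu p f * lpn mu q g)%E.
  apply: le_trans (hoelder mu mf mg p0 q0 pq); rewrite Lnorm1 EFin_normr_Rintegral//.
  exact: (le_abse_integral mu measurableT (measurable_int _ fg)).
rewrite -lee_fin; apply: (le_trans Hc); rewrite EFinM fineK ?ge0_fin_numE ?lpn_ge0// muleC; apply: lee_wpmul2l => //.
exact: lpn_ge0.
Qed.

End lp.
End mollified.

(** * Weak gradients and the closure of C_c^oo *)

Section weak_gradient.
Context {R : realType} {n : nat}.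
Local Notation E := 'rV[R]_n.
Local Notation mu := (@lebesgue_rV R n).
Implicit Types (U : set E) (u v f g phi : E -> R) (G H : E -> E).

Lemma Rint_Cc U g phi : Cc_smooth U phi ->
  \int[mu]_(x in U) (g x * phi x) = \int[mu]_x (g x * phi x).
Proof.
move=> [_ _ sU]; rewrite Rintegral_mkcond; apply: Rint_ext => x; rewrite patchE.
case: ifPn => // /negP nU; rewrite (supp_eq0 sU) ?mulr0// => Ux.
by apply: nU; exact/mem_set.
Qed.

Lemma loc_integrable_lin U (c : R) f g : loc_integrable U f -> loc_integrable U g ->
  loc_integrable U (fun x => f x + c * g x).
Proof.
move=> [mf lf] [mg lg]; split.
  exact: (measurable_funD mf (measurable_funM (measurable_cst c) mg)).
move=> K cK KU; have mK := compact_rV_measurable cK.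
exact: (integrableD mK (lf K cK KU) (integrableZl mK c (lg K cK KU))).
Qed.

Lemma weak_grad_lin U (c : R) u v G H : open U -> is_weak_grad U u G -> is_weak_grad U v H ->
  is_weak_grad U (fun x => u x + c * v x) (fun x => G x + c *: H x).
Proof.
move=> oU [lu lG uG] [lv lH vH].
have coE i : (fun x => (G x + c *: H x) 0 i) = (fun x => G x 0 i + c * H x 0 i).
  by apply/funext => x; rewrite !mxE.
split; first exact: loc_integrable_lin.
  by move=> i; rewrite coE; exact: loc_integrable_lin.
move=> phi Cphi i; have Cpi := Cc_smooth_partial i Cphi.
have a1 := Lp_mul_Cc oU lu Cpi; have a2 := Lp_mul_Cc oU lv Cpi.
have b1 := Lp_mul_Cc oU (lG i) Cphi; have b2 := Lp_mul_Cc oU (lH i) Cphi.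
have := uG phi Cphi i; have := vH phi Cphi i.
rewrite !(Rint_Cc _ Cphi) !(Rint_Cc _ Cpi) => e2 e1.
rewrite (Rint_ext (g := fun x => u x * partial i phi x + c * (v x * partial i phi x))); last first.
  by move=> x; rewrite mulrDl mulrA.
rewrite RintegralD//; last exact: (intgZ c a2).
rewrite RintegralZl// e1 e2.
rewrite [in RHS](Rint_ext (g := fun x => G x 0 i * phi x + c * (H x 0 i * phi x))); last first.
  by move=> x; rewrite !mxE mulrDl mulrA.
rewrite RintegralD//; last exact: (intgZ c b2).
by rewrite RintegralZl// opprD mulrN.
Qed.

Lemma weak_gradD U u v G H : open U -> is_weak_grad U u G -> is_weak_grad U v H ->
  is_weak_grad U (u \+ v) (fun x => G x + H x).
Proof.
move=> oU uG vH; have := weak_grad_lin 1 oU uG vH.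
by under eq_fun do rewrite mul1r; under [X in is_weak_grad U _ X]eq_fun do rewrite scale1r.
Qed.

Lemma weak_gradB U u v G H : open U -> is_weak_grad U u G -> is_weak_grad U v H ->
  is_weak_grad U (u \- v) (fun x => G x - H x).
Proof.
move=> oU uG vH; have := weak_grad_lin (- 1) oU uG vH.
by under eq_fun do rewrite mulN1r; under [X in is_weak_grad U _ X]eq_fun do rewrite scaleN1r.
Qed.

Lemma weak_grad_uniq U u G H : open U -> is_weak_grad U u G -> is_weak_grad U u H ->
  {ae mu, forall x, U x -> G x = H x}.
Proof.
move=> oU uG uH; have [_ lGH gh] := weak_gradB oU uG uH.
have : forall i, {ae mu, forall x, U x -> (G x - H x) 0 i = 0}.
  move=> i; apply: (fundamental_lemma oU (lGH i)) => phi Cphi.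
  have := gh phi Cphi i; have Cpi := Cc_smooth_partial i Cphi.
  rewrite (Rint_Cc _ Cpi) (Rint_ext (g := fun=> 0)) ?Rintegral_cst ?mul0r//; last first.
    by move=> x /=; rewrite subrr mul0r.
  by move=> /eqP; rewrite eq_sym oppr_eq0 => /eqP.
move=> h.
have : {ae mu, forall x, forall i : 'I_n, U x -> (G x - H x) 0 i = 0}.
  exact: filter_forall.
apply: filterS => x hx Ux; apply/rowP => i; have := hx i Ux.
by rewrite !mxE => /eqP; rewrite subr_eq0 => /eqP.
Qed.

(** [wgrad] is a choice among weak gradients; it is accessible only through this lemma and
    uniqueness almost everywhere. *)
Lemma wgradP U u G : is_weak_grad U u G -> is_weak_grad U u (wgrad U u).
Proof. by move=> uG; apply: (xgetPex (fun=> 0) (P := [set G | is_weak_grad U u G])); exists G. Qed.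

Lemma wgrad_ae U u G : open U -> is_weak_grad U u G -> {ae mu, forall x, U x -> wgrad U u x = G x}.
Proof. by move=> oU uG; apply: weak_grad_uniq oU (wgradP uG) uG. Qed.

Lemma weak_grad_ae U u v G H : measurable U -> is_weak_grad U u G ->
  measurable_fun U v -> (forall i, measurable_fun U (fun x => H x 0 i)) ->
  {ae mu, forall x, U x -> u x = v x} -> {ae mu, forall x, U x -> G x = H x} ->
  is_weak_grad U v H.
Proof.
move=> mU [[mu_ lu] lG uG] mv mH uv GH.
have aeK (K : set E) (f g : E -> R) : measurable K -> K `<=` U -> measurable_fun U g ->
    {ae mu, forall x, U x -> f x = g x} ->
    mu.-integrable K (EFin \o f) -> mu.-integrable K (EFin \o g).
  move=> mK KU mg fg fi.
  have mgK : measurable_fun K (EFin \o g).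
    by apply/measurable_EFinP; exact: measurable_funS KU mg.
  apply/integrableP; split => //; have/integrableP[mf] := fi.
  apply: le_lt_trans; apply: ereal_eqW; apply: ae_eq_integral.
  - exact: mK.
  - by apply: (measurableT_comp _ mgK).
  - by apply: (measurableT_comp _ mf).
  - by apply: filterS fg => x h Kx /=; rewrite h//; exact: KU.
have aeI (f g phi : E -> R) : measurable_fun U f -> measurable_fun U g -> smooth phi ->
   {ae mu, forall x, U x -> f x = g x} ->
   \int[mu]_(x in U) (f x * phi x) = \int[mu]_(x in U) (g x * phi x).
  move=> mf mg sphi fg; congr fine.
  have mphi : measurable_fun U phi := measurable_funTS (smooth_measurable sphi).
  apply: ae_eq_integral.
  - exact: mU.
  - exact/measurable_EFinP/(measurable_funM mf mphi).
  - exact/measurable_EFinP/(measurable_funM mg mphi).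
  - by apply: filterS fg => x h Ux /=; rewrite h.
have GHi i : {ae mu, forall x, U x -> G x 0 i = H x 0 i} by apply: filterS GH => x h /h ->.
split.
- split => // K cK KU; apply: (aeK K u) => //; [exact: compact_rV_measurable|exact: lu].
- move=> i; split => // K cK KU; apply: (aeK K (fun x => G x 0 i)) => //; first exact: compact_rV_measurable.
  by have [_] := lG i; apply.
- move=> phi Cphi i; have [sphi _ _] := Cphi.
  rewrite -(aeI _ _ _ mu_ mv (smooth_partial i sphi) uv) uG//; congr (- _).
  by apply: (aeI _ _ _ (lG i).1 (mH i) sphi (GHi i)).
Qed.

Lemma weak_grad_smooth U phi : Cc_smooth U phi -> is_weak_grad U phi (grad phi).
Proof.
move=> Cphi; have [r _ sr] := Cc_smoothP Cphi.
have lo r' g : smooth_cs r' g -> loc_integrable U g.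
  move=> sg; split; first by apply: measurable_funTS; exact: smooth_measurable sg.1.
  move=> K cK KU; apply: (integrableS measurableT) => //; first exact: compact_rV_measurable.
  exact: (smooth_cs_intg sg).
split; first exact: lo sr.
  move=> i; under eq_fun do rewrite grad_coord.
  exact: lo (smooth_cs_partial i sr).
move=> psi Cpsi i; have [s _ ss] := Cc_smoothP Cpsi.
rewrite (Rint_Cc _ Cpsi) (Rint_Cc _ (Cc_smooth_partial i Cpsi)) (integration_by_parts_smooth _ sr.1 ss).
by congr (- _); apply: Rint_ext => x; rewrite grad_coord.
Qed.

Lemma LpP U p u : 1 < p -> Lp U p u <-> measurable_fun setT (u \_ U) /\ (lpn mu p (u \_ U) < +oo)%E.
Proof.
move=> p1; rewrite /Lp inE; split.
  by move=> /andP[]; rewrite !inE /= /finite_norm.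
by move=> [h1 h2]; apply/andP; rewrite !inE.
Qed.

End weak_gradient.

(** * Limits of test functions, as pairs on the whole space, and their identification with [W1p0] *)

Section H0.
Context {R : realType} {n : nat}.
Local Notation E := 'rV[R]_n.
Local Notation mu := (@lebesgue_rV R n).
Variables (Om : set E) (oOm : open Om) (p : R) (p1 : 1 < p).
Implicit Types (u v f g phi : E -> R) (G H : E -> E).
Local Notation lp := (lpn mu p).
Local Notation vp := (vlpn mu p).

Let p0 : 0 < p. Proof. exact: lt_trans p1. Qed.
Let mOm : measurable Om. Proof. exact: open_rV_measurable. Qed.

(* The pairs (u, grad u) with u in W_0^{1,p}(Om) extended by 0, up to null sets. *)
Definition H0 u G := [/\ measurable_fun setT u, mfield G & forall e : R, 0 < e ->
  exists2 phi, Cc_smooth Om phi & (lp (fun x => u x - phi x)%R <= e%:E)%E /\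
    (vp (fun x => G x - grad phi x)%R <= e%:E)%E].

Lemma mfield_grad phi : smooth phi -> mfield (grad phi).
Proof.
by move=> sp i; under eq_fun do rewrite grad_coord; exact: smooth_measurable (smooth_partial i sp).
Qed.

Lemma Cc_measurable phi : Cc_smooth Om phi -> measurable_fun setT phi.
Proof. by case=> sp _ _; exact: smooth_measurable. Qed.

Lemma Cc_mgrad phi : Cc_smooth Om phi -> mfield (grad phi).
Proof. by case=> sp _ _; exact: mfield_grad. Qed.

Lemma smooth_cs_lpn r g : smooth_cs r g -> (lp g < +oo)%E.
Proof.
move=> sg; have mg := smooth_measurable sg.1.
have [M M0 HM] := smooth_cs_bounded sg.
rewrite (lpn_lty _ p1).
have : intg (fun x => `|g x| `^ p).
  apply: (@intg_vanish _ _ r (M `^ p)).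
  - by apply/measurable_EFinP; exact: measurable_normpow.
  - by move=> x; rewrite ger0_norm ?powR_ge0// le_powR2// ltW.
  - by move=> x rx; rewrite sg.2// normr0 powR0// gt_eqF.
move=> /integrableP[_]; apply: le_lt_trans; apply: ereal_eqW; apply: eq_integral => x _ /=.
by rewrite (ger0_norm (powR_ge0 _ _)).
Qed.

Lemma vlpn_lty G : mfield G -> (forall i, (lp (fun x => (G x 0 i)%R) < +oo)%E) -> (vp G < +oo)%E.
Proof.
move=> mG H; apply: le_lt_trans (vlpn_le_sum _ p1 mG) _.
by apply: lte_sum_pinfty => i _; exact: H.
Qed.

Lemma Cc_grad_lty phi : Cc_smooth Om phi -> (vp (grad phi) < +oo)%E.
Proof.
move=> Cp; apply: vlpn_lty; first exact: Cc_mgrad.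
move=> i; have [r _ sr] := Cc_smoothP Cp; under eq_fun do rewrite grad_coord.
exact: smooth_cs_lpn (smooth_cs_partial i sr).
Qed.

Lemma vlpn_fin G : (vp G < +oo)%E -> exists2 c, 0 <= c & (vp G = c%:E)%E.
Proof. exact: lpn_fin. Qed.

Lemma H0_smooth phi : Cc_smooth Om phi -> H0 phi (grad phi).
Proof.
move=> Cp; split; [exact: Cc_measurable|exact: Cc_mgrad|].
move=> e e0; exists phi => //; split.
  rewrite (eq_lpn mu p (g := fun=> 0)) ?lpn0 ?lee_fin ?ltW//.
  by move=> x; rewrite subrr.
rewrite /vlpn (eq_lpn mu p (g := fun=> 0)) ?lpn0 ?lee_fin ?ltW//.
by move=> x; rewrite subrr enorm0.
Qed.

Lemma H0_lin c u v G H : H0 u G -> H0 v H -> H0 (fun x => u x + c * v x) (fun x => G x + c *: H x).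
Proof.
move=> [mu_ mG uG] [mv mH vH]; split.
- exact: (measurable_funD mu_ (measurable_funM (measurable_cst c) mv)).
- exact: (mfieldD mG (mfieldcZ c mH)).
move=> e e0; have e2 : 0 < e / 2 by lra.
have c0 : 0 < `|c| + 1 by rewrite ltr_wpDl.
have [phi Cphi [a1 a2]] := uG _ e2.
have [psi Cpsi [b1 b2]] := vH (e / 2 / (`|c| + 1)) (divr_gt0 e2 c0).
have ce : `|c| * (e / 2 / (`|c| + 1)) <= e / 2.
  rewrite mulrA ler_pdivrMr// mulrC; apply: ler_wpM2l; first exact: ltW.
  by rewrite lerDl.
have [sphi _ _] := Cphi; have [spsi _ _] := Cpsi.
have mphi := smooth_measurable sphi; have mpsi := smooth_measurable spsi.
exists (phi + cst c * psi); first exact: (Cc_smoothD Cphi (Cc_smoothZ c Cpsi)).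
have comb (x y : \bar R) (a : R) : (x <= (e / 2)%:E)%E -> (y <= a%:E)%E -> `|c| * a <= e / 2 -> (x + `|c|%:E * y <= e%:E)%E.
  move=> xe ya ca; rewrite (_ : e%:E = (e / 2)%:E + (e / 2)%:E)%E; last by rewrite -EFinD; congr EFin; lra.
  apply: leeD => //; apply: le_trans (_ : `|c|%:E * a%:E <= _)%E; last by rewrite -EFinM lee_fin.
  by apply: lee_wpmul2l.
split.
  rewrite (eq_lpn mu p (g := fun x => (u x - phi x) + c * (v x - psi x))); last first.
    by move=> x; rewrite -[(phi + cst c * psi) x]/(phi x + c * psi x) mulrBr opprD addrACA.
  have m1 := measurable_funB mu_ mphi; have m2 := measurable_funB mv mpsi.
  apply: le_trans (lpnD _ p1 m1 (measurable_funM (measurable_cst c) m2)) _.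
  by rewrite (lpnZ _ p1 _ m2); exact: comb b1 ce.
have m1 := mfieldB mG (mfield_grad sphi); have m2 := mfieldB mH (mfield_grad spsi).
rewrite /vlpn (eq_lpn mu p (g := fun x => enorm ((G x - grad phi x) + c *: (H x - grad psi x)))); last first.
  move=> x /=; rewrite gradD//; last exact: (smoothM (smooth_cst c) spsi).
  by rewrite gradZ// scalerBr opprD addrACA.
apply: le_trans (vlpnD _ p1 m1 (mfieldcZ c m2)) _.
by rewrite (vlpnZ _ p1 _ m2); exact: comb b2 ce.
Qed.

Lemma H0_closed u G : measurable_fun setT u -> mfield G ->
  (forall e : R, 0 < e -> exists v H, [/\ H0 v H, (lp (fun x => u x - v x)%R <= e%:E)%E &
     (vp (fun x => G x - H x)%R <= e%:E)%E]) -> H0 u G.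
Proof.
move=> mu_ mG uG; split => // e e0; have e2 : 0 < e / 2 by lra.
have [v [H [[mv mH vH] a1 a2]]] := uG _ e2.
have [phi Cphi [b1 b2]] := vH _ e2; have [sphi _ _] := Cphi.
have mphi := smooth_measurable sphi.
have eE : (e%:E = (e / 2)%:E + (e / 2)%:E)%E by rewrite -EFinD; congr EFin; lra.
exists phi => //; split; rewrite eE.
  rewrite (eq_lpn mu p (g := fun x => (u x - v x) + (v x - phi x))); last by move=> x; rewrite addrA subrK.
  by apply: le_trans (lpnD _ p1 (measurable_funB mu_ mv) (measurable_funB mv mphi)) _; exact: leeD.
rewrite /vlpn (eq_lpn mu p (g := fun x => enorm ((G x - H x) + (H x - grad phi x)))); last by move=> x; rewrite addrA subrK.
by apply: le_trans (vlpnD _ p1 (mfieldB mG mH) (mfieldB mH (mfield_grad sphi))) _; exact: leeD.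
Qed.

Lemma H0_ae u v G H : H0 u G -> measurable_fun setT v -> mfield H ->
  {ae mu, forall x, u x = v x} -> {ae mu, forall x, G x = H x} -> H0 v H.
Proof.
move=> [mu_ mG uG] mv mH uv GH; split => // e /uG[phi Cphi [a b]].
have mphi := Cc_measurable Cphi; have mgphi := Cc_mgrad Cphi.
exists phi => //; split.
  apply: le_trans a; apply: ereal_eqW; apply: (ae_eq_lpn p (measurable_funB mv mphi) (measurable_funB mu_ mphi)).
  by apply: filterS uv => x h /=; rewrite h.
apply: le_trans b; apply: ereal_eqW; apply: (ae_eq_vlpn p (mfieldB mH mgphi) (mfieldB mG mgphi)).
by apply: filterS GH => x h /=; rewrite h.
Qed.

Lemma H0_lty u G : H0 u G -> (lp u < +oo)%E /\ (vp G < +oo)%E.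
Proof.
move=> [mu_ mG uG]; have [phi Cphi [a b]] := uG 1 ltr01.
have mphi := Cc_measurable Cphi; have mgphi := Cc_mgrad Cphi.
have [r _ sr] := Cc_smoothP Cphi; split.
  rewrite (eq_lpn mu p (g := fun x => (u x - phi x) + phi x)); last by move=> x; rewrite subrK.
  apply: le_lt_trans (lpnD _ p1 (measurable_funB mu_ mphi) mphi) _.
  by rewrite lte_add_pinfty ?(smooth_cs_lpn sr)// (le_lt_trans a)// ltry.
rewrite /vlpn (eq_lpn mu p (g := fun x => enorm ((G x - grad phi x) + grad phi x))); last by move=> x; rewrite subrK.
apply: le_lt_trans (vlpnD _ p1 (mfieldB mG mgphi) mgphi) _.
by rewrite lte_add_pinfty ?Cc_grad_lty// (le_lt_trans b)// ltry.
Qed.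

Lemma lpn_eps f : (forall e : R, 0 < e -> (lp f <= e%:E)%E) -> lp f = 0%E.
Proof.
move=> H; apply/eqP; rewrite eq_le lpn_ge0 andbT; apply/lee_addgt0Pr => e e0.
by rewrite add0e; exact: H.
Qed.

(** Test functions and their gradients vanish outside [Om], so multiplying by the indicator of the
    complement leaves only the approximation error. *)
Lemma H0_out u G : H0 u G ->
  {ae mu, forall x, ~ Om x -> u x = 0} /\ {ae mu, forall x, ~ Om x -> G x = 0}.
Proof.
move=> [mu_ mG uG].
have mi : measurable_fun setT (\1_(~` Om) : E -> R) by apply: measurable_indic; exact: measurableC.
have in1 (x : E) : ~ Om x -> \1_(~` Om) x = 1 :> R by move=> nO; rewrite indicE mem_set.
have in0 (x : E) : Om x -> \1_(~` Om) x = 0 :> R by move=> Ox; rewrite indicE memNset// => /(_ Ox).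
have outE phi x : Cc_smooth Om phi -> ~ Om x -> phi x = 0 by move=> [_ _ sO] nO; exact: (supp_eq0 sO).
split.
  have m1 := measurable_funM mi mu_.
  have : lp (fun x => \1_(~` Om) x * u x) = 0%E.
    apply: lpn_eps => e /uG[phi Cphi [a _]]; apply: le_trans a.
    apply: (le_lpn _ p1 m1 (measurable_funB mu_ (Cc_measurable Cphi))) => x /=.
    case: (pselect (Om x)) => [/in0 ->|nO]; first by rewrite mul0r normr0.
    by rewrite in1// (outE _ _ Cphi nO) mul1r subr0.
  move=> /(lpn_eq0 p1 m1); apply: filterS => x h nO.
  by move: h; rewrite /= in1// mul1r.
have m1 := mfieldZ mi mG.
have : vp (fun x => \1_(~` Om) x *: G x) = 0%E.
  apply: lpn_eps => e /uG[phi Cphi [_ b]]; apply: le_trans b.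
  apply: (le_vlpn _ p1 m1 (mfieldB mG (Cc_mgrad Cphi))) => x.
  case: (pselect (Om x)) => [/in0 ->|nO]; first by rewrite scale0r enorm0 enorm_ge0.
  rewrite in1// scale1r (_ : grad phi x = 0) ?subr0//.
  apply/rowP => i; rewrite grad_coord mxE; exact: outE (Cc_smooth_partial i Cphi) nO.
move=> /(vlpn_eq0 p1 m1); apply: filterS => x h nO.
by move: h; rewrite /= in1// scale1r.
Qed.

Lemma norm_eps (t C : R) : (forall e : R, 0 < e -> `|t| <= C * e) -> t = 0.
Proof.
move=> H; apply/eqP; rewrite -normr_le0; apply/ler_addgt0Pl => e e0.
rewrite addr0; have C0 : 0 < `|C| + 1 by rewrite ltr_wpDl.
apply: le_trans (H (e / (`|C| + 1)) (divr_gt0 e0 C0)) _.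
rewrite mulrA ler_pdivrMr// mulrC; apply: ler_wpM2l; first exact: ltW.
by have := ler_norm C; lra.
Qed.

(** Integration by parts holds even if the support of [theta] leaves [Om]: it holds for the
    approximating test functions, which have compact support, and both sides are continuous in
    L^p. *)
Lemma H0_weak u G theta r i : H0 u G -> smooth_cs r theta ->
  \int[mu]_x (u x * partial i theta x) = - \int[mu]_x (G x 0 i * theta x).
Proof.
move=> uG sth; have [lu lG] := H0_lty uG; move: uG => [mu_ mG uG].
have spt := smooth_cs_partial i sth.
have [C1 C10 HC1] := lpn_test_small p1 spt; have [C2 C20 HC2] := lpn_test_small p1 sth.
apply/eqP; rewrite -subr_eq0 opprK; apply/eqP; apply: (@norm_eps _ (C1 + C2)) => e e0.
have [phi Cphi [a b]] := uG e e0; have [s _ ss] := Cc_smoothP Cphi.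
have mphi := Cc_measurable Cphi; have mgphi := Cc_mgrad Cphi.
have lphi := smooth_cs_lpn ss.
have lGi : (lp (fun x => (G x 0 i)%R) < +oo)%E by exact: le_lt_trans (lpn_coord_le _ p1 i mG) lG.
have lgi : (lp (fun x => (grad phi x 0 i)%R) < +oo)%E.
  exact: le_lt_trans (lpn_coord_le _ p1 i mgphi) (Cc_grad_lty Cphi).
have i1 := lpn_mul_smooth p1 spt mu_ lu; have i2 := lpn_mul_smooth p1 sth (mG i) lGi.
have i3 := lpn_mul_smooth p1 spt mphi lphi; have i4 := lpn_mul_smooth p1 sth (mgphi i) lgi.
have ibp : \int[mu]_x (phi x * partial i theta x) + \int[mu]_x (grad phi x 0 i * theta x) = 0.
  rewrite (integration_by_parts_smooth _ ss.1 sth) addrC; apply/eqP; rewrite subr_eq0; apply/eqP.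
  by apply: Rint_ext => x; rewrite grad_coord.
have -> : \int[mu]_x (u x * partial i theta x) + \int[mu]_x (G x 0 i * theta x) =
   \int[mu]_x ((u x - phi x) * partial i theta x) + \int[mu]_x ((G x - grad phi x) 0 i * theta x).
  rewrite (Rint_ext (f := fun x => (u x - phi x) * _) (g := fun x => u x * partial i theta x - phi x * partial i theta x)); last first.
    by move=> x; rewrite mulrBl.
  rewrite (Rint_ext (f := fun x => (G x - grad phi x) 0 i * _) (g := fun x => G x 0 i * theta x - grad phi x 0 i * theta x)); last first.
    by move=> x; rewrite !mxE mulrBl.
  rewrite !RintegralB// addrACA -opprD ibp subr0//.
apply: le_trans (ler_normD _ _) _; rewrite mulrDl; apply: lerD.
  exact: (HC1 _ _ (measurable_funB mu_ mphi) (ltW e0) a).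
have mB := mfieldB mG mgphi.
exact: (HC2 _ _ (mB i) (ltW e0) (le_trans (lpn_coord_le _ p1 i mB) b)).
Qed.

(** Extension by zero, which links functions with irrelevant values outside [Om] to the pairs of
    [H0], whose values count everywhere. *)
Definition cutf u : E -> R := u \_ Om.
Definition cutv G : E -> E := fun x => \1_Om x *: G x.

Lemma cutv_in G x : Om x -> cutv G x = G x.
Proof. by move=> Ox; rewrite /cutv indicE mem_set// scale1r. Qed.

Lemma cutv_out G x : ~ Om x -> cutv G x = 0.
Proof. by move=> Ox; rewrite /cutv indicE memNset// scale0r. Qed.

Lemma cutf_in u x : Om x -> cutf u x = u x.
Proof. by move=> Ox; rewrite /cutf patchE mem_set. Qed.

Lemma cutf_out u x : ~ Om x -> cutf u x = 0.
Proof. by move=> Ox; rewrite /cutf patchE memNset. Qed.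

Lemma cutv_coord G i : (fun x => cutv G x 0 i) = (fun x => G x 0 i) \_ Om.
Proof.
apply/funext => x; rewrite patchE; case: ifPn => [/set_mem/cutv_in -> //|/negP nO].
by rewrite cutv_out ?mxE// => /mem_set.
Qed.

Lemma mfield_cutv G : (forall i, measurable_fun Om (fun x => G x 0 i)) -> mfield (cutv G).
Proof. by move=> mG i; rewrite cutv_coord; apply/(measurable_restrictT _ mOm). Qed.

Lemma weak_grad_mfield u G : is_weak_grad Om u G -> mfield (cutv G).
Proof. by move=> [_ lG _]; apply: mfield_cutv => i; case: (lG i). Qed.

Lemma enorm_cut G : (enorm \o G) \_ Om = (fun x => enorm (cutv G x)).
Proof.
apply/funext => x; rewrite patchE; case: ifPn => [/set_mem/cutv_in -> //|/negP nO].
by rewrite cutv_out ?enorm0// => /mem_set.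
Qed.

Lemma W1p0_H0 u : W1p0 Om p u -> H0 (cutf u) (cutv (wgrad Om u)).
Proof.
move=> [[/(LpP _ _ p1)[mu_ lu] [G uG] _] H].
have uW := wgradP uG.
split; [exact: mu_|exact: weak_grad_mfield uW|].
move=> e /H[phi Cphi le]; exists phi => //; have [_ _ sO] := Cphi.
have W2 := weak_gradB oOm uW (weak_grad_smooth Cphi).
have W3 := wgradP W2.
split.
  apply/ltW; apply: le_lt_trans le; apply: le_trans (leeDl _ _); last exact: lpn_ge0.
  apply: ereal_eqW; apply: eq_lpn => x; case: (pselect (Om x)) => Ox.
    by rewrite (@cutf_in u)// patchE mem_set.
  by rewrite cutf_out// patchE memNset// (supp_eq0 sO Ox) subr0.
apply/ltW; apply: le_lt_trans le; apply: le_trans (leeDr _ _); last exact: lpn_ge0.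
apply: ereal_eqW.
have -> : 'N[mu]_(p%:E)[EFin \o (enorm \o wgrad Om (u \- phi)%R) \_ Om]%E = vp (cutv (wgrad Om (u \- phi)%R)).
  by rewrite enorm_cut.
apply: (ae_eq_vlpn p); [|exact: weak_grad_mfield W3|].
  exact: mfieldB (weak_grad_mfield uW) (Cc_mgrad Cphi).
apply: filterS (weak_grad_uniq oOm W2 W3) => x h.
case: (pselect (Om x)) => Ox; first by rewrite !cutv_in// -h.
rewrite !cutv_out// sub0r; apply/rowP => i; rewrite !mxE -[X in - X]/(partial i phi x).
have [_ _ sO'] := Cc_smooth_partial i Cphi.
by rewrite (supp_eq0 sO' Ox) oppr0.
Qed.

Lemma Lp_loc_integrable u : measurable_fun setT (cutf u) -> (lp (cutf u) < +oo)%E -> loc_integrable Om u.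
Proof.
move=> mu_ lu; split; first by apply/(measurable_restrictT _ mOm).
move=> K cK KO; have mK := compact_rV_measurable cK.
have := lpn_integrable_on p1 mK (compact_lebesgue_lty cK) mu_ lu.
by apply: eq_integrable => // x /set_mem /KO Ox; rewrite /= cutf_in.
Qed.

Lemma H0_weak_grad u G : H0 (cutf u) G -> is_weak_grad Om u G.
Proof.
move=> uG; have [lu lG] := H0_lty uG; have [mu_ mG _] := uG.
split; first exact: Lp_loc_integrable.
  move=> i; apply: Lp_loc_integrable; rewrite /cutf.
    by apply/(measurable_restrictT _ mOm); exact: measurable_funTS (mG i).
  apply: le_lt_trans lG; apply: le_trans (lpn_coord_le _ p1 i mG); apply: (le_lpn _ p1) => //.
    by apply/(measurable_restrictT _ mOm); exact: measurable_funTS (mG i).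
  by move=> x; rewrite patchE; case: ifP => // _; rewrite normr0.
move=> phi Cphi i; have [r _ sr] := Cc_smoothP Cphi.
rewrite (Rint_Cc _ Cphi) -(H0_weak i uG sr) (Rint_Cc _ (Cc_smooth_partial i Cphi)).
apply: Rint_ext => x; case: (pselect (Om x)) => Ox; first by rewrite cutf_in.
have [_ _ sO] := Cc_smooth_partial i Cphi.
by rewrite (supp_eq0 sO Ox) !mulr0.
Qed.

(** The converse of [W1p0_H0]. The field [G] need not be the chosen [wgrad Om u], but both vanish or
    agree almost everywhere, so the norms coincide. *)
Lemma H0_W1p0 u G : H0 (cutf u) G -> W1p0 Om p u.
Proof.
move=> uG; have W := H0_weak_grad uG; have W' := wgradP W.
have [lu lG] := H0_lty uG; have [mu_ mG HuG] := uG.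
have GW : {ae mu, forall x, G x = cutv (wgrad Om u) x}.
  have [_ Gout] := H0_out uG.
  apply: filterS2 Gout (weak_grad_uniq oOm W W') => x h1 h2.
  by case: (pselect (Om x)) => Ox; [rewrite cutv_in// h2|rewrite cutv_out// h1].
have mW := weak_grad_mfield W'.
have lW : (vp (cutv (wgrad Om u)) < +oo)%E by rewrite -(ae_eq_vlpn p mG mW GW).
split.
  split; [exact/(LpP _ _ p1)|by exists G|].
  move=> i; apply/(LpP _ _ p1); rewrite -cutv_coord; split; first exact: mW.
  exact: le_lt_trans (lpn_coord_le _ p1 i mW) lW.
(* Two errors of [e / 3] leave room for the strict inequality in [W1p0]. *)
move=> e e0; have e3 : 0 < e / 3 by lra.
have [phi Cphi [a b]] := HuG _ e3; exists phi => //; have [_ _ sO] := Cphi.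
have W2 := weak_gradB oOm W (weak_grad_smooth Cphi).
have W3 := wgradP W2.
apply: (@le_lt_trans _ _ ((e / 3)%:E + (e / 3)%:E)%E); last by rewrite -EFinD lte_fin; lra.
apply: leeD.
  apply: le_trans a; apply: ereal_eqW; apply: eq_lpn => x; case: (pselect (Om x)) => Ox.
    by rewrite (@cutf_in u)// patchE mem_set.
  by rewrite cutf_out// patchE memNset// (supp_eq0 sO Ox) subr0.
apply: le_trans b; rewrite enorm_cut.
apply: ereal_eqW; apply: (ae_eq_vlpn p); [exact: weak_grad_mfield W3| |].
  exact: mfieldB mG (Cc_mgrad Cphi).
have [_ Gout] := H0_out uG.
apply: filterS2 Gout (weak_grad_uniq oOm W2 W3) => x h1 h2.
case: (pselect (Om x)) => Ox; first by rewrite !cutv_in// -h2.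
rewrite !cutv_out// h1// sub0r; apply/rowP => i; rewrite !mxE -[X in - X]/(partial i phi x).
have [_ _ sO'] := Cc_smooth_partial i Cphi.
by rewrite (supp_eq0 sO' Ox) oppr0.
Qed.

End H0.

(** * The inequality of Poincare and the theorem of Rellich *)

Section translation.
Context {R : realType} {n : nat}.
Local Notation E := 'rV[R]_n.
Local Notation mu := (@lebesgue_rV R n).
Variables (p : R) (p1 : 1 < p).
Implicit Types (u v f g phi : E -> R) (G H : E -> E).
Local Notation lp := (lpn mu p).
Local Notation vp := (vlpn mu p).

Let p0 : 0 < p. Proof. exact: lt_trans p1. Qed.

Lemma measurable_shift f (y : E) : measurable_fun setT f -> measurable_fun setT (fun x : E => f (x + y)).
Proof. by move=> mf; apply: (measurableT_comp mf); case: (mu_invariant_shift y). Qed.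

Lemma lpn_shift f y : measurable_fun setT f -> lp (fun x => f (x + y)) = lp f.
Proof.
move=> mf; apply: eq_lpn_int.
exact: (ge0_integral_invariant (mu_invariant_shift y) (measurable_normpow p mf) (fun x => powR_ge0 _ _)).
Qed.

(** The constant is the L^p norm of the indicator of the ball of radius [r]. *)
Lemma lpn_vanish_bound r : exists2 c, 0 <= c & forall f (M : R), measurable_fun setT f ->
  vanish_out r f -> 0 <= M -> (forall x, `|f x| <= M) -> (lp f <= (M * c)%:E)%E.
Proof.
have cK := @ball_closed_compact R n r; have mK := compact_rV_measurable cK.
pose k : E -> R := \1_[set x : E | `|x| <= r].
have mk : measurable_fun setT k by exact: measurable_indic.
have k_in x : `|x| <= r -> k x = 1 by move=> h; rewrite /k indicE mem_set.
have k_ge0 x : 0 <= k x by rewrite /k indicE.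
have k_le1 x : k x <= 1 by rewrite /k indicE; case: (_ \in _).
have klt : (lp k < +oo)%E.
  rewrite (lpn_lty _ p1); apply: (@le_lt_trans _ _ (\int[mu]_(x in [set x : E | (`|x| <= r)%R]) 1)%E); last first.
    by rewrite integral_cst// mul1e; exact: compact_lebesgue_lty.
  rewrite [leRHS]integral_mkcond; apply: ereal_eqW; apply: eq_integral => x _.
  rewrite patchE /k indicE; case: ifPn => h.
    by rewrite normr1 powR1.
  by rewrite normr0 powR0// gt_eqF.
have [c c0 kc] := lpn_fin klt.
exists c => // f M mf vf M0 fM.
have mMk := measurable_funM (measurable_cst M) mk.
apply: (@le_trans _ _ (lp (fun x => M * k x))).
  apply: (le_lpn _ p1 mf mMk) => x; rewrite [leRHS]ger0_norm; last exact: mulr_ge0.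
  have [xr|xr] := leP `|x| r; first by rewrite /= k_in// mulr1.
  by rewrite vf// normr0 mulr_ge0.
by rewrite (lpnZ _ p1 _ mk) kc ger0_norm.
Qed.

Lemma lee_eps_scale (x : \bar R) (a C : R) : 0 <= C ->
  (forall e : R, 0 < e -> (x <= (a + C * e)%:E)%E) -> (x <= a%:E)%E.
Proof.
move=> C0 H; apply/lee_addgt0Pr => e e0.
have C1 : 0 < C + 1 by rewrite ltr_wpDl.
apply: le_trans (H (e / (C + 1)) (divr_gt0 e0 C1)) _.
rewrite -EFinD lee_fin lerD2l mulrA ler_pdivrMr// mulrC; apply: ler_wpM2l; first exact: ltW.
by rewrite lerDl.
Qed.

Lemma lpn_dotv_le y G : mfield G -> (lp (fun x => dotv y (G x)) <= (enorm y)%:E * vp G)%E.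
Proof.
move=> mG; have me := mfield_enorm mG.
rewrite /vlpn -[X in (X%:E * _)%E](ger0_norm (enorm_ge0 y)) -(lpnZ _ p1 _ me).
apply: (le_lpn _ p1); last by move=> x; rewrite [leRHS]ger0_norm ?norm_dotv// mulr_ge0 ?enorm_ge0.
  by apply: measurable_dotv => // i; exact: measurable_cst.
exact: (measurable_funM (measurable_cst _) me).
Qed.

(** Cut the translation by [y] into [N + 1] steps [h *: y]. Each increment is [h] times the
    directional derivative up to [O(h^2)] in norm, and all translates of an increment have the same
    norm; summing leaves an error [O(h)]. *)
Lemma lpn_translate_le r phi y : smooth_cs r phi ->
  (lp (fun x => phi (x + y) - phi x)%R <= lp (fun x => dotv y (grad phi x)))%E.
Proof.
move=> sp; have [C C0 HC] := smooth_cs_taylor sp.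
have mphi := smooth_measurable sp.1.
have mg : mfield (grad phi) := mfield_grad sp.1.
pose D x := dotv y (grad phi x).
have DE x : D x = \sum_i y 0 i * partial i phi x.
  by apply: eq_bigr => i _; rewrite grad_coord.
have mD : measurable_fun setT D by apply: measurable_dotv => //; move=> i; exact: measurable_cst.
have vD : vanish_out r D.
  by move=> x xr; rewrite DE big1// => i _; rewrite (partial_vanish i sp.2 xr) mulr0.
(* The radius [r + |y|] contains the support of every translate by [h *: y] with [h <= 1]. *)
have [K K0 HK] := lpn_vanish_bound (r + `|y|).
have Dfin : (lp D < +oo)%E.
  apply: le_lt_trans (lpn_dotv_le y mg) _; apply: lte_mul_pinfty; rewrite ?lee_fin ?enorm_ge0//.
  apply: (vlpn_lty p1 mg) => i; under eq_fun do rewrite grad_coord.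
  exact: (smooth_cs_lpn p1 (smooth_cs_partial i sp)).
have [d d0 dE] := lpn_fin Dfin.
rewrite [X in (_ <= X)%E]dE; apply: (lee_eps_scale (C := C * `|y| ^+ 2 * K)).
  by rewrite !mulr_ge0.
move=> e e0; have [N Ne] := exists_invn_lt e0.
pose h : R := N.+1%:R^-1.
have h0 : 0 < h by rewrite invr_gt0.
have h1 : h <= 1 by rewrite invf_le1// ler1n.
have hN : N.+1%:R * h = 1 by rewrite divff.
pose Q x := phi (x + h *: y) - phi x.
have mQ : measurable_fun setT Q by exact: (measurable_funB (measurable_shift _ mphi) mphi).
have tele x : phi (x + y) - phi x = \sum_(k < N.+1) Q (x + (k%:R * h) *: y).
  have -> : \sum_(k < N.+1) Q (x + (k%:R * h) *: y) =
     \sum_(0 <= k < N.+1) (phi (x + (k.+1%:R * h) *: y) - phi (x + (k%:R * h) *: y)).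
    rewrite big_mkord; apply: eq_bigr => k _; rewrite /Q -addrA -scalerDl.
    by rewrite -[X in (_ + X) *: _]mul1r -mulrDl -natr1.
  by rewrite telescope_sumr// hN scale1r mul0r scale0r addr0.
rewrite (eq_lpn mu p tele).
have S := lpn_sum mu p1 (index_enum 'I_N.+1) xpredT
  (fun k : 'I_N.+1 => measurable_shift ((k%:R * h) *: y) mQ).
apply: (le_trans S).
under eq_bigr do rewrite lpn_shift//.
have QE : (lp Q <= (h * (d + C * `|y| ^+ 2 * K * h))%:E)%E.
  have mhD : measurable_fun setT (fun x => h * D x) := measurable_funM (measurable_cst h) mD.
  have mQD := measurable_funB mQ mhD.
  rewrite (eq_lpn mu p (g := fun x => (Q x - h * D x) + h * D x)); last by move=> x; rewrite subrK.
  apply: le_trans (lpnD _ p1 mQD mhD) _.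
  rewrite (lpnZ _ p1 _ mD) dE ger0_norm ?(ltW h0)//.
  rewrite mulrDr EFinD [leRHS]addeC; apply: leeD; last by rewrite EFinM.
  have -> : h * (C * `|y| ^+ 2 * K * h) = C * (`|h| * `|y|) ^+ 2 * K.
    by rewrite (ger0_norm (ltW h0)); ring.
  apply: (HK _ (C * (`|h| * `|y|) ^+ 2) mQD).
  - move=> x xr; rewrite /= /Q.
    have xr' : r < `|x| by apply: le_lt_trans xr; rewrite lerDl.
    rewrite vD// mulr0 (sp.2 x)// sp.2 ?subrr//.
    have H1 : `|x| <= `|x + h *: y| + `|h *: y|.
      by rewrite -[X in `|X| <= _](addrK (h *: y)); exact: ler_normB.
    have H2 : `|h *: y| <= `|y|.
      by rewrite normrZ (ger0_norm (ltW h0)) ler_piMl.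
    have := xr; lra.
  - by rewrite mulr_ge0// sqr_ge0.
  - move=> x; rewrite -normrZ /= /Q DE mulr_sumr.
    have := HC x (h *: y); rewrite (eq_bigr (fun i => h * (y 0 i * partial i phi x)))//.
    by move=> i _; rewrite mxE mulrA.
apply: (@le_trans _ _ (\sum_(k < N.+1) (h * (d + C * `|y| ^+ 2 * K * h))%:E)%E).
  by apply: lee_sum => k _.
rewrite sumEFin lee_fin sumr_const card_ord -[leLHS]mulr_natl mulrA hN mul1r.
by rewrite lerD2l; apply: ler_wpM2l; [rewrite !mulr_ge0|exact: ltW].
Qed.

Lemma lpn_translate_grad r phi y : smooth_cs r phi ->
  (lp (fun x => phi (x + y) - phi x)%R <= (enorm y)%:E * vp (grad phi))%E.
Proof.
move=> sp; apply: le_trans (lpn_translate_le y sp) _; apply: lpn_dotv_le; exact: mfield_grad sp.1.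
Qed.

Section bounded_domain.
Variables (n0 : (0 < n)%N) (Om : set E) (oOm : open Om) (bOm : bounded_set Om).

Lemma bounded_norm_le : exists2 r, 0 < r & forall x, Om x -> `|x| <= r.
Proof.
have [M [_ HM]] := bOm; exists (`|M| + 1); first by rewrite ltr_wpDl.
by move=> x Ox; apply: HM => //; have := ler_norm M; lra.
Qed.

Lemma Cc_vanish r phi : (forall x, Om x -> `|x| <= r) -> Cc_smooth Om phi -> smooth_cs r phi.
Proof.
move=> Hr [sp _ sO]; split => // x xr; apply: (supp_eq0 sO) => /Hr.
by rewrite leNgt xr.
Qed.

(** Translate along an axis by more than the diameter of the support: then [phi x] and [phi (x + y)]
    are never both nonzero, and the translation estimate bounds [phi] itself. *)
Lemma poincare_smooth : exists2 C, 0 <= C & forall phi, Cc_smooth Om phi ->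
  (lp phi <= C%:E * vp (grad phi))%E.
Proof.
have [r r0 Hr] := bounded_norm_le.
pose y : E := (2 * r + 1) *: delta_mx 0 (Ordinal n0).
have yr : 2 * r < `|y|.
  have := coord_norm_le y (Ordinal n0); rewrite !mxE !eqxx mulr1 ger0_norm; lra.
exists (enorm y); first exact: enorm_ge0.
move=> phi Cphi; have sp := Cc_vanish Hr Cphi; have mphi := smooth_measurable sp.1.
apply: le_trans (lpn_translate_grad y sp).
apply: (le_lpn _ p1 mphi (measurable_funB (measurable_shift y mphi) mphi)) => x /=.
have [xr|xr] := leP `|x| r; last by rewrite (sp.2 x)// normr0.
rewrite [phi (x + y)]sp.2 ?sub0r ?normrN//.
have : `|y| <= `|x + y| + `|x| by have := ler_normB (x + y) x; rewrite [x + y]addrC addrK.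
lra.
Qed.

Lemma H0_poincare : exists2 C, 0 <= C & forall u G, H0 Om p u G -> (lp u <= C%:E * vp G)%E.
Proof.
have [C C0 HC] := poincare_smooth; exists C => // u G uG.
have [lu lG] := H0_lty p1 uG; have [g g0 gE] := vlpn_fin lG.
have [mu_ mG HG] := uG.
rewrite gE -EFinM; apply: (lee_eps_scale (C := 1 + C)); first by rewrite addr_ge0.
move=> e e0; have [phi Cphi [a b]] := HG e e0.
have mphi := Cc_measurable Cphi; have mgphi := Cc_mgrad Cphi.
rewrite (eq_lpn mu p (g := fun x => (u x - phi x) + phi x)); last by move=> x; rewrite subrK.
apply: le_trans (lpnD _ p1 (measurable_funB mu_ mphi) mphi) _.
apply: (@le_trans _ _ (e%:E + C%:E * (g + e)%:E)%E); last first.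
  by rewrite -EFinM -EFinD lee_fin; lra.
apply: leeD => //; apply: le_trans (HC _ Cphi) _; apply: lee_wpmul2l => //.
rewrite /vlpn (eq_lpn mu p (g := fun x => enorm (G x - (G x - grad phi x)))); last by move=> x; rewrite subKr.
by apply: le_trans (vlpnB _ p1 mG (mfieldB mG mgphi)) _; rewrite gE EFinD; exact: leeD.
Qed.

Lemma H0_complete (u : nat -> E -> R) (G : nat -> E -> E) : (forall k, H0 Om p (u k) (G k)) ->
  (forall k, (vp (fun x => G k.+1 x - G k x)%R <= (2^-1 ^+ k)%:E)%E) ->
  exists v H, H0 Om p v H /\
    forall k, (vp (fun x => H x - G k x)%R <= (n%:R * (2 * 2^-1 ^+ k))%:E)%E.
Proof.
move=> uG Gk; have mu_ k : measurable_fun setT (u k) by case: (uG k).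
have mG k : mfield (G k) by case: (uG k).
have [H [mH HG]] := vlpn_complete p1 mG Gk.
have [C C0 HC] := H0_poincare.
have C1 : 0 < C + 1 by rewrite ltr_wpDl.
(* Dividing by [C + 1] makes Poincare's inequality turn the gradient increments into function
   increments below [2^-k], as [lpn_complete] requires. *)
pose v k x := (C + 1)^-1 * u k x.
have mv k : measurable_fun setT (v k) := measurable_funM (measurable_cst _) (mu_ k).
have vk k : (lp (fun x => v k.+1 x - v k x)%R <= (2^-1 ^+ k)%:E)%E.
  have uB := H0_lin p1 (-1) (uG k.+1) (uG k).
  have := HC _ _ uB.
  rewrite (eq_lpn mu p (f := fun x => u k.+1 x + -1 * u k x) (g := fun x => u k.+1 x - u k x)); last by move=> x; rewrite mulN1r.
  rewrite /vlpn (eq_lpn mu p (f := fun x => enorm (G k.+1 x + -1 *: G k x)) (g := fun x => enorm (G k.+1 x - G k x))); last by move=> x; rewrite scaleN1r.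
  move=> le1.
  rewrite (eq_lpn mu p (g := fun x => (C + 1)^-1 * (u k.+1 x - u k x))); last by move=> x; rewrite /v mulrBr.
  rewrite (lpnZ _ p1 _ (measurable_funB (mu_ _) (mu_ _))) ger0_norm ?invr_ge0 ?(ltW C1)//.
  apply: (@le_trans _ _ (((C + 1)^-1)%:E * (C%:E * (2^-1 ^+ k)%:E))%E).
    apply: lee_wpmul2l; first by rewrite lee_fin invr_ge0 ltW.
    by apply: le_trans le1 _; apply: lee_wpmul2l => //; exact: Gk.
  rewrite -!EFinM lee_fin mulrA; apply: ler_piMl; first by rewrite exprn_ge0// invr_ge0.
  by rewrite mulrC ler_pdivrMr// mul1r lerDl.
have [w [mw wv]] := lpn_complete p1 mv vk.
exists (fun x => (C + 1) * w x), H; split; last exact: HG.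
apply: (H0_closed p1); [exact: (measurable_funM (measurable_cst _) mw)|exact: mH|].
move=> e e0.
pose K := (C + 1) * 2 + n%:R * 2.
have K0 : 0 < K by rewrite /K ltr_pwDl ?mulr_gt0// mulr_ge0.
have [N Ne] : exists N, K * 2^-1 ^+ N <= e.
  have [N Ne] := exists_invn_lt (divr_gt0 e0 K0); exists N.
  rewrite mulrC -ler_pdivlMr//; apply: le_trans (ltW Ne).
  rewrite exprVn lef_pV2 ?posrE ?exprn_gt0//.
  by rewrite -natrX ler_nat; exact: ltn_expl.
exists (u N), (G N); split => //.
  rewrite (eq_lpn mu p (g := fun x => (C + 1) * (w x - v N x))); last first.
    by move=> x; rewrite mulrBr /v mulrA divff ?gt_eqF// mul1r.
  rewrite (lpnZ _ p1 _ (measurable_funB mw (mv _))) (ger0_norm (ltW C1)).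
  apply: (@le_trans _ _ ((C + 1)%:E * (2 * 2^-1 ^+ N)%:E)%E).
    by apply: lee_wpmul2l; [rewrite lee_fin ltW|exact: wv].
  rewrite -EFinM lee_fin; apply: le_trans Ne; rewrite mulrA; apply: ler_wpM2r.
    by rewrite exprn_ge0// invr_ge0.
  by rewrite /K lerDl mulr_ge0.
apply: le_trans (HG N) _; rewrite lee_fin; apply: le_trans Ne; rewrite mulrA; apply: ler_wpM2r.
  by rewrite exprn_ge0// invr_ge0.
by rewrite /K lerDr mulr_ge0// ltW.
Qed.

(** The values cluster at some [c], and an ultrafilter contains either the indices with values near
    [c] or their complement. The ultrafilter stands in for extracting subsequences at each of many
    points. *)
Lemma ultra_cauchy (F : set_system nat) (f : nat -> R) (B : R) : UltraFilter F ->
  (forall k, `|f k| <= B) -> forall e, 0 < e ->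
  exists2 A, F A & forall k l, A k -> A l -> `|f k - f l| <= e.
Proof.
move=> FU fB e e0.
have cB : compact `[- B, B]%classic by exact: segment_compact.
have [c [_ cc]] : `[- B, B]%classic `&` cluster (f @ F) !=set0.
  have FA : F (f @^-1` `[- B, B]%classic).
    by apply: filterS (@filterT _ F _) => k _; rewrite /= in_itv/= -ler_norml.
  exact: (cB (f @ F) (fmap_proper_filter f _) FA).
pose A := f @^-1` ball c (e / 2).
exists A; last first.
  move=> k l; rewrite /A /ball /= => h1 h2.
  rewrite (_ : f k - f l = (c - f l) - (c - f k)); last by ring.
  by apply: le_trans (ler_normB _ _) _; lra.
have [//|nA] := in_ultra_setVsetC A FU.
have := cc (~` ball c (e / 2)) (ball c (e / 2)) nA.
have nb : nbhs c (ball c (e / 2)) by apply: nbhsx_ballx; lra.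
by move=> /(_ nb)[z [h1 h2]].
Qed.

(** Mollify at a scale [s] where the gradient bound makes the error at most [e / 4]. At that fixed
    scale the functions are uniformly bounded and equi-Lipschitz, so it suffices to compare them at
    the finitely many centres of a net; the ultrafilter handles each centre. *)
Lemma rellich (F : set_system nat) (phi : nat -> E -> R) (M : R) : UltraFilter F ->
  (forall k, Cc_smooth Om (phi k)) -> 0 <= M -> (forall k, (vp (grad (phi k)) <= M%:E)%E) ->
  forall e, 0 < e -> exists2 A, F A & forall k l, A k -> A l ->
    (lp (fun x => phi k x - phi l x)%R <= e%:E)%E.
Proof.
move=> FU Cphi M0 HM e e0.
have [r r0 Hr] := bounded_norm_le.
have sphi k := Cc_vanish Hr (Cphi k).
have mphi k := Cc_measurable (Cphi k).
have iphi k := smooth_cs_intg (sphi k).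
have [C C0 HC] := poincare_smooth.
have lphi k : (lp (phi k) <= (C * M)%:E)%E.
  by apply: le_trans (HC _ (Cphi k)) _; rewrite EFinM; apply: lee_wpmul2l.
pose cn : R := n%:R; have cn0 : 0 <= cn by []; have Hcn (x : E) : enorm x <= cn * `|x| by exact: enorm_le_norm.
have [s s0 sM] : exists2 s, 0 < s & cn * s * M <= e / 4.
  have d0 : 0 < cn * M + 1 by rewrite ltr_wpDl// mulr_ge0.
  exists (e / 4 / (cn * M + 1)); first by rewrite divr_gt0// divr_gt0.
  rewrite mulrAC mulrA ler_pdivrMr// mulrC; apply: ler_wpM2l; first lra.
  by rewrite lerDl.
have [rho mr] := mollifier_exists (n := n) s0; have [_ sr _ _] := mr.
have close k : (lp (fun x => phi k x - convol (phi k) rho x)%R <= (e / 4)%:E)%E.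
  apply: (conv_close p1 mr (sphi k)); first lra.
  move=> z zs; rewrite (lpnC _ _).
  apply: le_trans (lpn_translate_grad (- z) (sphi k)) _.
  apply: (@le_trans _ _ ((cn * s)%:E * M%:E)%E); last by rewrite -EFinM lee_fin.
  apply: lee_pmul => //; [by rewrite lee_fin enorm_ge0|exact: vlpn_ge0|].
  by rewrite lee_fin enormN; apply: le_trans (Hcn _) _; apply: ler_wpM2l.
(* With [eta = 1] on the ball containing all supports, the L^1 norm of [phi k] is a pairing with a
   test function, bounded through its L^p norm. *)
have [eta [Ce _ [t t0 eta1]]] := cutoff (@ball_closed_compact R n r) openT (@subsetT _ _).
have [re _ se] := Cc_smoothP Ce.
have [Cs Cs0 HCs] := lpn_test_small p1 se.
pose I0 := Cs * (C * M).
have I00 : 0 <= I0 by rewrite !mulr_ge0.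
have HI k : \int[mu]_x `|phi k x| <= I0.
  have -> : \int[mu]_x `|phi k x| = \int[mu]_x (`|phi k x| * eta x).
    apply: Rint_ext => x; have [xr|xr] := leP `|x| r; last by rewrite (sphi k).2// normr0 mul0r.
    by rewrite (eta1 x x) ?mulr1// subrr normr0.
  apply: le_trans (ler_norm _) _; apply: HCs.
  - exact: measurable_normf (mphi k).
  - exact: mulr_ge0.
  - by rewrite lpn_norm.
have [B B0 HB] := smooth_cs_bounded sr.
have cB k x : `|convol (phi k) rho x| <= B * I0.
  apply: le_trans (Rintegral_norm_le (iphi k) (kernel_measurable x sr) (fun y => HB _)) _.
  exact: ler_wpM2l.
have [L L0 HL] := conv_lipschitz sr.
have cL k x x' : `|convol (phi k) rho x - convol (phi k) rho x'| <= L * I0 * `|x - x'|.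
  by apply: le_trans (HL _ (iphi k) x x') _; apply: ler_wpM2r => //; exact: ler_wpM2l.
have cv k : vanish_out (r + s) (convol (phi k) rho).
  move=> x xr; apply/eqP; apply: contraTT xr => /(conv_support sr.2)[y py xy].
  have yr : `|y| <= r by rewrite leNgt; apply: contraNN py => /(sphi k).2 ->.
  rewrite -leNgt; rewrite -(subrK y x); apply: le_trans (ler_normD _ _) _; lra.
have [K K0 HK] := lpn_vanish_bound (r + s).
pose e' := e / 4 / (K + 1).
have e'0 : 0 < e' by rewrite !divr_gt0// ltr_wpDl.
(* The mesh of the net: moving to the nearest centre changes each mollified function by at most
   [e' / 4], leaving [e' / 2] for the difference at the centre. *)
pose dl := e' / 4 / (L * I0 + 1).
have dl0 : 0 < dl by rewrite !divr_gt0// ltr_wpDl// mulr_ge0.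
have Ldl : L * I0 * dl <= e' / 4.
  rewrite /dl mulrA ler_pdivrMr; last by rewrite ltr_wpDl// mulr_ge0.
  by rewrite mulrC; apply: ler_wpM2l; [lra|rewrite lerDl].
have [D _ HD] : finite_subset_cover [set: E] (fun a => [set x : E | `|a - x| < dl]) [set x : E | `|x| <= r + s].
  have := @ball_closed_compact R n (r + s); rewrite compact_cover; apply; last first.
    by move=> x _; exists x => //=; rewrite subrr normr0.
  move=> a _; rewrite -closedC; have := @closed_norm_ge R n a dl; congr closed.
  by apply/seteqP; split => x /=; rewrite leNgt => /negP.
have HA (a : E) : exists A, F A /\ forall k l, A k -> A l ->
    `|convol (phi k) rho a - convol (phi l) rho a| <= e' / 2.
  have [|A FA HA] := ultra_cauchy FU (fun k => cB k a) (e := e' / 2); first lra.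
  by exists A.
have [A HA'] := choice HA.
have FD := @filter_bigI _ _ D A F _ (fun a _ => (HA' a).1).
eexists; first exact: FD.
move=> k l Ak Al.
have mcv j : measurable_fun setT (convol (phi j) rho).
  by apply: continuous_rV_measurable; exact: conv_continuous (iphi j) sr.
have m1 := measurable_funB (mphi k) (mcv k).
have m2 := measurable_funB (mcv k) (mcv l).
have m3 := measurable_funB (mcv l) (mphi l).
rewrite (eq_lpn mu p (g := fun x => ((phi k x - convol (phi k) rho x) +
  (convol (phi k) rho x - convol (phi l) rho x)) + (convol (phi l) rho x - phi l x))); last first.
  by move=> x; rewrite !addrA !subrK.
apply: le_trans (lpnD _ p1 (measurable_funD m1 m2) m3) _.
have -> : (e%:E = ((e / 4)%:E + (e / 2)%:E) + (e / 4)%:E)%E by rewrite -!EFinD; congr EFin; lra.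
apply: leeD; last by rewrite (lpnC _ _); exact: close.
apply: le_trans (lpnD _ p1 m1 m2) _; apply: leeD; first exact: close.
apply: (@le_trans _ _ (e' * K)%:E); last first.
  rewrite lee_fin /e' mulrAC ler_pdivrMr; last by rewrite ltr_wpDl.
  have : 0 <= e * K by rewrite mulr_ge0// ltW.
  by lra.
apply: (HK _ e' m2); [|exact: ltW|].
  by move=> x xr; rewrite /= !cv// subrr.
move=> x /=; have [xr|xr] := leP `|x| (r + s); last by rewrite !cv// subrr normr0 ltW.
have [a /= aD ax] := HD x xr.
have := (HA' a).2 k l (Ak a aD) (Al a aD).
have H1 := cL k x a; have H2 := cL l a x.
have H3 : L * I0 * `|x - a| <= e' / 4.
  by apply: le_trans Ldl; apply: ler_wpM2l; [exact: mulr_ge0|rewrite distrC ltW].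
have H4 : L * I0 * `|a - x| <= e' / 4 by rewrite distrC.
move=> H5.
rewrite (_ : _ - _ = (convol (phi k) rho x - convol (phi k) rho a) +
  (convol (phi k) rho a - convol (phi l) rho a) + (convol (phi l) rho a - convol (phi l) rho x)); last first.
  by rewrite !addrA !subrK.
apply: le_trans (ler_normD _ _) _.
have H6 := ler_normD (convol (phi k) rho x - convol (phi k) rho a) (convol (phi k) rho a - convol (phi l) rho a).
lra.
Qed.

End bounded_domain.
End translation.

(** * Functions in the closure of C_c^oo *)

(** Partial sums of the thresholds [N i] put both the terms of index [j] and [j + 1] beyond [N j];
    adding [j] makes the indices unbounded. *)
Lemma cauchy_subseq (P : nat -> nat -> nat -> Prop) :
  (forall j, exists N, forall k l, (N <= k)%N -> (N <= l)%N -> P j k l) ->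
  exists kap : nat -> nat, (forall j, (j <= kap j)%N) /\ forall j, P j (kap j.+1) (kap j).
Proof.
move=> /choice[N HN]; exists (fun j => \sum_(i < j.+1) N i + j)%N; split.
  by move=> j; exact: leq_addl.
have H j : (N j <= \sum_(i < j.+1) N i)%N by rewrite big_ord_recr /= leq_addl.
move=> j; apply: HN; last by apply: leq_trans (H j) _; exact: leq_addr.
apply: leq_trans (H j) _; rewrite [X in (_ <= X + _)%N]big_ord_recr /= -addnA; exact: leq_addr.
Qed.

Lemma exp_half_lt (R : realType) (e K : R) : 0 < e -> exists N, forall k, (N <= k)%N -> K * 2^-1 ^+ k <= e.
Proof.
move=> e0; have K0 : 0 < `|K| + 1 by rewrite ltr_wpDl.
have [N Ne] := exists_invn_lt (divr_gt0 e0 K0); exists N => k Nk.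
have h0 : 0 <= 2^-1 ^+ k :> R by rewrite exprn_ge0// invr_ge0.
apply: (@le_trans _ _ ((`|K| + 1) * 2^-1 ^+ k)).
  by apply: ler_wpM2r => //; have := ler_norm K; lra.
rewrite mulrC -ler_pdivlMr//; apply: le_trans (ltW Ne).
rewrite exprVn lef_pV2 ?posrE ?exprn_gt0//.
rewrite -natrX ler_nat; apply: leq_ltn_trans Nk _; exact: ltn_expl.
Qed.

Section weak_closure.
Context {R : realType} {n : nat}.
Local Notation E := 'rV[R]_n.
Local Notation mu := (@lebesgue_rV R n).
Variables (p : R) (p1 : 1 < p).
Implicit Types (u v f g phi psi theta : E -> R) (G H : E -> E).
Local Notation lp := (lpn mu p).
Local Notation vp := (vlpn mu p).
Variables (n0 : (0 < n)%N) (Om : set E) (oOm : open Om) (bOm : bounded_set Om).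

Let p0 : 0 < p. Proof. exact: lt_trans p1. Qed.

Definition midpoint f g : E -> R := cst 2^-1 * (f + g).

(** The midpoint-convex hull of a tail, as an intersection of classes: a property that holds on the
    tail and passes to midpoints holds on the hull by instantiation. *)
Definition hull (phi : nat -> E -> R) (m : nat) : set (E -> R) := [set psi |
  forall Q : set (E -> R), (forall k, (m <= k)%N -> Q (phi k)) ->
    (forall f g, Q f -> Q g -> Q (midpoint f g)) -> Q psi].

Lemma hull_base (phi : nat -> E -> R) m k : (m <= k)%N -> hull phi m (phi k).
Proof. by move=> mk Q Q1 _; exact: Q1. Qed.

Lemma hull_mid (phi : nat -> E -> R) m f g : hull phi m f -> hull phi m g -> hull phi m (midpoint f g).
Proof. by move=> hf hg Q Q1 Q2; apply: (Q2); [exact: (hf Q Q1 Q2)|exact: (hg Q Q1 Q2)]. Qed.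

Lemma hull_sub (phi : nat -> E -> R) m k : (m <= k)%N -> hull phi k `<=` hull phi m.
Proof. by move=> mk f hf Q Q1 Q2; apply: hf => // l kl; apply: Q1; exact: leq_trans kl. Qed.

Lemma Cc_midpoint f g : Cc_smooth Om f -> Cc_smooth Om g -> Cc_smooth Om (midpoint f g).
Proof. by move=> Cf Cg; apply: Cc_smoothZ; exact: Cc_smoothD. Qed.

Lemma grad_midpoint f g x : smooth f -> smooth g ->
  grad (midpoint f g) x = 2^-1 *: (grad f x + grad g x).
Proof. by move=> sf sg; rewrite (gradZ _ _ (smoothD sf sg)) (gradD _ sf sg). Qed.

Lemma plpn_lty G (c : R) : mfield G -> 0 <= c -> (vp G <= c%:E)%E -> (plpn mu p G <= (c `^ p)%:E)%E.
Proof. by move=> mG c0; rewrite (vlpn_leP _ p1). Qed.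

Lemma test_uniq u v : measurable_fun setT u -> measurable_fun setT v -> (lp u < +oo)%E ->
  (lp v < +oo)%E ->
  (forall r theta, smooth_cs r theta -> \int[mu]_x (u x * theta x) = \int[mu]_x (v x * theta x)) ->
  {ae mu, forall x, u x = v x}.
Proof.
move=> mu_ mv lu lv H.
have lB : (lp (u \- v)%R < +oo)%E.
  by apply: le_lt_trans (lpnB _ p1 mu_ mv) _; rewrite lte_add_pinfty.
have mB := measurable_funB mu_ mv.
have lo : loc_integrable setT (u \- v).
  split => // K cK _; apply: (lpn_integrable_on p1) => //; first exact: compact_rV_measurable.
  exact: compact_lebesgue_lty.
have := fundamental_lemma openT lo; move=> F.
have : {ae mu, forall x, setT x -> (u \- v) x = 0}.
  apply: F => phi Cphi; have [r _ sr] := Cc_smoothP Cphi.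
  have i1 := lpn_mul_smooth p1 sr mu_ lu; have i2 := lpn_mul_smooth p1 sr mv lv.
  rewrite (Rint_ext (g := fun x => u x * phi x - v x * phi x)); last by move=> x /=; rewrite mulrBl.
  by rewrite RintegralB// (H _ _ sr) subrr.
by apply: filterS => x /(_ I) /= /eqP; rewrite subr_eq0 => /eqP.
Qed.

Lemma H0_Blin u v G H : H0 Om p u G -> H0 Om p v H ->
  H0 Om p (fun x => u x - v x) (fun x => G x - H x).
Proof.
move=> uG vH; have := H0_lin p1 (-1) uG vH.
by under eq_fun do rewrite mulN1r; under [X in H0 _ _ _ X]eq_fun do rewrite scaleN1r.
Qed.

(** A strong form of Mazur's lemma. Let [d m] be the infimum of the gradient energy over the hull of
    the tail from [m]; it increases to a limit, and almost minimizers have strongly converging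
    gradients by uniform convexity. The limit function is [u] because closeness of the pairings with
    a test function survives midpoints. *)
Lemma weak_closure (phi : nat -> E -> R) u (M : R) : (forall k, Cc_smooth Om (phi k)) ->
  0 <= M -> (forall k, (vp (grad (phi k)) <= M%:E)%E) ->
  measurable_fun setT u -> (lp u < +oo)%E ->
  (forall r theta, smooth_cs r theta ->
    (fun k => \int[mu]_x (phi k x * theta x)) @ \oo --> \int[mu]_x (u x * theta x)) ->
  exists2 G, H0 Om p u G & (vp G <= M%:E)%E.
Proof.
move=> Cphi M0 HM mu_ lu Hu.
have hC m psi : hull phi m psi -> Cc_smooth Om psi.
  by apply; [move=> k _; exact: Cphi|exact: Cc_midpoint].
have hM m psi : hull phi m psi -> (vp (grad psi) <= M%:E)%E.
  move=> hp; suff : (fun f => Cc_smooth Om f /\ (vp (grad f) <= M%:E)%E) psi by case.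
  apply: (hp (fun f => Cc_smooth Om f /\ (vp (grad f) <= M%:E)%E)); first by move=> k _; split.
  move=> f g [Cf lf] [Cg lg]; split; first exact: Cc_midpoint.
  have [sf _ _] := Cf; have [sg _ _] := Cg.
  have mf := mfield_grad sf; have mg := mfield_grad sg.
  rewrite /vlpn (eq_lpn mu p (g := fun x => enorm (2^-1 *: (grad f x + grad g x)))); last first.
    by move=> x; rewrite grad_midpoint.
  apply: le_trans (ereal_eqW (vlpnZ mu p1 (2^-1) (mfieldD mf mg))) _.
  rewrite ger0_norm; last by rewrite invr_ge0.
  apply: (@le_trans _ _ ((2^-1)%:E * (M%:E + M%:E))%E); last by rewrite -EFinD -EFinM lee_fin; lra.
  apply: lee_wpmul2l; first by rewrite lee_fin invr_ge0.
  by apply: le_trans (vlpnD _ p1 mf mg) _; exact: (leeD lf lg).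
have hmg m psi : hull phi m psi -> mfield (grad psi) by move=> /hC; exact: Cc_mgrad.
have hP m psi : hull phi m psi -> (plpn mu p (grad psi) <= (M `^ p)%:E)%E.
  by move=> hp; exact: (plpn_lty (hmg _ _ hp) M0 (hM _ _ hp)).
have hF m psi : hull phi m psi -> plpn mu p (grad psi) = (fine (plpn mu p (grad psi)))%:E.
  move=> hp; rewrite fineK// ge0_fin_numE ?plpn_ge0//; apply: le_lt_trans (hP _ _ hp) _; exact: ltry.
pose V m : set R := [set fine (plpn mu p (grad psi)) | psi in hull phi m].
have V0 m : V m !=set0.
  by exists (fine (plpn mu p (grad (phi m)))), (phi m) => //; exact: hull_base.
have Vlb m : lbound (V m) 0.
  by move=> _ [psi _ <-]; rewrite fine_ge0// plpn_ge0.
have Vinf m : has_inf (V m) by split; [exact: V0|exists 0; exact: Vlb].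
pose d m := inf (V m).
have d_le m psi : hull phi m psi -> ((d m)%:E <= plpn mu p (grad psi))%E.
  move=> hp; rewrite (hF _ _ hp) lee_fin; apply: ge_inf; first by exists 0; exact: Vlb.
  by exists psi.
have dM m : d m <= M `^ p.
  by have hb : hull phi m (phi m) := hull_base (leqnn m); have := le_trans (d_le m _ hb) (hP m _ hb); rewrite lee_fin.
have d0 m : 0 <= d m by apply: lb_le_inf; [exact: V0|exact: Vlb].
have dnd : {homo d : a b / (a <= b)%N >-> a <= b}.
  move=> a b ab; apply: lb_le_inf => // _ [psi hp <-].
  by rewrite -lee_fin -(hF _ _ hp); apply: d_le; exact: hull_sub hp.
pose dd := sup (range d).
have dub : has_ubound (range d) by exists (M `^ p) => _ [m _ <-]; exact: dM.
have dcv : d @ \oo --> dd := nondecreasing_cvgn dnd dub.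
have ddm m : d m <= dd by apply: sup_upper_bound; [split => //; exists (d 0), 0|exists m].
have /choice[psi Hpsi] : forall m, exists psi, hull phi m psi /\
    (plpn mu p (grad psi) <= (d m + m.+1%:R^-1)%:E)%E.
  move=> m; have [|_ [f hf <-] lf] := inf_adherent (eps := m.+1%:R^-1) _ (Vinf m).
    by rewrite invr_gt0.
  by exists f; split => //; rewrite (hF _ _ hf) lee_fin ltW.
have Cpsi m := hC _ _ (Hpsi m).1.
have mpsi m := Cc_mgrad (Cpsi m).
(* Both slacks in one: [1/(m+1)] for missing the infimum [d m], and [dd - d m] for the distance of
   [d m] to its limit, which bounds the midpoints from below. *)
pose dl m := (m.+1%:R^-1 + (dd - d m)).
have dl0 : dl @ \oo --> 0.
  rewrite -(addr0 0); apply: cvgD; first exact: cvg_harmonic.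
  by rewrite -(subrr dd); apply: cvgB; [exact: cvg_cst|exact: dcv].
have mc := minimizing_cauchy (m := mu) p1 (a := fun m => grad (psi m)) mpsi (le_trans (d0 0) (ddm 0)) dl0.
have {}mc : forall eta : R, 0 < eta -> exists N, forall k l, (N <= k)%N -> (N <= l)%N ->
    (plpn mu p (fun x => grad (psi k) x - grad (psi l) x)%R <= eta%:E)%E.
  apply: mc => [k|k l kl].
    apply: le_trans (Hpsi k).2 _; rewrite lee_fin /dl.
    have := ddm k; have := invr_ge0 (k.+1%:R : R); rewrite ler0n; move: (k.+1%:R^-1) (d k) => a b; lra.
  apply: le_trans (_ : (d k)%:E <= _)%E.
    rewrite lee_fin /dl; have := invr_ge0 (k.+1%:R : R); rewrite ler0n; move: (k.+1%:R^-1) (d k) => a b; lra.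
  have hm := hull_mid (Hpsi k).1 (hull_sub kl (Hpsi l).1).
  apply: le_trans (d_le _ _ hm) _; apply: ereal_eqW; apply: eq_integral => x _.
  by have [sk _ _] := Cpsi k; have [sl _ _] := Cpsi l; rewrite grad_midpoint.
have [kap [kap1 kap2]] : exists kap : nat -> nat, (forall j, (j <= kap j)%N) /\
    forall j, (vp (fun x => grad (psi (kap j.+1)) x - grad (psi (kap j)) x)%R <= (2^-1 ^+ j)%:E)%E.
  apply: (cauchy_subseq (P := fun j k l => (vp (fun x => grad (psi k) x - grad (psi l) x)%R <= (2^-1 ^+ j)%:E)%E)).
  move=> j; have h0 : 0 < 2^-1 ^+ j :> R by rewrite exprn_gt0// invr_gt0.
  have [N HN] := mc ((2^-1 ^+ j) `^ p) (powR_gt0 _ h0).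
  by exists N => k l Nk Nl; rewrite (vlpn_leP _ p1) ?(ltW h0)//; exact: HN.
have [v [H [vH HH]]] := H0_complete p1 n0 bOm (fun j => H0_smooth p1 (Cpsi (kap j))) kap2.
have [mv mH _] := vH; have [lv lH] := H0_lty p1 vH.
have [C C0 HC] := H0_poincare p1 n0 bOm.
have vM : (vp H <= M%:E)%E.
  apply: (lee_eps_scale (C := 1)) => // e e0.
  have [N HN] := exp_half_lt (n%:R * 2) e0.
  rewrite mul1r addrC /vlpn (eq_lpn mu p (g := fun x => enorm ((H x - grad (psi (kap N)) x) + grad (psi (kap N)) x))); last by move=> x; rewrite subrK.
  apply: le_trans (vlpnD _ p1 (mfieldB mH (mpsi _)) (mpsi _)) _.
  rewrite EFinD; apply: leeD; last exact: hM (Hpsi _).1.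
  by apply: le_trans (HH N) _; rewrite lee_fin mulrA; exact: HN.
exists H => //; apply: (H0_ae vH mu_ mH) => //; last by apply: aeW.
apply: test_uniq => // r theta sth.
have [D D0 HD] := lpn_test_small p1 sth.
apply/eqP; rewrite -subr_eq0; apply/eqP; apply: (@norm_eps _ _ (D * C + 1)) => e e0.
have [N1 HN1] := exp_half_lt (n%:R * 2) e0.
have [N2 _ HN2] : \forall k \near \oo, `|\int[mu]_x (u x * theta x) - \int[mu]_x (phi k x * theta x)| <= e.
  by move/cvgrPdist_le : (Hu _ _ sth); apply.
pose N := maxn N1 N2; pose f := psi (kap N).
have hf : hull phi N2 f.
  by apply: hull_sub (Hpsi (kap N)).1; apply: leq_trans (kap1 N); exact: leq_maxr.
have mth := smooth_measurable sth.1.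
have Cint g : Cc_smooth Om g -> intg (fun x => g x * theta x).
  move=> Cg; have [s _ ss] := Cc_smoothP Cg; apply: (lpn_mul_smooth p1 sth (Cc_measurable Cg)).
  exact: (smooth_cs_lpn p1 ss).
have fu : `|\int[mu]_x (u x * theta x) - \int[mu]_x (f x * theta x)| <= e.
  pose Q g := Cc_smooth Om g /\ `|\int[mu]_x (u x * theta x) - \int[mu]_x (g x * theta x)| <= e.
  suff : Q f by case.
  apply: (hf Q); first by move=> k Nk; split => //; exact: HN2.
  move=> g h [Cg lg] [Ch lh]; split; first exact: Cc_midpoint.
  have i1 := Cint _ Cg; have i2 := Cint _ Ch.
  rewrite (Rint_ext (f := fun x => midpoint g h x * _) (g := fun x => 2^-1 * (g x * theta x + h x * theta x))); last first.
    by move=> x; rewrite -[midpoint g h x]/(2^-1 * (g x + h x)) -mulrA mulrDl.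
  rewrite RintegralZl//; last exact: intgD.
  rewrite RintegralD//; move: lg lh; move: (\int[mu]_x (u x * _)) (\int[mu]_x (g x * _)) (\int[mu]_x (h x * _)) => a b c.
  by rewrite !ler_norml => /andP[h1 h2] /andP[h3 h4]; apply/andP; split; lra.
have vf : `|\int[mu]_x (v x * theta x) - \int[mu]_x (f x * theta x)| <= D * (C * e).
  have i1 := lpn_mul_smooth p1 sth mv lv; have i2 := Cint _ (Cpsi (kap N)).
  rewrite -RintegralB// (Rint_ext (g := fun x => (v x - f x) * theta x)); last by move=> x; rewrite mulrBl.
  apply: HD; [exact: (measurable_funB mv (Cc_measurable (Cpsi _)))|by rewrite mulr_ge0// ltW|].
  apply: le_trans (HC _ _ (H0_Blin vH (H0_smooth p1 (Cpsi (kap N))))) _.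
  rewrite EFinM; apply: lee_wpmul2l => //; apply: le_trans (HH N) _.
  by rewrite lee_fin mulrA; apply: HN1; exact: leq_maxl.
rewrite (_ : _ - _ = (\int[mu]_x (v x * theta x) - \int[mu]_x (f x * theta x)) -
  (\int[mu]_x (u x * theta x) - \int[mu]_x (f x * theta x))); last by ring.
by apply: le_trans (ler_normB _ _) _; rewrite mulrDl mul1r -mulrA; exact: lerD.
Qed.

(** Mollifiers of radius below the margin of [K] in [Om] give test functions, and their pairings
    converge to those of [u]. *)
Lemma mollify_H0 u K (M r0 : R) : compact K -> K `<=` Om -> (forall x, u x != 0 -> K x) ->
  intg u -> (lp u < +oo)%E -> 0 <= M -> 0 < r0 ->
  (forall r rho, r < r0 -> mollifier r rho -> (vp (grad (convol u rho)) <= M%:E)%E) ->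
  exists2 G, H0 Om p u G & (vp G <= M%:E)%E.
Proof.
move=> cK KO uK ui lu M0 r00 HM.
have [t t0 Ht] := compact_core cK oOm KO.
have [N Nt] : exists N : nat, N.+1%:R^-1 < Num.min t r0.
  by apply: exists_invn_lt; rewrite lt_min t0.
have r_lt k : (k + N).+1%:R^-1 < Num.min t r0.
  apply: le_lt_trans Nt; rewrite lef_pV2 ?posrE// ler_nat ltnS; exact: leq_addl.
have /choice[rho Hrho] : forall k, exists rho, mollifier (n := n) ((k + N).+1%:R^-1 : R) rho.
  by move=> k; apply: mollifier_exists; rewrite invr_gt0.
have clK : closed K by apply: compact_closed => //; exact: norm_hausdorff.
have Cphi k : Cc_smooth Om (convol u (rho k)).
  have [rk0 sr _ _] := Hrho k; move: (r_lt k); rewrite lt_min => /andP[rt _].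
  have sc := smooth_conv ui sr.
  (* The closed neighbourhood of [K], compact as the image of a product of compact sets under
     addition. *)
  pose L : set E := [set x | exists2 y, K y & `|x - y| <= (k + N).+1%:R^-1].
  have LO : L `<=` Om by move=> x [y Ky xy]; apply: (Ht y Ky); exact: le_lt_trans xy rt.
  have cL : compact L.
    have -> : L = (fun z : E * E => z.1 + z.2) @` (K `*` [set z | `|z| <= (k + N).+1%:R^-1]).
      apply/seteqP; split => [x [y Ky xy]|_ [[y z] [/= Ky zr] <-]].
        by exists (y, x - y) => //=; rewrite addrC subrK.
      by exists y => //; rewrite addrC addKr || rewrite [y + z]addrC addrK.
    apply: continuous_compact; last by apply: compact_setX => //; exact: ball_closed_compact.
    by apply: continuous_subspaceT => z; exact: add_continuous.
  apply: (Cc_smooth_compact sc cL _ LO).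
    by apply: compact_closed => //; exact: norm_hausdorff.
  by move=> x /(conv_support sr.2)[y /uK Ky xy]; exists y.
apply: (weak_closure Cphi M0) => //.
- by move=> k; apply: (HM _ _ _ (Hrho k)); move: (r_lt k); rewrite lt_min => /andP[].
- exact: intg_measurable.
move=> r theta sth; have [L L0 HL] := smooth_cs_lipschitz sth.
have [B B0 HB] := smooth_cs_bounded sth.
pose I0 := \int[mu]_x `|u x|.
have I00 : 0 <= I0 by exact: Rintegral_ge0.
have c0 : (fun k => L * (k + N).+1%:R^-1 * I0) @ \oo --> (0 : R).
  have -> : (0 : R) = L * 0 * I0 by rewrite mulr0 mul0r.
  apply: cvgM; last exact: cvg_cst.
  apply: cvgM; first exact: cvg_cst.
  by have := @cvg_harmonic R; rewrite -(cvg_shiftn N).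
apply/cvgrPdist_le => e e0; move/cvgrPdist_le : c0 => /(_ e e0).
apply: filterS => k; rewrite sub0r normrN => lk.
apply: le_trans (le_trans (ler_norm _) lk); rewrite distrC.
apply: (conv_test (Hrho k) ui (smooth_measurable sth.1) L0) => //.
by exists B.
Qed.

(** Difference quotients commute with mollification, so by Young's inequality those of the mollified
    function obey the same bound; Fatou passes to its partial derivatives. The factor [n] comes from
    summing over coordinates. *)
Lemma partial_translate_H0 u K (M t0 : R) : compact K -> K `<=` Om -> (forall x, u x != 0 -> K x) ->
  continuous u -> 0 <= M -> 0 < t0 ->
  (forall i t, 0 < t < t0 -> (lp (fun x => u (x + t *: delta_mx 0 i) - u x)%R <= (M * t)%:E)%E) ->
  exists2 G, H0 Om p u G & (vp G <= (n%:R * M)%:E)%E.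
Proof.
move=> cK KO uK cu M0 t00 HM.
have [r rK] := compact_bounded_cube cK.
have vu : vanish_out `|r| u.
  move=> x rx; apply/eqP; apply: contraTT rx => /uK /rK Hx; rewrite -leNgt.
  apply: rV_norm_le => // i; have := Hx i; rewrite /= in_itv /= -ler_norml => /le_trans; apply.
  exact: ler_norm.
have [B B0 HB] := vanish_bounded cu vu.
have mu_ := continuous_rV_measurable cu.
have ui := intg_vanish mu_ HB vu.
have [c _ Hc] := lpn_vanish_bound p1 (n := n) `|r|.
have lu : (lp u < +oo)%E by apply: le_lt_trans (Hc _ _ mu_ vu B0 HB) _; exact: ltry.
apply: (mollify_H0 cK KO uK ui lu _ ltr01); first exact: mulr_ge0.
move=> s rho _ mr; have [_ sr _ _] := mr.
have sc := smooth_conv ui sr.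
apply: le_trans (vlpn_le_sum _ p1 (mfield_grad sc)) _.
apply: (@le_trans _ _ (\sum_(i < n) M%:E)%E); last first.
  by rewrite sumEFin lee_fin sumr_const card_ord mulr_natl.
apply: lee_sum => i _.
(* Starting at [k + 2] keeps the steps strictly below [t0]. *)
pose t k : R := t0 * k.+2%:R^-1.
have tk k : 0 < t k < t0.
  by rewrite /t mulr_gt0//= gtr_pMr// invf_lt1// ltr1n.
have t_0 : t @ \oo --> (0 : R).
  rewrite -(mulr0 t0); apply: cvgM; first exact: cvg_cst.
  by rewrite (cvg_shiftS (@harmonic R)); exact: cvg_harmonic.
pose e : E := delta_mx 0 i.
pose q k x := (t k)^-1 * (convol u rho (x + t k *: e) - convol u rho x).
have mc := smooth_measurable sc.
have mq k : measurable_fun setT (q k).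
  exact: (measurable_funM (measurable_cst _) (measurable_funB (measurable_shift _ mc) mc)).
apply: (lpn_fatou p1 M0 (f := q) mq).
  move=> x; rewrite grad_coord.
  have D : derivable (convol u rho) x e by exact: smooth_derivable.
  have tD : t @ \oo --> (0 : R)^'.
    move=> A HA; have HA' : \forall y \near (0 : R), y != 0 -> A y by exact: HA.
    have H : \forall k \near \oo, t k != 0 -> A (t k) := t_0 _ HA'.
    have : \forall k \near \oo, A (t k); last by [].
    by apply: filterS H => k; apply; rewrite gt_eqF//; case/andP: (tk k).
  have Cq := cvg_comp _ _ tD D.
  rewrite (_ : (fun k => q k x) = (fun h => h^-1 *: ((convol u rho \o shift x) (h *: e) - convol u rho x)) \o t).
    exact: Cq.
  by apply/funext => k; rewrite /q /= [X in convol u rho X]addrC.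
apply: nearW => k; have /andP[tk0 tk1] := tk k.
have uti := intg_shift (t k *: e) ui.
have cE x : convol u rho (x + t k *: e) - convol u rho x = convol (fun y => u (y + t k *: e) - u y) rho x.
  have i1 := conv_intg (x + t k *: e) ui sr.
  rewrite /convol -(Rintegral_shift (t k *: e) i1) -RintegralB//; last exact: (conv_intg _ ui sr).
    by apply: Rint_ext => y; rewrite mulrBl opprD addrACA subrr addr0.
  exact: (intg_shift (t k *: e) i1).
rewrite (eq_lpn mu p (g := fun x => (t k)^-1 * convol (fun y => u (y + t k *: e) - u y) rho x)); last first.
  by move=> x; rewrite /q cE.
have di := intgB uti ui.
rewrite (lpnZ _ p1); last by apply: continuous_rV_measurable; exact: conv_continuous di sr.
rewrite ger0_norm ?invr_ge0 ?(ltW tk0)//.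
apply: (@le_trans _ _ (((t k)^-1)%:E * (M * t k)%:E)%E).
  apply: lee_wpmul2l; first by rewrite lee_fin invr_ge0 ltW.
  by apply: le_trans (conv_lpn_le p1 mr di) _; exact: HM.
by rewrite -EFinM lee_fin mulrCA mulVf ?mulr1// gt_eqF.
Qed.

End weak_closure.

(** * Products with cutoffs, and locality of weak gradients *)

Section product.
Context {R : realType} {n : nat}.
Local Notation E := 'rV[R]_n.
Local Notation mu := (@lebesgue_rV R n).
Implicit Types (u v f g phi rho eta : E -> R) (F G H : E -> E).

Lemma kernel_is_derive r rho i (x y : E) : smooth_cs r rho ->
  is_derive y (delta_mx 0 i : E) (fun y => rho (x - y)) (- partial i rho (x - y)).
Proof.
move=> sr; have [C C0 HC] := smooth_cs_partial_taylor i sr.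
apply: (@is_derive_quadratic _ _ _ _ _ _ C) => t.
have -> : x - (y + t *: delta_mx 0 i) = (x - y) + (- t) *: delta_mx 0 i.
  by rewrite opprD addrA scaleNr.
by have := HC (x - y) (- t); rewrite normrN mulNr mulrN.
Qed.

Lemma smooth_kernel r rho (x : E) : smooth_cs r rho -> smooth (fun y => rho (x - y)).
Proof.
move=> sr.
suff : [set f : E -> R | exists2 rho, smooth_cs r rho & f = fun y => rho (x - y)] `<=` smooth.
  by apply; exists rho.
apply: smooth_coind => _ [k sk ->]; split.
- have [L L0 HL] := smooth_cs_lipschitz sk.
  apply: (@lipschitz_rV_continuous _ _ R^o _ L) => y z.
  have -> : x - y = (x - z) + (z - y) by rewrite addrA subrK.
  by rewrite distrC -normrN opprB (le_trans (HL _ _))// distrC.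
- by move=> i y; case: (kernel_is_derive i x y sk).
- move=> i; have spk := smooth_cs_partial i sk.
  exists (cst (-1) * partial i k).
    split; first exact: (smoothM (smooth_cst (-1)) spk.1).
    by move=> y ry; rewrite -[LHS]/(-1 * partial i k y) spk.2// mulr0.
  apply/funext => y; rewrite -[RHS]/(-1 * partial i k (x - y)) mulN1r /partial.
  by case: (kernel_is_derive i x y sk).
Qed.

Lemma partial_kernel r rho i (x y : E) : smooth_cs r rho ->
  partial i (fun y => rho (x - y)) y = - partial i rho (x - y).
Proof. by move=> sr; rewrite /partial; case: (kernel_is_derive i x y sr). Qed.

(** The product rule in mollified form: apply the definition of the weak gradient of [f] to the test
    function [rho (x - .) * eta]. *)
Lemma conv_product (Om : set E) r rho eta f F i x : open Om -> smooth_cs r rho -> Cc_smooth Om eta ->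
  is_weak_grad Om f F ->
  partial i (convol (fun y => f y * eta y) rho) x =
  convol (fun y => F y 0 i * eta y + f y * partial i eta y) rho x.
Proof.
move=> oO sr Ce [lf lF fF].
have [seta _ _] := Ce; have Cpe := Cc_smooth_partial i Ce.
have fe := Lp_mul_Cc oO lf Ce; have fpe := Lp_mul_Cc oO lf Cpe; have Fe := Lp_mul_Cc oO (lF i) Ce.
rewrite (partial_conv i x fe sr) /convol.
have sk := smooth_kernel x sr.
have Cpsi : Cc_smooth Om ((fun y => rho (x - y)) * eta) := Cc_smoothMr sk Ce.
have := fF _ Cpsi i; rewrite (Rint_Cc _ Cpsi) (Rint_Cc _ (Cc_smooth_partial i Cpsi)).
have spr := smooth_cs_partial i sr.
have i1 := conv_intg x fpe sr; have i2 := conv_intg x fe spr; have i3 := conv_intg x Fe sr.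
rewrite (Rint_ext (f := fun y => f y * partial i _ y) (g := fun y => f y * partial i eta y * rho (x - y) - f y * eta y * partial i rho (x - y))); last first.
  move=> y; rewrite partialM; [|exact: smooth_derivable|exact: smooth_derivable].
  by rewrite (partial_kernel _ _ _ sr); ring.
rewrite RintegralB//.
rewrite (Rint_ext (f := fun y => F y 0 i * _) (g := fun y => F y 0 i * eta y * rho (x - y))); last first.
  by move=> y; rewrite -[((fun y => rho (x - y)) * eta) y]/(rho (x - y) * eta y); ring.
move=> h; rewrite [in RHS](Rint_ext (g := fun y => F y 0 i * eta y * rho (x - y) + f y * partial i eta y * rho (x - y))); last first.
  by move=> y; rewrite mulrDl.
rewrite RintegralD//; move: h; move: (\int[mu]_y (F y 0 i * _ * _)) (\int[mu]_y (_ * partial i eta y * _)) (\int[mu]_y (_ * partial i rho _)) => a b c.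
by move=> h; lra.
Qed.

Variables (p : R) (p1 : 1 < p).
Local Notation lp := (lpn mu p).
Local Notation vp := (vlpn mu p).

Lemma lpn_mulb f g B : measurable_fun setT f -> measurable_fun setT g -> (forall x, `|g x| <= B) ->
  (lp (fun x => f x * g x)%R <= B%:E * lp f)%E.
Proof.
move=> mf mg HB; have B0 : 0 <= B by apply: le_trans (HB 0); exact: normr_ge0.
rewrite -[X in (X%:E * _)%E](ger0_norm B0) -(lpnZ _ p1 _ mf).
apply: (le_lpn _ p1 (measurable_funM mf mg) (measurable_funM (measurable_cst B) mf)) => x /=.
by rewrite !normrM mulrC; apply: ler_wpM2r => //; apply: le_trans (HB x) (ler_norm _).
Qed.

Variables (n0 : (0 < n)%N) (Om : set E) (oOm : open Om) (bOm : bounded_set Om).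

Lemma Lp_mul_Cc_lty f eta : Cc_smooth Om eta -> Lp Om p f ->
  measurable_fun setT (fun x => f x * eta x) /\ (lp (fun x => f x * eta x)%R < +oo)%E.
Proof.
move=> Ce /(LpP _ _ p1)[mf lf]; have [r _ sr] := Cc_smoothP Ce.
have me := smooth_measurable sr.1.
have -> : (fun x => f x * eta x) = (fun x => (f \_ Om) x * eta x).
  apply/funext => x; rewrite patchE; case: ifPn => // /negP nO.
  by have [_ _ sO] := Ce; rewrite (supp_eq0 sO) ?mulr0// => /mem_set.
split; first exact: (measurable_funM mf me).
have [B B0 HB] := smooth_cs_bounded sr.
by apply: le_lt_trans (lpn_mulb mf me HB) _; apply: lte_mul_pinfty; rewrite ?lee_fin.
Qed.

(** By [conv_product] the gradient of the mollified product is the mollified product rule, so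
    Young's inequality bounds it independently of the radius. *)
Lemma product_H0 f eta : W1p Om p f -> Cc_smooth Om eta -> exists G, H0 Om p (fun x => f x * eta x) G.
Proof.
move=> [Lf [F0 fF0] LF] Ce; have fF := wgradP fF0.
have [mfe lfe] := Lp_mul_Cc_lty Ce Lf; have [[lf _] lF _] := fF.
have fei := Lp_mul_Cc oOm (let: And3 l _ _ := fF in l) Ce.
pose g i y := wgrad Om f y 0 i * eta y + f y * partial i eta y.
have gi i : intg (g i).
  exact: intgD (Lp_mul_Cc oOm (lF i) Ce) (Lp_mul_Cc oOm (let: And3 l _ _ := fF in l) (Cc_smooth_partial i Ce)).
have gl i : (lp (g i) < +oo)%E.
  have [m1 l1] := Lp_mul_Cc_lty Ce (LF i).
  have [m2 l2] := Lp_mul_Cc_lty (Cc_smooth_partial i Ce) Lf.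
  by apply: le_lt_trans (lpnD _ p1 m1 m2) _; rewrite lte_add_pinfty.
have [_ ce sO] := Ce.
have M0 : (0 <= \sum_(i < n) lp (g i))%E by apply: sume_ge0 => i _; exact: lpn_ge0.
have Mfin : (\sum_(i < n) lp (g i))%E \is a fin_num.
  by rewrite ge0_fin_numE//; apply: lte_sum_pinfty => i _.
suff [G HG _] : exists2 G, H0 Om p (fun x => f x * eta x) G &
    (vp G <= (fine (\sum_(i < n) lp (g i)))%:E)%E by exists G.
apply: (mollify_H0 p1 n0 oOm bOm (u := fun x => f x * eta x) (K := supp eta)
   (M := fine (\sum_(i < n) lp (g i))) (r0 := 1)) => //.
- by move=> x h; apply: subset_closure; apply: contraNN h => /eqP ->; rewrite mulr0.
- by rewrite fine_ge0.
- move=> r rho _ mr; have [_ sr _ _] := mr; rewrite fineK//.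
  apply: le_trans (vlpn_le_sum _ p1 (mfield_grad (smooth_conv fei sr))) _.
  apply: lee_sum => i _; apply: le_trans (conv_lpn_le p1 mr (gi i)).
  apply: ereal_eqW; apply: eq_lpn => x; rewrite grad_coord.
  exact: conv_product oOm sr Ce fF.
Qed.

Lemma weak_grad_sub (V : set E) f F : open V -> V `<=` Om -> is_weak_grad Om f F -> is_weak_grad V f F.
Proof.
move=> oV VO [lf lF fF].
have lo g : loc_integrable Om g -> loc_integrable V g.
  move=> [mg lg]; split; first exact: measurable_funS (open_rV_measurable oOm) VO mg.
  by move=> K cK KV; apply: lg => //; exact: subset_trans VO.
split; [exact: lo|by move=> i; exact: lo|].
move=> phi Cphi i; have CO := Cc_smooth_sub VO Cphi.
have := fF _ CO i.
by rewrite (Rint_Cc _ Cphi) (Rint_Cc _ (Cc_smooth_partial i Cphi)) (Rint_Cc _ CO) (Rint_Cc _ (Cc_smooth_partial i CO)).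
Qed.

Lemma weak_grad_eq_fun (V : set E) f g F : open V -> (forall x, V x -> f x = g x) ->
  is_weak_grad V f F -> is_weak_grad V g F.
Proof.
move=> oV fg vF; have [[mf _] lF _] := vF; have mV := open_rV_measurable oV.
apply: (weak_grad_ae mV vF).
- by apply: eq_measurable_fun mf => x /set_mem; exact: fg.
- by move=> i; case: (lF i).
- by apply: aeW.
- by apply: aeW.
Qed.

Lemma weak_grad_eq_on (V : set E) f g F G : open V -> V `<=` Om -> (forall x, V x -> f x = g x) ->
  is_weak_grad Om f F -> is_weak_grad Om g G -> {ae mu, forall x, V x -> F x = G x}.
Proof.
move=> oV VO fg fF gG; apply: (weak_grad_uniq oV _ (weak_grad_sub oV VO gG)).
exact: weak_grad_eq_fun oV fg (weak_grad_sub oV VO fF).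
Qed.

Lemma H0_weak_grad_self u G : H0 Om p u G -> is_weak_grad Om u G.
Proof.
move=> uG; have [mu_ mG _] := uG; have [uo _] := H0_out oOm p1 uG.
have mO := open_rV_measurable oOm.
have uG' : H0 Om p (cutf Om u) G.
  apply: (H0_ae uG) => //; last by apply: aeW.
    by apply/(measurable_restrictT _ mO); exact: measurable_funTS mu_.
  apply: filterS uo => x h; case: (pselect (Om x)) => Ox; first by rewrite cutf_in.
  by rewrite h// cutf_out.
exact: (H0_weak_grad oOm p1 uG').
Qed.

End product.

(** * Lipschitz graphs *)

Lemma limn_einf_ge (R : realType) (u : (\bar R)^nat) (a : \bar R) :
  (\forall k \near \oo, (a <= u k)%E) -> (a <= limn_einf u)%E.
Proof.
move=> [N _ HN]; rewrite limn_einf_lim; apply: lime_ge; first exact: is_cvg_einfs.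
exists N => // k /= Nk; apply: le_ereal_inf_tmp => _ [j /= kj <-].
by apply: HN => /=; exact: leq_trans kj.
Qed.

Lemma limn_einf_le (R : realType) (u : (\bar R)^nat) (a : \bar R) :
  (forall k, (u k <= a)%E) -> (limn_einf u <= a)%E.
Proof.
move=> H; rewrite limn_einf_lim; apply: lime_le; first exact: is_cvg_einfs.
apply: nearW => k; apply: le_trans (H k); apply: ereal_inf_lbound.
by exists k => /=.
Qed.

Lemma measurable_fun_limn_einf d (T : measurableType d) (R : realType) (D : set T)
  (f : (T -> \bar R)^nat) : (forall k, measurable_fun D (f k)) ->
  measurable_fun D (fun x => limn_einf (f ^~ x)).
Proof.
move=> mf; rewrite (_ : (fun x => _) = -%E \o (fun x => limn_esup ((fun k x => - f k x)%E ^~ x)))//.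
apply: measurableT_comp => //; apply: measurable_fun_limn_esup => k.
exact: measurableT_comp (mf k).
Qed.

Section averages.
Context {R : realType} {n : nat}.
Local Notation E := 'rV[R]_n.
Local Notation mu := (@lebesgue_rV R n).

Lemma lebesgue_ball (x : E) (r : R) : 0 < r -> mu [set y : E | `|y - x| < r] = ((2 * r) ^+ n)%:E.
Proof.
move=> r0.
have -> : [set y : E | `|y - x| < r] = [set y | forall i, `]x 0 i - r, x 0 i + r[%classic (y 0 i)].
  apply/seteqP; split => y /= h.
    move=> i; rewrite in_itv/= -ltr_distl; have := coord_norm_le (y - x) i.
    by rewrite !mxE => h'; apply: le_lt_trans h.
  by apply: rV_norm_lt => // i; have := h i; rewrite !mxE in_itv/= -ltr_distl.
rewrite (@lebesgue_rV_box _ _ (fun i => `]x 0 i - r, x 0 i + r[%classic)); last by move=> i; exact: measurable_itv.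
under eq_bigr => i _ do rewrite lebesgue_measure_itv/= lte_fin ltrD2l gtrN// -EFinB.
rewrite (eq_bigr (fun=> (2 * r)%:E)) => [|i _]; last by congr EFin; ring.
by rewrite prodEFin prodr_const card_ord.
Qed.

Lemma measurable_ballE (x : E) (r : R) : measurable [set y : E | `|y - x| < r].
Proof.
have -> : [set y : E | `|y - x| < r] = ~` [set y | r <= `|x - y|].
  by apply/seteqP; split => y /=; rewrite distrC leNgt; [move=> h; apply/negP; rewrite negbK|move=> /negP; rewrite negbK].
by apply: measurableC; apply: closed_rV_measurable; exact: closed_norm_ge.
Qed.

(** Replace [F (S x)] by the average of [F] over the ball of radius [r] about [S x - r *: c]. By
    Tonelli each [y] is counted with the measure of the preimage of a ball under [S], at most [C0]
    times the ball; let [r] tend to 0 with Fatou. The shift by [c] keeps the ball inside [A] even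
    when [S x] lies on its boundary. *)
Lemma average_integral (S : E -> E) (La C0 s0 : R) (c : E) (Z A : set E) (F : E -> R) :
  (forall x y, `|S x - S y| <= La * `|x - y|) -> 0 <= C0 ->
  (forall y r, 0 < r -> (mu [set x | (`|y - S x| < r)%R] <= (C0 * (2 * r) ^+ n)%:E)%E) ->
  measurable Z -> measurable A -> 0 < s0 -> continuous F -> (forall x, 0 <= F x) ->
  (forall r x z, 0 < r < s0 -> Z x -> `|z - (S x - r *: c)| < r -> A z) ->
  (\int[mu]_(x in Z) (F (S x))%:E <= C0%:E * \int[mu]_(x in A) (F x)%:E)%E.
Proof.
move=> SL C00 HS mZ mA s00 cF F0 HZ.
have mF := continuous_rV_measurable cF.
have mS i : measurable_fun setT (fun x => S x 0 i).
  apply: continuous_rV_measurable; apply: (@lipschitz_rV_continuous _ _ R^o _ La) => x y.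
  by apply: le_trans (SL x y); have := coord_norm_le (S x - S y) i; rewrite !mxE.
have cS : continuous S by exact: lipschitz_rV_continuous SL.
pose r (k : nat) : R := s0 * k.+2%:R^-1.
have rk k : 0 < r k < s0.
  by rewrite /r mulr_gt0//= gtr_pMr// invf_lt1// ltr1n.
have r0 k : 0 < r k by case/andP: (rk k).
have r_0 : r @ \oo --> (0 : R).
  rewrite -(mulr0 s0); apply: cvgM; first exact: cvg_cst.
  by rewrite (cvg_shiftS (@harmonic R)); exact: cvg_harmonic.
pose q k : R := ((2 * r k) ^+ n)^-1.
have q0 k : 0 < q k by rewrite invr_gt0 exprn_gt0// mulr_gt0.
pose B k : set (E * E) := [set z | `|z.2 - (S z.1 - r k *: c)| < r k].
have oB k : open [set y : E | `|y| < r k].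
  have -> : [set y : E | `|y| < r k] = ~` [set y | r k <= `|0 - y|].
    by apply/seteqP; split => y /=; rewrite sub0r normrN leNgt; [move=> h; apply/negP; rewrite negbK|move=> /negP; rewrite negbK].
  by rewrite openC; exact: closed_norm_ge.
have mB k : measurable (B k).
  apply: (mfun_open_preimage (F := fun z : E * E => z.2 - (S z.1 - r k *: c)) _ (oB k)) => i.
  rewrite (_ : (fun z => _) = (fun z : E * E => z.2 0 i - (S z.1 0 i - r k * c 0 i))); last first.
    by apply/funext => z; rewrite !mxE.
  apply: measurable_funB; first exact: (measurableT_comp (measurable_coord i) measurable_snd).
  exact: (measurable_funB (measurableT_comp (mS i) measurable_fst) (measurable_cst _)).
(* The averaging kernel on [E * E]. The indicator of [A] costs nothing for [x] in [Z], by [HZ], and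
   localizes the integral in [y]. *)
pose K k (z : E * E) : \bar R := (q k * (F z.2 * \1_A z.2) * \1_(B k) z * \1_Z z.1)%:E.
have mK k : measurable_fun setT (K k).
  have mA' : measurable_fun setT (\1_A : E -> R) by exact: measurable_indic.
  have mZ' : measurable_fun setT (\1_Z : E -> R) by exact: measurable_indic.
  have mB' : measurable_fun setT (\1_(B k) : E * E -> R) by exact: measurable_indic.
  have m1 := measurableT_comp (measurable_funM mF mA') (@measurable_snd _ _ E E).
  have m2 := measurableT_comp mZ' (@measurable_fst _ _ E E).
  apply/measurable_EFinP.
  apply: (measurable_funM (f := fun z => q k * (F z.2 * \1_A z.2) * \1_(B k) z)); last exact: m2.
  by apply: measurable_funM; [apply: measurable_funM; [exact: measurable_cst|exact: m1]|exact: mB'].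
have K0 k z : (0 <= K k z)%E by rewrite lee_fin !mulr_ge0// ltW.
pose avg k x := (\int[mu]_y K k (x, y))%E.
have mFA : measurable_fun setT ((fun x => (F x)%:E) \_ A).
  by apply/(measurable_restrictT _ mA); apply: measurable_funTS; exact/measurable_EFinP.
have avgE k : (\int[mu]_(x in Z) avg k x <= C0%:E * \int[mu]_(x in A) (F x)%:E)%E.
  apply: (@le_trans _ _ (\int[mu]_x avg k x)%E).
    apply: ge0_subset_integral; [exact: mZ|exact: measurableT| | |exact: subsetT].
      exact: measurable_fun_fubini_tonelli_F (mK k) (K0 k).
    by move=> x _; exact: integral_ge0.
  rewrite /avg (fubini_tonelli _ (mK k) (K0 k)).
  rewrite [X in (C0%:E * X)%E]integral_mkcond -ge0_integralZl//; first last.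
  - by move=> x _; rewrite patchE; case: ifP => _; rewrite ?lee_fin.
  apply: ge0_le_integral; first exact: measurableT.
  - by move=> y _; exact: integral_ge0.
  - exact: measurable_fun_fubini_tonelli_G (mK k) (K0 k).
  - by apply: emeasurable_funM; [exact: measurable_cst|exact: mFA].
  move=> y _.
  pose s : set E := [set x : E | `|(y + r k *: c) - S x| < r k].
  have ms : measurable s.
    apply: (mfun_open_preimage (F := fun x : E => (y + r k *: c) - S x) _ (oB k)) => i.
    rewrite (_ : (fun x => _) = (fun x : E => (y + r k *: c) 0 i - S x 0 i)); last by apply/funext => x; rewrite !mxE.
    exact: (measurable_funB (measurable_cst _) (mS i)).
  have mis : measurable_fun setT (\1_s : E -> R) by exact: measurable_indic.
  have mp : measurable_fun setT (fun x : E => (x, y)).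
    by apply: measurable_fun_pair => //; exact: measurable_cst.
  have a0 : 0 <= q k * (F y * \1_A y) by rewrite !mulr_ge0// ltW.
  apply: (@le_trans _ _ (\int[mu]_x ((q k * (F y * \1_A y))%:E * (\1_s x)%:E))%E).
    apply: ge0_le_integral; first exact: measurableT.
    - by move=> x _; exact: K0.
    - exact: (measurableT_comp (mK k) mp).
    - by apply: emeasurable_funM; [exact: measurable_cst|exact/measurable_EFinP].
    move=> x _; rewrite /K /= -EFinM lee_fin.
    have -> : \1_(B k) (x, y) = \1_s x :> R.
      rewrite !indicE /B /s; congr (_ %:R); congr (nat_of_bool _).
      apply/idP/idP => /set_mem /= h; apply/mem_set => /=; move: h.
        by rewrite opprB addrA [y + _]addrC addrC.
      by rewrite opprB addrA [y + _]addrC addrC.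
    by apply: ler_piMr; [rewrite mulr_ge0|rewrite indicE; case: (x \in Z)].
  rewrite ge0_integralZl; [|exact: measurableT|exact/measurable_EFinP|by move=> x _; rewrite lee_fin|by rewrite lee_fin].
  rewrite integral_indic// setIT.
  apply: (@le_trans _ _ ((q k * (F y * \1_A y))%:E * (C0 * (2 * r k) ^+ n)%:E)%E).
    apply: lee_wpmul2l => //; exact: HS.
  rewrite -EFinM patchE indicE; case: (y \in A); last by rewrite /= !mulr0 mul0r mule0.
  rewrite -EFinM lee_fin /= mulr1 le_eqVlt; apply/orP; left; apply/eqP.
  rewrite /q; have : (2 * r k) ^+ n != 0 by rewrite gt_eqF// exprn_gt0// mulr_gt0.
  by move: (_ ^+ n) => w w0; field.
have mavg k : measurable_fun setT (avg k) by exact: measurable_fun_fubini_tonelli_F (mK k) (K0 k).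
have avg0 k x : (0 <= avg k x)%E by exact: integral_ge0.
apply: (@le_trans _ _ (\int[mu]_(x in Z) limn_einf (avg ^~ x))%E); last first.
  apply: le_trans (fatou mu mZ (f := avg) _ _) _.
  - by move=> k; exact: measurable_funTS.
  - by move=> k x _.
  - exact: limn_einf_le.
have mFS : measurable_fun setT (fun x => F (S x)).
  by apply: (mfun_continuous_comp _ cF) => i; exact: mS.
apply: ge0_le_integral; first exact: mZ.
- by move=> x _; rewrite lee_fin.
- by apply/measurable_EFinP; exact: measurable_funTS.
- by apply: measurable_fun_limn_einf => k; exact: measurable_funTS.
move=> x Zx; apply/lee_addgt0Pr => e e0; rewrite -leeBlDr//; apply: limn_einf_ge.
have c0 : 0 < 1 + `|c| by rewrite ltr_wpDr.
have /cvgrPdist_lt/(_ e e0)/nbhs_normP[d /= d0 Hd] := cF (S x).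
have : \forall k \near \oo, `|0 - r k| < d / (1 + `|c|).
  by move/cvgrPdist_lt : r_0; apply; rewrite divr_gt0.
apply: filterS => k; rewrite sub0r normrN (gtr0_norm (r0 k)) ltr_pdivlMr// => rd.
have [Fe|Fe] := leP (F (S x) - e) 0; first by apply: le_trans (avg0 k x); rewrite -EFinB lee_fin.
pose b : set E := [set y | `|y - (S x - r k *: c)| < r k].
have mb : measurable b by exact: measurable_ballE.
have mib : measurable_fun setT (\1_b : E -> R) by exact: measurable_indic.
have a0 : 0 <= q k * (F (S x) - e) by rewrite mulr_ge0 ?ltW.
apply: (@le_trans _ _ (\int[mu]_y ((q k * (F (S x) - e))%:E * (\1_b y)%:E))%E).
  have Ib : (\int[mu]_y (\1_b y)%:E = ((2 * r k) ^+ n)%:E)%E.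
    by rewrite integral_indic// setIT; exact: lebesgue_ball.
  rewrite ge0_integralZl; [|exact: measurableT|exact/measurable_EFinP|by move=> y _; rewrite lee_fin|by rewrite lee_fin].
  apply: le_trans (_ : _ <= (q k * (F (S x) - e))%:E * ((2 * r k) ^+ n)%:E)%E _; last first.
    by apply: lee_wpmul2l; [rewrite lee_fin|exact: ereal_eqW (esym Ib)].
  rewrite -EFinM -EFinB lee_fin le_eqVlt; apply/orP; left; apply/eqP.
  rewrite /q; have : (2 * r k) ^+ n != 0 by rewrite gt_eqF// exprn_gt0// mulr_gt0.
  by move: (_ ^+ n) => w w0; field.
have mp : measurable_fun setT (fun y : E => (x, y)).
  by apply: measurable_fun_pair => //; exact: measurable_cst.
apply: ge0_le_integral; first exact: measurableT.
- by move=> y _; rewrite -EFinM lee_fin mulr_ge0.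
- by apply: emeasurable_funM; [exact: measurable_cst|exact/measurable_EFinP].
- exact: (measurableT_comp (mK k) mp).
move=> y _; rewrite /K -EFinM lee_fin /= [\1_Z x]indicE mem_set// mulr1.
have -> : \1_(B k) (x, y) = \1_b y :> R.
  by rewrite !indicE /B /b; congr (_ %:R); congr (nat_of_bool _); apply/idP/idP => /set_mem /= h; apply/mem_set.
rewrite indicE; case: (boolP (y \in b)) => [/set_mem /= yb|_]; last by rewrite !mulr0.
rewrite !mulr1 indicE mem_set ?mulr1; last exact: (HZ (r k) x).
apply: ler_wpM2l; first exact: ltW.
have ySx : `|S x - y| < d.
  rewrite distrC (_ : y - S x = (y - (S x - r k *: c)) - r k *: c); last by rewrite opprB addrCA [r k *: c + _]addrC addrK.
  apply: le_lt_trans (ler_normB _ _) _; rewrite normrZ (gtr0_norm (r0 k)).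
  by apply: lt_trans rd; rewrite mulrDr mulr1 ltrD2r.
have := Hd y ySx; rewrite /= ltr_distl => /andP[h1 h2].
lra.
Qed.

End averages.

(** * Folding along a Lipschitz graph *)

Section fold.
Context {R : realType} {n : nat}.
Local Notation E := 'rV[R]_n.
Local Notation mu := (@lebesgue_rV R n).
Variables (nu : E) (g : E -> R) (L : R).
Hypothesis nu1 : enorm nu = 1.
Hypothesis gL : forall y z, `|g y - g z| <= L * enorm (y - z).

(* Near a boundary point, the domain bounded by the graph is [height x > 0]. *)
Definition height (x : E) : R := dotv x nu - g (x - dotv x nu *: nu).

Definition reflect (x : E) : E := x - (2 * height x) *: nu.

(** The identity below the graph and the reflection along [nu] above it; all values lie on the side
    [height <= 0], outside the domain. *)
Definition fold (x : E) : E := x - (2 * Num.max 0 (height x)) *: nu.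

Let dnu : dotv nu nu = 1.
Proof. by rewrite -enorm_sqr nu1 expr1n. Qed.

Let nnu : `|nu| <= 1.
Proof. by rewrite -nu1; exact: norm_le_enorm. Qed.

Lemma height_shift x s : height (x + s *: nu) = height x + s.
Proof.
rewrite /height dotvDl dotvZl dnu mulr1 (_ : x + s *: nu - _ = x - dotv x nu *: nu).
  by rewrite addrAC.
by apply/rowP => i; rewrite !mxE; ring.
Qed.

(** Measured in the sup norm: [n] for the component along [nu], and [2 n] for the projection
    orthogonal to [nu] on which [g] acts. *)
Definition height_lip : R := n%:R + `|L| * (2 * n%:R).

Lemma height_lip_ge0 : 0 <= height_lip.
Proof. by rewrite addr_ge0// mulr_ge0. Qed.

Lemma height_lipschitz x y : `|height x - height y| <= height_lip * `|x - y|.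
Proof.
have H1 : `|dotv (x - y) nu| <= n%:R * `|x - y|.
  by apply: le_trans (norm_dotv _ _) _; rewrite nu1 mulr1; exact: enorm_le_norm.
have H2 : enorm ((x - dotv x nu *: nu) - (y - dotv y nu *: nu)) <= 2 * n%:R * `|x - y|.
  have -> : (x - dotv x nu *: nu) - (y - dotv y nu *: nu) = (x - y) - dotv (x - y) nu *: nu.
    by rewrite dotvBl; apply/rowP => i; rewrite !mxE; ring.
  apply: le_trans (enormB _ _) _; rewrite enormZ nu1 mulr1.
  have := enorm_le_norm (x - y); lra.
have H3 : `|g (x - dotv x nu *: nu) - g (y - dotv y nu *: nu)| <= `|L| * (2 * n%:R) * `|x - y|.
  apply: le_trans (gL _ _) _; apply: (@le_trans _ _ (`|L| * enorm (x - dotv x nu *: nu - (y - dotv y nu *: nu)))).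
    by apply: ler_wpM2r; [exact: enorm_ge0|exact: ler_norm].
  by rewrite -mulrA; apply: ler_wpM2l.
rewrite /height (_ : _ - _ - _ = dotv (x - y) nu - (g (x - dotv x nu *: nu) - g (y - dotv y nu *: nu))); last first.
  by rewrite dotvBl; ring.
apply: le_trans (ler_normB _ _) _; rewrite /height_lip mulrDl; exact: lerD.
Qed.

Definition fold_lip : R := 1 + 2 * height_lip.

Lemma fold_lip_ge1 : 1 <= fold_lip.
Proof. by rewrite lerDl mulr_ge0// height_lip_ge0. Qed.

Lemma scale_nu_lipschitz (k : E -> R) x y : `|k x - k y| <= height_lip * `|x - y| ->
  `|(x - (2 * k x) *: nu) - (y - (2 * k y) *: nu)| <= fold_lip * `|x - y|.
Proof.
move=> H; rewrite (_ : x - _ - _ = (x - y) - (2 * (k x - k y)) *: nu); last first.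
  by apply/rowP => i; rewrite !mxE; ring.
apply: le_trans (ler_normB _ _) _; rewrite normrZ /fold_lip [X in _ <= X]mulrDl mul1r; apply: lerD => //.
apply: (@le_trans _ _ `|2 * (k x - k y)|); first by rewrite ler_piMr.
by rewrite normrM ger0_norm// -mulrA ler_wpM2l.
Qed.

Lemma reflect_lipschitz x y : `|reflect x - reflect y| <= fold_lip * `|x - y|.
Proof. by apply: scale_nu_lipschitz; exact: height_lipschitz. Qed.

Lemma fold_lipschitz x y : `|fold x - fold y| <= fold_lip * `|x - y|.
Proof.
apply: (@scale_nu_lipschitz (fun x => Num.max 0 (height x))).
apply: le_trans (height_lipschitz x y); move: (height x) (height y) => a b.
rewrite !maxEle; case: ifP; case: ifP => h1 h2.
- exact: lexx.
- by rewrite subr0 !ger0_norm; lra.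
- by rewrite sub0r normrN (ler0_norm (x := a - b)) ?ger0_norm; lra.
- by rewrite subrr normr0.
Qed.

Lemma height_reflect x : height (reflect x) = - height x.
Proof. by rewrite /reflect -scaleNr height_shift; ring. Qed.

Lemma reflectK x : reflect (reflect x) = x.
Proof. by rewrite {1}/reflect height_reflect /reflect mulrN scaleNr opprK subrK. Qed.

Lemma fold_id x : height x <= 0 -> fold x = x.
Proof. by move=> h; rewrite /fold max_l// mulr0 scale0r subr0. Qed.

Lemma fold_reflect x : 0 < height x -> fold x = reflect x.
Proof. by move=> h; rewrite /fold max_r// ltW. Qed.

Lemma height_fold x : height (fold x) <= 0.
Proof.
have [h|h] := leP (height x) 0; first by rewrite fold_id.
by rewrite fold_reflect// height_reflect oppr_le0 ltW.
Qed.

(** A point folded into a ball lies in that ball or, the reflection being its own inverse, in the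
    ball of radius [fold_lip * r] about the reflected centre. *)
Lemma fold_ball y r : 0 < r ->
  (mu [set x | (`|y - fold x| < r)%R] <= ((1 + fold_lip ^+ n) * (2 * r) ^+ n)%:E)%E.
Proof.
move=> r0; have f0 : 0 < fold_lip by apply: lt_le_trans fold_lip_ge1.
apply: (@le_trans _ _ (mu ([set x | `|x - y| < r] `|` [set x | `|x - reflect y| < fold_lip * r]))).
  apply: le_outer_measure => x /= yx; have [h|h] := leP (height x) 0.
    by left; rewrite distrC -(fold_id h).
  right; rewrite -{1}(reflectK x); apply: le_lt_trans (reflect_lipschitz _ _) _.
  by rewrite ltr_pM2l// distrC -fold_reflect.
apply: le_trans (measureU2 _ _ _) _; try exact: measurable_ballE.
apply: (@le_trans _ _ (((2 * r) ^+ n)%:E + ((2 * (fold_lip * r)) ^+ n)%:E)%E).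
  by apply: leeD; apply: ereal_eqW; apply: lebesgue_ball => //; rewrite mulr_gt0.
rewrite -EFinD lee_fin [X in _ <= X]mulrDl mul1r -exprMn.
by rewrite (_ : 2 * (fold_lip * r) = fold_lip * (2 * r))//; ring.
Qed.

Lemma fold_integral (Z A : set E) (F : E -> R) (s0 : R) : measurable Z -> measurable A -> 0 < s0 ->
  continuous F -> (forall x, 0 <= F x) ->
  (forall x z, Z x -> `|z - fold x| < s0 -> height z < 0 -> A z) ->
  (\int[mu]_(x in Z) (F (fold x))%:E <= (1 + fold_lip ^+ n)%:E * \int[mu]_(x in A) (F x)%:E)%E.
Proof.
(* The averaging balls are moved down by [r * ka]. Within radius [r] the height rises by at most
   [height_lip * r], so [ka = height_lip + 1] keeps it at or below [-r]. *)
move=> mZ mA s00 cF F0 HZ; pose ka := height_lip + 1.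
have ka0 : 0 < ka by rewrite ltr_wpDl// height_lip_ge0.
apply: (average_integral (c := ka *: nu) (s0 := s0 / (1 + ka)) fold_lipschitz) => //.
- by rewrite addr_ge0// exprn_ge0// (le_trans _ fold_lip_ge1).
- exact: fold_ball.
- by rewrite divr_gt0// addr_gt0.
move=> r x z /andP[r0 rs] Zx zr; apply: (HZ x) => //.
  rewrite (_ : z - fold x = (z - (fold x - r *: (ka *: nu))) - r *: (ka *: nu)); last by apply/rowP => i; rewrite !mxE; ring.
  apply: le_lt_trans (ler_normB _ _) _.
  have H : `|r *: (ka *: nu)| <= r * ka.
    by rewrite !normrZ !gtr0_norm// mulrA ler_piMr// mulr_ge0// ltW.
  have k1 : 0 < 1 + ka := addr_gt0 ltr01 ka0.
  have rs' : r * (1 + ka) < s0 by rewrite -ltr_pdivlMr.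
  have e : r * (1 + ka) = r + r * ka by ring.
  move: rs' zr H; rewrite e; move: (`|z - _|) (`|r *: _|) (r * ka) => a b d; lra.
have := height_lipschitz z (fold x - r *: (ka *: nu)); rewrite ler_norml => /andP[_].
rewrite scalerA -scaleNr height_shift.
have H1 := height_fold x.
have H2 : height_lip * `|z - (fold x - r *: (ka *: nu))| <= height_lip * r.
  by apply: ler_wpM2l; [exact: height_lip_ge0|exact: ltW].
move: H2; rewrite scalerA -scaleNr /ka => H2 H3.
have : height_lip * r - r * (height_lip + 1) = - r by ring.
lra.
Qed.

(** The translates of a bounded piece by [nu / (k + 1)] lie at different heights, hence are
    disjoint; they have equal measure and stay in one ball, so this measure is zero. *)
Lemma graph_null (c : R) : mu [set x | height x = 0 /\ `|x| <= c] = 0%E.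
Proof.
pose A : set E := [set x | height x = 0 /\ `|x| <= c].
have ch : continuous height by exact: (@lipschitz_rV_continuous _ _ R^o _ _ height_lipschitz).
have clA : closed A.
  apply: closedI; last first.
    by apply: compact_closed; [exact: norm_hausdorff|exact: ball_closed_compact].
  by apply: (@preimage_closed _ _ height [set y : R | y = 0] (fun x _ => ch x)); exact: closed_eq.
have mA : measurable A by exact: closed_rV_measurable.
pose B k : set E := (fun x => x + k.+1%:R^-1 *: nu) @^-1` A.
have mB k : measurable (B k).
  by rewrite -[B k]setTI; have [+ _] := mu_invariant_shift (k.+1%:R^-1 *: nu : E); apply.
have muB k : mu (B k) = mu A by have [_] := mu_invariant_shift (k.+1%:R^-1 *: nu : E); apply.
have tB : trivIset setT B.
  apply/trivIsetP => i j _ _ ij; apply/seteqP; split => // x [/= [h1 _] [h2 _]].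
  move: h1 h2; rewrite !height_shift => h1 h2; move/eqP: ij; apply.
  have /invr_inj/eqP : (i.+1%:R^-1 : R) = j.+1%:R^-1 by apply: (addrI (height x)); rewrite h1 h2.
  by rewrite eqr_nat => /eqP[].
have mD : measurable [set x : E | `|x| <= c + 1].
  by apply: compact_rV_measurable; exact: ball_closed_compact.
have fD : (mu [set x : E | (`|x| <= c + 1)%R] < +oo)%E.
  by apply: compact_lebesgue_lty; exact: ball_closed_compact.
have BD k : B k `<=` [set x : E | `|x| <= c + 1].
  move=> x [_ /= h]; rewrite -[x](addrK (k.+1%:R^-1 *: nu)); apply: le_trans (ler_normB _ _) _.
  apply: lerD => //; rewrite normrZ ger0_norm ?invr_ge0//.
  by apply: mulr_ile1; rewrite ?invr_ge0// invf_le1// ler1n.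
have muA0 : (0 <= mu A)%E by exact: measure_ge0.
have Afin : mu A \is a fin_num.
  rewrite ge0_fin_numE// -(muB 0%N); apply: le_lt_trans fD.
  by apply: le_measure; rewrite ?inE//; exact: BD.
have H N : (N%:R%:E * mu A <= mu [set x : E | (`|x| <= c + 1)%R])%E.
  apply: (@le_trans _ _ (mu (\big[setU/set0]_(k < N) B k))); last first.
    apply: le_measure; rewrite ?inE//; first exact: bigsetU_measurable.
    by move=> x; rewrite -bigcup_mkord => -[k _]; exact: BD.
  rewrite measure_bigsetU//.
  apply: (@le_trans _ _ (\sum_(k < N) mu A)%E).
    by rewrite -(fineK Afin) sumEFin sumr_const card_ord -EFinM mulr_natl.
  by apply: lee_sum => k _; exact: ereal_eqW (esym (muB k)).
apply/eqP; rewrite eq_le muA0 andbT -(fineK Afin) lee_fin leNgt; apply/negP => A0.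
move: H fD; rewrite -(fineK Afin); case: (mu [set x | _]) => [d| |] // H _; last first.
  by have := H 0%N; rewrite mul0e.
have := H (Num.truncn (d / fine (mu A))).+1; rewrite -EFinM lee_fin -ler_pdivlMr// leNgt.
by rewrite truncnS_gt.
Qed.

End fold.

(** * Extension across a Lipschitz boundary *)

Section extension.
Context {R : realType} {n : nat}.
Local Notation E := 'rV[R]_n.
Local Notation mu := (@lebesgue_rV R n).
Variables (p : R) (p1 : 1 < p).
Local Notation lp := (lpn mu p).
Local Notation vp := (vlpn mu p).
Variable D : set E.
Hypothesis oD : open D.
Implicit Types (chi m b phi w : E -> R) (S : E -> E).

Let p0 : 0 < p. Proof. exact: lt_trans p1. Qed.
Let mD : measurable (~` D). Proof. by apply: measurableC; exact: open_rV_measurable. Qed.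

(** Lipschitz at short distances only, which admits a cutoff times the indicator of the complement
    of [D] when the cutoff vanishes near the boundary. *)
Definition small_lip (t L : R) chi := forall x y, `|x - y| < t -> `|chi x - chi y| <= L * `|x - y|.

(** The integral bound is a change of variables for a map into the complement of [D] with bounded
    multiplicity. [Z] contains a neighbourhood of [N], so that small translations of a function
    supported in [N] stay in [Z]. *)
Definition folding S (t B : R) (Z N : set E) := [/\ measurable Z, (mu Z < +oo)%E,
  (forall x y, N y -> `|x - y| < t -> Z x) &
  forall F : E -> R, continuous F -> (forall x, 0 <= F x) ->
    (\int[mu]_(x in Z) (F (S x))%:E <= B%:E * \int[mu]_(x in ~` D) (F x)%:E)%E].

Definition outer phi : E -> R := fun x => \1_(~` D) x * phi x.
Definition outer_grad phi : E -> E := fun x => \1_(~` D) x *: grad phi x.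

(** Difference quotients replace the gradient, since [T phi] composes [phi] with Lipschitz maps. [C]
    is uniform in [phi]; the second-order Taylor error, which depends on [phi], is absorbed into [d]
    by taking [t0] small. *)
Definition extends (T : (E -> R) -> E -> R) := exists2 C, 0 <= C &
  forall r phi (a : R), smooth_cs r phi -> 0 <= a -> (lp (outer phi) <= a%:E)%E ->
    (vp (outer_grad phi) <= a%:E)%E ->
    continuous (T phi) /\
    forall d, 0 < d -> exists2 t0, 0 < t0 & forall i t, 0 < t < t0 ->
      (lp (fun x => T phi (x + t *: delta_mx 0 i) - T phi x)%R <= ((C * a + d) * t)%:E)%E.

Lemma extendsD T1 T2 : extends T1 -> extends T2 -> extends (fun phi x => T1 phi x + T2 phi x).
Proof.
move=> [C1 C10 H1] [C2 C20 H2]; exists (C1 + C2); first exact: addr_ge0.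
move=> r phi a sp a0 h1 h2; have [c1 G1] := H1 r phi a sp a0 h1 h2; have [c2 G2] := H2 r phi a sp a0 h1 h2.
split; first by move=> x; exact: cvgD (c1 x) (c2 x).
move=> d d0; have d2 : 0 < d / 2 by lra.
have [t1 t10 K1] := G1 _ d2; have [t2 t20 K2] := G2 _ d2.
exists (Num.min t1 t2); first by rewrite lt_min t10.
move=> i t; rewrite lt_min => /and3P[t0 tt1 tt2].
have m1 := continuous_rV_measurable c1; have m2 := continuous_rV_measurable c2.
have B1 := measurable_funB (measurable_shift (t *: delta_mx 0 i) m1) m1.
have B2 := measurable_funB (measurable_shift (t *: delta_mx 0 i) m2) m2.
rewrite (eq_lpn mu p (g := fun x => (T1 phi (x + t *: delta_mx 0 i) - T1 phi x) +
   (T2 phi (x + t *: delta_mx 0 i) - T2 phi x))); last by move=> x; rewrite opprD addrACA.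
apply: le_trans (lpnD _ p1 B1 B2) _.
have -> : ((C1 + C2) * a + d) * t = (C1 * a + d / 2) * t + (C2 * a + d / 2) * t by field.
by rewrite EFinD; apply: leeD; [apply: K1|apply: K2]; rewrite t0.
Qed.

Lemma lpn_fold S t B Z N (La : R) (F : E -> R) (a : R) : folding S t B Z N -> 0 <= B ->
  (forall x y, `|S x - S y| <= La * `|x - y|) -> continuous F -> 0 <= a ->
  (lp (fun x => \1_(~` D) x * F x)%R <= a%:E)%E ->
  (lp (fun x => \1_Z x * F (S x))%R <= (B `^ p^-1 * a)%:E)%E.
Proof.
move=> [mZ fZ _ HF] B0 SL cF a0.
have indE (A : set E) (f : E -> R) : measurable A ->
    (\int[mu]_x (`|\1_A x * f x| `^ p)%:E = \int[mu]_(x in A) (`|f x| `^ p)%:E)%E.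
  move=> mA; rewrite [RHS]integral_mkcond; apply: eq_integral => x _; rewrite patchE indicE.
  by case: (x \in A); rewrite ?mul1r// mul0r normr0 powR0// gt_eqF.
rewrite !(lpn_leP mu p1)//; last by rewrite mulr_ge0// powR_ge0.
rewrite !indE// => h.
have cG : continuous (fun x => `|F x| `^ p).
  move=> x; apply: (@continuous_comp _ _ _ F (fun t : R => `|t| `^ p)); first exact: cF.
  exact: powR_continuous_normr.
apply: le_trans (HF _ cG _) _; first by move=> x; exact: powR_ge0.
rewrite powRM ?powR_ge0// powRVK// EFinM; apply: lee_wpmul2l => //.
Qed.

Lemma enorm_grad_continuous r phi : smooth_cs r phi -> continuous (fun x => enorm (grad phi x)).
Proof.
move=> sp; have /choice[Lf HL] : forall i, exists L, forall x v, `|partial i phi (x + v) - partial i phi x| <= L * `|v|.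
  by move=> i; have [L _ HL] := smooth_cs_lipschitz (smooth_cs_partial i sp); exists L.
apply: (@lipschitz_rV_continuous _ _ R^o _ (\sum_i Lf i)) => x y.
apply: le_trans (ler_dist_enorm _ _) _; apply: le_trans (enorm_le_sum _) _.
rewrite mulr_suml; apply: ler_sum => i _; rewrite !mxE -/(partial i phi x) -/(partial i phi y).
by have := HL i y (x - y); rewrite [y + _]addrC subrK.
Qed.

(** The increment of [chi * (phi \o S)] has three parts: the gradient of [phi] along the increment
    of [S], the increment of [chi] times [phi], and a Taylor remainder of order [t^2]. The first two
    are integrals over [Z] of functions composed with [S], which the folding bound moves outside
    [D]. *)
Lemma extends_term chi S (t1 L La B : R) Z : (forall x, `|chi x| <= 1) -> 0 < t1 -> 0 <= L ->
  small_lip t1 L chi -> 0 <= La -> (forall x y, `|S x - S y| <= La * `|x - y|) -> 0 <= B ->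
  folding S t1 B Z [set y | chi y != 0] ->
  extends (fun phi x => chi x * phi (S x)).
Proof.
move=> chi1 t10 L0 Lchi La0 SL B0 fS; have [mZ fZ NZ HF] := fS.
pose Bp := B `^ p^-1; have Bp0 : 0 <= Bp by exact: powR_ge0.
have cS : continuous S by exact: lipschitz_rV_continuous SL.
have cchi : continuous chi.
  move=> x; apply/(@cvgrPdist_lt _ R^o _ _ (nbhs_filter x)) => e e0.
  have L1 : 0 < L + 1 by rewrite ltr_wpDl.
  have H1 : \forall y \near x, `|x - y| < Num.min t1 (e / (L + 1)).
    by apply/nbhs_normP; exists (Num.min t1 (e / (L + 1))); rewrite //= lt_min t10 divr_gt0.
  apply: filterS H1 => y; rewrite lt_min => /andP[h1]; rewrite ltr_pdivlMr// => h2.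
  apply: le_lt_trans (Lchi _ _ h1) _; apply: le_lt_trans h2; rewrite mulrC.
  by apply: ler_wpM2l => //; rewrite lerDl.
have mi : measurable_fun setT (\1_Z : E -> R) by exact: measurable_indic.
have Zfin : (lp (\1_Z : E -> R) < +oo)%E.
  rewrite (lpn_lty _ p1); apply: le_lt_trans fZ.
  apply: (@le_trans _ _ (\int[mu]_(x in Z) 1)%E); last by rewrite integral_cst// mul1e.
  rewrite [leRHS]integral_mkcond; apply: ereal_eqW; apply: eq_integral => x _; rewrite patchE indicE.
  by case: (x \in Z); rewrite ?normr1 ?powR1// normr0 powR0// gt_eqF.
have [z z0 zE] := lpn_fin Zfin.
exists (Bp * (n%:R * La + L)); first by rewrite mulr_ge0// addr_ge0// mulr_ge0.
move=> r phi a sp a0 h1 h2.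
have cphi := smooth_continuous sp.1.
have cT : continuous (fun x => chi x * phi (S x)).
  move=> x; have cpS := @continuous_comp _ _ _ S phi x (cS x) (cphi (S x)).
  exact: cvgM (cchi x) cpS.
split => // d d0.
have [C C0 HC] := smooth_cs_taylor sp.
have K0 : 0 <= C * La ^+ 2 * z by rewrite !mulr_ge0// sqr_ge0.
have K1 : 0 < C * La ^+ 2 * z + 1 by rewrite ltr_wpDl.
(* Below [t1] the translates stay in [Z]; the second bound makes the Taylor remainder at most
   [d * t]. *)
exists (Num.min t1 (d / (C * La ^+ 2 * z + 1))); first by rewrite lt_min t10 divr_gt0.
move=> i t; rewrite lt_min => /and3P[t0 tt1]; rewrite ltr_pdivlMr// => td.
pose e : E := t *: delta_mx 0 i.
have ne : `|e| <= t.
  apply: rV_norm_le => [|j]; first exact: ltW.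
  rewrite !mxE /= normrM (gtr0_norm t0); case: (_ == _); rewrite ?mulr1n ?mulr0n ?normr1 ?normr0 ?mulr1 ?mulr0//.
  exact: ltW.
have h1' := lpn_fold fS B0 SL cphi a0 h1.
have cg := enorm_grad_continuous sp.
have h2' : (lp (fun x => \1_Z x * enorm (grad phi (S x)))%R <= (Bp * a)%:E)%E.
  apply: (lpn_fold fS B0 SL cg a0); apply: le_trans h2; apply: ereal_eqW; apply: eq_lpn => x.
  by rewrite /outer_grad enormZ ger0_norm// indicE.
have mphiS : measurable_fun setT (fun x => phi (S x)).
  by apply: continuous_rV_measurable => x; exact: (@continuous_comp _ _ _ S phi x (cS x) (cphi (S x))).
have mgS : measurable_fun setT (fun x => enorm (grad phi (S x))).
  by apply: continuous_rV_measurable => x; exact: (@continuous_comp _ _ _ S (fun y => enorm (grad phi y)) x (cS x) (cg (S x))).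
have mT := continuous_rV_measurable cT.
have mA := measurable_funM mi mgS; have mB := measurable_funM mi mphiS.
pose f1 x := (n%:R * La * t) * (\1_Z x * enorm (grad phi (S x))).
pose f2 x := (L * t) * (\1_Z x * phi (S x)).
pose f3 x := (C * La ^+ 2 * t ^+ 2) * \1_Z x.
have mf1 : measurable_fun setT f1 := measurable_funM (measurable_cst _) mA.
have mf2' : measurable_fun setT f2 := measurable_funM (measurable_cst _) mB.
have mf2 : measurable_fun setT (fun x => `|f2 x|) := measurable_normf mf2'.
have mf3 : measurable_fun setT f3 := measurable_funM (measurable_cst _) mi.
have m12 := measurable_funD mf1 mf2.
have i0 x : 0 <= \1_Z x :> R by rewrite indicE.
have f10 x : 0 <= f1 x by rewrite mulr_ge0 ?(mulr_ge0, i0, enorm_ge0)// ?mulr_ge0// ltW.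
have f30 x : 0 <= f3 x := (mulr_ge0 (mulr_ge0 (mulr_ge0 C0 (sqr_ge0 La)) (sqr_ge0 t)) (i0 x)).
apply: (@le_trans _ _ (lp (fun x => (f1 x + `|f2 x|) + f3 x)%R)).
  apply: (le_lpn _ p1 (measurable_funB (measurable_shift e mT) mT) (measurable_funD m12 mf3)) => x.
  rewrite [leRHS]ger0_norm; last by rewrite /= !addr_ge0.
  rewrite /=.
  have [xZ|xZ] := boolP (x \in Z); last first.
    have nZ y : `|x - y| < t1 -> chi y = 0.
      move=> xy; apply/eqP; apply: contraNT xZ => cy; apply/mem_set; exact: (NZ x y).
    rewrite (nZ x) ?subrr ?normr0// (nZ (x + e)) ?mul0r ?subrr ?normr0 ?addr_ge0//.
    by rewrite opprD addrA subrr sub0r normrN; exact: le_lt_trans ne tt1.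
  have iZ : \1_Z x = 1 :> R by rewrite indicE xZ.
  rewrite /f1 /f2 /f3 iZ !mul1r mulr1.
  have xe : `|x + e - x| = `|e| by rewrite addrC addrA addNr add0r.
  rewrite (_ : _ - _ = chi (x + e) * (phi (S (x + e)) - phi (S x)) + (chi (x + e) - chi x) * phi (S x)); last by ring.
  apply: le_trans (ler_normD _ _) _; rewrite !normrM.
  have b1 : `|chi (x + e) - chi x| <= L * t.
    apply: le_trans (Lchi _ _ _) _; rewrite xe; first exact: le_lt_trans ne tt1.
    exact: ler_wpM2l.
  pose v := S (x + e) - S x.
  have nv : `|v| <= La * t by apply: le_trans (SL _ _) _; rewrite xe; exact: ler_wpM2l.
  have b2 : `|phi (S (x + e)) - phi (S x)| <= n%:R * La * t * enorm (grad phi (S x)) + C * La ^+ 2 * t ^+ 2.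
    have := HC (S x) v; rewrite /v [S x + _]addrC subrK -/v => T1.
    have T2 : `|\sum_i v 0 i * partial i phi (S x)| <= n%:R * La * t * enorm (grad phi (S x)).
      have -> : \sum_i v 0 i * partial i phi (S x) = dotv v (grad phi (S x)).
        by apply: eq_bigr => j _; rewrite grad_coord.
      apply: le_trans (norm_dotv _ _) _; apply: ler_wpM2r; first exact: enorm_ge0.
      by apply: le_trans (enorm_le_norm _) _; rewrite -mulrA; exact: ler_wpM2l.
    have T3 : C * `|v| ^+ 2 <= C * La ^+ 2 * t ^+ 2.
      rewrite -mulrA -exprMn; apply: ler_wpM2l => //; rewrite lerXn2r ?nnegrE// mulr_ge0// ltW//.
    have := ler_normD (phi (S (x + e)) - phi (S x) - \sum_i v 0 i * partial i phi (S x)) (\sum_i v 0 i * partial i phi (S x)).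
    rewrite subrK; lra.
  rewrite (ger0_norm L0) (gtr0_norm t0).
  have b3 : `|chi (x + e)| * `|phi (S (x + e)) - phi (S x)| <= `|phi (S (x + e)) - phi (S x)| by exact: ler_piMl.
  have b4 : `|chi (x + e) - chi x| * `|phi (S x)| <= L * t * `|phi (S x)| by exact: ler_wpM2r.
  lra.
apply: le_trans (lpnD _ p1 m12 mf3) _.
apply: (@le_trans _ _ ((((n%:R * La * t) * (Bp * a))%:E + ((L * t) * (Bp * a))%:E) + ((C * La ^+ 2 * t ^+ 2) * z)%:E)%E).
  apply: leeD; last first.
    by rewrite (lpnZ _ p1 _ mi) zE -EFinM (ger0_norm (mulr_ge0 (mulr_ge0 C0 (sqr_ge0 La)) (sqr_ge0 t))).
  apply: le_trans (lpnD _ p1 mf1 mf2) _; apply: leeD.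
    rewrite (lpnZ _ p1 _ mA) ger0_norm; last by rewrite !mulr_ge0// ltW.
    by rewrite [leRHS]EFinM; apply: lee_wpmul2l => //; rewrite lee_fin !mulr_ge0// ltW.
  rewrite lpn_norm (lpnZ _ p1 _ mB) ger0_norm; last by rewrite mulr_ge0// ltW.
  by rewrite [leRHS]EFinM; apply: lee_wpmul2l => //; rewrite lee_fin mulr_ge0// ltW.
rewrite -!EFinD lee_fin.
have tz : C * La ^+ 2 * z * t <= d by move: td K0; rewrite mulrDr mulr1 mulrC; lra.
have -> : (Bp * (n%:R * La + L) * a + d) * t = n%:R * La * t * (Bp * a) + L * t * (Bp * a) + d * t by ring.
rewrite lerD2l (_ : C * La ^+ 2 * t ^+ 2 * z = (C * La ^+ 2 * z * t) * t); last by ring.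
by apply: ler_wpM2r => //; exact: ltW.
Qed.

End extension.

(** * Gluing local folds along the boundary *)

Section glue.
Context {R : realType} {n : nat}.
Local Notation E := 'rV[R]_n.
Local Notation mu := (@lebesgue_rV R n).
Variables (p : R) (p1 : 1 < p).
Local Notation lp := (lpn mu p).
Local Notation vp := (vlpn mu p).
Variable D : set E.
Hypothesis oD : open D.
Implicit Types (chi m b phi w : E -> R) (S : E -> E).

Definition boundary_patch (q : (E -> R) * (E -> E)) := [/\
  forall x, 0 <= q.1 x <= 1,
  exists2 L, 0 <= L & forall x y, `|q.1 x - q.1 y| <= L * `|x - y|,
  exists2 La, 0 <= La & forall x y, `|q.2 x - q.2 y| <= La * `|x - y|,
  exists t B Z, [/\ 0 < t, 0 <= B & folding D q.2 t B Z [set y | q.1 y != 0]] &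
  forall x, q.1 x != 0 -> ~ D x -> q.2 x = x].

(* The factors 1 - q.1 turn the cutoffs q.1 into a partition of unity; each q.2 maps
   the support of q.1 to the outside of D and is the identity there. *)
Fixpoint extend m (l : seq ((E -> R) * (E -> E))) w (x : E) : R :=
  if l is q :: l' then m x * q.1 x * w (q.2 x) + extend (fun x => m x * (1 - q.1 x)) l' w x
  else m x * \1_(~` D) x * w x.

Fixpoint all_patches (l : seq ((E -> R) * (E -> E))) :=
  if l is q :: l' then boundary_patch q /\ all_patches l' else True.

(** If one cutoff is 1 at both points, the factor left over after it vanishes at both. *)
Fixpoint covered (l : seq ((E -> R) * (E -> E))) (x y : E) :=
  if l is q :: l' then (q.1 x = 1 /\ q.1 y = 1) \/ covered l' x y else False.

(** Outside [D] each fold is the identity wherever its cutoff is nonzero, and the weights of all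
    terms add up to [m]. *)
Lemma extend_out l m w x : all_patches l -> ~ D x -> extend m l w x = m x * w x.
Proof.
elim: l m => [|q l IH] m /=; first by move=> _ nD; rewrite indicE mem_set// mulr1.
move=> [[_ _ _ _ qx] al] nD; rewrite IH//.
have [->|/qx/(_ nD) ->] := eqVneq (q.1 x) 0; first by rewrite mulr0 mul0r add0r subr0 mulr1.
ring.
Qed.

Lemma folding_sub S (t t' B : R) Z (N N' : set E) : N' `<=` N -> t' <= t -> folding D S t B Z N -> folding D S t' B Z N'.
Proof.
move=> NN tt [h1 h2 h3 h4]; split => // x y Ny xy.
by apply: (h3 x y); [exact: NN|exact: lt_le_trans tt].
Qed.

(** Induction on the patches. The invariant says that across the boundary, at short distance, the
    remaining factor [m] vanishes or a later patch makes it vanish. At the end of the list [m] is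
    zero near the boundary, so its product with the indicator of the complement of [D] is Lipschitz
    at short distances. *)
Lemma extend_extends l m (L rm : R) : all_patches l -> (forall x, 0 <= m x <= 1) -> 0 <= L ->
  (forall x y, `|m x - m y| <= L * `|x - y|) -> vanish_out rm m ->
  (exists2 t, 0 < t & forall x y, ~ D x -> D y -> `|x - y| < t ->
     (m x = 0 /\ m y = 0) \/ covered l x y) ->
  extends p D (extend m l).
Proof.
elim: l m L => [|q l IH] m L /=.
  move=> _ m01 L0 mL vm [t t0 Ht].
  have mi x : ~ D x -> \1_(~` D) x = 1 :> R by move=> nD; rewrite indicE mem_set.
  have mo x : D x -> \1_(~` D) x = 0 :> R by move=> Dx; rewrite indicE memNset// => /(_ Dx).
  have cr := @ball_closed_compact R n (rm + t).
  have mD' : measurable (~` D) by apply: measurableC; exact: open_rV_measurable.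
  apply: (extends_term p1 oD (chi := fun x => m x * \1_(~` D) x) (S := id) (t1 := t) (L := L) (La := 1) (B := 1)
    (Z := ~` D `&` [set x | `|x| <= rm + t])) => //.
  - move=> x; have /andP[a0 a1] := m01 x; rewrite indicE normrM.
    by rewrite (ger0_norm a0); case: (_ \in _); rewrite ?normr1 ?mulr1// normr0 mulr0.
  - move=> x y xy; case: (pselect (D x)) => Dx; case: (pselect (D y)) => Dy.
    + by rewrite !mo// !mulr0 subrr normr0 mulr_ge0.
    + have [|[-> _]|//] := Ht y x Dy Dx; first by rewrite distrC.
      by rewrite (mo x)// mulr0 mul0r subrr normr0 mulr_ge0.
    + have [[-> _]|//] := Ht x y Dx Dy xy.
      by rewrite (mo y)// mulr0 mul0r subrr normr0 mulr_ge0.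
    + by rewrite !mi// !mulr1.
  - by move=> x y; rewrite mul1r.
  - split.
    + by apply: measurableI => //; exact: compact_rV_measurable.
    + apply: le_lt_trans (compact_lebesgue_lty cr); apply: le_outer_measure => x [] //.
    + move=> x y /= my xy.
      have Dy : ~ D y by move=> Dy; move: my; rewrite mo// mulr0 eqxx.
      have my0 : m y != 0 by apply: contraNN my => /eqP ->; rewrite mul0r.
      split.
        move=> Dx; have [|[h _]|//] := Ht y x Dy Dx; first by rewrite distrC.
        by move: my0; rewrite h eqxx.
      have yr : `|y| <= rm by rewrite leNgt; apply: contraNN my0 => /vm ->.
      rewrite /= -[x](subrK y); apply: le_trans (ler_normD _ _) _; rewrite addrC.
      by apply: lerD => //; exact: ltW.
    + move=> F cF F0; rewrite mul1e; apply: ge0_subset_integral => //.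
      * by apply: measurableI => //; exact: compact_rV_measurable.
      * by apply/measurable_EFinP; apply: measurable_funTS; exact: continuous_rV_measurable.
      * by move=> x _; rewrite lee_fin.
move=> [[q01 [Lq Lq0 qL] [La La0 SL] [t [B [Z [t0 B0 fZ]]]] qD] al] m01 L0 mL vm [s s0 Hs].
have q01' x : 0 <= 1 - q.1 x <= 1 by have /andP[a b] := q01 x; rewrite subr_ge0 b lerBlDr lerDl.
have prodL (f g : E -> R) Lf Lg x y : (forall x, 0 <= f x <= 1) -> (forall x, 0 <= g x <= 1) ->
    `|f x - f y| <= Lf * `|x - y| -> `|g x - g y| <= Lg * `|x - y| ->
    `|f x * g x - f y * g y| <= (Lf + Lg) * `|x - y|.
  move=> f01 g01 hf hg.
  rewrite (_ : _ - _ = (f x - f y) * g x + f y * (g x - g y)); last by ring.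
  apply: le_trans (ler_normD _ _) _; rewrite [leRHS]mulrDl !normrM; apply: lerD.
    have /andP[a b] := g01 x; rewrite (ger0_norm a); apply: le_trans hf; exact: ler_piMr.
  have /andP[a b] := f01 y; rewrite (ger0_norm a); apply: le_trans hg; exact: ler_piMl.
apply: (extendsD p1).
  apply: (extends_term p1 oD (chi := fun x => m x * q.1 x) (t1 := t) (L := L + Lq) (La := La) (B := B) (Z := Z)) => //.
  - move=> x; have /andP[a b] := m01 x; have /andP[c d] := q01 x.
    by rewrite ger0_norm ?mulr_ge0// mulr_ile1.
  - exact: addr_ge0.
  - by move=> x y _; apply: prodL.
  - apply: folding_sub fZ => // x /=; apply: contraNN => /eqP ->; by rewrite mulr0.
apply: (IH _ (L + Lq)) => //.
- move=> x; have /andP[a b] := m01 x; have /andP[c d] := q01' x.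
  by rewrite mulr_ge0// mulr_ile1.
- exact: addr_ge0.
- move=> x y; apply: (prodL m (fun x => 1 - q.1 x)) => //.
  by rewrite (_ : _ - _ = - (q.1 x - q.1 y)) ?normrN//; ring.
- by move=> x rx; rewrite vm// mul0r.
exists s => // x y nx Dy xy.
have [[-> ->]|[[-> ->]|]] := Hs x y nx Dy xy; first by left; rewrite !mul0r.
  by left; rewrite subrr !mulr0.
by right.
Qed.

(** Since [x0] is not in [D] it is fixed by the fold, so a small ball about it is folded into the
    ball where [height] describes [D]. *)
Lemma local_patch x0 : Lipschitz_boundary D -> boundary D x0 ->
  exists q rho, [/\ boundary_patch q, 0 < rho & forall x, `|x - x0| < rho -> q.1 x = 1].
Proof.
move=> HL bx0; have [nu [g [L [nu1 gL /nbhs_normP[dl /= dl0 Hd]]]]] := HL x0 bx0.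
have {}Hd x : `|x - x0| < dl -> D x <-> 0 < height nu g x.
  by move=> xx0; rewrite /height subr_gt0; apply: Hd; rewrite /= distrC.
have nDx0 : ~ D x0 by move=> Dx0; case: bx0 => _; apply; rewrite /interior; exact: open_nbhs_nbhs.
have h0 : height nu g x0 <= 0.
  by rewrite leNgt; apply/negP => h; apply: nDx0; apply/(Hd x0) => //; rewrite subrr normr0.
pose La := fold_lip (n := n) L; have La1 : 1 <= La by exact: fold_lip_ge1.
have La0 : 0 < La by apply: lt_le_trans La1.
(* The fold is Lipschitz with constant [La], so the ball of radius [2 * s] is folded into the one of
   radius [dl / 2]; another [dl / 2] remains for the averaging balls. *)
pose s := dl / (4 * La).
have s0 : 0 < s by rewrite divr_gt0// mulr_gt0.
have Ls : La * s = dl / 4 by rewrite /s; field; rewrite gt_eqF.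
have sd : s <= dl / 4 by rewrite -Ls ler_peMl// ltW.
pose K : set E := [set x | `|x - x0| <= s / 2].
pose O : set E := [set x | `|x - x0| < s].
have oO : open O.
  have -> : O = ~` [set x | s <= `|x0 - x|].
    by apply/seteqP; split => x; rewrite /O /= distrC leNgt; [move=> h; apply/negP; rewrite negbK|move=> /negP; rewrite negbK].
  by rewrite openC; exact: closed_norm_ge.
have cK : compact K.
  have -> : K = (fun x => x + x0) @` [set x | `|x| <= s / 2].
    apply/seteqP; split => [x xK|_ [x xs <-]]; first by exists (x - x0) => //; rewrite subrK.
    by rewrite /K /= addrK.
  apply: continuous_compact; last exact: ball_closed_compact.
  apply: continuous_subspaceT; apply: (@lipschitz_rV_continuous _ _ E _ 1) => x y.
  by rewrite mul1r opprD addrACA subrr addr0.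
have KO : K `<=` O by move=> x; rewrite /K /O /=; lra.
have [b [Cb b01 [t t0 bt]]] := cutoff cK oO KO.
have bO x : b x != 0 -> `|x - x0| < s.
  have [_ _ sO] := Cb; move=> bx; apply: sO; exact: subset_closure.
exists (b, fold nu g), (s / 2); split; last 2 first.
- lra.
- by move=> x xs; apply: (bt x x); rewrite ?subrr ?normr0// /K /= ltW.
have [rb _ sb] := Cc_smoothP Cb.
split => //=.
- have [Lb Lb0 HLb] := smooth_cs_lipschitz sb; exists Lb => // x y.
  by have := HLb y (x - y); rewrite [y + _]addrC subrK.
- by exists La; [exact: ltW|move=> x y; exact: (fold_lipschitz nu1 gL)].
- have mO2 : measurable [set x : E | `|x - x0| < 2 * s] by exact: measurable_ballE.
  exists s, (1 + La ^+ n), [set x | `|x - x0| < 2 * s]; split => //.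
    by rewrite addr_ge0// exprn_ge0// ltW.
  split => //.
  + by rewrite lebesgue_ball ?ltry// mulr_gt0.
  + move=> x y /bO yO xy /=; rewrite (_ : x - x0 = (x - y) + (y - x0)); last by rewrite addrA subrK.
    by apply: le_lt_trans (ler_normD _ _) _; lra.
  + move=> F cF F0.
    apply: (fold_integral nu1 gL (s0 := dl / 2)) => //.
    * by apply: measurableC; exact: open_rV_measurable.
    * by rewrite divr_gt0.
    move=> x z /= xs zf hz.
    have H1 : `|fold nu g x - x0| <= dl / 2.
      have := fold_lipschitz nu1 gL x x0; rewrite (fold_id h0) => /le_trans; apply.
      have : fold_lip (n := n) L * `|x - x0| <= La * (2 * s) by apply: ler_wpM2l; exact: ltW.
      by rewrite mulrCA Ls; lra.
    have H2 : `|z - x0| < dl.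
      rewrite (_ : z - x0 = (z - fold nu g x) + (fold nu g x - x0)); last by rewrite addrA subrK.
      by apply: le_lt_trans (ler_normD _ _) _; lra.
    by move=> /(Hd z H2); rewrite ltNge ltW.
- move=> x /bO xs nDx; apply: fold_id; rewrite leNgt; apply/negP => h; apply: nDx.
  by apply/(Hd x) => //; lra.
Qed.

Lemma seq_pos_min (T : eqType) (s : seq T) (f : T -> R) : (forall a, a \in s -> 0 < f a) ->
  exists2 t, 0 < t & forall a, a \in s -> t <= f a.
Proof.
elim: s => [|a s IH] H; first by exists 1.
have [|t t0 Ht] := IH; first by move=> b bs; apply: H; rewrite inE bs orbT.
exists (Num.min t (f a)); first by rewrite lt_min t0 H// mem_head.
move=> b; rewrite inE => /orP[/eqP ->|/Ht h]; first by rewrite ge_min lexx orbT.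
by rewrite ge_min h.
Qed.

(** Finitely many balls of half the patch radius cover the boundary, with union [V]. The rest of the
    closure of [D] is compact in [D], hence has a margin; a point of [D] closer than that to the
    outside lies in [V], and the outside point is then in the same full ball, where the cutoff is
    1. *)
Lemma boundary_cover : bounded_set D -> Lipschitz_boundary D -> exists l, all_patches l /\
  exists2 t, 0 < t & forall x y, ~ D x -> D y -> `|x - y| < t -> covered l x y.
Proof.
move=> bD HL.
have cD : compact (closure D).
  have [M [_ HM]] := bD.
  apply: (subclosed_compact _ (@ball_closed_compact R n (`|M| + 1))); first exact: closed_closure.
  have cb : closed [set x : E | `|x| <= `|M| + 1].
    by apply: compact_closed; [exact: norm_hausdorff|exact: ball_closed_compact].
  rewrite [X in _ `<=` X](closure_id _).1//; apply: closureS => x Dx /=.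
  by apply: HM => //; have := ler_norm M; lra.
have cB : compact (boundary D).
  apply: subclosed_compact cD _; last by move=> x [].
  by apply: closedD || (apply: closedI; [exact: closed_closure|apply: open_closedC; exact: open_interior]).
have /choice[f Hf] : forall x0, exists q : ((E -> R) * (E -> E)) * R, boundary D x0 ->
    [/\ boundary_patch q.1, 0 < q.2 & forall x, `|x - x0| < q.2 -> q.1.1 x = 1].
  move=> x0; case: (pselect (boundary D x0)) => [/(local_patch HL)[q [rho h]]|nb].
    by exists (q, rho).
  (* A default away from the boundary, where nothing is claimed. *)
  by exists ((fun=> 0, id), 1).
pose W a : set E := [set x | `|x - a| < (f a).2 / 2].
have oW a : open (W a).
  have -> : W a = ~` [set x | (f a).2 / 2 <= `|a - x|].
    by apply/seteqP; split => x; rewrite /W /= distrC leNgt; [move=> h; apply/negP; rewrite negbK|move=> /negP; rewrite negbK].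
  by rewrite openC; exact: closed_norm_ge.
have [A sA HA] : finite_subset_cover (boundary D) W (boundary D).
  move: cB; rewrite compact_cover; apply; first by move=> a _; exact: oW.
  by move=> x bx; exists x => //; rewrite /W /= subrr normr0 divr_gt0//; case: (Hf x bx).
have bA a : a \in finmap.enum_fset A -> boundary D a by move=> aA; have /set_mem := sA a aA.
have [t1 t10 Ht1] : exists2 t, 0 < t & forall a, a \in finmap.enum_fset A -> t <= (f a).2 / 2.
  by apply: seq_pos_min => a /bA /Hf[_ h _]; rewrite divr_gt0.
pose V := \bigcup_(a in [set a | a \in finmap.enum_fset A]) W a.
have oV : open V by apply: bigcup_open => a _; exact: oW.
have cC : compact (closure D `\` V).
  by apply: subclosed_compact cD _; [apply: closedI; [exact: closed_closure|exact: open_closedC]|move=> x []].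
have CD : closure D `\` V `<=` D.
  move=> x [cx nV]; apply: contrapT => nD; apply: nV.
  have [a aA Wx] := HA x (conj cx (fun h => nD (interior_subset h))).
  by exists a.
have [t2 t20 Ht2] := compact_core cC oD CD.
exists [seq (f a).1 | a <- finmap.enum_fset A]; split.
  elim: (finmap.enum_fset A) bA => //= a s IH bs; split.
    by case: (Hf a); first by apply: bs; exact: mem_head.
  by apply: IH => b hb; apply: bs; rewrite inE hb orbT.
exists (Num.min t1 t2); first by rewrite lt_min t10.
move=> x y nDx Dy; rewrite lt_min => /andP[xt1 xt2].
have Vy : V y.
  apply: contrapT => nV; apply: nDx; apply: (Ht2 y) => //; split => //; exact: subset_closure.
have [a /= aA Wa] := Vy.
have h1 := Ht1 a aA; have [_ _ Hq] := Hf a (bA a aA).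
have qy : (f a).1.1 y = 1 by apply: Hq; move: Wa; rewrite /W /=; have [_ ? _] := Hf a (bA a aA); lra.
have qx : (f a).1.1 x = 1.
  apply: Hq; rewrite (_ : x - a = (x - y) + (y - a)); last by rewrite addrA subrK.
  by apply: le_lt_trans (ler_normD _ _) _; move: Wa; rewrite /W /=; lra.
have aA' : a \in finmap.enum_fset A by [].
elim: (finmap.enum_fset A) aA' => //= c s IH; rewrite inE => /orP[/eqP <-|/IH]; [by left|by right].
Qed.

End glue.

(** * Extension of test functions from the outside of the Lipschitz set *)

Section extension_theorem.
Context {R : realType} {n : nat}.
Local Notation E := 'rV[R]_n.
Local Notation mu := (@lebesgue_rV R n).
Variables (p : R) (p1 : 1 < p).
Local Notation lp := (lpn mu p).
Local Notation vp := (vlpn mu p).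
Variables (n0 : (0 < n)%N) (Om : set E) (oOm : open Om) (bOm : bounded_set Om).
Variable D : set E.
Hypothesis oD : open D.
Hypothesis DOm : closure D `<=` Om.
Hypothesis LD : Lipschitz_boundary D.
Implicit Types (phi : E -> R) (G : E -> E).

Let bD : bounded_set D.
Proof.
have [M [Mr HM]] := bOm; exists M; split => // x Mx y Dy; apply: HM Mx _ _.
by apply: DOm; exact: subset_closure.
Qed.

(** Near a boundary point [height] is zero on the boundary: where it is negative the point is not in
    the closure, where it is positive it is interior. Compactness reduces to finitely many null
    graph pieces. *)
Lemma boundary_null : mu (boundary D) = 0%E.
Proof.
have [M [_ HM]] := bOm.
have bM x : closure D x -> `|x| <= `|M| + 1.
  by move=> /DOm Ox; apply: HM Ox; have := ler_norm M; lra.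
have cB : compact (boundary D).
  apply: (subclosed_compact _ (@ball_closed_compact R n (`|M| + 1))); last by move=> x [/bM].
  by apply: closedI; [exact: closed_closure|apply: open_closedC; exact: open_interior].
have loc x0 : boundary D x0 -> exists2 W : set E, open W /\ W x0 & mu (boundary D `&` W) = 0%E.
  move=> bx0; have [nu [g [L [nu1 gL /nbhs_normP[dl /= dl0 Hd]]]]] := LD bx0.
  exists [set x | `|x - x0| < dl].
    split; last by rewrite /= subrr normr0.
    have -> : [set x | `|x - x0| < dl] = ~` [set x | dl <= `|x0 - x|].
      by apply/seteqP; split => x; rewrite /= distrC leNgt; [move=> h; apply/negP; rewrite negbK|move=> /negP; rewrite negbK].
    by rewrite openC; exact: closed_norm_ge.
  apply/eqP; rewrite eq_le measure_ge0 andbT -(graph_null nu1 gL (`|M| + 1)).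
  apply: le_outer_measure => x [[cx nix] /= xd]; split; last exact: bM.
  have ch : continuous (height nu g) by exact: (@lipschitz_rV_continuous _ _ R^o _ _ (height_lipschitz nu1 gL)).
  have near_x : \forall y \near x, `|y - x0| < dl.
    by apply/nbhs_normP; exists (dl - `|x - x0|); rewrite /= ?subr_gt0// => y /= xy;
      rewrite (_ : y - x0 = (y - x) + (x - x0)); [apply: le_lt_trans (ler_normD _ _) _; rewrite (distrC y); lra|rewrite addrA subrK].
  have Hd' y : `|y - x0| < dl -> D y <-> 0 < height nu g y.
    by move=> yx0; rewrite /height subr_gt0; apply: Hd; rewrite /= distrC.
  have [h|h|//] := ltgtP (height nu g x) 0.
    have : \forall y \near x, ~ D y.
      have H1 : \forall y \near x, height nu g y < 0 by exact: (cvgr_lt _ (ch x) _ h).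
      by apply: filterS2 near_x H1 => y /Hd' Dy hy /Dy; rewrite ltNge ltW.
    by move=> /cx[y [Dy]]; move/(_ Dy).
  exfalso; apply: nix.
  have H1 : \forall y \near x, 0 < height nu g y by exact: (cvgr_gt _ (ch x) _ h).
  have : \forall y \near x, D y by apply: filterS2 near_x H1 => y /Hd' Dy hy; apply/Dy.
  by [].
have /choice[W HW] : forall x0, exists W : set E, boundary D x0 -> [/\ open W, W x0 & mu (boundary D `&` W) = 0%E].
  move=> x0; case: (pselect (boundary D x0)) => [/loc[W [h1 h2] h3]|nb]; first by exists W.
  by exists setT.
have [A sA HA] : finite_subset_cover (boundary D) W (boundary D).
  move: cB; rewrite compact_cover; apply; first by move=> a ba; case: (HW a ba).
  by move=> x bx; exists x => //; case: (HW x bx).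
have mB : measurable (boundary D) by exact: compact_rV_measurable.
apply/eqP; rewrite eq_le measure_ge0 andbT.
have bA a : a \in finmap.enum_fset A -> boundary D a by move=> aA; have /set_mem := sA a aA.
have cov : boundary D `<=` \big[setU/set0]_(a <- finmap.enum_fset A) (boundary D `&` W a).
  move=> x bx; have [a /= aA Wx] := HA x bx.
  have aA' : a \in finmap.enum_fset A by [].
  by rewrite -bigcup_seq; exists a.
apply: le_trans (le_outer_measure mu _ _ cov) _.
have H s : (forall a, a \in s -> boundary D a) -> (mu (\big[setU/set0]_(a <- s) (boundary D `&` W a)) <= 0)%E.
  elim: s => [|a s IH] bs; first by rewrite big_nil measure0.
  rewrite big_cons; have ba : boundary D a by apply: bs; exact: mem_head.
  apply: le_trans (outer_measureU2 mu _ _) _.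
  have [_ _ e] := HW a ba; rewrite -[leRHS]adde0; apply: leeD; first exact: ereal_eqW e.
  by apply: IH => b hb; apply: bs; rewrite inE hb orbT.
exact: H.
Qed.

(** The extension equals [phi] outside [D], since the global cutoff is 1 on a ball containing [Om].
    Its gradient agrees there almost everywhere: by locality off the closure of [D], trivially
    outside [Om], and on the boundary because it is null. *)
Lemma extension : exists2 C, 0 <= C & forall phi (a d : R), Cc_smooth Om phi -> 0 <= a -> 0 < d ->
  (lp (outer D phi) <= a%:E)%E -> (vp (outer_grad D phi) <= a%:E)%E ->
  exists psi G, [/\ H0 Om p psi G, {ae mu, forall x, ~ D x -> G x = grad phi x} &
    (vp G <= (C * a + d)%:E)%E].
Proof.
have [r r0 Hr] := bounded_norm_le bOm.
have [l [al [t t0 Ht]]] := boundary_cover oD bD LD.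
have [eta [Ce eta01 [s s0 eta1]]] := cutoff (@ball_closed_compact R n r) openT (@subsetT _ _).
have [re _ se] := Cc_smoothP Ce; have [L L0 HL] := smooth_cs_lipschitz se.
have [C C0 HC] : extends p D (extend D eta l).
  apply: (extend_extends p1 oD (L := L) (rm := re) al eta01 L0).
  - by move=> x y; have := HL y (x - y); rewrite [y + _]addrC subrK.
  - exact: se.2.
  - by exists t => // x y nx Dy xy; right; exact: Ht.
exists (n%:R * C); first by rewrite mulr_ge0.
move=> phi a d Cphi a0 d0 h1 h2.
have sp := Cc_vanish Hr Cphi.
have [cT HT] := HC r phi a sp a0 h1 h2.
pose psi := extend D eta l phi.
have psi_out x : ~ D x -> psi x = phi x.
  move=> nD; rewrite /psi extend_out//.
  have [xr|xr] := leP `|x| r; last by rewrite sp.2// mulr0.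
  by rewrite (eta1 x x) ?mul1r// subrr normr0.
have n1 : 0 < (n%:R + 1 : R) by rewrite ltr_wpDl.
(* The passage from difference quotients to the gradient costs a factor [n], and
   [n / (n + 1) * d <= d]. *)
have [t1 t10 Ht1] := HT (d / (n%:R + 1)) (divr_gt0 d0 n1).
have [_ cs sO] := Cphi.
have [G HG vG] : exists2 G, H0 Om p psi G & (vp G <= (n%:R * (C * a + d / (n%:R + 1)))%:E)%E.
  apply: (partial_translate_H0 p1 n0 oOm bOm (K := supp phi `|` closure D) (t0 := t1)) => //.
  - apply: compactU => //.
    have [M [_ HM]] := bOm.
    apply: (subclosed_compact _ (@ball_closed_compact R n (`|M| + 1))); first exact: closed_closure.
    by move=> x /DOm Ox; apply: HM Ox; have := ler_norm M; lra.
  - by move=> x [/sO|/DOm].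
  - move=> x; case: (pselect (D x)) => Dx; first by move=> _; right; exact: subset_closure.
    by rewrite psi_out// => h; left; exact: subset_closure.
  - by rewrite addr_ge0 ?mulr_ge0// ltW// divr_gt0.
exists psi, G; split => //; last first.
  apply: le_trans vG _; rewrite lee_fin mulrDr mulrA lerD2l mulrA ler_pdivrMr// mulrC.
  by apply: ler_wpM2l; [exact: ltW|rewrite lerDl].
have oV : open (Om `\` closure D) by rewrite setDE; apply: openI => //; rewrite openC; exact: closed_closure.
have VO : Om `\` closure D `<=` Om by move=> x [].
have E1 : {ae mu, forall x, (Om `\` closure D) x -> G x = grad phi x}.
  have fg x : (Om `\` closure D) x -> psi x = phi x.
    by move=> [_ nc]; apply: psi_out => Dx; apply: nc; exact: subset_closure.
  have w1 := H0_weak_grad_self p1 oOm HG; have w2 := weak_grad_smooth Cphi.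
  exact: (weak_grad_eq_on oOm oV VO fg w1 w2).
have [_ E2] := H0_out oOm p1 HG.
have E3 : {ae mu, forall x, ~ boundary D x}.
  have mB : measurable (boundary D).
    by apply: closed_rV_measurable; apply: closedI; [exact: closed_closure|apply: open_closedC; exact: open_interior].
  by exists (boundary D); split => //; [exact: boundary_null|move=> x /= /contrapT].
apply: filterS3 E1 E2 E3 => x e1 e2 e3 nD.
case: (pselect (Om x)) => Ox; last first.
  rewrite e2//; apply/rowP => i; rewrite grad_coord mxE.
  by have [_ _ sO'] := Cc_smooth_partial i Cphi; rewrite (supp_eq0 sO' Ox).
apply: e1; split => // cx; apply: e3; split => // /interior_subset; exact: nD.
Qed.

End extension_theorem.

(** * Correction inside the insulator *)

Section correction.
Context {R : realType} {n : nat}.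
Local Notation E := 'rV[R]_n.
Local Notation mu := (@lebesgue_rV R n).
Variables (p : R) (p1 : 1 < p).
Local Notation lp := (lpn mu p).
Local Notation vp := (vlpn mu p).
Variables (n0 : (0 < n)%N) (Om : set E) (oOm : open Om) (bOm : bounded_set Om).
Variable D : set E.
Hypothesis oD : open D.
Hypothesis DOm : closure D `<=` Om.
Hypothesis LD : Lipschitz_boundary D.
Implicit Types (phi : E -> R) (G H W : E -> E).

Definition off G : E -> E := fun x => \1_(~` D) x *: G x.

Let mi : measurable_fun setT (\1_(~` D) : E -> R).
Proof. by apply: measurable_indic; apply: measurableC; exact: open_rV_measurable. Qed.

Lemma off_in G x : ~ D x -> off G x = G x.
Proof. by move=> nD; rewrite /off indicE mem_set// scale1r. Qed.

Lemma off_out G x : D x -> off G x = 0.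
Proof. by move=> Dx; rewrite /off indicE memNset ?scale0r// => /(_ Dx). Qed.

Lemma mfield_off G : mfield G -> mfield (off G).
Proof. exact: mfieldZ. Qed.

Lemma off_le G : mfield G -> (vp (off G) <= vp G)%E.
Proof.
move=> mG; apply: (le_vlpn _ p1 (mfield_off mG) mG) => x.
case: (pselect (D x)) => Dx; first by rewrite off_out// enorm0 enorm_ge0.
by rewrite off_in.
Qed.

Lemma offD_le G H : mfield G -> mfield H -> (vp (off (fun x => G x + H x)%R) <= vp (off G) + vp (off H))%E.
Proof.
move=> mG mH; apply: le_trans (vlpnD _ p1 (mfield_off mG) (mfield_off mH)); apply: ereal_eqW.
by apply: eq_lpn => x; rewrite /off scalerDr.
Qed.

Lemma off_ae G H : mfield G -> mfield H -> {ae mu, forall x, ~ D x -> G x = H x} -> vp (off G) = vp (off H).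
Proof.
move=> mG mH GH; apply: (ae_eq_vlpn p (mfield_off mG) (mfield_off mH)).
apply: filterS GH => x h; case: (pselect (D x)) => Dx; first by rewrite !off_out.
by rewrite !off_in// h.
Qed.

Lemma off_eq0 G : mfield G -> vp (off G) = 0%E -> {ae mu, forall x, ~ D x -> G x = 0}.
Proof.
move=> mG /(vlpn_eq0 p1 (mfield_off mG)); apply: filterS => x h nD.
by rewrite -h off_in.
Qed.

Lemma H0_mfield u G : H0 Om p u G -> mfield G.
Proof. by case. Qed.

Lemma grad_cst0 x : grad (cst 0 : E -> R) x = 0.
Proof. by apply/rowP => i; rewrite grad_coord mxE partial_cst. Qed.

Lemma H0_zero : H0 Om p (fun=> 0) (fun=> 0).
Proof.
have := H0_smooth p1 (Cc_smooth0 Om); congr H0.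
by apply/funext => x; exact: grad_cst0.
Qed.

(** The partial sums of the [W j] have, off [D], the gradients [grad (phi j) - grad (phi 0)], and
    inside [D] they stay controlled by the [W j]. The geometric sum gives [2 * e], and [e <= 1]
    makes the steps small enough for completeness. *)
Lemma telescoping (phi : nat -> E -> R) (w : nat -> E -> R) (W : nat -> E -> E) (e : R) :
  (forall j, Cc_smooth Om (phi j)) -> (forall j, H0 Om p (w j) (W j)) ->
  (forall j, {ae mu, forall x, ~ D x -> W j x = grad (phi j.+1) x - grad (phi j) x}) ->
  0 <= e <= 1 -> (forall j, (vp (W j) <= (e * 2^-1 ^+ j)%:E)%E) ->
  exists v H, [/\ H0 Om p v H, (vp H <= (2 * e)%:E)%E &
    forall j, (vp (off (fun x => H x - (grad (phi j) x - grad (phi 0%N) x))%R) <= (n%:R * (2 * 2^-1 ^+ j))%:E)%E].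
Proof.
move=> Cphi wW Wae /andP[e0 e1] We.
pose u := fix u j : E -> R := if j is j'.+1 then fun x => u j' x + 1 * w j' x else fun=> 0.
pose U := fix U j : E -> E := if j is j'.+1 then fun x => U j' x + 1 *: W j' x else fun=> 0.
have mW j : mfield (W j) by exact: H0_mfield (wW j).
have uU j : H0 Om p (u j) (U j).
  by elim: j => [|j IH]; [exact: H0_zero|exact: (H0_lin p1 1 IH (wW j))].
have mU j : mfield (U j) by exact: H0_mfield (uU j).
have half0 j : 0 <= 2^-1 ^+ j :> R by rewrite exprn_ge0// invr_ge0.
have dU j : (vp (fun x => U j.+1 x - U j x)%R <= (2^-1 ^+ j)%:E)%E.
  apply: (@le_trans _ _ (vp (W j))).
    by apply: ereal_eqW; apply: eq_lpn => x /=; rewrite scale1r addrC addKr.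
  by apply: le_trans (We j) _; rewrite lee_fin ler_piMl.
have [v [H [vH HU]]] := H0_complete p1 n0 bOm uU dU.
have mH := H0_mfield vH.
have vU j : (vp (U j) <= (e * (2 - 2 * 2^-1 ^+ j))%:E)%E.
  elim: j => [|j IH]; first by rewrite expr0 mulr1 subrr mulr0 /= vlpn0.
  rewrite (_ : U j.+1 = fun x => U j x + W j x); last by apply/funext => x /=; rewrite scale1r.
  apply: le_trans (vlpnD _ p1 (mU j) (mW j)) _.
  rewrite (_ : e * (2 - 2 * 2^-1 ^+ j.+1) = e * (2 - 2 * 2^-1 ^+ j) + e * 2^-1 ^+ j).
    by rewrite EFinD; exact: leeD.
  by rewrite exprS; field.
exists v, H; split => //.
  apply: (lee_eps_scale (C := 1)) => // d d0.
  have [N HN] := exp_half_lt (n%:R * 2) d0.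
  rewrite mul1r /vlpn (eq_lpn mu p (g := fun x => enorm (U N x + (H x - U N x)))); last by move=> x; rewrite addrC subrK.
  apply: le_trans (vlpnD _ p1 (mU N) (mfieldB mH (mU N))) _.
  rewrite EFinD; apply: leeD.
    apply: le_trans (vU N) _; rewrite lee_fin mulrC; apply: ler_wpM2r => //.
    by rewrite gerBl mulr_ge0.
  by apply: le_trans (HU N) _; rewrite lee_fin mulrA; exact: HN.
move=> j; have mg k : mfield (grad (phi k)) by exact: Cc_mgrad (Cphi k).
apply: le_trans (HU j); apply: le_trans (off_le (mfieldB mH (mU j))); apply: ereal_eqW.
apply: off_ae; [exact: (mfieldB mH (mfieldB (mg j) (mg 0%N)))|exact: (mfieldB mH (mU j))|].
have : {ae mu, forall x, ~ D x -> U j x = grad (phi j) x - grad (phi 0%N) x}.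
  elim: j => [|j IH]; first by apply: aeW => x _ /=; rewrite subrr.
  apply: filterS2 IH (Wae j) => x h1 h2 nD /=.
  by rewrite h1// h2// scale1r addrC addrA subrK.
by apply: filterS => x h nD; rewrite h.
Qed.

(** Only the gradients must agree off [D], so the function itself may change by constants on
    components of [Om] cut off by [D]. *)
Definition admissible phi (c : R) := exists psi G, [/\ H0 Om p psi G,
  {ae mu, forall x, ~ D x -> G x = grad phi x} & (vp G <= c%:E)%E].

(* Rescaling phi by the norm of its best modification inside D. *)
Lemma bad_function (k : nat) : (exists phi (q d : R), [/\ Cc_smooth Om phi, 0 <= q, 0 < d,
    (vp (off (grad phi)) <= q%:E)%E & ~ admissible phi (k.+1%:R * q + d)]) ->
  exists phi, [/\ Cc_smooth Om phi, (vp (grad phi) <= 3%:E)%E,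
    (vp (off (grad phi)) <= (2 * k.+1%:R^-1)%:E)%E & ~ admissible phi 4^-1].
Proof.
move=> [phi [q [d [Cphi q0 d0 hq nadm]]]].
pose V : set R := [set c | 0 <= c /\ admissible phi c].
have [c0 c00 c0E] := vlpn_fin (Cc_grad_lty p1 Cphi).
have V0 : V !=set0.
  exists c0; split => //; exists phi, (grad phi); split; [exact: H0_smooth|by apply: aeW|by rewrite c0E].
have admW c c' : c <= c' -> admissible phi c -> admissible phi c'.
  move=> cc [psi [G [h1 h2 h3]]]; exists psi, G; split => //.
  by apply: le_trans h3 _; rewrite lee_fin.
have Vlb : lbound V (k.+1%:R * q + d).
  move=> c [_ hc]; rewrite leNgt; apply/negP => h; apply: nadm; exact: admW (ltW h) hc.
have Vinf : has_inf V by split => //; exists (k.+1%:R * q + d).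
pose N := inf V.
have Nge : k.+1%:R * q + d <= N by exact: lb_le_inf.
have N0 : 0 < N by apply: lt_le_trans Nge; rewrite ltr_wpDl// mulr_ge0.
(* The infimum [N] is positive, so some modification costs less than [2 * N]; divided by [N], it has
   gradient norm at most 2. *)
have [c [c_0 [psi [G [HG Gae vG]]]] cN] := inf_adherent (eps := N) N0 Vinf.
have {}cN : c < 2 * N by move: cN; rewrite -/N; lra.
have mG := H0_mfield HG.
(* The smoothing error. As [t <= 1/2], both [2 + t <= 3] and [1/4 + t < 1] hold; as [t <= 1/(k+1)],
   the norm off [D] stays below [2/(k+1)]. *)
pose t : R := k.+2%:R^-1.
have t0 : 0 < t by rewrite invr_gt0.
have t2 : t <= 2^-1 by rewrite lef_pV2 ?posrE// ler_nat.
have HcG : H0 Om p (fun x => 0 + N^-1 * psi x) (fun x => 0 + N^-1 *: G x).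
  exact: (H0_lin p1 _ H0_zero HG).
have [mcp mcG appr] := HcG.
have [phi' Cphi' [a1 a2]] := appr t t0.
have mphi' := Cc_mgrad Cphi'.
have vcG : (vp (fun x => 0 + N^-1 *: G x)%R <= 2%:E)%E.
  rewrite /vlpn (eq_lpn mu p (g := fun x => enorm (N^-1 *: G x))); last by move=> x; rewrite add0r.
  apply: le_trans (ereal_eqW (vlpnZ mu p1 N^-1 mG)) _; rewrite gtr0_norm ?invr_gt0//.
  apply: (@le_trans _ _ ((N^-1)%:E * c%:E)%E); first by apply: lee_wpmul2l => //; rewrite lee_fin invr_ge0 ltW.
  by rewrite -EFinM lee_fin mulrC ler_pdivrMr// ltW.
exists phi'; split => //.
- rewrite /vlpn (eq_lpn mu p (g := fun x => enorm ((0 + N^-1 *: G x) - ((0 + N^-1 *: G x) - grad phi' x)))); last by move=> x; rewrite subKr.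
  apply: le_trans (vlpnB _ p1 mcG (mfieldB mcG mphi')) _.
  by apply: (@le_trans _ _ (2%:E + t%:E)%E); [exact: leeD|rewrite -EFinD lee_fin; lra].
- have mgphi := Cc_mgrad Cphi.
  have e1 : (vp (off (fun x => N^-1 *: grad phi x)) <= (k.+1%:R^-1)%:E)%E.
    rewrite /vlpn (eq_lpn mu p (g := fun x => enorm (N^-1 *: off (grad phi) x))); last first.
      by move=> x; rewrite /off !scalerA mulrC.
    apply: le_trans (ereal_eqW (vlpnZ mu p1 N^-1 (mfield_off mgphi))) _; rewrite gtr0_norm ?invr_gt0//.
    apply: (@le_trans _ _ ((N^-1)%:E * q%:E)%E); first by apply: lee_wpmul2l => //; rewrite lee_fin invr_ge0 ltW.
    rewrite -EFinM lee_fin mulrC ler_pdivrMr// mulrC ler_pdivlMr// mulrC; lra.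
  have e2 : (vp (off (fun x => grad phi' x - (0 + N^-1 *: G x))%R) <= t%:E)%E.
    apply: le_trans (off_le (mfieldB mphi' mcG)) _; apply: le_trans a2; apply: ereal_eqW.
    exact: vlpn_distC.
  have mNphi := mfieldcZ N^-1 mgphi.
  apply: (@le_trans _ _ (vp (off (fun x => (grad phi' x - (0 + N^-1 *: G x)) + N^-1 *: grad phi x)))).
    apply: ereal_eqW; apply: off_ae; [exact: mphi'|exact: (mfieldD (mfieldB mphi' mcG) mNphi)|].
    by apply: filterS Gae => x h nD; rewrite h// add0r subrK.
  apply: le_trans (offD_le (mfieldB mphi' mcG) mNphi) _.
  apply: (@le_trans _ _ (t%:E + (k.+1%:R^-1)%:E)%E); first exact: leeD.
  rewrite -EFinD lee_fin.
  have : t <= k.+1%:R^-1 by rewrite lef_pV2 ?posrE// ler_nat.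
  by move: (k.+1%:R^-1) => z; lra.
move=> [psi' [G' [HG' G'ae vG']]].
have mG' := H0_mfield HG'.
have HB := H0_lin p1 N H0_zero (H0_lin p1 1 HG' (H0_Blin p1 HcG (H0_smooth p1 Cphi'))).
(* A modification of [phi'] of cost [1/4], with the smoothing error undone and rescaled by [N],
   would modify [phi] at a cost below the infimum. *)
have : V (N * (4^-1 + t)).
  split; first by apply: mulr_ge0; [exact: ltW|apply: addr_ge0; [rewrite invr_ge0|exact: ltW]].
  do 2 eexists; split; first exact: HB.
    apply: filterS2 Gae G'ae => x h1 h2 nD /=.
    rewrite h1// h2// !add0r scale1r addrC subrK scalerA divff ?scale1r//.
    by rewrite gt_eqF.
  have mB := mfieldB mcG mphi'.
  rewrite /vlpn (eq_lpn mu p (g := fun x => enorm (N *: (G' x + ((0 + N^-1 *: G x) - grad phi' x))))); last first.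
    by move=> x; rewrite add0r scale1r.
  apply: le_trans (ereal_eqW (vlpnZ mu p1 N (mfieldD mG' mB))) _; rewrite gtr0_norm//.
  rewrite EFinM; apply: lee_wpmul2l; first by rewrite lee_fin ltW.
  apply: le_trans (vlpnD _ p1 mG' mB) _; rewrite EFinD; exact: leeD.
move=> /(ge_inf (ex_intro _ _ Vlb)); rewrite -/N leNgt => /negP; apply.
by rewrite gtr_pMr//; lra.
Qed.

Lemma correction : exists2 C, 0 <= C & forall phi (q d : R), Cc_smooth Om phi -> 0 <= q -> 0 < d ->
  (vp (off (grad phi)) <= q%:E)%E -> admissible phi (C * q + d).
Proof.
apply: contrapT => nC.
have /choice[phi Hphi] : forall k : nat, exists phi, [/\ Cc_smooth Om phi, (vp (grad phi) <= 3%:E)%E,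
    (vp (off (grad phi)) <= (2 * k.+1%:R^-1)%:E)%E & ~ admissible phi 4^-1].
  move=> k; apply: bad_function; apply: contrapT => nb; apply: nC; exists k.+1%:R => // phi q d C0 q0 d0 hq.
  by apply: contrapT => na; apply: nb; exists phi, q, d.
have Cphi k : Cc_smooth Om (phi k) by case: (Hphi k).
have mphi k := Cc_mgrad (Cphi k).
have vphi k : (vp (grad (phi k)) <= 3%:E)%E by case: (Hphi k).
have ophi k : (vp (off (grad (phi k))) <= (2 * k.+1%:R^-1)%:E)%E by case: (Hphi k).
have [F [FU Foo]] := ultraFilterLemma eventually_filter.
have [C C0 HC] := extension p1 n0 oOm bOm oD DOm LD.
have Cd k l : Cc_smooth Om (phi k + cst (-1) * phi l) := Cc_smoothD (Cphi k) (Cc_smoothZ (-1) (Cphi l)).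
have gd k l x : grad (phi k + cst (-1) * phi l) x = grad (phi k) x - grad (phi l) x.
  have [sk _ _] := Cphi k; have [sl _ _] := Cphi l.
  by rewrite (gradD _ sk (smoothM (smooth_cst (-1)) sl)) gradZ// scaleN1r.
have half0 j : 0 < 2^-1 ^+ j :> R by rewrite exprn_gt0// invr_gt0.
(* The factor [1/8] is half the threshold [1/4] refuted for every [phi k], because telescoping
   doubles it. *)
have /choice[A HA] : forall j : nat, exists A : set nat, [/\ F A, A `<=` [set k | (j <= k)%N] &
    forall k l, A k -> A l -> admissible (phi k + cst (-1) * phi l) (8^-1 * 2^-1 ^+ j)].
  (* The extension costs [C * a] plus a slack, each at most [2^-j / 16]. *)
  move=> j; pose a := 16^-1 * 2^-1 ^+ j / (C + 1).
  have C1 : 0 < C + 1 by rewrite ltr_wpDl.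
  have a0 : 0 < a by rewrite divr_gt0// mulr_gt0.
  have [B FB HB] := rellich p1 n0 bOm FU Cphi (ler0n _ 3) vphi a0.
  have [N Na] := exists_invn_lt (divr_gt0 a0 (ltr0n _ 4)).
  exists (B `&` [set k | (maxn j N <= k)%N]); split.
  - by apply: filterI => //; apply: Foo; exists (maxn j N).
  - by move=> k [_ /=]; rewrite geq_max => /andP[].
  move=> k l [Bk /= kN] [Bl /= lN].
  have small i : (maxn j N <= i)%N -> 2 * i.+1%:R^-1 <= a / 2.
    move=> iN; have : i.+1%:R^-1 <= N.+1%:R^-1 :> R.
      by rewrite lef_pV2 ?posrE// ler_nat ltnS; apply: leq_trans iN; exact: leq_maxr.
    move: Na; move: (i.+1%:R^-1) (N.+1%:R^-1) => x y; lra.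
  have d16 : 0 < 16^-1 * 2^-1 ^+ j :> R by apply: mulr_gt0 => //; rewrite invr_gt0.
  have [||psi [G [h1 h2 h3]]] := HC (phi k + cst (-1) * phi l) a (16^-1 * 2^-1 ^+ j) (Cd k l) (ltW a0) d16.
  - have mk := Cc_measurable (Cphi k); have ml := Cc_measurable (Cphi l).
    apply: le_trans (HB k l Bk Bl).
    apply: (le_lpn _ p1 (measurable_funM mi (Cc_measurable (Cd k l))) (measurable_funB mk ml)) => x /=.
    rewrite -[(phi k + cst (-1) * phi l) x]/(phi k x + -1 * phi l x) mulN1r normrM ler_piMl//.
    by rewrite indicE; case: (_ \in _); rewrite ?normr1 ?normr0.
  - apply: (@le_trans _ _ (vp (off (fun x => grad (phi k) x + - grad (phi l) x)))).
      by apply: ereal_eqW; apply: eq_lpn => x; rewrite /outer_grad /off gd.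
    have mNl : mfield (fun x => - grad (phi l) x).
      rewrite (_ : (fun x => _) = (fun x => -1 *: grad (phi l) x)); last by apply/funext => x; rewrite scaleN1r.
      exact: (mfieldcZ _ (mphi l)).
    apply: le_trans (offD_le (mphi k) mNl) _.
    have -> : vp (off (fun x => - grad (phi l) x)) = vp (off (grad (phi l))).
      by rewrite -[RHS]vlpnN; apply: eq_lpn => x; rewrite /off scalerN.
    apply: (@le_trans _ _ ((a / 2)%:E + (a / 2)%:E)%E); last by rewrite -EFinD lee_fin; lra.
    by apply: leeD; [apply: le_trans (ophi k) _|apply: le_trans (ophi l) _]; rewrite lee_fin small.
  exists psi, G; split => //; apply: le_trans h3 _; rewrite lee_fin.
  have : C * a <= 16^-1 * 2^-1 ^+ j.
    rewrite /a mulrA ler_pdivrMr// mulrC; apply: ler_wpM2l; last by rewrite lerDl.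
    by rewrite mulr_ge0// ltW.
  move: (2^-1 ^+ j) => z; lra.
(* The index [kap j] lies in all [A i] with [i <= j], so both [kap j] and [kap j.+1] lie in
   [A j]. *)
have /choice[kap Hkap] : forall j, exists k, forall i, (i <= j)%N -> A i k.
  move=> j; have FB : F (\bigcap_(i in [set i | (i <= j)%N]) A i).
    elim: j => [|j IH].
      have [FA0 _ _] := HA 0%N; apply: filterS FA0 => k Ak i /=; rewrite leqn0 => /eqP ->; exact: Ak.
    have [FA1 _ _] := HA j.+1; apply: filterS2 IH FA1 => k h1 h2 i /=; rewrite leq_eqVlt => /orP[/eqP -> //|].
    by rewrite ltnS => ij; exact: (h1 i ij).
  have [k Hk] := filter_ex FB; exists k => i ij; exact: (Hk i ij).
have kj j : (j <= kap j)%N by have [_ h _] := HA j; exact: (h _ (Hkap j j (leqnn j))).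
have /choice[wW HwW] : forall j, exists wW : (E -> R) * (E -> E), [/\ H0 Om p wW.1 wW.2,
    {ae mu, forall x, ~ D x -> wW.2 x = grad (phi (kap j.+1)) x - grad (phi (kap j)) x} &
    (vp wW.2 <= (8^-1 * 2^-1 ^+ j)%:E)%E].
  move=> j; have [_ _ h] := HA j.
  have [psi [G [h1 h2 h3]]] := h _ _ (Hkap j.+1 j (leqnSn j)) (Hkap j j (leqnn j)).
  by exists (psi, G); split => //; apply: filterS h2 => x hx nD /=; rewrite hx// gd.
have [|||||v [H [vH H4 Hoff]]] := telescoping (phi := fun j => phi (kap j)) (w := fun j => (wW j).1) (W := fun j => (wW j).2) (e := 8^-1).
- by move=> j; exact: Cphi.
- by move=> j; case: (HwW j).
- by move=> j; case: (HwW j).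
- by apply/andP; split; lra.
- by move=> j; case: (HwW j).
have [_ _ _ nad] := Hphi (kap 0%N); apply: nad.
have mH := H0_mfield vH.
pose S x := H x + grad (phi (kap 0%N)) x.
have mS : mfield S := mfieldD mH (mphi _).
have S0 : vp (off S) = 0%E.
  apply: (lpn_eps (p := p)) => e e0; have e2 : 0 < e / 2 by lra.
  have [N1 HN1] := exp_half_lt (n%:R * 2) e2.
  have [N2 HN2] := exists_invn_lt (divr_gt0 e2 (ltr0n _ 2)).
  pose j := maxn N1 N2.
  have m1 := mfieldB mH (mfieldB (mphi (kap j)) (mphi (kap 0%N))).
  apply: (@le_trans _ _ (vp (off (fun x => (H x - (grad (phi (kap j)) x - grad (phi (kap 0%N)) x)) + grad (phi (kap j)) x)))).
    apply: ereal_eqW; apply: eq_lpn => x; congr (enorm (_ *: _)).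
    by rewrite /S opprB addrA subrK.
  apply: le_trans (offD_le m1 (mphi _)) _.
  apply: (@le_trans _ _ ((e / 2)%:E + (e / 2)%:E)%E); last by rewrite -EFinD lee_fin; lra.
  apply: leeD; first by apply: le_trans (Hoff j) _; rewrite lee_fin mulrA; apply: HN1; exact: leq_maxl.
  apply: le_trans (ophi _) _; rewrite lee_fin.
  have : (kap j).+1%:R^-1 <= N2.+1%:R^-1 :> R.
    by rewrite lef_pV2 ?posrE// ler_nat ltnS; apply: leq_trans (kj j); exact: leq_maxr.
  move: HN2; move: (N2.+1%:R^-1) ((kap j).+1%:R^-1) => y z; lra.
exists (fun x => 0 + -1 * v x), (fun x => 0 + -1 *: H x); split.
- exact: (H0_lin p1 (-1) H0_zero vH).
- apply: filterS (off_eq0 mS S0) => x h nD; have := h nD; rewrite /S add0r scaleN1r => /eqP.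
  by rewrite addrC addr_eq0 => /eqP ->.
- rewrite /vlpn (eq_lpn mu p (g := fun x => enorm (- H x))); last by move=> x; rewrite add0r scaleN1r.
  apply: le_trans (ereal_eqW (vlpnN mu p H)) _; apply: le_trans H4 _; rewrite lee_fin; lra.
Qed.

End correction.

(** * Minimization and first variation *)

Lemma ge0_fin (R : realType) (x : \bar R) : (0 <= x)%E -> (x < +oo)%E -> exists2 r, 0 <= r & x = r%:E.
Proof. by case: x => [r|//|//] r0 _; exists r. Qed.

Section minimization.
Context {R : realType} {n : nat}.
Local Notation E := 'rV[R]_n.
Local Notation mu := (@lebesgue_rV R n).
Variables (p : R) (p1 : 1 < p).
Local Notation vp := (vlpn mu p).
Local Notation pp := (plpn mu p).
Variables (n0 : (0 < n)%N) (Om : set E) (oOm : open Om) (bOm : bounded_set Om).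
Variables (D D' : set E).
Hypotheses (oD : open D) (oD' : open D').
Hypothesis DOm : closure D `<=` Om.
Hypothesis DD' : forall x, D x -> ~ D' x.
Hypothesis LD : Lipschitz_boundary D.
Variables (s : E -> R) (c C : R).
Hypotheses (ms : measurable_fun setT s) (c0 : 0 < c) (C0 : 0 <= C).
Hypothesis s_le : forall x, `|s x| <= C.
Hypothesis s_ge : forall x, Om x -> ~ D x -> ~ D' x -> c <= s x.
Hypothesis s_out : forall x, D x -> s x = 0.
Variables (F : E -> E) (mF : mfield F) (vF : (vp F < +oo)%E).
Implicit Types (w : E -> R) (G H : E -> E).

Let p0 : 0 < p. Proof. exact: lt_trans p1. Qed.

Definition competitor w G := H0 Om p w G /\ {ae mu, forall x, D' x -> F x + G x = 0}.

Definition flux G : E -> E := fun x => s x *: (F x + G x).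

Lemma competitor_mfield w G : competitor w G -> mfield G.
Proof. by case=> /H0_mfield. Qed.

Lemma mfield_flux G : mfield G -> mfield (flux G).
Proof. by move=> mG; exact: (mfieldZ ms (mfieldD mF mG)). Qed.

Lemma scale_le G : mfield G -> (vp (fun x => s x *: G x) <= C%:E * vp G)%E.
Proof.
move=> mG; rewrite -[in leRHS](ger0_norm C0); apply: le_trans (ereal_eqW (vlpnZ mu p1 C mG)).
apply: (le_vlpn _ p1 (mfieldZ ms mG) (mfieldcZ C mG)) => x.
by rewrite !enormZ; apply: ler_wpM2r; [exact: enorm_ge0|rewrite (ger0_norm C0)].
Qed.

Lemma vlpn_plpn_fin G : mfield G -> (vp G < +oo)%E -> (pp G < +oo)%E.
Proof.
move=> mG /vlpn_fin[b b0 bE]; apply: (@le_lt_trans _ _ (b `^ p)%:E); last exact: ltry.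
by rewrite -(vlpn_leP mu p1 _ b0) bE.
Qed.

Lemma flux_fin w G : H0 Om p w G -> (vp (flux G) < +oo)%E /\ (pp (flux G) < +oo)%E.
Proof.
move=> HG; have mG := H0_mfield HG; have [_ lG] := H0_lty p1 HG.
suff h : (vp (flux G) < +oo)%E by split => //; exact: vlpn_plpn_fin (mfield_flux mG) h.
apply: le_lt_trans (scale_le (mfieldD mF mG)) _.
have [b b_0 bE] := vlpn_fin (le_lt_trans (vlpnD _ p1 mF mG) (lte_add_pinfty vF lG)).
by rewrite bE -EFinM ltry.
Qed.

Lemma competitor_half w1 w2 G1 G2 : competitor w1 G1 -> competitor w2 G2 ->
  exists w G, competitor w G /\ forall x, flux G x = 2^-1 *: (flux G1 x + flux G2 x).
Proof.
move=> [H1 a1] [H2 a2].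
have HH := H0_lin p1 2^-1 H1 (H0_Blin p1 H2 H1).
do 2 eexists; split; first (split; first exact: HH).
  apply: filterS2 a1 a2 => x h1 h2 Dx /=.
  rewrite addrA h1// add0r (_ : G2 x - G1 x = (F x + G2 x) - (F x + G1 x)).
    by rewrite h1// h2// subrr scaler0.
  by rewrite [F x + G2 x]addrC opprD addrA addrK.
by move=> x; rewrite /flux; apply/rowP => i; rewrite !mxE; field.
Qed.

(** Off [D] the weight is at least [c], except on [D'] and outside [Om]; but on [D'] both fields
    equal [- F], and outside [Om] both vanish. *)
Lemma competitor_sub w1 w2 G1 G2 : competitor w1 G1 -> competitor w2 G2 ->
  (c%:E * vp (off D (fun x => G1 x - G2 x)%R) <= vp (fun x => flux G1 x - flux G2 x)%R)%E.
Proof.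
move=> [H1 a1] [H2 a2]; have m1 := H0_mfield H1; have m2 := H0_mfield H2.
have mB := mfieldB m1 m2; have mO := mfield_off oD mB.
have mP : measurable_fun setT (\1_(Om `\` (D `|` D')) : E -> R).
  apply: measurable_indic; apply: measurableD; first exact: open_rV_measurable.
  by apply: open_rV_measurable; exact: openU.
pose K x : E := \1_(Om `\` (D `|` D')) x *: (G1 x - G2 x).
have mK : mfield K := mfieldZ mP mB.
have -> : vp (off D (fun x => G1 x - G2 x)) = vp K.
  apply: (ae_eq_vlpn p mO mK).
  have [_ o1] := H0_out oOm p1 H1; have [_ o2] := H0_out oOm p1 H2.
  apply: filterS2 (filterI a1 a2) (filterI o1 o2) => x [h1 h2] [h3 h4].
  rewrite /K indicE; case: (boolP (x \in _)) => [/set_mem[_ nD]|/negP nP].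
    by rewrite off_in ?scale1r// => Dx; apply: nD; left.
  rewrite scale0r; case: (pselect (D x)) => Dx; first by rewrite off_out.
  rewrite off_in//; case: (pselect (Om x)) => Ox; last by rewrite h3// h4// subrr.
  have D'x : D' x by apply: contrapT => nD'; apply: nP; apply/mem_set; split => // -[].
  have := h1 D'x; have := h2 D'x; move=> e2 e1; apply/eqP; rewrite subr_eq0; apply/eqP.
  by apply: (addrI (F x)); rewrite e1 e2.
rewrite -(ger0_norm (ltW c0)) -(vlpnZ mu p1 c mK).
apply: (le_vlpn _ p1 (mfieldcZ c mK) (mfieldB (mfield_flux m1) (mfield_flux m2))) => x.
have -> : flux G1 x - flux G2 x = s x *: (G1 x - G2 x).
  by apply/rowP => i; rewrite !mxE; ring.
rewrite /K indicE; case: (boolP (x \in _)) => [/set_mem[Ox nD]|_].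
  have sx : c <= s x by apply: s_ge => // h; apply: nD; [left|right].
  rewrite scale1r !enormZ; apply: ler_wpM2r; first exact: enorm_ge0.
  by rewrite !gtr0_norm// (lt_le_trans c0).
by rewrite scale0r scaler0 enorm0; exact: enorm_ge0.
Qed.

Lemma plpn_small G (e : R) : 0 < e -> (pp G <= (e `^ p)%:E)%E -> (vp G <= e%:E)%E.
Proof. by move=> e0; rewrite (vlpn_leP mu p1 _ (ltW e0)). Qed.

Lemma vlpn_pow_le G (d : R) : 0 <= d ->
  (forall e : R, 0 < e -> (vp G <= (d `^ p^-1 + e)%:E)%E) -> (pp G <= d%:E)%E.
Proof.
move=> d0 H; have q0 := powR_ge0 d p^-1.
have : (vp G <= (d `^ p^-1)%:E)%E.
  by apply/lee_addgt0Pr => e e0; rewrite -EFinD; exact: H.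
by rewrite (vlpn_leP mu p1 _ q0) powRVK.
Qed.

(** The correction applies to test functions, so the [G k] are first replaced by gradients of close
    test functions; the corrected differences of a subsequence are then summed. The limit is close
    to [G (kap j)] only off [D]. This suffices, since the weight vanishes on [D] and the constraint
    lives on [D'], which is disjoint from [D]. *)
Lemma minimizer_exists w0 G0 : competitor w0 G0 ->
  exists w G, competitor w G /\
    forall w' G', competitor w' G' -> (pp (flux G) <= pp (flux G'))%E.
Proof.
move=> comp0.
pose V : set R := [set r | exists w G, competitor w G /\ pp (flux G) = r%:E].
have valE w G : competitor w G -> exists2 r, V r & pp (flux G) = r%:E.
  move=> cG; have [_ fl] := flux_fin cG.1.
  have [r _ rE] := ge0_fin (plpn_ge0 mu p (flux G)) fl.
  by exists r; [exists w, G|].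
have V0 : V !=set0 by have [r Vr _] := valE _ _ comp0; exists r.
have Vlb : lbound V 0.
  by move=> r [w [G [_ rE]]]; rewrite -lee_fin -rE plpn_ge0.
have Vinf : has_inf V by split => //; exists 0.
pose d := inf V.
have d0 : 0 <= d by exact: lb_le_inf.
have dle w G : competitor w G -> (d%:E <= pp (flux G))%E.
  by move=> /valE[r Vr ->]; rewrite lee_fin; apply: ge_inf => //; exists 0.
have /choice[wG HwG] : forall k : nat, exists wG : (E -> R) * (E -> E),
    competitor wG.1 wG.2 /\ (pp (flux wG.2) <= (d + k.+1%:R^-1)%:E)%E.
  move=> k; have k0 : 0 < k.+1%:R^-1 :> R by rewrite invr_gt0.
  have [r [w [G [cG rE]]] rd] := inf_adherent k0 Vinf.
  by exists (w, G); split => //=; rewrite rE lee_fin ltW.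
pose G k := (wG k).2.
have cG k : competitor (wG k).1 (G k) by case: (HwG k).
have Gd k : (pp (flux (G k)) <= (d + k.+1%:R^-1)%:E)%E by case: (HwG k).
have mG k : mfield (G k) by exact: competitor_mfield (cG k).
have mf k := mfield_flux (mG k).
have inv0 : (fun k : nat => k.+1%:R^-1 : R) @ \oo --> 0 by exact: cvg_harmonic.
have cau := minimizing_cauchy (m := mu) p1 mf d0 inv0 Gd _.
have {}cau : forall e : R, 0 < e -> exists N, forall k l, (N <= k)%N -> (N <= l)%N ->
    (vp (fun x => flux (G k) x - flux (G l) x)%R <= e%:E)%E.
  move=> e e0; have [|N HN] := cau _ (e `^ p) (powR_gt0 p e0).
    move=> k l _; have [w [H [cH HE]]] := competitor_half (cG k) (cG l).
    apply: (@le_trans _ _ d%:E); first by rewrite lee_fin gerBl invr_ge0.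
    apply: le_trans (dle _ _ cH) _; apply: ereal_eqW.
    by apply: eq_integral => x _; rewrite HE.
  by exists N => k l Nk Nl; apply: plpn_small => //; exact: HN.
have /choice[phi Hphi] : forall k : nat, exists phi, Cc_smooth Om phi /\
    (vp (fun x => G k x - grad phi x)%R <= (k.+1%:R^-1)%:E)%E.
  move=> k; have k0 : 0 < k.+1%:R^-1 :> R by rewrite invr_gt0.
  by have [[_ _ /(_ _ k0)[phi Cphi [_ h]]] _] := cG k; exists phi.
have Cphi k : Cc_smooth Om (phi k) by case: (Hphi k).
have aphi k : (vp (fun x => G k x - grad (phi k) x)%R <= (k.+1%:R^-1)%:E)%E by case: (Hphi k).
have mphi k := Cc_mgrad (Cphi k).
have small (e : R) : 0 < e -> exists N, forall k, (N <= k)%N -> k.+1%:R^-1 <= e.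
  move=> e0; have [N Ne] := exists_invn_lt e0; exists N => k Nk.
  by apply: le_trans (ltW Ne); rewrite lef_pV2 ?posrE// ler_nat.
have offcau (e : R) : 0 < e -> exists N, forall k l, (N <= k)%N -> (N <= l)%N ->
    (vp (off D (fun x => grad (phi k) x - grad (phi l) x)%R) <= e%:E)%E.
  move=> e0; have e3 : 0 < e / 3 by lra.
  have [N1 h1] := cau _ (mulr_gt0 c0 e3); have [N2 h2] := small _ e3.
  exists (maxn N1 N2) => k l; rewrite !geq_max => /andP[k1 k2] /andP[l1 l2].
  have mk := mfieldB (mphi k) (mG k); have ml := mfieldB (mG l) (mphi l).
  have mkl := mfieldB (mG k) (mG l).
  have o k' : (N2 <= k')%N -> (vp (fun x => G k' x - grad (phi k') x)%R <= (e / 3)%:E)%E.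
    by move=> Nk; apply: le_trans (aphi k') _; rewrite lee_fin h2.
  have ok : (vp (off D (fun x => grad (phi k) x - G k x)%R) <= (e / 3)%:E)%E.
    apply: le_trans (off_le p1 oD mk) _; apply: le_trans (o k k2); apply: ereal_eqW; exact: vlpn_distC.
  have ol : (vp (off D (fun x => G l x - grad (phi l) x)%R) <= (e / 3)%:E)%E.
    by apply: le_trans (off_le p1 oD ml) _; exact: o.
  have okl : (vp (off D (fun x => G k x - G l x)%R) <= (e / 3)%:E)%E.
    have := le_trans (competitor_sub (cG k) (cG l)) (h1 k l k1 l1).
    by rewrite [(c * _)%:E]EFinM lee_pmul2l// lte_fin.
  apply: (@le_trans _ _ (vp (off D (fun x => ((grad (phi k) x - G k x) + (G k x - G l x)) + (G l x - grad (phi l) x))))).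
    by apply: ereal_eqW; apply: eq_lpn => x; congr (enorm (_ *: _)); apply/rowP => i; rewrite !mxE; ring.
  apply: le_trans (offD_le p1 oD (mfieldD mk mkl) ml) _.
  apply: (@le_trans _ _ (((e / 3)%:E + (e / 3)%:E) + (e / 3)%:E)%E); last by rewrite -!EFinD lee_fin; lra.
  apply: leeD ol; apply: le_trans (offD_le p1 oD mk mkl) _; exact: leeD.
have [K K0 HK] := correction p1 n0 oOm bOm oD DOm LD.
have half0 j : 0 < 2^-1 ^+ j :> R by rewrite exprn_gt0// invr_gt0.
(* Chosen so that the cost [K * q j] of the correction and its slack [2^-j / 2] add up to at most
   [2^-j]. *)
pose q j : R := 2^-1 ^+ j / 2 / (K + 1).
have K1 : 0 < K + 1 by rewrite ltr_wpDl.
have q0 j : 0 < q j by rewrite !divr_gt0.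
have [kap [jk kapP]] := cauchy_subseq (fun j => offcau (q j) (q0 j)).
have Kq j : K * q j + 2^-1 ^+ j / 2 <= 1 * 2^-1 ^+ j.
  have : K * q j <= 2^-1 ^+ j / 2.
    rewrite /q mulrA ler_pdivrMr// mulrC; apply: ler_wpM2l; last by rewrite lerDl.
    exact: ltW (divr_gt0 _ _).
  by move: (2^-1 ^+ j) => z; lra.
have Cd k l : Cc_smooth Om (phi k + cst (-1) * phi l) := Cc_smoothD (Cphi k) (Cc_smoothZ (-1) (Cphi l)).
have gd k l x : grad (phi k + cst (-1) * phi l) x = grad (phi k) x - grad (phi l) x.
  have [sk _ _] := Cphi k; have [sl _ _] := Cphi l.
  by rewrite (gradD _ sk (smoothM (smooth_cst (-1)) sl)) gradZ// scaleN1r.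
have /choice[wW HwW] : forall j, exists wW : (E -> R) * (E -> E), [/\ H0 Om p wW.1 wW.2,
    {ae mu, forall x, ~ D x -> wW.2 x = grad (phi (kap j.+1)) x - grad (phi (kap j)) x} &
    (vp wW.2 <= (1 * 2^-1 ^+ j)%:E)%E].
  move=> j; have d2 : 0 < 2^-1 ^+ j / 2 :> R by rewrite divr_gt0.
  have [|psi [H [h1 h2 h3]]] := HK (phi (kap j.+1) + cst (-1) * phi (kap j)) (q j) _ (Cd _ _) (ltW (q0 j)) d2.
    by apply: le_trans (kapP j); apply: ereal_eqW; apply: eq_lpn => x; rewrite /off gd.
  exists (psi, H); split => //=; first by apply: filterS h2 => x hx nD; rewrite hx// gd.
  by apply: le_trans h3 _; rewrite lee_fin.
have [|||||v [H [vH _ Hoff]]] := telescoping p1 n0 bOm oD (phi := fun j => phi (kap j)) (w := fun j => (wW j).1) (W := fun j => (wW j).2) (e := 1).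
- by move=> j; exact: Cphi.
- by move=> j; case: (HwW j).
- by move=> j; case: (HwW j).
- by apply/andP; split; lra.
- by move=> j; case: (HwW j).
have HL := H0_lin p1 1 vH (H0_smooth p1 (Cphi (kap 0%N))).
pose L x := H x + 1 *: grad (phi (kap 0%N)) x.
have mL : mfield L := H0_mfield HL.
have near (e : R) : 0 < e -> exists N, forall j, (N <= j)%N -> (vp (off D (fun x => L x - G (kap j) x)%R) <= e%:E)%E.
  move=> e0; have e2 : 0 < e / 2 by lra.
  have [N1 h1] := exp_half_lt (n%:R * 2) e2; have [N2 h2] := small _ e2.
  exists (maxn N1 N2) => j; rewrite geq_max => /andP[j1 j2].
  have m1 := mfieldB (H0_mfield vH) (mfieldB (mphi (kap j)) (mphi (kap 0%N))).
  have m2 := mfieldB (mphi (kap j)) (mG (kap j)).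
  apply: (@le_trans _ _ (vp (off D (fun x => (H x - (grad (phi (kap j)) x - grad (phi (kap 0%N)) x)) + (grad (phi (kap j)) x - G (kap j) x))))).
    apply: ereal_eqW; apply: eq_lpn => x; congr (enorm (_ *: _)).
    by rewrite /L; apply/rowP => i; rewrite !mxE; ring.
  apply: le_trans (offD_le p1 oD m1 m2) _.
  apply: (@le_trans _ _ ((e / 2)%:E + (e / 2)%:E)%E); last by rewrite -EFinD lee_fin; lra.
  apply: leeD; first by apply: le_trans (Hoff j) _; rewrite lee_fin mulrA; exact: h1.
  apply: le_trans (off_le p1 oD m2) _.
  apply: le_trans (ereal_eqW (vlpn_distC _ _ _ _)) _; apply: le_trans (aphi _) _; rewrite lee_fin; apply: h2.
  by apply: leq_trans j2 (jk j).
have mI : measurable_fun setT (\1_D' : E -> R) by apply: measurable_indic; exact: open_rV_measurable.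
(* The defect of the constraint for [L]: on [D'] it equals [L - G (kap N)], which is arbitrarily
   small in norm off [D]. *)
pose Z x : E := \1_D' x *: (F x + L x).
have mZ : mfield Z := mfieldZ mI (mfieldD mF mL).
have Z0 : vp Z = 0%E.
  apply: (lpn_eps (p := p)) => e e0; have [N /(_ N (leqnn N)) HN] := near e e0.
  pose Y x : E := \1_D' x *: off D (fun x => L x - G (kap N) x) x.
  have mO := mfield_off oD (mfieldB mL (mG (kap N))).
  have mY : mfield Y := mfieldZ mI mO.
  apply: le_trans HN; apply: (@le_trans _ _ (vp Y)).
    apply: ereal_eqW; apply: (ae_eq_vlpn p mZ mY).
    have [_ a] := cG (kap N); apply: filterS a => x hx; rewrite /Z /Y indicE.
    case: (boolP (x \in _)) => [/set_mem D'x|_]; last by rewrite !scale0r.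
    rewrite off_in; last by move=> Dx; exact: (DD' Dx).
    congr (_ *: _); rewrite -[L x - _]add0r -(hx D'x); apply/rowP => i; rewrite !mxE; ring.
  apply: (le_vlpn _ p1 mY mO) => x; rewrite /Y enormZ ler_piMl ?enorm_ge0// indicE.
  by case: (_ \in _); rewrite ?normr1 ?normr0.
have cL : competitor (fun x => v x + 1 * phi (kap 0%N) x) L.
  split => //; apply: filterS (vlpn_eq0 p1 mZ Z0) => x h D'x.
  by move: h; rewrite /Z indicE mem_set// scale1r.
exists (fun x => v x + 1 * phi (kap 0%N) x), L; split; first exact: cL.
move=> w' G' cG'; apply: le_trans (dle _ _ cG').
apply: vlpn_pow_le => // e e0.
have e2 : 0 < e / 2 by lra.
have eC : 0 < e / 2 / (C + 1) by rewrite divr_gt0// ltr_wpDl.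
have [N1 h1] := near _ eC.
(* The room, at the level of p-th powers, for an error [e / 2] in the norm. *)
have dd : 0 < (d `^ p^-1 + e / 2) `^ p - d.
  rewrite subr_gt0 -[ltLHS](powRVK p0 d0); apply: lt_powR2 => //; first exact: powR_ge0.
  by rewrite ltrDl.
have [N2 h2] := small _ dd.
pose j := maxn N1 N2.
pose r : E -> E := fun x => flux L x - flux (G (kap j)) x.
have mr : mfield r := mfieldB (mfield_flux mL) (mf (kap j)).
apply: (@le_trans _ _ (vp (fun x => flux (G (kap j)) x + r x)%R)).
  by apply: ereal_eqW; apply: eq_lpn => x; rewrite /r addrC subrK.
apply: le_trans (vlpnD _ p1 (mf _) mr) _.
rewrite (_ : d `^ p^-1 + e = (d `^ p^-1 + e / 2) + e / 2); last by field.
rewrite [leRHS]EFinD; apply: leeD.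
  rewrite vlpn_leP//; last by apply: addr_ge0; [exact: powR_ge0|exact: ltW].
  apply: le_trans (Gd _) _; rewrite lee_fin -lerBrDl; apply: h2.
  by apply: leq_trans (jk j); exact: leq_maxr.
have mO := mfieldB mL (mG (kap j)).
apply: (@le_trans _ _ (vp (fun x => s x *: off D (fun x => L x - G (kap j) x) x)%R)).
  apply: ereal_eqW; apply: eq_lpn => x; congr enorm; rewrite /r /flux.
  case: (pselect (D x)) => Dx; last by rewrite off_in// -scalerBr; congr (_ *: _); apply/rowP => i; rewrite !mxE; ring.
  by rewrite off_out// s_out// !scale0r subrr.
apply: le_trans (scale_le (mfield_off oD mO)) _.
apply: (@le_trans _ _ (C%:E * (e / 2 / (C + 1))%:E)%E).
  by apply: lee_wpmul2l; [rewrite lee_fin|exact: h1 (leq_maxl _ _)].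
rewrite -EFinM lee_fin mulrA ler_pdivrMr ?ltr_wpDl// mulrC; apply: ler_wpM2l; first exact: ltW.
by rewrite lerDl.
Qed.

Lemma minimizer_unique w1 w2 G1 G2 : competitor w1 G1 -> competitor w2 G2 ->
  (forall w G, competitor w G -> (pp (flux G1) <= pp (flux G))%E) ->
  (forall w G, competitor w G -> (pp (flux G2) <= pp (flux G))%E) ->
  {ae mu, forall x, ~ D x -> G1 x = G2 x}.
Proof.
move=> cG1 cG2 h1 h2.
have m1 := competitor_mfield cG1; have m2 := competitor_mfield cG2.
have e12 : pp (flux G1) = pp (flux G2) by apply/le_anti/andP; split; [exact: (h1 _ _ cG2)|exact: (h2 _ _ cG1)].
have [_ fl] := flux_fin cG1.1.
have [d d0 dE] := ge0_fin (plpn_ge0 mu p (flux G1)) fl.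
(* The two minimizers alternate, so the Cauchy property with zero slack forces equal fluxes. *)
pose G k := if odd k then G1 else G2.
pose w k := if odd k then w1 else w2.
have cG k : competitor (w k) (G k) by rewrite /w /G; case: odd.
have Gd k : (pp (flux (G k)) <= (d + cst 0 k)%:E)%E.
  rewrite addr0 /G; case: (odd k); first exact: ereal_eqW dE.
  exact: ereal_eqW (etrans (esym e12) dE).
have mf k := mfield_flux (competitor_mfield (cG k)).
have mid k l : (k <= l)%N -> ((d - cst 0 k)%:E <= pp (fun x => 2^-1 *: (flux (G k) x + flux (G l) x))%R)%E.
  move=> _; have [v [H [cH HE]]] := competitor_half (cG k) (cG l).
  rewrite subr0; apply: le_trans (ereal_eqW (esym dE)) _; apply: le_trans (h1 _ _ cH) _; apply: ereal_eqW.
  by apply: eq_integral => x _; rewrite HE.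
have cau := minimizing_cauchy (m := mu) p1 mf d0 (cvg_cst 0) Gd mid.
have z : vp (fun x => flux G1 x - flux G2 x) = 0%E.
  apply: (lpn_eps (p := p)) => e e0; apply: (plpn_small e0).
  have [N HN] := cau _ _ (powR_gt0 p e0).
  have := HN (N.*2.+1) (N.*2) _ _; rewrite /G /= odd_double /=; apply.
    by rewrite -addnn; apply: leqW; exact: leq_addr.
  by rewrite -addnn; exact: leq_addr.
have := competitor_sub cG1 cG2; rewrite z pmule_rle0; last by rewrite lte_fin.
move=> h; have mB := mfieldB m1 m2.
have {h} : vp (off D (fun x => G1 x - G2 x)) = 0%E.
  by apply/eqP; rewrite eq_le h; exact: vlpn_ge0.
move=> /(off_eq0 p1 oD mB); apply: filterS => x h nD.
by apply/eqP; rewrite -subr_eq0 h.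
Qed.

End minimization.

(** * First variation of the p-energy *)

Section variation.
Context {R : realType} {n : nat}.
Local Notation E := 'rV[R]_n.
Local Notation mu := (@lebesgue_rV R n).
Variables (p : R) (p1 : 1 < p).
Local Notation pp := (plpn mu p).

Let p0 : 0 < p. Proof. exact: lt_trans p1. Qed.

(** The derivative of [|.|^p / p] at [a] in the direction [b]. It is 0 at [a = 0] for every
    exponent, since the scalar product vanishes. *)
Definition pflux (a b : E) : R := enorm a `^ (p - 2) * dotv a b.

Lemma pflux0 b : pflux 0 b = 0.
Proof. by rewrite /pflux dotv0l mulr0. Qed.

Lemma pfluxZ k a b : pflux a (k *: b) = k * pflux a b.
Proof. by rewrite /pflux dotvZr; ring. Qed.

Lemma pfluxBr a b d : pflux a (b - d) = pflux a b - pflux a d.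
Proof. by rewrite /pflux dotvBr mulrBr. Qed.

Lemma powR_mul_base (x r : R) : 0 < x -> x `^ r * x = x `^ (r + 1).
Proof. by move=> x0; rewrite powRD ?powRr1 ?(ltW x0)//; rewrite (gt_eqF x0) implybT. Qed.

Lemma pflux_scale k a b : 0 < k -> pflux (k *: a) (k *: b) = k `^ p * pflux a b.
Proof.
move=> k0; rewrite /pflux enormZ gtr0_norm// powRM ?enorm_ge0 ?ltW// dotvZl dotvZr.
rewrite (_ : k `^ p = k `^ (p - 2) * k * k); first by ring.
by rewrite !powR_mul_base//; congr (_ `^ _); ring.
Qed.

Lemma pflux_self a : pflux a a = enorm a `^ p.
Proof.
case: (eqVneq a 0) => [->|a0]; first by rewrite pflux0 enorm0 powR0// gt_eqF.
have ea : 0 < enorm a.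
  by rewrite lt_neqAle enorm_ge0 andbT; apply: contraNneq a0 => /esym/enorm_eq0/eqP.
by rewrite /pflux -enorm_sqr expr2 mulrA !powR_mul_base//; congr (_ `^ _); ring.
Qed.

Lemma pflux_le a b : `|pflux a b| <= enorm a `^ (p - 1) * enorm b.
Proof.
case: (eqVneq a 0) => [->|a0].
  by rewrite pflux0 normr0; apply: mulr_ge0; [exact: powR_ge0|exact: enorm_ge0].
have ea : 0 < enorm a.
  by rewrite lt_neqAle enorm_ge0 andbT; apply: contraNneq a0 => /esym/enorm_eq0/eqP.
rewrite /pflux normrM ger0_norm ?powR_ge0//.
rewrite (_ : p - 1 = p - 2 + 1); last by ring.
rewrite -powR_mul_base// -mulrA; apply: ler_wpM2l; first exact: powR_ge0.
exact: norm_dotv.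
Qed.

(* Convexity of |.|^p, through Young's inequality p |a|^(p-1) |b| <= (p-1) |a|^p + |b|^p. *)
Lemma pflux_convex a b : enorm a `^ p - enorm b `^ p <= p * pflux a (a - b).
Proof.
rewrite pfluxBr pflux_self.
have h : pflux a b <= enorm b * enorm a `^ (p - 1).
  by rewrite mulrC; apply: le_trans (pflux_le a b); exact: ler_norm.
have pn : p != 0 by rewrite gt_eqF.
have pn1 : p - 1 != 0 by rewrite subr_eq0 gt_eqF.
have q0 : 0 < p / (p - 1) by apply: divr_gt0 => //; rewrite subr_gt0.
have pq : p^-1 + (p / (p - 1))^-1 = 1 by field; rewrite ?pn ?pn1.
have := conjugate_powR (enorm_ge0 b) (powR_ge0 (enorm a) (p - 1)) p0 q0 pq.
rewrite -powRrM (_ : (p - 1) * (p / (p - 1)) = p); last by field; rewrite ?pn ?pn1.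
move: h; move: (pflux a b) (enorm b * _) (enorm a `^ p) (enorm b `^ p) => x y z t h1 h2.
have h3 : p * x <= p * (t / p + z / (p / (p - 1))) by apply: ler_wpM2l; [exact: ltW|exact: le_trans h1 h2].
have h4 : p * (t / p + z / (p / (p - 1))) = t + z * (p - 1) by field; rewrite ?pn ?pn1.
by move: h3; rewrite h4 => h3; lra.
Qed.

(** At [a = 0] and [p < 2] the factor [|u k|^(p-2)] may blow up, so the limit is taken through the
    bound [|u k|^(p-1) |b|]; elsewhere the power is continuous. *)
Lemma pflux_cvg (u : nat -> E) a b : (enorm \o u) @ \oo --> enorm a ->
  (fun k => dotv (u k) b) @ \oo --> dotv a b -> (fun k => pflux (u k) b) @ \oo --> pflux a b.
Proof.
move=> cu cd; case: (eqVneq a 0) => [a0|a0].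
  rewrite a0 pflux0; apply/cvgrPdist_le => e e0.
  have b1 : 0 < enorm b + 1 by rewrite ltr_wpDl ?enorm_ge0.
  have r0 : 0 < p - 1 by rewrite subr_gt0.
  have : (fun k => `|enorm (u k)| `^ (p - 1)) @ \oo --> `|enorm a| `^ (p - 1).
    exact: (continuous_cvg _ (@powR_continuous_normr R (p - 1) r0 (enorm a)) cu).
  rewrite a0 enorm0 normr0 powR0 ?gt_eqF// => /cvgrPdist_lt /(_ _ (divr_gt0 e0 b1)).
  apply: filterS => k; rewrite sub0r normrN ger0_norm ?powR_ge0//= (ger0_norm (enorm_ge0 (u k))) => h.
  rewrite sub0r normrN; apply: le_trans (pflux_le (u k) b) _.
  apply: (@le_trans _ _ (e / (enorm b + 1) * (enorm b + 1))).
    apply: ler_pM; [exact: powR_ge0|exact: enorm_ge0|exact: ltW|by rewrite lerDl].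
  by rewrite divfK// gt_eqF.
have ea : 0 < enorm a.
  by rewrite lt_neqAle enorm_ge0 andbT; apply: contraNneq a0 => /esym/enorm_eq0/eqP.
apply: cvgM cd.
have c : {for enorm a, continuous (fun y => expR ((p - 2) * ln y))}.
  apply: (continuous_comp (f := fun y => (p - 2) * ln y)); last exact: continuous_expR.
  exact: (cvgM (cvg_cst _) (continuous_ln ea)).
rewrite [X in _ --> X](_ : _ = expR ((p - 2) * ln (enorm a))); last by rewrite /powR gt_eqF.
have : (fun k => expR ((p - 2) * ln (enorm (u k)))) @ \oo --> expR ((p - 2) * ln (enorm a)).
  exact: (continuous_cvg _ c cu).
apply: cvg_trans; apply: near_eq_cvg.
have /cvgrPdist_lt /(_ _ ea) := cu; apply: filterS => k /=; rewrite /powR => h; rewrite gt_eqF//.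
by move: h; rewrite ltr_norml => /andP[_ h]; lra.
Qed.

Lemma pfield_intg (a : E -> E) : mfield a -> (pp a < +oo)%E -> intg (fun x => enorm (a x) `^ p).
Proof.
move=> ma h; apply/integrableP; split; first exact: measurable_enorm_pow.
move: h; rewrite /plpn; under [X in _ -> (X < _)%E]eq_integral do rewrite /= ger0_norm ?powR_ge0//.
exact.
Qed.

Lemma measurable_pflux (a b : E -> E) : mfield a -> mfield b -> measurable_fun setT (fun x => pflux (a x) (b x)).
Proof.
move=> ma mb; apply: measurable_funM; last exact: measurable_dotv.
by apply: (measurableT_comp (measurable_powR (p - 2))); exact: mfield_enorm.
Qed.

(** Convexity, with the derivative taken at the perturbed point, gives [0 <= t * p] times the
    integral of [pflux (a + t b) b]. Divide by [t p] and let [t] tend to 0 by dominated convergence,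
    with [S] as the dominating function. *)
Lemma pflux_variation (a b : E -> E) : mfield a -> mfield b -> (pp a < +oo)%E -> (pp b < +oo)%E ->
  (forall t : R, 0 < t -> (pp a <= pp (fun x => a x + t *: b x)%R)%E) ->
  intg (fun x => pflux (a x) (b x)) /\ 0 <= \int[mu]_x pflux (a x) (b x).
Proof.
move=> ma mb fa fb H.
have ia := pfield_intg ma fa; have ib := pfield_intg mb fb.
pose t (k : nat) : R := k.+1%:R^-1.
have t0 k : 0 < t k by rewrite invr_gt0.
have t1 k : t k <= 1 by rewrite invf_le1// ler1n.
have mt k : mfield (fun x => a x + t k *: b x) := mfieldD ma (mfieldcZ (t k) mb).
pose f k x := pflux (a x + t k *: b x) (b x).
have mf k : measurable_fun setT (f k) := measurable_pflux (mt k) mb.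
pose S x := 2 `^ p * (enorm (a x) `^ p + enorm (b x) `^ p).
have iS : intg S by exact: intgZ (intgD ia ib).
have sum_le (x : E) (e : R) : 0 <= e <= 1 -> (enorm (a x) + e * enorm (b x)) `^ p <= S x.
  move=> /andP[e0 e1]; apply: (@le_trans _ _ ((enorm (a x) + enorm (b x)) `^ p)).
    apply: le_powR2; [exact: ltW|apply: addr_ge0; [exact: enorm_ge0|apply: mulr_ge0 => //; exact: enorm_ge0]|].
    by apply: lerD => //; rewrite ler_piMl ?enorm_ge0.
  exact: (powRD_le p1 (enorm_ge0 _) (enorm_ge0 _)).
have te k : 0 <= t k <= 1 by rewrite ltW ?t1.
have bt k x : enorm (a x + t k *: b x) <= enorm (a x) + t k * enorm (b x).
  by apply: le_trans (enormD _ _) _; rewrite enormZ gtr0_norm.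
have fS k x : `|f k x| <= S x.
  apply: le_trans (pflux_le _ _) _.
  pose z := enorm (a x) + enorm (b x).
  have z0 : 0 <= z by apply: addr_ge0; exact: enorm_ge0.
  have bz : enorm (b x) <= z by rewrite lerDr enorm_ge0.
  have az : enorm (a x + t k *: b x) <= z.
    by apply: le_trans (bt k x) _; rewrite lerD2l ler_piMl ?enorm_ge0.
  apply: (@le_trans _ _ (z `^ (p - 1) * z)).
    apply: ler_pM => //; [exact: powR_ge0|exact: enorm_ge0|apply: le_powR2 => //; [rewrite subr_ge0; exact: ltW|exact: enorm_ge0]].
  apply: le_trans (sum_le x 1 _); last by rewrite ler01 lexx.
  rewrite mul1r -/z; move: z0; rewrite le_eqVlt => /orP[/eqP <-|z0]; first by rewrite mulr0 powR_ge0.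
  by rewrite powR_mul_base// subrK.
have cf x : f ^~ x @ \oo --> pflux (a x) (b x).
  have th : t @ \oo --> 0 by exact: cvg_harmonic.
  apply: pflux_cvg.
    apply/cvgrPdist_le => e e0.
    have b1 : 0 < enorm (b x) + 1 by rewrite ltr_wpDl ?enorm_ge0.
    have /cvgrPdist_le /(_ _ (divr_gt0 e0 b1)) := th; apply: filterS => k; rewrite sub0r normrN => h /=.
    apply: le_trans (ler_dist_enorm _ _) _; rewrite enorm_distC addrC addKr enormZ.
    apply: (@le_trans _ _ (e / (enorm (b x) + 1) * (enorm (b x) + 1))); last by rewrite divfK// gt_eqF.
    by apply: ler_pM => //; [exact: enorm_ge0|rewrite lerDl].
  rewrite (_ : (fun k => _) = (fun k => dotv (a x) (b x) + t k * dotv (b x) (b x))); last first.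
    by apply/funext => k; rewrite dotvDl dotvZl.
  rewrite -[X in _ --> X]addr0 -(mul0r (dotv (b x) (b x))).
  by apply: cvgD; [exact: cvg_cst|apply: cvgM => //; exact: cvg_cst].
have [ip lim] := Rint_dct mf (measurable_pflux ma mb) cf iS fS.
split => //.
have fk k : 0 <= \int[mu]_x f k x.
  have fin : (pp (fun x => a x + t k *: b x)%R < +oo)%E.
    apply: (@le_lt_trans _ _ (\int[mu]_x (S x)%:E)%E); last first.
      by rewrite (EFin_Rint iS) ltry.
    apply: ge0_le_integral; first exact: measurableT.
    - by move=> x _; rewrite lee_fin powR_ge0.
    - exact: measurable_enorm_pow (mt k).
    - by apply/measurable_EFinP; exact: intg_measurable iS.
    - move=> x _; rewrite lee_fin; apply: le_trans (sum_le x (t k) (te k)).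
      by apply: le_powR2; [exact: ltW|exact: enorm_ge0|exact: bt].
  have it := pfield_intg (mt k) fin.
  have ifk : intg (f k) := intg_le (mf k) (fun x => le_trans (fS k x) (ler_norm _)) iS.
  have ig := intgB it ia.
  have ih := intgZ (t k * p) ifk.
  have le1 : \int[mu]_x (enorm (a x + t k *: b x) `^ p - enorm (a x) `^ p) <= \int[mu]_x (t k * p * f k x).
    apply: le_Rintegral => //= x _; apply: le_trans (pflux_convex _ _) _.
    rewrite (_ : a x + t k *: b x - a x = t k *: b x); last by rewrite addrC addKr.
    by rewrite pfluxZ /f mulrA [p * t k]mulrC.
  have ge0 : 0 <= \int[mu]_x (enorm (a x + t k *: b x) `^ p - enorm (a x) `^ p).
    rewrite (RintegralB measurableT it ia) subr_ge0 -lee_fin.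
    by apply: le_trans (ereal_eqW (esym (EFin_Rint ia))) (le_trans (H _ (t0 k)) (ereal_eqW (EFin_Rint it))).
  have := le_trans ge0 le1; rewrite (RintegralZl _ measurableT ifk) pmulr_rge0//.
  exact: mulr_gt0.
rewrite -(cvg_lim _ lim)//; apply: limr_ge; first by apply/cvg_ex; eexists; exact: lim.
by apply: nearW.
Qed.

(** The one-sided variation for [b] and for [- b]. *)
Lemma pflux_stationary (a b : E -> E) : mfield a -> mfield b -> (pp a < +oo)%E -> (pp b < +oo)%E ->
  (forall t : R, (pp a <= pp (fun x => a x + t *: b x)%R)%E) ->
  intg (fun x => pflux (a x) (b x)) /\ \int[mu]_x pflux (a x) (b x) = 0.
Proof.
move=> ma mb fa fb H.
have [i1 h1] := pflux_variation ma mb fa fb (fun t _ => H t).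
have mNb : mfield (fun x => -1 *: b x) := mfieldcZ (-1) mb.
have fNb : (pp (fun x => -1 *: b x)%R < +oo)%E.
  by apply: le_lt_trans fb; apply: ereal_eqW; apply: eq_integral => x _; rewrite scaleN1r enormN.
have HN (t : R) : 0 < t -> (pp a <= pp (fun x => a x + t *: (-1 *: b x))%R)%E.
  move=> _; apply: le_trans (H (- t)) _; apply: ereal_eqW; apply: eq_integral => x _.
  by rewrite scalerA mulrN1.
have [i2 h2] := pflux_variation ma mNb fa fNb HN.
split => //; apply/eqP; rewrite eq_le h1 andbT.
move: h2; rewrite (Rint_ext (g := fun x => -1 * pflux (a x) (b x))); last by move=> x; rewrite pfluxZ.
by rewrite (RintegralZl _ measurableT i1) mulN1r oppr_ge0.
Qed.

End variation.

(** * The conductivity problem *)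

Section conductivity.
Context {R : realType} {n : nat}.
Local Notation E := 'rV[R]_n.
Local Notation mu := (@lebesgue_rV R n).
Variables (p : R) (p1 : 1 < p).
Local Notation vp := (vlpn mu p).
Local Notation pp := (plpn mu p).
Variables (n0 : (0 < n)%N) (Om : set E) (oOm : open Om) (bOm : bounded_set Om).
Variable sigma : E -> \bar R.
Hypothesis sigma_ge0 : forall x, Om x -> (0 <= sigma x)%E.
Hypothesis sigma_meas : measurable_fun Om sigma.
Local Notation D := (D_zero Om sigma).
Local Notation D' := (D_infty Om sigma).
Hypotheses (oD : open D) (oD' : open D').
Hypotheses (D_bd : closure D `&` boundary Om = set0) (D'_bd : closure D' `&` boundary Om = set0).
Variables (c C : R).
Hypothesis c0 : 0 < c.
Hypothesis sigma_cC : {ae mu, forall x, (Om `\` (D `|` D')) x -> (c%:E <= sigma x)%E /\ (sigma x <= C%:E)%E}.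
Hypothesis LD : Lipschitz_boundary D.
Variables (f : E -> R) (Wf : W1p Om p f).
Implicit Types (u v w : E -> R) (G H a b : E -> E).

Let p0 : 0 < p. Proof. exact: lt_trans p1. Qed.
Let mOm : measurable Om. Proof. exact: open_rV_measurable. Qed.
Let P := Om `\` (D `|` D').
Let mP : measurable P.
Proof. by apply: measurableD => //; apply: open_rV_measurable; exact: openU. Qed.

Lemma closure_inner (A : set E) : A `<=` Om -> closure A `&` boundary Om = set0 -> closure A `<=` Om.
Proof.
move=> AO A0 x clx; apply: contrapT => nO.
suff : (closure A `&` boundary Om) x by rewrite A0.
split => //; split; first exact: closureS AO _ clx.
by move=> /interior_subset.
Qed.

Lemma closure_inner_compact (A : set E) : closure A `<=` Om -> compact (closure A).
Proof.
move=> AO; have [M [_ HM]] := bOm.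
apply: (subclosed_compact _ (@ball_closed_compact R n (`|M| + 1))); first exact: closed_closure.
by move=> x /AO Ox; apply: HM Ox; have := ler_norm M; lra.
Qed.

Let DO : D `<=` Om. Proof. by move=> x []. Qed.
Let D'O : D' `<=` Om. Proof. by move=> x []. Qed.
Let DOm : closure D `<=` Om. Proof. exact: closure_inner. Qed.
Let D'Om : closure D' `<=` Om. Proof. exact: closure_inner. Qed.
Let DD' x : D x -> ~ D' x. Proof. by move=> [_ /= h] [_ /=]; rewrite h. Qed.

Lemma compl_P x : Om x -> ~ D x -> ~ D' x -> P x.
Proof. by move=> Ox nD nD'; split => // -[]. Qed.

(* Clamping to [c, C] makes the a.e. bounds on sigma hold everywhere. *)
Definition weight : E -> R := (fun x => Num.max c (Num.min C (fine (sigma x))) `^ p^-1) \_ P.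

Lemma weight_out x : ~ P x -> weight x = 0.
Proof. by move=> nP; rewrite /weight patchE memNset. Qed.

Lemma weight_zero x : D x -> weight x = 0.
Proof. by move=> Dx; apply: weight_out => -[_]; apply; left. Qed.

Lemma weight_ge x : P x -> c `^ p^-1 <= weight x.
Proof.
move=> Px; rewrite /weight patchE mem_set//.
by apply: le_powR2; [rewrite invr_ge0; exact: ltW|exact: ltW|rewrite le_max lexx].
Qed.

Lemma weight_le x : `|weight x| <= (Num.max c C) `^ p^-1.
Proof.
rewrite /weight patchE; case: ifP => _; last by rewrite normr0 powR_ge0.
rewrite ger0_norm ?powR_ge0//; apply: le_powR2; first by rewrite invr_ge0; exact: ltW.
  by rewrite le_max (ltW c0).
rewrite ge_max le_max lexx /=; apply: (@le_trans _ _ C); first by rewrite ge_min lexx.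
by rewrite le_max lexx orbT.
Qed.

Lemma measurable_weight : measurable_fun setT weight.
Proof.
apply/(measurable_restrictT _ mP).
have mf : measurable_fun P (fun x => fine (sigma x)).
  apply: (measurableT_comp (fine_measurable measurableT)).
  by apply: measurable_funS sigma_meas => // x [].
apply: (measurableT_comp (measurable_powR p^-1)).
by apply: measurable_maxr; [exact: measurable_cst|apply: measurable_minr; [exact: measurable_cst|exact: mf]].
Qed.

Lemma sigma_weight : {ae mu, forall x, P x -> sigma x = (weight x `^ p)%:E}.
Proof.
apply: filterS sigma_cC => x h Px; have [] := h Px.
rewrite /weight patchE mem_set//; case: (sigma x) => [r| |]; [|by move=> _; rewrite leye_eq|by rewrite leeNy_eq].
rewrite !lee_fin => cr rC; rewrite powRVK//; last by rewrite le_max (ltW c0).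
by rewrite (min_idPr rC) (max_idPr cr).
Qed.

Lemma ae_eq_plpn a b : mfield a -> mfield b -> {ae mu, forall x, a x = b x} -> pp a = pp b.
Proof.
move=> ma mb ab.
apply: ae_eq_integral; [exact: measurableT|exact: measurable_enorm_pow ma|exact: measurable_enorm_pow mb|].
by apply: filterS ab => x -> _.
Qed.

Let ediff v : E -> \bar R := (fun x => (sigma x * (enorm (wgrad Om v x) `^ p)%:E)%E) \_ Om.

Let energyE v : energy Om sigma p v = (\int[mu]_x ediff v x)%E.
Proof. exact: integral_mkcond. Qed.

Let measurable_ediff v G : is_weak_grad Om v G -> measurable_fun setT (ediff v).
Proof.
move=> /wgradP/(weak_grad_mfield oOm) mG; apply/(measurable_restrictT _ mOm).
apply: (emeasurable_funM sigma_meas).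
have := measurable_funTS (measurable_enorm_pow p mG) (D := Om).
by apply: eq_measurable_fun => x /set_mem Ox; rewrite cutv_in.
Qed.

(** On the conducting part [sigma] is the p-th power of the weight; on [D] both sides vanish with
    the coefficient, and on [D'] with the gradient, by the convention that infinity times 0 is 0. *)
Lemma energy_plpn v G a : is_weak_grad Om v G -> mfield a ->
  {ae mu, forall x, Om x -> wgrad Om v x = a x} -> {ae mu, forall x, D' x -> a x = 0} ->
  energy Om sigma p v = pp (fun x => weight x *: a x).
Proof.
move=> vG ma va a0; rewrite energyE.
have mwa := mfieldZ measurable_weight ma.
apply: ae_eq_integral; [exact: measurableT|exact: measurable_ediff vG|exact: measurable_enorm_pow mwa|].
have z : enorm (0 : E) `^ p = 0 by rewrite enorm0 powR0// gt_eqF.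
apply: filterS2 va (filterI a0 sigma_weight) => x h1 [h2 h3] _; rewrite /ediff patchE.
case: (pselect (Om x)) => Ox; last first.
  by rewrite memNset// weight_out ?scale0r ?z// => -[].
rewrite mem_set//; case: (pselect (D x)) => Dx.
  by rewrite weight_zero// scale0r z; case: Dx => _ /= ->; rewrite mul0e.
case: (pselect (D' x)) => D'x; first by rewrite h1// h2// scaler0 z mule0.
have Px := compl_P Ox Dx D'x; rewrite h3// h1// -EFinM; congr EFin.
by rewrite enorm_powZ// ger0_norm// (le_trans _ (weight_ge Px))// powR_ge0.
Qed.

(** A nonnegative function with finite integral is finite almost everywhere, and on [D'] the energy
    density is infinite wherever the gradient is not zero. *)
Lemma energy_fin v G : is_weak_grad Om v G -> (energy Om sigma p v < +oo)%E ->
  {ae mu, forall x, D' x -> wgrad Om v x = 0}.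
Proof.
move=> vG; rewrite energyE => fin.
have e0 x : (0 <= ediff v x)%E.
  rewrite /ediff patchE; case: ifPn => [/set_mem Ox|_]; last exact: lexx.
  by apply: mule_ge0; [exact: sigma_ge0|rewrite lee_fin; exact: powR_ge0].
have ei : mu.-integrable setT (ediff v).
  apply/integrableP; split; first exact: measurable_ediff vG.
  by under eq_integral do rewrite (gee0_abs (e0 _)).
apply: filterS (integrable_ae measurableT ei) => x /(_ I) h D'x.
have [Ox /= sx] := D'x; move: h; rewrite /ediff patchE mem_set// sx => h.
apply: enorm_eq0; apply/eqP; apply: contraT => ne.
have ep : 0 < enorm (wgrad Om v x) `^ p by apply: powR_gt0; rewrite lt_neqAle eq_sym ne enorm_ge0.
by move: h; rewrite gt0_mulye// lte_fin.
Qed.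

Let F := cutv Om (wgrad Om f).

Let fW : is_weak_grad Om f (wgrad Om f).
Proof. by have [_ [G fG] _] := Wf; exact: wgradP fG. Qed.

Let mF : mfield F. Proof. exact: (weak_grad_mfield oOm fW). Qed.

Let vF : (vp F < +oo)%E.
Proof.
apply: (vlpn_lty p1 mF) => i; rewrite cutv_coord.
by have [_ _ /(_ i)/(LpP _ _ p1)[]] := Wf.
Qed.

Local Notation comp := (competitor p Om D' F).
Local Notation flx := (flux weight F).
Let mw := measurable_weight.
Let B0 : 0 <= (Num.max c C) `^ p^-1. Proof. exact: powR_ge0. Qed.
Let b0 : 0 < c `^ p^-1. Proof. exact: powR_gt0. Qed.
Let wge x : Om x -> ~ D x -> ~ D' x -> c `^ p^-1 <= weight x.
Proof. by move=> h1 h2 h3; apply: weight_ge; exact: compl_P. Qed.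

Lemma affine_H0 v : W1p_affine Om p f v -> exists G, H0 Om p (cutf Om (v \- f)) G.
Proof. by move=> /(W1p0_H0 oOm p1) h; exists (cutv Om (wgrad Om (v \- f))). Qed.

Lemma H0_affine v G : H0 Om p (cutf Om (v \- f)) G -> [/\ W1p_affine Om p f v,
  exists H, is_weak_grad Om v H & {ae mu, forall x, Om x -> wgrad Om v x = F x + G x}].
Proof.
move=> HG; have W := weak_gradD oOm fW (H0_weak_grad oOm p1 HG).
have vE : f \+ (v \- f) = v by apply/funext => x /=; rewrite addrC subrK.
rewrite vE in W; split; [exact: (H0_W1p0 oOm p1 HG)|by eexists; exact: W|].
by apply: filterS (wgrad_ae oOm W) => x h Ox; rewrite h// /F cutv_in.
Qed.

Lemma affine_competitor v G : H0 Om p (cutf Om (v \- f)) G -> (energy Om sigma p v < +oo)%E ->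
  comp (cutf Om (v \- f)) G.
Proof.
move=> HG fin; split => //; have [_ [H vH] vG] := H0_affine HG.
by apply: filterS2 vG (energy_fin vH fin) => x h1 h2 D'x; rewrite -h1 ?h2//; exact: D'O.
Qed.

Lemma competitor_energy v G : comp (cutf Om (v \- f)) G -> energy Om sigma p v = pp (flx G).
Proof.
move=> [HG a0]; have [_ [H vH] vG] := H0_affine HG.
exact: (energy_plpn vH (mfieldD mF (H0_mfield HG)) vG a0).
Qed.

Lemma competitor_affine w G : comp w G -> exists v, comp (cutf Om (v \- f)) G.
Proof.
move=> [HG a0]; exists (f \+ w); split => //.
have -> : (f \+ w) \- f = w by apply/funext => x /=; rewrite addrC addKr.
have [mw' mG _] := HG.
apply: (H0_ae (p := p) HG) => //; last by apply: aeW.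
  by apply/(measurable_restrictT _ mOm); exact: measurable_funTS.
have [wo _] := H0_out oOm p1 HG; apply: filterS wo => x h.
by case: (pselect (Om x)) => Ox; [rewrite cutf_in|rewrite cutf_out// h].
Qed.

Lemma competitor_nonempty : exists w G, comp w G.
Proof.
have cD' := closure_inner_compact D'Om.
have [eta [Ceta _ [t t0 Ht]]] := cutoff cD' oOm D'Om.
have [G0 HG0] := product_H0 p1 n0 oOm bOm Wf Ceta.
have H1 := H0_lin p1 (-1) (H0_zero p1 Om) HG0.
do 2 eexists; split; first exact: H1.
have eqf x : D' x -> f x = f x * eta x.
  by move=> D'x; rewrite (Ht x x) ?mulr1// ?subrr ?normr0//; exact: subset_closure.
apply: filterS (weak_grad_eq_on oOm oD' D'O eqf fW (H0_weak_grad_self p1 oOm HG0)) => x h D'x.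
by rewrite /F cutv_in ?h ?add0r ?scaleN1r ?subrr//; exact: D'O.
Qed.

(** Some competitor exists and has finite energy, so a minimizer has too; finite energy makes it a
    competitor, and every competitor comes from a function of the affine class with the same
    energy. *)
Lemma minimizer_competitor u : is_minimizer Om sigma p f u ->
  (energy Om sigma p u < +oo)%E /\ exists G, comp (cutf Om (u \- f)) G /\
    forall w' G', comp w' G' -> (pp (flx G) <= pp (flx G'))%E.
Proof.
move=> [Au Mu].
have le w' G' : comp w' G' -> (energy Om sigma p u <= pp (flx G'))%E.
  move=> /competitor_affine[v cv]; have [Av _ _] := H0_affine cv.1.
  by apply: le_trans (Mu _ Av) _; exact: ereal_eqW (competitor_energy cv).
have [w0 [G0 c00]] := competitor_nonempty.
have fin : (energy Om sigma p u < +oo)%E.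
  apply: le_lt_trans (le _ _ c00) _.
  by have [_] := flux_fin p1 mw B0 weight_le mF vF c00.1.
split => //; have [G HG] := affine_H0 Au; have cG := affine_competitor HG fin.
exists G; split; first exact: cG.
move=> w' G' cG'; apply: le_trans (le _ _ cG'); exact: ereal_eqW (esym (competitor_energy cG)).
Qed.

(** Functions of infinite energy compare trivially, and those of finite energy are competitors. *)
Lemma competitor_minimizer u G : comp (cutf Om (u \- f)) G ->
  (forall w' G', comp w' G' -> (pp (flx G) <= pp (flx G'))%E) -> is_minimizer Om sigma p f u.
Proof.
move=> cG MG; have [Au _ _] := H0_affine cG.1; split; first exact: Au.
move=> v /affine_H0[H HH]; apply: le_trans (ereal_eqW (competitor_energy cG)) _.
have [oo|] := eqVneq (energy Om sigma p v) +oo%E; first by rewrite oo leey.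
rewrite -ltey => fin; have cH := affine_competitor HH fin.
by apply: le_trans (MG _ _ cH) _; exact: ereal_eqW (esym (competitor_energy cH)).
Qed.

Lemma conductivity_minimizer_exists : exists u, is_minimizer Om sigma p f u.
Proof.
have [w0 [G0 c00]] := competitor_nonempty.
have [w [G [cG MG]]] := minimizer_exists p1 n0 oOm bOm oD oD' DOm DD' LD mw b0 B0 weight_le wge weight_zero mF vF c00.
have [u cu] := competitor_affine cG.
by exists u; apply: competitor_minimizer cu MG.
Qed.

Lemma conductivity_minimizer_unique u v : is_minimizer Om sigma p f u ->
  is_minimizer Om sigma p f v <-> W1p0 Om p (v \- u) /\
    {ae mu, forall x, (Om `\` D) x -> wgrad Om (v \- u) x = 0}.
Proof.
move=> /minimizer_competitor[_ [Gu [cu Mu]]]; split.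
  move=> /minimizer_competitor[_ [Gv [cv Mv]]].
  have HB : H0 Om p (cutf Om (v \- u)) (fun x => Gv x - Gu x).
    have := H0_Blin p1 cv.1 cu.1; congr H0; apply/funext => x.
    case: (pselect (Om x)) => Ox; last by rewrite !cutf_out// subrr.
    by rewrite !cutf_in//=; ring.
  split; first exact: (H0_W1p0 oOm p1 HB).
  have uniq := minimizer_unique p1 oOm oD oD' mw b0 B0 weight_le wge mF vF cv cu Mv Mu.
  apply: filterS2 uniq (wgrad_ae oOm (H0_weak_grad oOm p1 HB)) => x h1 h2 [Ox nD].
  by rewrite h2// h1// subrr.
(* Conversely, adding a gradient that vanishes off [D] keeps the constraint on [D'] and the flux,
   whose weight is zero on [D]. *)
move=> [/(W1p0_H0 oOm p1) HH H0D].
set H := cutv Om _ in HH; have mH := H0_mfield HH; have mGu := H0_mfield cu.1.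
have Hz : {ae mu, forall x, ~ D x -> H x = 0}.
  apply: filterS H0D => x h nD; case: (pselect (Om x)) => Ox; last by rewrite /H cutv_out.
  by rewrite /H cutv_in// h.
have HS : H0 Om p (cutf Om (v \- f)) (fun x => Gu x + 1 *: H x).
  have := H0_lin p1 1 cu.1 HH; congr H0; apply/funext => x.
  case: (pselect (Om x)) => Ox; last by rewrite !cutf_out// mulr0 addr0.
  by rewrite !cutf_in//=; ring.
have cS : comp (cutf Om (v \- f)) (fun x => Gu x + 1 *: H x).
  split => //; apply: filterS2 cu.2 Hz => x h1 h2 D'x.
  by rewrite h2 ?scaler0 ?addr0 ?h1// => /DD'; exact.
apply: (competitor_minimizer cS) => w' G' /Mu; apply: le_trans; apply: ereal_eqW.
apply: ae_eq_plpn; [exact: (mfield_flux mw mF (H0_mfield HS))|exact: (mfield_flux mw mF mGu)|].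
apply: filterS Hz => x h; rewrite /flux; case: (pselect (D x)) => Dx; first by rewrite weight_zero// !scale0r.
by rewrite h// scaler0 addr0.
Qed.

Let grad_out (V : set E) phi x : Cc_smooth V phi -> ~ V x -> grad phi x = 0.
Proof.
move=> Cphi nV; apply/rowP => i; rewrite grad_coord mxE.
by have [_ _ sV] := Cc_smooth_partial i Cphi; exact: supp_eq0 sV nV.
Qed.

(** A test function supported away from the closure of [D'] preserves the constraint, so the flux is
    stationary in the direction [weight * grad phi]. By homogeneity the common weight leaves [pflux]
    as its p-th power, which is [sigma]. *)
Lemma conductivity_equation u : is_minimizer Om sigma p f u ->
  weak_div_eq0 (Om `\` (closure D `|` closure D')) sigma p (wgrad Om u).
Proof.
move=> /minimizer_competitor[_ [G [cG MG]]] phi Cphi.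
set U := Om `\` _ in Cphi *.
have UO : U `<=` Om by move=> x [].
have UP : U `<=` P by move=> x [Ox nc]; split => // -[h|h]; apply: nc; [left|right]; exact: subset_closure.
have mU : measurable U.
  apply: open_rV_measurable; rewrite /U setDE; apply: openI => //; rewrite openC.
  by apply: closedU; exact: closed_closure.
have CO := Cc_smooth_sub UO Cphi; have mg := Cc_mgrad CO; have mG := H0_mfield cG.1.
have ma := mfield_flux mw mF mG; have mb := mfieldZ mw mg.
have [_ fa] := flux_fin p1 mw B0 weight_le mF vF cG.1.
have fb : (pp (fun x => weight x *: grad phi x)%R < +oo)%E.
  apply: (vlpn_plpn_fin p1 mb); apply: le_lt_trans (scale_le p1 mw B0 weight_le mg) _.
  by have [b _ ->] := vlpn_fin (Cc_grad_lty p1 CO); rewrite -EFinM ltry.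
have st (t : R) : (pp (flx G) <= pp (fun x => flx G x + t *: (weight x *: grad phi x))%R)%E.
  have HS := H0_lin p1 t cG.1 (H0_smooth p1 CO).
  have cS : comp (fun x => cutf Om (u \- f) x + t * phi x) (fun x => G x + t *: grad phi x).
    split => //; apply: filterS cG.2 => x h D'x.
    rewrite (grad_out Cphi) ?scaler0 ?addr0 ?h// => -[_]; apply; right; exact: subset_closure.
  apply: le_trans (MG _ _ cS) _; apply: ereal_eqW; apply: eq_integral => x _.
  by congr (enorm _ `^ _)%:E; rewrite /flux; apply/rowP => i; rewrite !mxE; ring.
have [ip p_0] := pflux_stationary p1 ma mb fa fb st.
have [_ [H uH] uG] := H0_affine cG.1.
have mW := weak_grad_mfield oOm (wgradP uH).
rewrite integral_mkcond.
apply: etrans (etrans (EFin_Rint ip) (congr1 EFin p_0)).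
apply: ae_eq_integral; first exact: measurableT.
- apply/(measurable_restrictT _ mU); apply: emeasurable_funM; first exact: measurable_funS sigma_meas.
  have /measurable_EFinP := measurable_funTS (measurable_pflux p mW mg) (D := U).
  by apply: eq_measurable_fun => x /set_mem /UO Ox; rewrite /= cutv_in.
- by apply/measurable_EFinP; exact: measurable_pflux.
apply: filterS2 uG sigma_weight => x h1 h2 _; rewrite patchE.
case: (pselect (U x)) => Ux; last first.
  by rewrite memNset//= (grad_out Cphi)// scaler0 /pflux dotvC dotv0l mulr0.
have Px := UP _ Ux; have w0 : 0 < weight x by apply: lt_le_trans (weight_ge Px).
by rewrite (mem_set Ux) (h2 Px) (h1 (UO _ Ux)) /flux (pflux_scale _ _ _ w0) EFinM.
Qed.

Lemma conductivity_grad0 u : is_minimizer Om sigma p f u ->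
  {ae mu, forall x, D' x -> wgrad Om u x = 0}.
Proof.
move=> /minimizer_competitor[fin [G [cG _]]].
by have [_ [H uH] _] := H0_affine cG.1; exact: energy_fin uH fin.
Qed.

End conductivity.

Theorem theorem3p1 (R : realType) (n : nat) (n_ge2 : (2 <= n)%N)
  (Omega : set 'rV[R]_n) (Omega_domain : domain Omega)
  (Omega_bounded : bounded_set Omega)
  (sigma : 'rV[R]_n -> \bar R)
  (sigma_ge0 : forall x, Omega x -> (0 <= sigma x)%E)
  (sigma_meas : measurable_fun Omega sigma)
  (D0_open : open (D_zero Omega sigma))
  (Dinf_open : open (D_infty Omega sigma))
  (D0_Dinf_disj :
    closure (D_zero Omega sigma) `&` closure (D_infty Omega sigma) = set0)
  (D0_bd_disj : closure (D_zero Omega sigma) `&` boundary Omega = set0)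
  (Dinf_bd_disj : closure (D_infty Omega sigma) `&` boundary Omega = set0)
  (sigma_bounds : exists c C : R, [/\ 0 < c, 0 < C &
    {ae @lebesgue_rV R n, forall x,
      (Omega `\` (D_zero Omega sigma `|` D_infty Omega sigma)) x ->
      (c%:E <= sigma x)%E /\ (sigma x <= C%:E)%E}])
  (D0_Lipschitz : Lipschitz_boundary (D_zero Omega sigma))
  (p : R) (p_gt1 : 1 < p)
  (f : 'rV[R]_n -> R) (f_W1p : W1p Omega p f) :
  (exists u, is_minimizer Omega sigma p f u) /\
  (forall u, is_minimizer Omega sigma p f u ->
    [/\ (energy Omega sigma p u < +oo)%E,
        (forall v, is_minimizer Omega sigma p f v <->
          W1p0 Omega p (v \- u) /\
          {ae @lebesgue_rV R n, forall x, (Omega `\` D_zero Omega sigma) x ->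
            wgrad Omega (v \- u) x = 0}),
        weak_div_eq0
          (Omega `\` (closure (D_zero Omega sigma) `|`
                      closure (D_infty Omega sigma)))
          sigma p (wgrad Omega u) &
        {ae @lebesgue_rV R n, forall x, D_infty Omega sigma x ->
          wgrad Omega u x = 0}]).
Proof.
have [c [C [c0 _ sigma_cC]]] := sigma_bounds.
have [_ oOm _] := Omega_domain.
have n0 : (0 < n)%N by exact: leq_trans n_ge2.
split.
  exact: (conductivity_minimizer_exists p_gt1 n0 oOm Omega_bounded sigma_ge0 sigma_meas
    D0_open Dinf_open D0_bd_disj Dinf_bd_disj c0 sigma_cC D0_Lipschitz f_W1p).
move=> u mu_; split.
- exact: (minimizer_competitor p_gt1 n0 oOm Omega_bounded sigma_ge0 sigma_meas
    D0_open Dinf_open Dinf_bd_disj c0 sigma_cC f_W1p mu_).1.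
- move=> v; exact: (conductivity_minimizer_unique p_gt1 n0 oOm Omega_bounded sigma_ge0 sigma_meas
    D0_open Dinf_open Dinf_bd_disj c0 sigma_cC f_W1p v mu_).
- exact: (conductivity_equation p_gt1 n0 oOm Omega_bounded sigma_ge0 sigma_meas
    D0_open Dinf_open Dinf_bd_disj c0 sigma_cC f_W1p mu_).
- exact: (conductivity_grad0 p_gt1 n0 oOm Omega_bounded sigma_ge0 sigma_meas
    D0_open Dinf_open Dinf_bd_disj c0 sigma_cC f_W1p mu_).
Qed.
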